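(* Let $M$ be a complete $G$-Riemannian manifold with $M/G$ non-compact. Then the $K$-theory $K_*(C(\partial_h^G(\overline{M})))=K_0\oplus K_1$ of the Higson $G$-corona of $M$ is uncountable.
   Context: $G$ is a Lie group. A $G$-Riemannian manifold is a Riemannian manifold on which $G$ acts smoothly, properly and isometrically. A subset of $M$ is cocompact if its image in $M/G$ has compact closure. $C_b^G(M)$: bounded continuous $G$-invariant functions on $M$. $C_0^G(M)$: $G$-invariant continuous functions $f$ such that for every $\epsilon>0$ there is a cocompact $M_1\subseteq M$ with $|f|<\epsilon$ on $M\setminus M_1$. $C_g^{\infty,G}(M)\subset C_b^G(M)$: bounded smooth $G$-invariant functions $f$ with $\|df\|_{T^*M}\in C_0^G(M)$. $C_g^G(M)$ is the completion of $C_g^{\infty,G}(M)$ in $C_b^G(M)$ for the sup norm. Set $C(\partial_h^G(\overline{M}))=C_g^G(M)/C_0^G(M)$; its maximal ideal space $\partial_h^G\overline{M}$ is the Higson $G$-corona of $M$. *)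

(* Defs.v *)
From HB Require Import structures.
From mathcomp Require Import all_boot all_order all_algebra.
From mathcomp Require Import complex.
From mathcomp Require Import all_classical all_reals all_analysis.

Set Implicit Arguments.
Unset Strict Implicit.
Unset Printing Implicit Defensive.

Import Order.TTheory GRing.Theory Num.Theory.
Import numFieldNormedType.Exports.

Local Open Scope classical_set_scope.
Local Open Scope ring_scope.
Local Open Scope complex_scope.

(** * Smooth maps and manifolds *)

Section Smooth.
Context {R : realType} {V W : normedModType R}.

(* C^k on an open set U in terms of iterated directional derivatives; for
   finite-dimensional V this is the usual notion. *)
Fixpoint Ck (k : nat) (U : set V) (h : V -> W) : Prop :=
  (forall x, U x -> {for x, continuous h}) /\
  if k is k'.+1 then
    forall v, (forall x, U x -> derivable h x v) /\ Ck k' U (fun x => 'D_v h x)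
  else True.

Definition smooth_on (U : set V) (h : V -> W) : Prop := forall k, Ck k U h.

End Smooth.

(* [cinv] is only meaningful on the image [cmap @` dom]. *)
Record chart {R : realType} (V : normedModType R) (M : Type) := Chart {
  dom : set M;
  cmap : M -> V;
  cinv : V -> M }.

Definition cimg {R : realType} {V : normedModType R} {M : Type}
  (c : chart V M) : set V := cmap c @` dom c.

(* An atlas modelled on V comes with a preferred chart around every point, so
   that the tangent space at p can be taken to be V, read in [chart_at p].
   [is_manifold] below states the axioms. *)
Record atlas {R : realType} (V : normedModType R) (M : Type) := Atlas {
  charts : set (chart V M);
  chart_at : M -> chart V M }.

Section Manifolds.
Context {R : realType}.

Definition is_chart {V : normedModType R} {M : topologicalType}
    (c : chart V M) : Prop :=
  [/\ open (dom c) /\ open (cimg c),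
      {within dom c, continuous (cmap c)},
      {within cimg c, continuous (cinv c)} &
      forall p, dom c p -> cinv c (cmap c p) = p].

Definition smooth_atlas {V : normedModType R} {M : topologicalType}
    (A : atlas V M) : Prop :=
  [/\ forall c, charts A c -> is_chart c,
      forall p, charts A (chart_at A p) /\ dom (chart_at A p) p &
      forall c d, charts A c -> charts A d ->
        smooth_on (cmap c @` (dom c `&` dom d)) (cmap d \o cinv c)].

Definition is_manifold {n : nat} {M : topologicalType}
    (A : atlas 'rV[R]_n M) : Prop :=
  [/\ hausdorff_space M, @second_countable M & smooth_atlas A].

Definition line_atlas : atlas R^o R :=
  let c := @Chart R R^o R setT id id in @Atlas R R^o R [set c] (fun=> c).

Definition prod_chart {V W : normedModType R} {M N : Type}
    (c : chart V M) (d : chart W N) : chart (V * W)%type (M * N) :=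
  @Chart R (V * W)%type (M * N) (dom c `*` dom d)
    (fun z => (cmap c z.1, cmap d z.2)) (fun z => (cinv c z.1, cinv d z.2)).

Definition prod_atlas {V W : normedModType R} {M N : Type}
    (A : atlas V M) (B : atlas W N) : atlas (V * W)%type (M * N) :=
  @Atlas R (V * W)%type (M * N)
    [set e | exists c d, [/\ charts A c, charts B d & e = prod_chart c d]]
    (fun z => prod_chart (chart_at A z.1) (chart_at B z.2)).

Definition smooth_map {V W : normedModType R} {M N : topologicalType}
    (A : atlas V M) (B : atlas W N) (f : M -> N) : Prop :=
  continuous f /\
  forall c d, charts A c -> charts B d ->
    smooth_on (cmap c @` (dom c `&` f @^-1` dom d)) (cmap d \o f \o cinv c).

Definition tangent_map {V W : normedModType R} {M N : Type}
    (A : atlas V M) (B : atlas W N) (f : M -> N) (p : M) (v : V) : W :=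
  let c := chart_at A p in let d := chart_at B (f p) in
  'D_v (cmap d \o f \o cinv c) (cmap c p).

(* The coordinate vector field of the chart c in the constant direction v,
   read in the preferred charts. *)
Definition coord_field {V : normedModType R} {M : Type}
    (A : atlas V M) (c : chart V M) (v : V) (p : M) : V :=
  'D_v (cmap (chart_at A p) \o cinv c) (cmap c p).

(** * Riemannian metrics *)

(* [g p] is the inner product on the tangent space at p, identified with V
   through [chart_at A p]; smoothness is tested on coordinate vector fields of
   all the charts, since [chart_at A p] need not vary continuously with p. *)

Definition riemannian_metric {V : normedModType R} {M : Type}
    (A : atlas V M) (g : M -> V -> V -> R) : Prop :=
  [/\ forall p a u v w, g p (a *: u + v) w = a * g p u w + g p v w,
      forall p v w, g p v w = g p w v,
      forall p v, v != 0 -> 0 < g p v v &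
      forall c v w, charts A c ->
        smooth_on (cimg c : set V)
          (fun x => let p := cinv c x in
             g p (coord_field A c v p) (coord_field A c w p) : R^o)].

Definition curve_length {V : normedModType R} {M : Type}
    (A : atlas V M) (g : M -> V -> V -> R) (gamma : R -> M) : \bar R :=
  let velocity t := tangent_map line_atlas A gamma t (1 : R^o) in
  (\int[@lebesgue_measure R]_(t in `[0%R, 1%R])
    (Num.sqrt (g (gamma t) (velocity t) (velocity t)))%:E)%E.

(* Piecewise smooth paths from p to q: finite concatenations of smooth curves,
   each of them restricted to [0, 1]. *)
Fixpoint path_between {V : normedModType R} {M : topologicalType}
    (A : atlas V M) (p : M) (s : seq (R -> M)) (q : M) : Prop :=
  if s is gamma :: s' then
    [/\ smooth_map line_atlas A gamma, gamma 0 = p &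
        path_between A (gamma 1) s' q]
  else p = q.

(* Equal to +oo between different connected components. *)
Definition riemannian_dist {V : normedModType R} {M : topologicalType}
    (A : atlas V M) (g : M -> V -> V -> R) (p q : M) : \bar R :=
  ereal_inf [set l | exists2 s, path_between A p s q &
    l = (\sum_(gamma <- s) curve_length A g gamma)%E].

Definition riemannian_complete {V : normedModType R} {M : topologicalType}
    (A : atlas V M) (g : M -> V -> V -> R) : Prop :=
  forall u : nat -> M,
    (forall e : R, 0 < e -> exists N, forall i j, (N <= i)%N -> (N <= j)%N ->
       (riemannian_dist A g (u i) (u j) < e%:E)%E) ->
    exists p, forall e : R, 0 < e -> exists N, forall i, (N <= i)%N ->
       (riemannian_dist A g (u i) p < e%:E)%E.

(* Norm in T*_pM of the differential of a real function. *)
Definition real_codiff_norm {V : normedModType R} {M : Type}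
    (A : atlas V M) (g : M -> V -> V -> R) (f : M -> R) (p : M) : R :=
  sup [set `|tangent_map A line_atlas f p v| | v in [set v | g p v v <= 1]].

(* Hermitian extension of the previous norm to complex covectors. *)
Definition codiff_norm {V : normedModType R} {M : Type}
    (A : atlas V M) (g : M -> V -> V -> R) (f : M -> R[i]) (p : M) : R :=
  Num.sqrt (real_codiff_norm A g (fun x => complex.Re (f x)) p ^+ 2 +
            real_codiff_norm A g (fun x => complex.Im (f x)) p ^+ 2).

End Manifolds.

(** * Lie groups and their actions *)

(* A group with a topology, with no compatibility required. *)
#[short(type="groupTopType")]
HB.structure Definition GroupTop := {T of Group T & Topological T}.

Definition lie_group {R : realType} {k : nat} {G : groupTopType}
    (A : atlas 'rV[R]_k G) : Prop :=
  [/\ is_manifold A,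
      smooth_map (prod_atlas A A) A (fun x => x.1 * x.2)%g &
      smooth_map A A (fun x => x^-1)%g].

Record group_action (G : groupType) (M : Type) := GroupAction {
  act :> G -> M -> M;
  act_one : forall x, act 1%g x = x;
  act_mul : forall a b x, act (a * b)%g x = act a (act b x) }.

Section Actions.
Context {G : groupTopType} {M : topologicalType}.
Variable a : group_action G M.

Definition proper_action : Prop :=
  forall K : set (M * M), compact K ->
    compact [set z : G * M | K (z.2, a z.1 z.2)].

Definition same_orbit (x y : M) : bool := `[< exists h : G, a h x = y >].

Lemma same_orbit_equiv : equiv_class_of same_orbit.
Proof.
split=> [x|x y|y x z].
- by apply/asboolP; exists 1%g; exact: act_one.
- apply/asboolP/asboolP => -[h <-]; exists h^-1%g;
    by rewrite -act_mul mulVg act_one.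
- move=> /asboolP[h <-] /asboolP[h' <-]; apply/asboolP.
  by exists (h' * h)%g; rewrite act_mul.
Qed.

Canonical same_orbit_equivrel := EquivRelPack same_orbit_equiv.

Definition orbit_space : topologicalType :=
  quotient_topology {eq_quot same_orbit_equivrel}%qT.

Definition orbit_proj (x : M) : orbit_space :=
  (\pi_({eq_quot same_orbit_equivrel}%qT) x)%qT.

Definition cocompact (S : set M) : Prop :=
  compact (closure (orbit_proj @` S)).

End Actions.

Definition isometric_action {R : realType} {V : normedModType R}
    {G : groupTopType} {M : topologicalType} (A : atlas V M)
    (g : M -> V -> V -> R) (a : group_action G M) : Prop :=
  forall h p v w,
    g (a h p) (tangent_map A A (a h) p v) (tangent_map A A (a h) p w) = g p v w.

Definition G_riemannian {R : realType} {k n : nat} {G : groupTopType}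
    {M : topologicalType} (AG : atlas 'rV[R]_k G) (AM : atlas 'rV[R]_n M)
    (g : M -> 'rV[R]_n -> 'rV[R]_n -> R) (a : group_action G M) : Prop :=
  [/\ is_manifold AM /\ riemannian_metric AM g,
      smooth_map (prod_atlas AG AM) AM (fun z => a z.1 z.2),
      proper_action a &
      isometric_action AM g a].

(** * The function algebras defining the Higson corona *)

Section HigsonAlgebra.
Context {R : realType} {n : nat} {G : groupTopType} {M : topologicalType}.
Variables (A : atlas 'rV[R]_n M) (g : M -> 'rV[R]_n -> 'rV[R]_n -> R).
Variable a : group_action G M.

Definition invariant (f : M -> R[i]) : Prop := forall h x, f (a h x) = f x.

Definition CbG : set (M -> R[i]) :=
  [set f | [/\ continuous (f : M -> R[i]^o), invariant f &
               exists B : R, forall x, `|f x| <= B%:C]].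

Definition C0G : set (M -> R[i]) :=
  [set f | [/\ continuous (f : M -> R[i]^o), invariant f &
      forall e : R, 0 < e -> exists M1 : set M, cocompact a M1 /\
        forall x, ~ M1 x -> `|f x| < e%:C]].

Definition CgG_smooth : set (M -> R[i]) :=
  [set f | [/\ CbG f,
      smooth_map A line_atlas (fun x => complex.Re (f x)) /\
      smooth_map A line_atlas (fun x => complex.Im (f x)) &
      C0G (fun x => (codiff_norm A g f x)%:C)]].

(* C_b^G(M) is complete, so the completion is the closure in the sup norm. *)
Definition CgG : set (M -> R[i]) :=
  [set f | CbG f /\ forall e : R, 0 < e ->
      exists2 h, CgG_smooth h & forall x, `|f x - h x| <= e%:C].

End HigsonAlgebra.

(** * K-theory of a quotient of function algebras *)

(* S is a sup-norm closed unital algebra of bounded functions on T and J a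
   closed ideal of S. Elements of M_n(S/J) are represented by matrices with
   entries in S, two of them being identified when their difference has entries
   in J. K_0 and K_1 of the Banach algebra S/J are defined by idempotents and
   by invertibles up to homotopy, as in Blackadar's book. *)
Section KTheory.
Context {R : realType} {T : Type}.
Variables S J : set (T -> R[i]).
Local Notation F := (T -> R[i]).

Definition mxin (X : set F) {m n} (u : 'M[F]_(m, n)) : Prop :=
  forall i j, X (u i j).

Definition eqmodJ {m n} (u v : 'M[F]_(m, n)) : Prop := mxin J (u - v).

Definition dsum {m n} (u : 'M[F]_m) (v : 'M[F]_n) : 'M[F]_(m + n) :=
  block_mx u 0 0 v.

Record idempotent_mx := IdempotentMx {
  idim : nat;
  imx : 'M[F]_idim;
  imx_in : mxin S imx;
  imx_idem : eqmodJ (imx *m imx) imx }.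

(* Murray-von Neumann equivalence in M_oo(S/J). *)
Definition mvn_equiv {m n} (p : 'M[F]_m) (q : 'M[F]_n) : Prop :=
  exists (x : 'M[F]_(m, n)) (y : 'M[F]_(n, m)),
    [/\ mxin S x, mxin S y, eqmodJ (x *m y) p & eqmodJ (y *m x) q].

(* (p, q) stands for the formal difference [p] - [q] in the Grothendieck group
   of the monoid of classes of idempotents. *)
Definition K0_rel (z w : idempotent_mx * idempotent_mx) : Prop :=
  exists r : idempotent_mx,
    mvn_equiv (dsum (dsum (imx z.1) (imx w.2)) (imx r))
              (dsum (dsum (imx w.1) (imx z.2)) (imx r)).

Definition K0 : set (set (idempotent_mx * idempotent_mx)) :=
  range (fun z => [set w | K0_rel z w]).

Definition invertible {n} (u : 'M[F]_n) : Prop :=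
  mxin S u /\
  exists v : 'M[F]_n,
    [/\ mxin S v, eqmodJ (u *m v) 1%:M & eqmodJ (v *m u) 1%:M].

(* The quotient norm distance of the classes of f and f' in S/J is < e. *)
Definition quotient_near (e : R) (f f' : F) : Prop :=
  exists j e', [/\ J j, e' < e & forall x, `|f x - f' x - j x| <= e'%:C].

Definition gl_homotopic {n} (u v : 'M[F]_n) : Prop :=
  exists gamma : R -> 'M[F]_n,
    [/\ forall t, 0 <= t <= 1 -> invertible (gamma t),
        forall t e, 0 <= t <= 1 -> 0 < e -> exists2 d, 0 < d &
          forall s, 0 <= s <= 1 -> `|s - t| < d ->
            forall i j, quotient_near e (gamma s i j) (gamma t i j),
        eqmodJ (gamma 0) u & eqmodJ (gamma 1) v].

Record invertible_mx := InvertibleMx {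
  gdim : nat;
  gmx : 'M[F]_gdim;
  gmx_inv : invertible gmx }.

(* Being in the same path component of GL_oo(S/J). *)
Definition K1_rel (u v : invertible_mx) : Prop :=
  exists (b c : nat) (e : gdim u + b = gdim v + c),
    gl_homotopic (castmx (e, e) (dsum (gmx u) (1%:M : 'M[F]_b)))
                 (dsum (gmx v) (1%:M : 'M[F]_c)).

Definition K1 : set (set invertible_mx) :=
  range (fun u => [set v | K1_rel u v]).

End KTheory.

Arguments K0 {R T} S J.
Arguments K1 {R T} S J.

(* Main.v *)
Require Import Defs.
From HB Require Import structures.
From mathcomp Require Import all_boot all_order all_algebra.
From mathcomp Require Import complex.
From mathcomp Require Import all_classical all_reals all_analysis.
From mathcomp Require Import measurable_realfun perm.
From mathcomp Require Import ring lra.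

Set Implicit Arguments.
Unset Strict Implicit.
Unset Printing Implicit Defensive.

Import Order.TTheory GRing.Theory Num.Theory.
Import numFieldNormedType.Exports.

Local Open Scope classical_set_scope.
Local Open Scope ring_scope.

(* Let two points of M be at pseudo-distance < e when they are joined by coordinate segments
   of total length < e and by jumps along orbits.  By completeness, as in Hopf-Rinow, balls
   for this pseudo-distance are cocompact, and the points at finite pseudo-distance from one
   another form open invariant classes.

   If all classes are cocompact, there are infinitely many of them, since M/G is not compact;
   index a sequence of them by the rationals.  The indicator of the union of the classes with
   index < c, for c real, is in C_g^G(M), and two of these indicators do not differ by an
   element of C_0^G(M); as the trace of an idempotent modulo C_0^G(M) depends on its K_0 class
   only, K_0 is uncountable.

   Otherwise let x0 have a class that is not cocompact, and let rho be the pseudo-distance to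
   x0.  Cutoffs of rho, regularised by convolution in charts and averaged over G with a right
   invariant functional (built as in Weil and Cartan), add up to a smooth invariant unbounded
   function h >= 0 with |dh| vanishing at infinity, so that e^{ich} is in C_g^G(M).  If e^{ich}
   and e^{ic'h} had the same class in K_1, the determinants along a path in GL_m would give
   e^{i(c'-c)h} a bounded continuous argument theta where h is large.  There the continuous
   function (c'-c)h - theta takes its values in 2 pi Z and is unbounded; a set where it is > T
   would then be a nonempty open and closed subset of the class of x0 on which h does not
   vanish, although the class is connected. *)

(** * Functions of class C^k *)

(** Lengths are measured along straight segments of charts because these can be reversed and cut in
    any proportion, as the Hopf-Rinow argument requires. Completeness only needs the Riemannian
    distance to be bounded by a multiple of such lengths, and the function h only needs a gradient
    tending to 0, so constant factors may be lost freely. The obstacle in the regularisation is to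
    glue local convolutions without paying for the derivatives of the gluing functions. The result
    is a quotient Q/P of averages of Y and X, where Y approximates wX. At a point where its value is
    s, its differential is that of Q - sP divided by P, and there the derivative of X is multiplied
    only by the small difference between s and the local values of w. The case distinction is
    forced. If all classes are cocompact, (c'-c)h - theta may jump by multiples of 2 pi from one
    class to another: for h constant on each class, theta can be taken bounded. If M is connected,
    there is a single class and no indicator to use. Convolution is obtained from the same
    Weil-Cartan functional, for the additive group of row vectors; thus a single theorem on
    differentiation under the functional serves twice. *)

Section Calculus.
Context {R : realType}.
Implicit Types V W : normedModType R.

(** Directional derivatives are reduced to one variable, where the mean value theorem and the
    composition rule are available. *)
Lemma is_derive_lineP V W (f : V -> W) (y v : V) (s : R) d :
  is_derive s (1 : R) (fun s => f (y + s *: v)) d <-> is_derive (y + s *: v) v f d.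
Proof.
have E : (fun h : R => h^-1 *: (((fun s => f (y + s *: v)) \o shift s) (h *: (1 : R^o)) - f (y + s *: v)))
   = (fun h => h^-1 *: ((f \o shift (y + s *: v)) (h *: v) - f (y + s *: v))).
  apply/funext => h /=; congr (_ *: (f _ - _)).
  by rewrite [h *: _]mulr1 scalerDl addrCA.
split=> -[dv <-].
  by apply: DeriveDef; move: dv; rewrite /derivable /derive E.
by apply: DeriveDef; move: dv; rewrite /derivable /derive E.
Qed.

Lemma is_derive_line V W (f : V -> W) (y v : V) (s : R) :
  derivable f (y + s *: v) v ->
  is_derive s (1 : R) (fun s => f (y + s *: v)) ('D_v f (y + s *: v)).
Proof. by move=> dv; apply/is_derive_lineP/derivableP. Qed.

(** The differential is selected by a choice operator: a linear map with the little-o estimate is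
    first shown to exist, then identified by [diff_unique]. *)
Lemma differentiable_of_estimate V W (f : V -> W) (df : {linear V -> W}) x :
  continuous df ->
  (forall e : R, 0 < e -> \forall h \near (0 : V), `|f (h + x) - f x - df h| <= e * `|h|) ->
  is_diff x f df.
Proof.
move=> dfc est.
have E : f \o shift x = cst (f x) + df +o_ (0 : V) id.
  apply/eqaddoP => e e0; near=> h.
  rewrite /= opprD addrA.
  by near: h; exact: est.
apply: DiffDef; last exact: diff_unique.
apply/diffP => /=.
apply: (@getPex _ (fun (df : {linear V -> W}) => continuous df /\
  forall y, f y = f (lim (nbhs x)) + df (y - lim (nbhs x))
                  +o_(y \near x) (y - lim (nbhs x)))).
exists df; split=> //.
(* Differentiability is stated along a filter, with [lim (nbhs x)] as base point; it equals [x] by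
   [lim_id]. *)
have H : f = (fun y => f (lim (nbhs x)) + df (y - lim (nbhs x))) +o_ x (fun y => y - lim (nbhs x)).
  apply/eqaddoP => e e0.
  have /nbhs_ballP[r r0 He] := est e e0; apply/nbhs_ballP; exists r => // y.
  rewrite -ball_normE /= distrC => xy; rewrite !fctE lim_id //.
  by have := He (y - x); rewrite /= subrK opprD addrA; apply; rewrite -ball_normE /= sub0r normrN.
by move=> y; rewrite {1}H.
Unshelve. all: by end_near. Qed.

Lemma cvg_bigsum (T I : Type) V (F : set_system T) {FF : Filter F} (r : seq I) (P : pred I)
    (f : I -> T -> V) (l : I -> V) :
  (forall i, P i -> f i x @[x --> F] --> l i) ->
  \sum_(i <- r | P i) f i x @[x --> F] --> \sum_(i <- r | P i) l i.
Proof.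
move=> H; elim: r => [|i r IH].
  by rewrite big_nil; under eq_fun do rewrite big_nil; exact: cvg_cst.
rewrite big_cons; under eq_fun do rewrite big_cons.
by case: ifP => // Pi; apply: cvgD => //; exact: H.
Qed.

(** The slope [c] is subtracted so that a bound on the variation of the derivative controls the
    error of the linear approximation; [min] and [max] cover increments of either sign. *)
Lemma mvt_estimate (phi dphi : R -> R) (a b c e : R) :
  (forall s, Num.min a b <= s <= Num.max a b -> is_derive s 1 phi (dphi s)) ->
  (forall s, Num.min a b <= s <= Num.max a b -> `|dphi s - c| <= e) ->
  `|phi b - phi a - c * (b - a)| <= e * `|b - a|.
Proof.
wlog ab : a b / a <= b => [H d1 d2|].
  have [ab|/ltW ba] := leP a b; first exact: H.
  have := H b a ba; rewrite minC maxC => /(_ d1 d2).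
  rewrite [`|b - a|]distrC => h.
  have -> : phi b - phi a - c * (b - a) = - (phi a - phi b - c * (a - b)) by ring.
  by rewrite normrN.
rewrite min_l // max_r // => d1 d2.
have [||x] := @MVT_segment R phi dphi a b ab.
- by move=> x; rewrite in_itv /= => /andP[x1 x2]; apply: d1; rewrite !ltW.
- apply: derivable_within_continuous => x; rewrite in_itv /= => h.
  by have [] := d1 x h.
rewrite in_itv /= => /d2 h ->.
by rewrite -mulrBl normrM ler_wpM2r.
Qed.

(** * Functions of row vectors: partial derivatives, differential, chain rule *)

Section Coords.
Variable n : nat.
Implicit Types b : 'rV[R]_n -> R^o.

Definition evec (j : 'I_n) : 'rV[R]_n := delta_mx 0 j.

Lemma coord_le_norm (x : 'rV[R]_n) j : `|x 0 j| <= `|x|.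
Proof. by rewrite [leRHS]/Num.norm /= mx_normrE; apply: (le_bigmax _ (fun i : 'I_1 * 'I_n => `|x i.1 i.2|) (0, j)). Qed.

Lemma norm_le_coord (x : 'rV[R]_n) (e : R) : 0 <= e -> (forall j, `|x 0 j| <= e) -> `|x| <= e.
Proof.
move=> e0 H; rewrite [leLHS]/Num.norm /= mx_normrE.
by apply: bigmax_le => // -[i j] _; rewrite ord1.
Qed.

Definition trunc_row (m : nat) (h : 'rV[R]_n) : 'rV[R]_n :=
  \row_j (if (j < m)%N then h 0 j else 0).

(** The increment of [b] telescopes along the points [trunc_row m h + y]. Consecutive ones differ in
    one coordinate, and [mvt_estimate] bounds each leg. *)
Lemma C1_estimate b (y : 'rV[R]_n) (e d : R) (h : 'rV[R]_n) : 0 <= e ->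
  (forall z j, `|z - y| <= d -> derivable b z (evec j) /\
     `|'D_(evec j) b z - 'D_(evec j) b y| <= e) ->
  `|h| <= d ->
  `|b (h + y) - b y - \sum_j h 0 j * 'D_(evec j) b y| <= (n%:R * e) * `|h|.
Proof.
move=> e0 H hd.
have step : forall m, (m <= n)%N ->
   `|b (trunc_row m h + y) - b y - \sum_(j < n | (j < m)%N) h 0 j * 'D_(evec j) b y| <= (m%:R * e) * `|h|.
  elim=> [_|m IH mn].
    rewrite big_pred0 // (_ : trunc_row 0 h = 0) ?add0r ?subrr ?subr0 ?normr0 ?mul0r //.
    by apply/rowP => j; rewrite !mxE.
  pose j0 : 'I_n := Ordinal mn.
  have E s : trunc_row m h + y + s *: evec j0 = trunc_row m h + s *: evec j0 + y by rewrite addrAC.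
  have Em : trunc_row m.+1 h = trunc_row m h + h 0 j0 *: evec j0.
    apply/rowP => j; rewrite !mxE eqxx /= ltnS.
    case: (eqVneq j j0) => [->|nj] /=; first by rewrite leqnn ltnn mulr1 add0r.
    rewrite leq_eqVlt mulr0 addr0; case: eqP => //= jm.
    by case/eqP: nj; apply: val_inj.
  rewrite (bigD1 j0) //=.
  rewrite (eq_bigl (fun j : 'I_n => (j < m)%N)); last first.
    by move=> j; rewrite ltnS andbC ltn_neqAle -val_eqE /=.
  pose phi s := b (trunc_row m h + y + s *: evec j0).
  have /(_ _ _) M := @mvt_estimate phi (fun s => 'D_(evec j0) b (trunc_row m h + y + s *: evec j0)) 0 (h 0 j0) ('D_(evec j0) b y) e.
  (* Each leg stays in the ball of radius [d], because the norm is the supremum of the coordinates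
     and no coordinate exceeds the corresponding one of [h]. *)
  have bd s : Num.min 0 (h 0 j0) <= s <= Num.max 0 (h 0 j0) -> `|trunc_row m h + y + s *: evec j0 - y| <= d.
    move=> hs; have sh : `|s| <= `|h 0 j0|.
      case: (leP 0 (h 0 j0)) hs => h0.
        by move=> /andP[s0 s1]; rewrite !ger0_norm.
      by move=> /andP[s0 s1]; rewrite !ler0_norm ?lerN2 // ltW.
    apply: le_trans hd; rewrite E addrK.
    apply: norm_le_coord => // j; rewrite !mxE eqxx /=.
    case: (eqVneq j j0) => [->|nj] /=.
      by rewrite ltnn add0r mulr1 (le_trans sh) // coord_le_norm.
    rewrite mulr0 addr0; case: ifP => _; first exact: coord_le_norm.
    by rewrite normr0.
  have := M _ _; rewrite subr0 /phi => {}M.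
  have M1 : `|b (trunc_row m.+1 h + y) - b (trunc_row m h + y) - 'D_(evec j0) b y * h 0 j0| <= e * `|h 0 j0|.
    rewrite Em -E.
    have -> : b (trunc_row m h + y) = b (trunc_row m h + y + 0 *: evec j0) by rewrite scale0r addr0.
    apply: M => s hs.
      by apply: is_derive_line; have [] := H _ j0 (bd _ hs).
    by have [] := H _ j0 (bd _ hs).
  have {}IH := IH (ltnW mn).
  have -> : b (trunc_row m.+1 h + y) - b y - (h 0 j0 * 'D_(evec j0) b y + \sum_(j < n | (j < m)%N) h 0 j * 'D_(evec j) b y)
    = (b (trunc_row m.+1 h + y) - b (trunc_row m h + y) - 'D_(evec j0) b y * h 0 j0) + (b (trunc_row m h + y) - b y - \sum_(j < n | (j < m)%N) h 0 j * 'D_(evec j) b y).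
    by ring.
  apply: (le_trans (ler_normD _ _)).
  rewrite -natr1 [m%:R + 1]addrC mulrDl mul1r mulrDl lerD //.
  by apply: (le_trans M1); rewrite ler_wpM2l // coord_le_norm.
have := step n (leqnn n).
rewrite (_ : trunc_row n h = h); last by apply/rowP => j; rewrite !mxE ltn_ord.
by under eq_bigl do rewrite ltn_ord.
Qed.

Section LinForm.
Variable c : 'I_n -> R.
Definition lform (h : 'rV[R]_n) : R^o := \sum_j h 0 j * c j.
Lemma lform_is_linear : linear lform.
Proof.
move=> a u v; rewrite /lform /GRing.scale /= mulr_sumr -big_split /=.
by apply: eq_bigr => j _; rewrite !mxE mulrDl mulrA.
Qed.
HB.instance Definition _ := GRing.isLinear.Build R 'rV[R]_n R^o *:%R lform lform_is_linear.
Lemma lform_continuous : continuous lform.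
Proof.
move=> x; apply: (@cvg_bigsum _ _ _ (nbhs x)) => j _.
by apply: (@cvgM R); [exact: coord_continuous | exact: cvg_cst].
Qed.
End LinForm.

(** [Ck] only mentions directional derivatives; continuity of the partial ones yields a genuine
    differential, on which the chain rule rests. *)
Lemma Ck1_is_diff U b y : open U -> Ck 1 U b -> U y ->
  is_diff y b (lform (fun j => 'D_(evec j) b y)).
Proof.
move=> oU [_ /= cb] Uy.
apply: differentiable_of_estimate; first exact: lform_continuous.
move=> e e0.
(* [n.+1] rather than [n], since the dimension may be 0. *)
have e0' : 0 < e / n.+1%:R by rewrite divr_gt0.
have : \forall z \near y, forall j : 'I_n, derivable b z (evec j) /\
     `|'D_(evec j) b z - 'D_(evec j) b y| <= e / n.+1%:R.
  apply: (@filter_forall _ _ (fun j z => derivable b z (evec j) /\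
     `|'D_(evec j) b z - 'D_(evec j) b y| <= e / n.+1%:R) (nbhs y)) => j.
  have [d1 [d2 _]] := cb (evec j).
  have /cvgrPdist_le /(_ _ e0') H := d2 _ Uy.
  near=> z; split; first by apply: d1; near: z; exact: open_nbhs_nbhs.
  by rewrite distrC; near: z.
move=> /nbhs_ballP[r r0 Hr].
apply/nbhs_ballP; exists (r / 2); first by rewrite /= divr_gt0.
move=> h; rewrite -ball_normE /= sub0r normrN => hr.
apply: le_trans (C1_estimate (ltW e0') (d := r / 2) _ _) _.
- move=> z j zy; apply: Hr; rewrite -ball_normE /= distrC (le_lt_trans zy) //.
  by rewrite ltr_pdivrMr // ltr_pMr // ltr1n.
- exact: ltW.
rewrite ler_wpM2r // mulrA ler_pdivrMr // mulrC ler_wpM2l // ?ler_nat // ltW.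
Unshelve. all: by end_near. Qed.

(** Only the derivative of [T] in the direction [v] is known. Restricted to the line through [x],
    [T] is a differentiable function of one variable, and differentials can be composed there. *)
Lemma chain_rV V U b (T : V -> 'rV[R]_n) x v w : open U -> Ck 1 U b -> U (T x) ->
  is_derive x v T w -> is_derive x v (b \o T : V -> R^o) (\sum_j w 0 j * 'D_(evec j) b (T x)).
Proof.
move=> oU cb Ux dT.
have E : x = x + 0 *: v by rewrite scale0r addr0.
rewrite E in dT; move/is_derive_lineP : dT => dT.
rewrite {1}E; apply/is_derive_lineP => /=.
have dfT : differentiable (fun s : R => T (x + s *: v)) (0 : R).
  by apply/derivable1_diffP; have [] := dT.
have Ux' : U (T (x + 0 *: v)) by rewrite -E.
have db := Ck1_is_diff oU cb Ux'.
have dc : differentiable (b \o (fun s : R => T (x + s *: v))) (0 : R).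
  by apply: differentiable_comp => //; have [] := db.
have dv : derivable (b \o (fun s : R => T (x + s *: v))) (0 : R) 1 by exact: diff_derivable.
apply: DeriveDef => //.
have [dbd dbE] := db; have [_ dTE] := dT.
transitivity ('d b (T (x + 0 *: v)) ('d (fun s : R => T (x + s *: v)) (0 : R) 1)).
  rewrite (deriveE (1 : R^o) dc) diff_comp //.
rewrite -(deriveE (1 : R^o) dfT) dTE dbE.
by rewrite /lform -E.
Qed.

Lemma Ck1_is_derive U b y v : open U -> Ck 1 U b -> U y ->
  is_derive y v b (\sum_j v 0 j * 'D_(evec j) b y).
Proof. by move=> oU cb Uy; apply: (@chain_rV _ U b id). Qed.

End Coords.

Lemma near_eq_cont (V W : topologicalType) (f g : V -> W) x :
  (\near x, f x = g x) -> {for x, continuous f} -> {for x, continuous g}.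
Proof.
move=> fg fc; rewrite /prop_for /continuous_at -(nbhs_singleton fg).
by apply: cvg_trans fc; apply: near_eq_cvg.
Qed.

Section CkTheory.
Variables V W : normedModType R.
Implicit Types (U : set V) (f g : V -> W).

Lemma Ck_continuous k U f : Ck k U f -> forall x, U x -> {for x, continuous f}.
Proof. by case: k => [|k] []. Qed.

Lemma Ck_derivable k U f v x : Ck k.+1 U f -> U x -> derivable f x v.
Proof. by move=> [_ /(_ v) []]; auto. Qed.

Lemma Ck_derive k U f v : Ck k.+1 U f -> Ck k U ('D_v f).
Proof. by move=> [_ /(_ v) []]. Qed.

Lemma Ck_le k U f : Ck k.+1 U f -> Ck k U f.
Proof.
elim: k U f => [|k IH] U f [fc fd] //.
by split=> // v; have [d1 d2] := fd v; split=> //; exact: IH.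
Qed.

Lemma Ck_leq k l U f : (k <= l)%N -> Ck l U f -> Ck k U f.
Proof.
move=> /subnK <-; elim: (l - k)%N => // m IH; rewrite addSn => /Ck_le; exact: IH.
Qed.

Lemma Ck_sub k U U' f : U' `<=` U -> Ck k U f -> Ck k U' f.
Proof.
move=> sU; elim: k f => [|k IH] f [fc fd].
  by split=> // x /sU; exact: fc.
split=> [x /sU|v]; first exact: fc.
by have [d1 d2] := fd v; split=> [x /sU|]; [exact: d1|exact: IH].
Qed.

Lemma Ck_ext k U f g : open U -> (forall x, U x -> f x = g x) -> Ck k U f -> Ck k U g.
Proof.
move=> oU; elim: k f g => [|k IH] f g fg [fc fd].
  split=> // x Ux; apply: near_eq_cont (fc _ Ux).
  by apply: filterS (open_nbhs_nbhs (conj oU Ux)) => y; exact: fg.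
have nfg x : U x -> \near x, f x = g x.
  by move=> Ux; apply: filterS (open_nbhs_nbhs (conj oU Ux)) => y; exact: fg.
split=> [x Ux|v]; first exact: near_eq_cont (nfg _ Ux) (fc _ Ux).
have [d1 d2] := fd v; split=> [x Ux|].
  by apply: near_eq_derivable (d1 _ Ux); exact: nfg.
by apply: IH d2 => x Ux; apply: near_eq_derive; exact: nfg.
Qed.

(** [Ck k U f] is a conjunction of conditions at the single points of [U], with limits taken in the
    whole space, so it can be checked point by point. *)
Lemma Ck_local k U f :
  (forall x, U x -> exists2 B : set V, B x & Ck k B f) -> Ck k U f.
Proof.
elim: k f => [|k IH] f H.
  by split=> // x /H[B Bx [fc _]]; exact: fc.
split=> [x /H[B Bx [fc _]]|v]; first exact: fc.
split=> [x /H[B Bx [_ /(_ v)[d1 _]]]|]; first exact: d1.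
by apply: IH => x /H[B Bx [_ /(_ v)[_ d2]]]; exists B.
Qed.

Lemma Ck_cst k U (w : W) : Ck k U (fun=> w).
Proof.
elim: k w => [|k IH] w; first by split=> // x _; exact: cvg_cst.
split=> [x _|v]; first exact: cvg_cst.
split=> [x _|]; first exact: derivable_cst.
by rewrite (_ : 'D_v _ = fun=> 0) //; apply/funext => x; exact: derive_cst.
Qed.

Lemma Ck_add k U f g : open U -> Ck k U f -> Ck k U g -> Ck k U (fun x => f x + g x).
Proof.
move=> oU; elim: k f g => [|k IH] f g [fc fd] [gc gd].
  by split=> // x Ux; apply: cvgD; [exact: fc|exact: gc].
split=> [x Ux|v]; first by apply: cvgD; [exact: fc|exact: gc].
have [d1 d2] := fd v; have [e1 e2] := gd v.
split=> [x Ux|]; first by apply: derivableD; [exact: d1|exact: e1].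
apply: Ck_ext oU _ (IH _ _ d2 e2) => x Ux.
by rewrite -deriveD //; [exact: d1|exact: e1].
Qed.

Lemma Ck_sum k U (I : Type) (r : seq I) (P : pred I) (F : I -> V -> W) : open U ->
  (forall i, P i -> Ck k U (F i)) -> Ck k U (fun x => \sum_(i <- r | P i) F i x).
Proof.
move=> oU H; elim: r => [|i r IH].
  by under eq_fun do rewrite big_nil; exact: Ck_cst.
under eq_fun do rewrite big_cons.
by case: (boolP (P i)) => Pi //; apply: Ck_add => //; exact: H.
Qed.

Lemma Ck_linear k U (L : {linear V -> W}) : continuous L -> Ck k U L.
Proof.
move=> cL; case: k => [|k]; first by split=> // x _; exact: cL.
split=> [x _|v]; first exact: cL.
have dL x : differentiable L x by exact: linear_differentiable.
split=> [x _|]; first exact: diff_derivable.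
rewrite (_ : 'D_v _ = fun=> L v); first exact: Ck_cst.
by apply/funext => x; rewrite deriveE // diff_lin.
Qed.

End CkTheory.

Section CkScalar.
Variables V : normedModType R.
Implicit Types (U : set V) (f g : V -> R^o).

Lemma Ck_mul k U f g : open U -> Ck k U f -> Ck k U g -> Ck k U (fun x => f x * g x : R^o).
Proof.
move=> oU; elim: k f g => [|k IH] f g cf cg.
  by split=> // x Ux; apply: (@cvgM R); [exact: (Ck_continuous cf)|exact: (Ck_continuous cg)].
split=> [x Ux|v].
  by apply: (@cvgM R); [exact: (Ck_continuous cf)|exact: (Ck_continuous cg)].
split=> [x Ux|]; first by apply: derivableM; [exact: (Ck_derivable cf Ux)|exact: (Ck_derivable cg Ux)].
apply: Ck_ext oU _ (Ck_add oU (IH _ _ (Ck_le cf) (Ck_derive v cg)) (IH _ _ (Ck_le cg) (Ck_derive v cf))) => x Ux.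
by rewrite deriveM; [|exact: (Ck_derivable cf Ux)|exact: (Ck_derivable cg Ux)].
Qed.

Lemma is_derive_comp1 (F : R -> R) (dF : R) f x v :
  is_derive (f x) (1 : R) F dF -> derivable f x v ->
  is_derive x v (fun y => F (f y) : R^o) (dF * 'D_v f x).
Proof.
move=> HF df.
have E : x = x + 0 *: v by rewrite scale0r addr0.
move: HF df; rewrite E => HF /derivableP /is_derive_lineP dl.
rewrite {1}E; apply/is_derive_lineP.
by rewrite -E; rewrite -E in dl HF; apply: (@is_derive1_comp _ F (fun s => f (x + s *: v))) => //; rewrite -E.
Qed.

Lemma Ck_comp_R k (F : R^o -> R^o) (D : set R^o) U f : open U -> open D ->
  (forall x, U x -> D (f x)) -> Ck k D F -> Ck k U f -> Ck k U (fun x => F (f x)).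
Proof.
move=> oU oD fD; elim: k F f fD => [|k IH] F f fD cF cf.
  split=> // x Ux; apply: continuous_comp; first exact: (Ck_continuous cf).
  by apply: (Ck_continuous cF); exact: fD.
have HD x v : U x -> is_derive x v (fun y => F (f y)) ('D_1 F (f x) * 'D_v f x).
  move=> Ux; apply: is_derive_comp1; last exact: (Ck_derivable cf Ux).
  by apply: derivableP; exact: (Ck_derivable cF (fD _ Ux)).
split=> [x Ux|v].
  apply: continuous_comp; first exact: (Ck_continuous cf).
  by apply: (Ck_continuous cF); exact: fD.
split=> [x Ux|]; first by have [] := HD x v Ux.
have H := Ck_mul oU (IH _ f fD (Ck_derive (1 : R^o) cF) (Ck_le cf)) (Ck_derive v cf).
apply: Ck_ext oU _ H => x Ux.
by have [_ ->] := HD x v Ux.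
Qed.

Lemma Ck_opp k U f : open U -> Ck k U f -> Ck k U (fun x => - f x).
Proof.
move=> oU cf; apply: Ck_ext oU _ (Ck_mul oU (Ck_cst k U (-1 : R^o)) cf) => x _.
by rewrite mulN1r.
Qed.

Lemma Ck_sub_fun k U f g : open U -> Ck k U f -> Ck k U g -> Ck k U (fun x => f x - g x).
Proof. by move=> oU cf cg; apply: Ck_add => //; exact: Ck_opp. Qed.

End CkScalar.

Section CkRow.
Variables (V : normedModType R) (n : nat).
Implicit Types (U : set V) (f : V -> 'rV[R]_n).

Lemma derive_coord f x v j : derivable f x v -> is_derive x v (fun y => f y 0 j) ('D_v f x 0 j).
Proof.
move=> df; rewrite derive_mx // mxE; apply: derivableP.
by move/derivable_mxP : df; exact.
Qed.

Lemma continuous_coord f x j : {for x, continuous f} -> {for x, continuous (fun y => f y 0 j : R^o)}.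
Proof.
move=> fc; apply: (@continuous_comp _ _ _ f (fun M : 'rV[R]_n => M 0 j : R^o)) => //.
exact: coord_continuous.
Qed.

Lemma Ck_coord k U f j : open U -> Ck k U f -> Ck k U (fun x => f x 0 j : R^o).
Proof.
move=> oU; elim: k f => [|k IH] f cf.
  by split=> // x Ux; apply: continuous_coord; exact: (Ck_continuous cf).
split=> [x Ux|v].
  by apply: continuous_coord; exact: (Ck_continuous cf).
split=> [x Ux|]; first by have [] := derive_coord j (Ck_derivable cf Ux : derivable f x v).
apply: Ck_ext oU _ (IH _ (Ck_derive v cf)) => x Ux.
by have [_ ->] := derive_coord j (Ck_derivable cf Ux : derivable f x v).
Qed.

Lemma continuous_rV (f : V -> 'rV[R]_n) x :
  (forall j, {for x, continuous (fun x => f x 0 j : R^o)}) -> {for x, continuous f}.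
Proof.
move=> H; apply/cvgrPdist_le => e e0.
have : \forall y \near x, forall j, `|f x 0 j - f y 0 j| <= e.
  apply: (@filter_forall _ _ (fun j y => `|f x 0 j - f y 0 j| <= e) (nbhs x)) => j.
  by have /cvgrPdist_le /(_ _ e0) := H j.
apply: filterS => y Hy; apply: norm_le_coord; first exact: ltW.
by move=> j; rewrite !mxE.
Qed.

Lemma Ck_rV k U f : open U -> (forall j, Ck k U (fun x => f x 0 j : R^o)) -> Ck k U f.
Proof.
move=> oU; elim: k f => [|k IH] f cf.
  by split=> // x Ux; apply: continuous_rV => j; exact: (Ck_continuous (cf j)).
have df x v : U x -> derivable f x v.
  by move=> Ux; apply/derivable_mxP => i j; rewrite ord1; exact: (Ck_derivable (cf j) Ux).
split=> [x Ux|v].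
  by apply: continuous_rV => j; exact: (Ck_continuous (cf j)).
split=> [x Ux|]; first exact: df.
apply: IH => j; apply: Ck_ext oU _ (Ck_derive v (cf j)) => x Ux.
by have [_ ->] := derive_coord j (df x v Ux).
Qed.

Lemma Ck_comp_rV k (b : 'rV[R]_n -> R^o) D U f : open U -> open D ->
  (forall x, U x -> D (f x)) -> Ck k D b -> Ck k U f -> Ck k U (b \o f).
Proof.
move=> oU oD fD; elim: k b f fD => [|k IH] b f fD cb cf.
  split=> // x Ux; apply: continuous_comp; first exact: (Ck_continuous cf).
  by apply: (Ck_continuous cb); exact: fD.
have HD x v : U x -> is_derive x v (b \o f) (\sum_j 'D_v f x 0 j * 'D_(evec j) b (f x)).
  move=> Ux; apply: chain_rV oD _ (fD _ Ux) _; first exact: Ck_leq cb.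
  by apply: derivableP; exact: (Ck_derivable cf Ux).
split=> [x Ux|v].
  apply: continuous_comp; first exact: (Ck_continuous cf).
  by apply: (Ck_continuous cb); exact: fD.
split=> [x Ux|]; first by have [] := HD x v Ux.
have H : Ck k U (fun x => \sum_j 'D_v f x 0 j * 'D_(evec j) b (f x) : R^o).
  apply: Ck_sum => // j _; apply: Ck_mul => //.
    by apply: Ck_coord => //; exact: Ck_derive.
  exact: (IH ('D_(evec j) b) f fD (Ck_derive _ cb) (Ck_le cf)).
by apply: Ck_ext oU _ H => x Ux; have [_ ->] := HD x v Ux.
Qed.

End CkRow.

Lemma Ck_comp_rV2 k V (m n : nat) (b : 'rV[R]_n -> 'rV[R]_m) D (U : set V) f : open U -> open D ->
  (forall x, U x -> D (f x)) -> Ck k D b -> Ck k U f -> Ck k U (b \o f).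
Proof.
move=> oU oD fD cb cf; apply: Ck_rV => // j.
by apply: (@Ck_comp_rV _ _ k (fun y => b y 0 j) D) => //; exact: Ck_coord.
Qed.

(** * Elementary smooth functions of one variable *)

Section Elementary.
Implicit Types (D : set R^o) (F : R^o -> R^o).

Lemma is_derive_scale (F : R -> R) (x v d : R) : is_derive x (1 : R) F d -> is_derive x v F (v * d).
Proof.
move=> [dF <-]; move/derivable1_diffP : (dF) => df.
apply: DeriveDef; first exact: diff_derivable.
by rewrite deriveE // diff1E // derive1E.
Qed.

Lemma CkS_R k D F (F' : R^o -> R^o) : open D ->
  (forall x, D x -> is_derive (x : R) (1 : R) F (F' x)) -> Ck k D F' -> Ck k.+1 D F.
Proof.
move=> oD dF cF'; split=> [x Dx|v].
  by apply: differentiable_continuous; apply/derivable1_diffP; have [] := dF x Dx.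
split=> [x Dx|]; first by have [] := is_derive_scale v (dF x Dx).
apply: Ck_ext oD _ (Ck_mul oD (Ck_cst k D (v : R^o)) cF') => x Dx.
by have [_ ->] := is_derive_scale v (dF x Dx).
Qed.

Lemma Ck_sin_cos k : Ck k setT (sin : R^o -> R^o) /\ Ck k setT (cos : R^o -> R^o).
Proof.
elim: k => [|k [IHs IHc]].
  by split; split=> // x _; [exact: continuous_sin|exact: continuous_cos].
split; first by apply: CkS_R IHc => //; exact: openT.
by apply: CkS_R (Ck_opp openT IHs) => //; exact: openT.
Qed.

Lemma Ck_inv k : Ck k [set x : R^o | x != 0] (fun x => x^-1 : R^o).
Proof.
have oD : open [set x : R^o | x != 0] by exact: open_neq.
elim: k => [|k IH]; first by split=> // x x0; exact: inv_continuous.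
apply: (CkS_R (F' := fun x => - (x^-1 * x^-1)) oD) => [x /= x0|].
  apply: is_derive_eq; first exact: (is_deriveV (f := id)).
  by rewrite /= [_%:A]mulr1 expr2 invfM.
by apply: Ck_opp => //; exact: Ck_mul.
Qed.

(** The functions exp(-1/t) t^(-m), extended by 0. Derivatives stay in their linear span, so
    smoothness follows by induction for all [m] at once. *)
Definition flat (m : nat) (t : R^o) : R^o := if 0 < t then expR (- t^-1) * t^-1 ^+ m else 0.

Lemma flat_ge0 m t : 0 <= flat m t.
Proof. by rewrite /flat; case: ifP => // t0; rewrite mulr_ge0 ?expR_ge0 // exprn_ge0 // invr_ge0 ltW. Qed.

Lemma flat_gt0 m t : 0 < t -> 0 < flat m t.
Proof. by move=> t0; rewrite /flat t0 mulr_gt0 ?expR_gt0 // exprn_gt0 // invr_gt0. Qed.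

Lemma flat_le0 m t : t <= 0 -> flat m t = 0.
Proof. by rewrite /flat leNgt => /negbTE ->. Qed.

Lemma flat_le m t : `|flat m t| <= (m.+1)`!%:R * `|t|.
Proof.
rewrite ger0_norm ?flat_ge0 // /flat; case: ifP => t0; last by rewrite mulr_ge0.
rewrite expRN mulrC ler_pdivrMr ?expR_gt0 // gtr0_norm //.
have ti : 0 <= t^-1 by rewrite invr_ge0 ltW.
(* One term of the exponential series: exp(s) is at least s^(m+1)/(m+1)! for s = 1/t. *)
have H := expR_ge1Dxn m ti.
have : t^-1 ^+ m.+1 / m.+1`!%:R <= expR t^-1.
  by apply: le_trans H; rewrite lerDr.
rewrite ler_pdivrMr ?ltr0n ?fact_gt0 // exprSr ler_pdivrMr // => {}H.
by apply: (le_trans H); rewrite le_eqVlt; apply/orP; left; apply/eqP; ring.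
Qed.

Lemma is_derive_flat m (x : R) : is_derive x (1 : R) (flat m) (flat m.+2 x - m%:R * flat m.+1 x).
Proof.
have [x0|x0|<-] := ltgtP 0 x.
- apply: (@near_eq_is_derive _ _ _ (fun t : R => expR (- t^-1) * t^-1 ^+ m)).
    by near=> t; rewrite /flat ifT //; near: t; exact: lt_nbhsr.
  have xn : x != 0 by rewrite gt_eqF.
  have dV : is_derive x (1 : R) (fun t : R => t^-1) (- x^-2).
    apply: is_derive_eq; first exact: (is_deriveV (f := id)).
    by rewrite /= [_%:A]mulr1.
  have dN : is_derive x (1 : R) (fun t : R => - t^-1) (x^-2).
    by rewrite -[x^-2]opprK; exact: is_deriveN.
  have dE : is_derive x (1 : R) (fun t : R => expR (- t^-1)) (expR (- x^-1) * x^-2).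
    exact: (@is_derive1_comp _ expR (fun t => - t^-1)).
  have dP : is_derive x (1 : R) (fun t : R => t^-1 ^+ m) (m%:R * x^-1 ^+ m.-1 * - x^-2).
    case: (m) => [|m'] /=.
      by rewrite mul0r mul0r; exact: is_derive_cst.
    rewrite (_ : (fun t : R => t^-1 ^+ m'.+1) = (fun t : R => t^-1) ^+ m'.+1).
      exact: is_deriveX.
    by apply/funext => t; rewrite exprfctE.
  apply: (is_derive_eq (is_deriveM dE dP)).
  rewrite /flat x0 /GRing.scale /=.
  have gen (E y : R) : E * (m%:R * y ^+ m.-1 * - y ^+ 2) + y ^+ m * (E * y ^+ 2) =
      E * y ^+ m.+2 - m%:R * (E * y ^+ m.+1).
    case: (m) => [|m'] /=; rewrite ?exprS ?expr0; first by ring.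
    by move: (y ^+ m') (m'.+1%:R : R) => p q; ring.
  by have := gen (expR (- x^-1)) x^-1; rewrite (exprVn x 2).
- apply: (@near_eq_is_derive _ _ _ (fun t : R => 0 : R)).
    by near=> t; rewrite flat_le0 //; near: t; exact: lt_le_nbhsl.
  by rewrite !flat_le0 ?ltW // mulr0 subr0; exact: is_derive_cst.
rewrite !flat_le0 // mulr0 subr0.
have H : h^-1 *: ((flat m \o shift 0) (h *: 1) - flat m 0) @[h --> (0 : R)^'] --> (0 : R).
  apply/cvgrPdist_le => e e0; near=> h.
  have hn : h != 0 by near: h; exact: nbhs_dnbhs_neq.
  rewrite sub0r normrN /= addr0 (flat_le0 m (lexx 0)) subr0 [h *: 1]mulr1.
  (* At 0 the difference quotient of [flat m] is [flat m.+1], which is O(h) by [flat_le]. *)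
  have -> : h^-1 *: flat m h = flat m.+1 h.
    by rewrite /flat; case: ifP => _; rewrite ?scaler0 // /GRing.scale /= exprS mulrCA.
  apply: (le_trans (flat_le _ _)); rewrite mulrC -ler_pdivlMr ?ltr0n ?fact_gt0 //.
  by near: h; apply: dnbhs0_le; rewrite divr_gt0 // ltr0n fact_gt0.
apply: DeriveDef; first by apply/cvg_ex; exists 0.
exact/cvg_lim.
Unshelve. all: by end_near. Qed.

Lemma Ck_flat k m : Ck k setT (flat m).
Proof.
elim: k m => [|k IH] m.
  split=> // x _; apply: differentiable_continuous; apply/derivable1_diffP.
  by have [] := is_derive_flat m x.
apply: (CkS_R openT (fun x _ => is_derive_flat m x)).
by apply: Ck_sub_fun => //; [exact: openT|apply: Ck_mul => //; [exact: openT|exact: Ck_cst]].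
Qed.

End Elementary.

End Calculus.

(** * Smooth functions on a manifold *)

Section Charts.
Context {R : realType}.
Implicit Types V W : normedModType R.

Section OneChart.
Context {V : normedModType R} {M : topologicalType}.
Variable c : chart V M.
Hypothesis hc : is_chart c.

Lemma open_dom : open (dom c). Proof. by have [[]] := hc. Qed.
Lemma open_cimg : open (cimg c). Proof. by have [[]] := hc. Qed.

Lemma cmapK p : dom c p -> cinv c (cmap c p) = p.
Proof. by have [_ _ _] := hc; exact. Qed.

Lemma cimg_cmap p : dom c p -> cimg c (cmap c p).
Proof. by move=> cp; exists p. Qed.

Lemma cinvK y : cimg c y -> cmap c (cinv c y) = y.
Proof. by move=> [p cp <-]; rewrite cmapK. Qed.

Lemma dom_cinv y : cimg c y -> dom c (cinv c y).
Proof. by move=> [p cp <-]; rewrite cmapK. Qed.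

Lemma cmap_continuous p : dom c p -> {for p, continuous (cmap c)}.
Proof.
have [_ + _ _] := hc; rewrite continuous_open_subspace; last exact: open_dom.
by move=> + cp; apply; rewrite inE.
Qed.

Lemma cinv_continuous y : cimg c y -> {for y, continuous (cinv c)}.
Proof.
have [_ _ + _] := hc; rewrite continuous_open_subspace; last exact: open_cimg.
by move=> + cp; apply; rewrite inE.
Qed.

Lemma open_preim_cinv (B : set M) : open B -> open [set y | cimg c y /\ B (cinv c y)].
Proof.
move=> oB; rewrite openE => y [cy By]; rewrite /interior /=.
near=> z; split; first by near: z; exact: (open_nbhs_nbhs (conj open_cimg cy)).
by near: z; apply: (cinv_continuous cy); exact: open_nbhs_nbhs.
Unshelve. all: by end_near. Qed.

Lemma open_preim_cmap (B : set V) : open B -> open [set p | dom c p /\ B (cmap c p)].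
Proof.
move=> oB; rewrite openE => y [cy By]; rewrite /interior /=.
near=> z; split; first by near: z; exact: (open_nbhs_nbhs (conj open_dom cy)).
by near: z; apply: (cmap_continuous cy); exact: open_nbhs_nbhs.
Unshelve. all: by end_near. Qed.

Lemma image_domI (B : set M) : cmap c @` (dom c `&` B) = [set y | cimg c y /\ B (cinv c y)].
Proof.
apply/seteqP; split=> [y [p [cp Bp] <-]|y [[p cp <-]]]; first by split; [exists p|rewrite cmapK].
by rewrite cmapK // => Bp; exists p.
Qed.

End OneChart.

Lemma is_chart_line : is_chart (@Chart R R^o R setT id id).
Proof.
split=> //=; first by split; [exact: openT|rewrite /cimg image_id; exact: openT].
- by apply: continuous_subspaceT => x; exact: cvg_id.
- by apply: continuous_subspaceT => x; exact: cvg_id.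
Qed.

Lemma cimg_line : cimg (@Chart R R^o R setT id id) = setT.
Proof. by rewrite /cimg /= image_id. Qed.

Lemma smooth_atlas_line : smooth_atlas (@line_atlas R).
Proof.
split=> [c -> | p | c d -> ->] //=; first exact: is_chart_line.
move=> k; rewrite setIid image_id.
have H : continuous (@idfun R^o) by move=> x; exact: cvg_id.
exact: (@Ck_linear R R^o R^o k setT (@idfun R^o : {linear R^o -> R^o}) H).
Qed.

Lemma open_setX (T S : topologicalType) (A : set T) (B : set S) : open A -> open B -> open (A `*` B).
Proof.
move=> oA oB; rewrite openE => -[x y] [/= Ax By]; exists (A, B) => //=.
by split; exact: open_nbhs_nbhs.
Qed.

Lemma cimg_prod V W (M N : Type) (c : chart V M) (d : chart W N) :
  cimg (prod_chart c d) = cimg c `*` cimg d.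
Proof.
apply/seteqP; split=> [_ [[p q] [/= cp dq] <-]|[x y] [/= [p cp <-] [q dq <-]]] /=.
  by split; [exists p|exists q].
by exists (p, q).
Qed.

Lemma is_chart_prod V W (M N : topologicalType) (c : chart V M) (d : chart W N) :
  is_chart c -> is_chart d -> is_chart (prod_chart c d).
Proof.
move=> hc hd.
have o1 : open (dom (prod_chart c d)) by apply: open_setX; exact: open_dom.
have o2 : open (cimg (prod_chart c d)).
  by rewrite cimg_prod; apply: open_setX; exact: open_cimg.
split=> //.
- rewrite continuous_open_subspace // => -[p q]; rewrite inE => -[/= cp dq].
  apply: cvg_pair => /=.
    move=> B /(cmap_continuous hc cp) nB; exists (cmap c @^-1` B, setT); [split=> //; exact: filterT|by move=> [u v] [/= + _]].
  move=> B /(cmap_continuous hd dq) nB; exists (setT, cmap d @^-1` B); [split=> //; exact: filterT|by move=> [u v] [/= _ +]].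
- rewrite continuous_open_subspace // => -[x y]; rewrite inE cimg_prod => -[/= cx dy].
  apply: cvg_pair => /=.
    move=> B /(cinv_continuous hc cx) nB; exists (cinv c @^-1` B, setT); [split=> //; exact: filterT|by move=> [u v] [/= + _]].
  move=> B /(cinv_continuous hd dy) nB; exists (setT, cinv d @^-1` B); [split=> //; exact: filterT|by move=> [u v] [/= _ +]].
- by move=> [p q] [/= cp dq]; rewrite !cmapK.
Qed.

Section SmoothReal.
Context {n : nat} {M : topologicalType}.
Variable A : atlas 'rV[R]_n M.
Hypothesis hA : smooth_atlas A.

Definition smoothR (f : M -> R) : Prop :=
  continuous f /\ forall c, charts A c -> smooth_on (cimg c) (f \o cinv c : 'rV[R]_n -> R^o).

Lemma smRP f : smooth_map A (@line_atlas R) f <-> smoothR f.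
Proof.
split=> -[fc H]; split=> // c.
  move=> Ac k; have := H c _ Ac erefl k.
  by rewrite /= preimage_setT setIT.
move=> d Ac -> k /=; rewrite preimage_setT setIT; exact: H.
Qed.

Lemma chart_ok c : charts A c -> is_chart c.
Proof. by have [H _ _] := hA; exact: H. Qed.

Lemma chart_at_ok p : charts A (chart_at A p) /\ dom (chart_at A p) p.
Proof. by have [_ H _] := hA. Qed.

Lemma is_chart_at p : is_chart (chart_at A p).
Proof. by apply: chart_ok; have [] := chart_at_ok p. Qed.

Lemma dom_chart_at p : dom (chart_at A p) p.
Proof. by have [] := chart_at_ok p. Qed.

Lemma transition_Ck c d k : charts A c -> charts A d ->
  Ck k [set y | cimg c y /\ dom d (cinv c y)] (cmap d \o cinv c).
Proof.
move=> Ac Ad; rewrite -image_domI; last exact: chart_ok.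
by have [_ _ H] := hA; exact: H.
Qed.

(** One chart per point is enough, because the transition maps to all other charts are smooth. *)
Lemma smoothR_local (f : M -> R) : continuous f ->
  (forall p, exists d B, [/\ charts A d, dom d p, open B, B (cmap d p) &
     forall k, Ck k B (f \o cinv d : 'rV[R]_n -> R^o)]) -> smoothR f.
Proof.
move=> fc H; split=> // c Ac k; apply: Ck_local => y cy.
have [d [B [Ad dp oB Bp cB]]] := H (cinv c y).
have hc := chart_ok Ac; have hd := chart_ok Ad.
pose O := [set z | cimg c z /\ (dom d (cinv c z) /\ B (cmap d (cinv c z)))].
have oO : open O by exact: (open_preim_cinv hc (open_preim_cmap hd oB)).
exists O => //.
apply: (@Ck_ext R _ _ k O ((f \o cinv d) \o (cmap d \o cinv c))) => //.
  by move=> z [cz [dz Bz]] /=; rewrite cmapK.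
apply: (Ck_comp_rV (D := B)) => //; first by move=> z [_ []].
by apply: Ck_sub (transition_Ck k Ac Ad) => z [? []].
Qed.

Lemma smoothR_comp V (N : topologicalType) (B : atlas V N) (T : N -> M) (f : M -> R) c k :
  is_chart c -> smooth_map B A T -> smoothR f -> charts B c -> Ck k (cimg c) (f \o T \o cinv c : V -> R^o).
Proof.
move=> hc [Tc TS] [fc fS] Bc.
apply: Ck_local => y cy.
pose d := chart_at A (T (cinv c y)).
have [Ad dp] := chart_at_ok (T (cinv c y)); have hd := chart_ok Ad.
exists (cmap c @` (dom c `&` T @^-1` dom d)).
  by rewrite image_domI.
have oD : open (cmap c @` (dom c `&` T @^-1` dom d)).
  rewrite image_domI //; apply: (open_preim_cinv hc).
  by apply: open_comp => [x _|]; [exact: Tc|exact: open_dom].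
apply: (@Ck_ext R _ _ k _ ((f \o cinv d) \o (cmap d \o T \o cinv c))) => //.
  move=> z; rewrite image_domI // => -[cz dz] /=; by rewrite cmapK.
apply: (Ck_comp_rV (D := cimg d)) => //; first exact: open_cimg.
  move=> z; rewrite image_domI // => -[cz dz] /=; exact: cimg_cmap.
  exact: fS.
exact: TS.
Qed.

Definition extend (c : chart 'rV[R]_n M) (b : 'rV[R]_n -> R) (p : M) : R :=
  if `[< dom c p >] then b (cmap c p) else 0.

Lemma compact_cball (y : 'rV[R]_n) (r : R) : compact [set z | `|z - y| <= r].
Proof.
apply: bounded_closed_compact.
  exists (`|y| + r); split; first exact: num_real.
  move=> x hx z /= hz; apply: le_trans (ltW hx).
  rewrite -[z](subrK y) [leRHS]addrC; apply: (le_trans (ler_normD _ _)).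
  by rewrite lerD2r.
have -> : [set z | `|z - y| <= r] = (fun z => `|z - y|) @^-1` [set x | x <= r] by [].
apply: closed_comp => [x _|]; last exact: closed_le.
by apply: (@cvg_norm _ _ _ (nbhs x)); apply: (@cvgB _ _ _ (nbhs x)); [exact: cvg_id|exact: cvg_cst].
Qed.

Lemma compact_cinv c (K : set 'rV[R]_n) : charts A c -> compact K -> K `<=` cimg c ->
  compact (cinv c @` K).
Proof.
move=> Ac cK Kc; apply: continuous_compact => //.
apply: continuous_subspaceW Kc _.
by have [_ _ + _] := chart_ok Ac.
Qed.

Section Bump.
Hypothesis hM : hausdorff_space M.
Variables (c : chart 'rV[R]_n M) (b : 'rV[R]_n -> R^o) (y : 'rV[R]_n) (r : R).
Hypothesis Ac : charts A c.
Hypothesis sub : [set z | `|z - y| <= r] `<=` cimg c.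
Hypothesis bC : forall k, Ck k setT b.
Hypothesis b0 : forall z, r < `|z - y| -> b z = 0.

Definition bump_supp := cinv c @` [set z | `|z - y| <= r].

Lemma compact_bump_supp : compact bump_supp.
Proof. by apply: compact_cinv => //; exact: compact_cball. Qed.

Lemma extend_out p : ~ bump_supp p -> extend c b p = 0.
Proof.
move=> np; rewrite /extend; case: asboolP => // cp.
have [h|] := leP `|cmap c p - y| r; last exact: b0.
by case: np; exists (cmap c p) => //; rewrite cmapK //; exact: chart_ok.
Qed.

Lemma extendE z : cimg c z -> extend c b (cinv c z) = b z.
Proof.
move=> cz; rewrite /extend asboolT; last by apply: dom_cinv => //; exact: chart_ok.
by rewrite cinvK //; exact: chart_ok.
Qed.

Lemma closed_bump_supp : closed bump_supp.
Proof. by apply: compact_closed => //; exact: compact_bump_supp. Qed.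

(** Outside the domain of [c] the extension vanishes locally: [bump_supp] is compact, hence closed
    in the Hausdorff space [M]. *)
Lemma smoothR_extend : smoothR (extend c b).
Proof.
have hc := chart_ok Ac.
have cont : continuous (extend c b).
  move=> p; have [cp|np] := pselect (dom c p).
    apply: (@near_eq_cont _ _ (b \o cmap c)); last first.
      apply: continuous_comp; first exact: cmap_continuous.
      by apply: (Ck_continuous (bC 0)).
    near=> q; rewrite /extend asboolT //.
    by near: q; exact: (open_nbhs_nbhs (conj (open_dom hc) cp)).
  apply: (@near_eq_cont _ _ (fun=> 0)); last exact: cvg_cst.
  near=> q; rewrite extend_out //; near: q; apply: open_nbhs_nbhs; split.
    by apply: closed_openC; exact: closed_bump_supp.
  by move=> [z /sub zc zp]; apply: np; rewrite -zp; exact: dom_cinv.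
apply: smoothR_local => // p.
have [cp|np] := pselect (dom c p).
  exists c, (cimg c); split=> //; [exact: open_cimg|exact: cimg_cmap|].
  move=> k; apply: (@Ck_ext R _ _ k _ b); first exact: open_cimg.
    by move=> z cz /=; rewrite extendE.
  exact: Ck_sub (bC k).
have [Ad dp] := chart_at_ok p; have hd := chart_ok Ad.
have oB : open [set z | cimg (chart_at A p) z /\ (~` bump_supp) (cinv (chart_at A p) z)].
  by apply: open_preim_cinv => //; apply: closed_openC; exact: closed_bump_supp.
exists (chart_at A p), [set z | cimg (chart_at A p) z /\ (~` bump_supp) (cinv (chart_at A p) z)]; split=> //.
  split; first exact: cimg_cmap.
  by rewrite cmapK // => -[z /sub zc zp]; apply: np; rewrite -zp; exact: dom_cinv.
move=> k; apply: Ck_ext oB _ (Ck_cst k _ (0 : R^o)) => z [_ zn] /=.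
by rewrite extend_out.
Unshelve. all: by end_near. Qed.

End Bump.

End SmoothReal.

End Charts.

(** * The chain rule in charts and tangent maps *)

Section Chain.
Context {R : realType}.

(** The chain rule for functions with values in [W]. It is a parameter of the statements on charts,
    because real functions and row vectors require separate proofs. *)
Definition chain_target (W : normedModType R) := forall (V : normedModType R) (n : nat) (b : 'rV[R]_n -> W)
  (T : V -> 'rV[R]_n) (D : set 'rV[R]_n) x v w, open D -> Ck 1 D b -> D (T x) ->
  is_derive x v T w -> is_derive x v (b \o T) ('D_w b (T x)).

Lemma chain_R : chain_target R^o.
Proof.
move=> V n b T D x v w oD cb Dx dT.
have [_ ->] := Ck1_is_derive w oD cb Dx.
exact: chain_rV oD cb Dx dT.
Qed.

Lemma is_derive_rV (V : normedModType R) m (f : V -> 'rV[R]_m) x v (d : 'rV[R]_m) :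
  (forall j, is_derive x v (fun y => f y 0 j) (d 0 j)) -> is_derive x v f d.
Proof.
move=> H.
have df : derivable f x v by apply/derivable_mxP => i j; rewrite ord1; have [] := H j.
apply: DeriveDef => //; apply/rowP => j.
have [_ <-] := derive_coord j df.
by have [_ ->] := H j.
Qed.

Lemma chain_row m : chain_target 'rV[R]_m.
Proof.
move=> V n b T D x v w oD cb Dx dT.
apply: is_derive_rV => j.
have cbj : Ck 1 D (fun y => b y 0 j : R^o) by exact: Ck_coord.
have dbj := derive_coord j (Ck_derivable cb Dx : derivable b (T x) w).
have [_ <-] := dbj.
exact: (chain_R oD cbj Dx dT).
Qed.

Lemma derive_lin_row m n (b : 'rV[R]_n -> 'rV[R]_m) D y : open D -> Ck 1 D b -> D y ->
  forall (a : R) u v, 'D_(a *: u + v) b y = a *: 'D_u b y + 'D_v b y.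
Proof.
move=> oD cb Dy a u v; apply/rowP => j; rewrite !mxE.
have cbj : Ck 1 D (fun y => b y 0 j : R^o) by exact: Ck_coord.
have H w : ('D_w b y) 0 j = \sum_i w 0 i * 'D_(evec i) (fun y => b y 0 j : R^o) y.
  have [_ <-] := derive_coord j (Ck_derivable cb Dy : derivable b y w).
  by have [_ ->] := Ck1_is_derive w oD cbj Dy.
apply: (etrans (H _)); apply: (etrans (lform_is_linear _ a u v)).
by congr (a * _ + _); exact/esym/H.
Qed.

Lemma derive_lin_R n (b : 'rV[R]_n -> R^o) D y : open D -> Ck 1 D b -> D y ->
  forall (a : R) u v, 'D_(a *: u + v) b y = a * 'D_u b y + 'D_v b y.
Proof.
move=> oD cb Dy a u v.
have H w : 'D_w b y = \sum_i w 0 i * 'D_(evec i) b y.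
  by have [_ ->] := Ck1_is_derive w oD cb Dy.
apply: (etrans (H _)); apply: (etrans (lform_is_linear _ a u v)).
by congr (a * _ + _); exact/esym/H.
Qed.

End Chain.

Section Tangent.
Context {R : realType} {n : nat} {M : topologicalType}.
Variable A : atlas 'rV[R]_n M.
Hypothesis hA : smooth_atlas A.

Section Comp.
Context {V W : normedModType R} {N P : topologicalType}.
Variables (B : atlas V N) (C : atlas W P).
Hypothesis hB : smooth_atlas B.
Hypothesis hC : smooth_atlas C.
Hypothesis chW : chain_target W.

Lemma local_rep_Ck k (T : N -> M) c d : smooth_map B A T -> charts B c -> charts A d ->
  Ck k [set y | cimg c y /\ dom d (T (cinv c y))] (cmap d \o T \o cinv c).
Proof.
move=> [_ TS] Bc Ad; have := TS c d Bc Ad k; rewrite image_domI //.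
by have [h _ _] := hB; exact: h.
Qed.

Lemma open_local_rep (T : N -> M) c d : continuous T -> charts B c -> charts A d ->
  open [set y | cimg c y /\ dom d (T (cinv c y))].
Proof.
move=> Tc Bc Ad; apply: (@open_preim_cinv R V N c _ (T @^-1` dom d)).
  by have [h _ _] := hB; exact: h.
by apply: open_comp => [x _|]; [exact: Tc|apply: open_dom; exact: (chart_ok hA)].
Qed.

(** The intermediate chart [d] is arbitrary. With an identity for [T] or [S], this becomes the
    change of coordinates between a given chart and a preferred one. *)
Lemma chain_charts (T : N -> M) (S : M -> P) c d e y v :
  smooth_map B A T -> smooth_map A C S -> charts B c -> charts A d -> charts C e ->
  cimg c y -> dom d (T (cinv c y)) -> dom e (S (T (cinv c y))) ->
  is_derive y v (cmap e \o (S \o T) \o cinv c)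
    ('D_('D_v (cmap d \o T \o cinv c) y) (cmap e \o S \o cinv d) (cmap d (T (cinv c y)))).
Proof.
move=> hT [Sc hS] Bc Ad Ce cy dy ey.
have hd := chart_ok hA Ad; have he : is_chart e by have [h _ _] := hC; exact: h.
have Tc : continuous T by have [] := hT.
apply: (@near_eq_is_derive _ _ _ ((cmap e \o S \o cinv d) \o (cmap d \o T \o cinv c))).
  have := open_nbhs_nbhs (conj (open_local_rep Tc Bc Ad) (conj cy dy : [set y | cimg c y /\ dom d (T (cinv c y))] y)).
  by apply: filterS => z [cz dz] /=; rewrite cmapK.
have oD : open [set y | cimg d y /\ (S @^-1` dom e) (cinv d y)].
  apply: open_preim_cinv => //; apply: open_comp => [x _|]; [exact: Sc|exact: open_dom].
apply: chW oD _ _ _.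
- by rewrite -image_domI //; exact: hS.
- by split; [exact: cimg_cmap|rewrite /= cmapK].
- apply: derivableP.
  exact: (Ck_derivable (local_rep_Ck 1 hT Bc Ad) (conj cy dy : [set y | cimg c y /\ dom d (T (cinv c y))] y)).
Qed.

Lemma tangent_comp (T : N -> M) (S : M -> P) q v : smooth_map B A T -> smooth_map A C S ->
  tangent_map B C (S \o T) q v = tangent_map A C S (T q) (tangent_map B A T q v).
Proof.
move=> hT hS; rewrite /tangent_map /=.
have [_ hB2 _] := hB; have [hC1 hC2 _] := hC.
have [Bc cq] := hB2 q; have [Ce eq] := hC2 (S (T q)).
have [Ad dq] := chart_at_ok hA (T q).
have hc : is_chart (chart_at B q) by have [h _ _] := hB; exact: h.
have := @chain_charts T S _ _ _ (cmap (chart_at B q) q) v hT hS Bc Ad Ce.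
rewrite (cmapK hc cq) => /(_ (cimg_cmap cq) dq eq) [_ ->].
by [].
Qed.

End Comp.

Lemma idmap_smooth : smooth_map A A id.
Proof.
split=> [x|c d Ac Ad k]; first exact: cvg_id.
rewrite image_domI; last exact: (chart_ok hA).
exact: (transition_Ck hA k Ac Ad).
Qed.

Definition tangent_real (f : M -> R) (p : M) (v : 'rV[R]_n) : R := tangent_map A (@line_atlas R) f p v.

Lemma coord_field_real f c y v : smoothR A f -> charts A c -> cimg c y ->
  is_derive y v (f \o cinv c : 'rV[R]_n -> R^o) (tangent_real f (cinv c y) (coord_field A c v (cinv c y))).
Proof.
move=> fS Ac cy; have [Ad dp] := chart_at_ok hA (cinv c y).
have hc := chart_ok hA Ac.
have sf : smooth_map A (@line_atlas R) f by apply/smRP.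
have := @chain_charts _ R^o _ R^o A (@line_atlas R) hA (@smooth_atlas_line R) (@chain_R R) id f c _ _ y v idmap_smooth sf Ac Ad (erefl _) cy dp I.
by rewrite /tangent_real /tangent_map /coord_field (cinvK hc cy).
Qed.

Lemma open_trans c d : charts A c -> charts A d -> open [set y | cimg c y /\ dom d (cinv c y)].
Proof.
by move=> Ac Ad; apply: open_preim_cinv; [exact: (chart_ok hA)|apply: open_dom; exact: (chart_ok hA)].
Qed.

Lemma coord_field_lin c p : charts A c -> dom c p -> forall (a : R) u v,
  coord_field A c (a *: u + v) p = a *: coord_field A c u p + coord_field A c v p.
Proof.
move=> Ac cp; have [Ad dp] := chart_at_ok hA p; have hc := chart_ok hA Ac.
apply: (derive_lin_row (open_trans Ac Ad) (transition_Ck hA 1 Ac Ad)).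
by split; [exact: cimg_cmap|rewrite cmapK].
Qed.

(** The chain rule for the identity, through the preferred chart and back: opposite transition maps
    have inverse differentials. Positivity of the metric in arbitrary charts depends on it. *)
Lemma coord_field_inv c p v : charts A c -> dom c p ->
  'D_(coord_field A c v p) (cmap c \o cinv (chart_at A p)) (cmap (chart_at A p) p) = v.
Proof.
move=> Ac cp; have [Ad dp] := chart_at_ok hA p; have hc := chart_ok hA Ac.
have cy : cimg c (cmap c p) by exact: cimg_cmap.
have := @chain_charts _ _ _ _ A A hA hA (@chain_row R n) id id c (chart_at A p) c (cmap c p) v idmap_smooth idmap_smooth Ac Ad Ac cy.
rewrite /= cmapK // => /(_ dp cp) [_] /= E.
rewrite -[RHS](derive_id (cmap c p) v) /coord_field.
transitivity ('D_v (cmap c \o (id \o id) \o cinv c) (cmap c p)).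
  by rewrite E; congr ('D_ _ _ _).
apply: near_eq_derive; have := open_nbhs_nbhs (conj (open_cimg hc) cy).
by apply: filterS => z cz /=; rewrite cinvK.
Qed.

Lemma coord_field_surj c p w : charts A c -> dom c p -> exists v, coord_field A c v p = w.
Proof.
move=> Ac cp; have [Ad dp] := chart_at_ok hA p; have hc := chart_ok hA Ac.
have hd := chart_ok hA Ad.
have cy : cimg (chart_at A p) (cmap (chart_at A p) p) by exact: cimg_cmap.
have := @chain_charts _ _ _ _ A A hA hA (@chain_row R n) id id (chart_at A p) c (chart_at A p) (cmap (chart_at A p) p) w idmap_smooth idmap_smooth Ad Ac Ad cy.
rewrite /= cmapK // => /(_ cp dp) [_] /= E.
eexists; rewrite -[RHS](derive_id (cmap (chart_at A p) p) w) /coord_field.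
transitivity ('D_w (cmap (chart_at A p) \o (id \o id) \o cinv (chart_at A p)) (cmap (chart_at A p) p)).
  by rewrite E; congr ('D_ _ _ _).
apply: near_eq_derive; have := open_nbhs_nbhs (conj (open_cimg hd) cy).
by apply: filterS => z cz /=; rewrite cinvK.
Qed.

Lemma velocity_chart (gamma : R -> M) c (t : R) : smooth_map (@line_atlas R) A gamma ->
  charts A c -> dom c (gamma t) ->
  tangent_map (@line_atlas R) A gamma t (1 : R^o) =
    coord_field A c ('D_1 (cmap c \o gamma : R^o -> _) (t : R^o)) (gamma t).
Proof.
move=> hg Ac ct; have [Ad dt] := chart_at_ok hA (gamma t).
have := @chain_charts R^o _ _ _ (@line_atlas R) A (@smooth_atlas_line R) hA (@chain_row R n) gamma id _ c (chart_at A (gamma t)) t (1 : R^o) hg idmap_smooth (erefl _) Ac Ad _ ct dt.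
by rewrite cimg_line => /(_ I) [_].
Qed.

End Tangent.

(** * Norms of covectors *)

Section Forms.
Context {R : realType} {n : nat}.
Variable B : 'rV[R]_n -> 'rV[R]_n -> R.
Hypothesis Blin : forall a u v w, B (a *: u + v) w = a * B u w + B v w.
Hypothesis Bsym : forall v w, B v w = B w v.

Lemma form0 w : B 0 w = 0.
Proof.
have := Blin 1 0 0 w; rewrite scaler0 addr0 mul1r => H.
by apply: (@addrI _ (B 0 w)); rewrite addr0 -H.
Qed.

Lemma formZ a u w : B (a *: u) w = a * B u w.
Proof. by rewrite -[a *: u]addr0 Blin form0 addr0. Qed.

Lemma formD u v w : B (u + v) w = B u w + B v w.
Proof. by rewrite -[u in u + v]scale1r Blin mul1r. Qed.

Lemma formZZ a u : B (a *: u) (a *: u) = a ^+ 2 * B u u.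
Proof. by rewrite formZ Bsym formZ mulrA -expr2. Qed.

Lemma form_sum (I : Type) (r : seq I) (P : pred I) (c : I -> R) (F : I -> 'rV[R]_n) w :
  B (\sum_(i <- r | P i) c i *: F i) w = \sum_(i <- r | P i) c i * B (F i) w.
Proof.
elim: r => [|i r IH]; first by rewrite !big_nil form0.
by rewrite !big_cons; case: ifP => // _; rewrite formD formZ IH.
Qed.

Lemma row_evec (v : 'rV[R]_n) : v = \sum_j v 0 j *: evec j.
Proof.
apply/rowP => i; rewrite summxE (bigD1 i) //= !mxE !eqxx mulr1 big1 ?addr0 // => j ji.
by rewrite !mxE eqxx /= eq_sym (negbTE ji) mulr0.
Qed.

Lemma form_coords v w : B v w = \sum_i \sum_j v 0 i * w 0 j * B (evec i) (evec j).
Proof.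
rewrite {1}(row_evec v) form_sum; apply: eq_bigr => i _.
rewrite Bsym {1}(row_evec w) form_sum big_distrr /=; apply: eq_bigr => j _.
by rewrite mulrA Bsym.
Qed.

Hypothesis Bpos : forall v, v != 0 -> 0 < B v v.

Lemma form_ge0 v : 0 <= B v v.
Proof. by have [->|/Bpos/ltW] := eqVneq v 0; rewrite ?form0. Qed.

(** The form attains a positive minimum on the unit sphere, and homogeneity does the rest. *)
Lemma form_lower : exists2 m : R, 0 < m & forall v, m * `|v| ^+ 2 <= B v v.
Proof.
(* In dimension 0 the sphere is empty and any constant serves. *)
have [[v0 v0n]|H] := pselect (exists v : 'rV[R]_n, v != 0); last first.
  exists 1 => // v; have -> : v = 0 by apply: contrapT => /eqP vn; apply: H; exists v.
  by rewrite normr0 expr0n mulr0 form0.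
pose S := [set v : 'rV[R]_n | `|v| = 1].
have S0 : S !=set0.
  exists (`|v0|^-1 *: v0); rewrite /S /= normrZ normfV normr_id mulVf //.
  by rewrite normr_eq0.
have cS : compact S.
  apply: bounded_closed_compact.
    by exists 1; split=> // x x1 v /= ->; exact: ltW.
  have -> : S = Num.norm @^-1` [set 1 : R] by [].
  apply: closed_comp => [x _|]; first exact: norm_continuous.
  exact: closed_eq.
have Bc : continuous (fun v => B v v : R^o).
  under eq_fun do rewrite form_coords.
  move=> x; apply: (@cvg_bigsum _ _ _ _ (nbhs x)) => i _.
  apply: (@cvg_bigsum _ _ _ _ (nbhs x)) => j _.
  apply: (@cvgM R); last exact: cvg_cst.
  by apply: (@cvgM R); exact: coord_continuous.
have [v vS vmin] := EVT_min_rV S0 cS (continuous_subspaceT Bc).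
have vn : v != 0.
  by move: vS; rewrite inE /S /= => v1; rewrite -normr_eq0 v1 oner_eq0.
exists (B v v); first exact: Bpos.
move=> w; have [->|wn] := eqVneq w 0.
  by rewrite normr0 expr0n mulr0 form0.
have := vmin (`|w|^-1 *: w); rewrite inE /S /= normrZ normfV normr_id mulVf ?normr_eq0 // => /(_ erefl).
rewrite formZZ exprVn mulrC ler_pdivlMr //.
by rewrite exprn_gt0 // normr_gt0.
Qed.

End Forms.

(** Only finitely many coefficients have to be close; [form_lower] at [y0] turns the absolute error
    into a relative one. *)
Lemma form_near {R : realType} {n : nat} {T : topologicalType} (B : T -> 'rV[R]_n -> 'rV[R]_n -> R) (y0 : T) (K : R) :
  (\forall y \near y0, forall a u v w, B y (a *: u + v) w = a * B y u w + B y v w) ->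
  (\forall y \near y0, forall v w, B y v w = B y w v) ->
  (forall v, v != 0 -> 0 < B y0 v v) ->
  (forall v w, {for y0, continuous (fun y => B y v w : R^o)}) ->
  1 < K ->
  \forall y \near y0, forall v, B y v v <= K * B y0 v v /\ B y0 v v <= K * B y v v.
Proof.
move=> lin sym pos cont K1.
have lin0 := nbhs_singleton lin; have sym0 := nbhs_singleton sym.
have [m m0 hm] := form_lower lin0 sym0 pos.
(* Then [1 - d = K^-1] and [1 + d = 2 - K^-1 <= K], so a relative error [d] gives both
   inequalities. *)
pose d := 1 - K^-1.
have K0 : 0 < K by exact: lt_trans K1.
have d0 : 0 < d by rewrite subr_gt0 invf_lt1.
(* The n^2 coefficients contribute at most n^2 e |v|^2, which is at most d m |v|^2. *)
pose e := d * m / (n.+1%:R ^+ 2).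
have e0 : 0 < e by rewrite divr_gt0 // ?mulr_gt0 // exprn_gt0.
have nr : \forall y \near y0, forall ij : 'I_n * 'I_n,
    `|B y (evec ij.1) (evec ij.2) - B y0 (evec ij.1) (evec ij.2)| <= e.
  apply: (@filter_forall _ _ (fun (ij : 'I_n * 'I_n) y => `|B y (evec ij.1) (evec ij.2) - B y0 (evec ij.1) (evec ij.2)| <= e) (nbhs y0)) => ij.
  have /cvgrPdist_le /(_ _ e0) := cont (evec ij.1) (evec ij.2).
  by apply: filterS => y; rewrite distrC.
near=> y.
have liny : forall a u v w, B y (a *: u + v) w = a * B y u w + B y v w by near: y.
have symy : forall v w, B y v w = B y w v by near: y.
have nry : forall ij : 'I_n * 'I_n,
    `|B y (evec ij.1) (evec ij.2) - B y0 (evec ij.1) (evec ij.2)| <= e by near: y.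
move=> v.
have D : `|B y v v - B y0 v v| <= d * B y0 v v.
  have -> : B y v v - B y0 v v = \sum_i \sum_j v 0 i * v 0 j *
      (B y (evec i) (evec j) - B y0 (evec i) (evec j)).
    rewrite (form_coords liny symy) (form_coords lin0 sym0) -sumrB.
    by apply: eq_bigr => i _; rewrite -sumrB; apply: eq_bigr => j _; rewrite mulrBr.
  apply: (@le_trans _ _ (\sum_(i < n) \sum_(j < n) (`|v| * `|v| * e))).
    apply: (le_trans (ler_norm_sum _ _ _)); apply: ler_sum => i _.
    apply: (le_trans (ler_norm_sum _ _ _)); apply: ler_sum => j _.
    rewrite normrM; apply: ler_pM => //.
      by rewrite normrM; apply: ler_pM => //; exact: coord_le_norm.
    exact: (nry (i, j)).
  rewrite !sumr_const !card_ord -mulrnA -mulr_natr.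
  apply: (@le_trans _ _ (d * (m * `|v| ^+ 2))); last by rewrite ler_pM2l.
  rewrite /e -expr2.
  have -> : `|v| ^+ 2 * (d * m / n.+1%:R ^+ 2) * (n * n)%:R = (d * (m * `|v| ^+ 2)) * ((n * n)%:R / n.+1%:R ^+ 2).
    by ring.
  have p0 : 0 <= d * (m * `|v| ^+ 2).
    by apply: mulr_ge0; [exact: ltW|apply: mulr_ge0; [exact: ltW|exact: exprn_ge0]].
  rewrite ler_piMr //; apply: ltW.
  rewrite ltr_pdivrMr ?exprn_gt0 // mul1r -natrX ltr_nat expnS expn1.
  by apply: (leq_ltn_trans (leq_mul (leqnSn n) (leqnn n))); rewrite ltn_mul2l /=.
have B0 := form_ge0 lin0 pos v.
move: D; rewrite ler_norml /d => /andP[D1 D2].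
have Ki : 0 < K^-1 by rewrite invr_gt0.
have KK : K * K^-1 = 1 by rewrite divff // gt_eqF.
split; last by nra.
have : 0 <= (K - 1) ^+ 2 * K^-1 by rewrite mulr_ge0 ?sqr_ge0 // ltW.
move=> H; have : 2 - K^-1 <= K by nra.
by nra.
Unshelve. all: by end_near. Qed.

Section Metric.
Context {R : realType} {n : nat} {M : topologicalType}.
Variable A : atlas 'rV[R]_n M.
Hypothesis hA : smooth_atlas A.
Variable g : M -> 'rV[R]_n -> 'rV[R]_n -> R.
Hypothesis hg : riemannian_metric A g.

Lemma g_lin p a u v w : g p (a *: u + v) w = a * g p u w + g p v w.
Proof. by have [h _ _ _] := hg. Qed.
Lemma g_sym p v w : g p v w = g p w v.
Proof. by have [_ h _ _] := hg. Qed.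
Lemma g_pos p v : v != 0 -> 0 < g p v v.
Proof. by have [_ _ h _] := hg; exact: h. Qed.
Lemma g_ge0 p v : 0 <= g p v v.
Proof. exact: (form_ge0 (g_lin p) (fun v => @g_pos p v)). Qed.

Definition gnrm p v := Num.sqrt (g p v v).

Lemma gnrm_ge0 p v : 0 <= gnrm p v. Proof. exact: sqrtr_ge0. Qed.

Lemma gnrm0 p : gnrm p 0 = 0.
Proof. by rewrite /gnrm (form0 (g_lin p)) sqrtr0. Qed.

(** The metric in the coordinate frame of [c]. The preferred charts may jump from point to point, so
    [g] read in them need not be continuous in the point, whereas these coefficients are smooth. *)
Definition Gm (c : chart 'rV[R]_n M) (y : 'rV[R]_n) v w : R :=
  g (cinv c y) (coord_field A c v (cinv c y)) (coord_field A c w (cinv c y)).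

Section InChart.
Variable c : chart 'rV[R]_n M.
Hypothesis Ac : charts A c.
Let hc : is_chart c := chart_ok hA Ac.

Lemma Gm_lin y : cimg c y -> forall a u v w, Gm c y (a *: u + v) w = a * Gm c y u w + Gm c y v w.
Proof. by move=> cy a u v w; rewrite /Gm (coord_field_lin hA Ac (dom_cinv hc cy)) g_lin. Qed.

Lemma Gm_sym y v w : Gm c y v w = Gm c y w v.
Proof. exact: g_sym. Qed.

Lemma Gm_pos y : cimg c y -> forall v, v != 0 -> 0 < Gm c y v v.
Proof.
move=> cy v v0; apply: g_pos; apply: contra v0 => /eqP v0.
have dy := dom_cinv hc cy.
rewrite -(coord_field_inv hA v Ac dy) v0; apply/eqP; exact: derive0.
Qed.

Lemma Gm_ge0 y v : 0 <= Gm c y v v.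
Proof. exact: g_ge0. Qed.

Lemma Gm_cont v w y : cimg c y -> {for y, continuous (fun y => Gm c y v w : R^o)}.
Proof. by move=> cy; have [_ _ _ h] := hg; exact: (Ck_continuous (h c v w Ac 0)). Qed.

Lemma near_cimg y0 : cimg c y0 -> \forall y \near y0, cimg c y.
Proof. by move=> cy; exact: (open_nbhs_nbhs (conj (open_cimg hc) cy)). Qed.

Lemma Gm_near y0 (K : R) : cimg c y0 -> 1 < K ->
  \forall y \near y0, cimg c y /\ forall v, Gm c y v v <= K * Gm c y0 v v /\ Gm c y0 v v <= K * Gm c y v v.
Proof.
move=> cy0 K1.
have H := @form_near R n _ (Gm c) y0 K _ _ (Gm_pos cy0) (fun v w => Gm_cont cy0) K1.
near=> y; split; first by near: y; exact: near_cimg.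
near: y; apply: H.
  near=> y; apply: Gm_lin; near: y; exact: near_cimg.
by near=> y; exact: Gm_sym.
Unshelve. all: by end_near. Qed.

Lemma gnrm_Gm y v : gnrm (cinv c y) (coord_field A c v (cinv c y)) = Num.sqrt (Gm c y v v).
Proof. by []. Qed.

End InChart.

(** A bound on the norm of the differential that avoids the supremum: such bounds can be added,
    averaged over the group and read in any chart. *)
Definition grad_le (f : M -> R) p (C : R) := forall v, `|tangent_real A f p v| <= C * gnrm p v.

Lemma tangent_real_lin f p : smoothR A f -> forall a u v,
  tangent_real A f p (a *: u + v) = a * tangent_real A f p u + tangent_real A f p v.
Proof.
move=> [_ fS] a u v; have [Ad dp] := chart_at_ok hA p.
have hd := chart_ok hA Ad.
exact: (derive_lin_R (open_cimg hd) (fS _ Ad 1%N) (cimg_cmap dp)).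
Qed.

Lemma tangent_real_bounded f p : smoothR A f -> exists2 C, 0 <= C & grad_le f p C.
Proof.
move=> fS; have [Ad dp] := chart_at_ok hA p.
have [m m0 hm] := form_lower (g_lin p) (g_sym p) (@g_pos p).
pose l j := tangent_real A f p (evec j).
have E v : tangent_real A f p v = \sum_j v 0 j * l j.
  have [_ fS'] := fS; have hd := chart_ok hA Ad.
  by have [_] := Ck1_is_derive v (open_cimg hd) (fS' _ Ad 1%N) (cimg_cmap dp).
have L0 : 0 <= \sum_j `|l j| by exact: sumr_ge0.
exists ((\sum_j `|l j|) / Num.sqrt m); first by rewrite divr_ge0 // sqrtr_ge0.
move=> v; rewrite E mulrAC ler_pdivlMr ?sqrtr_gt0 //.
apply: (@le_trans _ _ ((\sum_j `|l j|) * `|v| * Num.sqrt m)).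
  rewrite ler_wpM2r ?sqrtr_ge0 //; apply: (le_trans (ler_norm_sum _ _ _)).
  rewrite mulr_suml; apply: ler_sum => j _; rewrite normrM mulrC ler_wpM2l //.
  exact: coord_le_norm.
rewrite -mulrA ler_wpM2l // /gnrm mulrC -[`|v|]normr_id -sqrtr_sqr -sqrtrM ?(ltW m0) //.
exact: ler_wsqrtr.
Qed.

Definition rcn := real_codiff_norm A g.

(** Ensures that the [sup] in [real_codiff_norm] is a true supremum and not a default value. *)
Lemma rcn_has_sup f p : smoothR A f -> has_sup [set `|tangent_real A f p v| | v in [set v | g p v v <= 1]].
Proof.
move=> fS; have [C C0 hC] := tangent_real_bounded p fS; split.
  exists `|tangent_real A f p 0|; exists 0 => //=.
  by rewrite (form0 (g_lin p)).
exists C => _ [v /= v1 <-]; apply: (le_trans (hC v)).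
by rewrite ler_piMr // /gnrm -sqrtr1 ler_wsqrtr.
Qed.

Lemma rcn_ge0 f p : smoothR A f -> 0 <= rcn f p.
Proof.
move=> fS; have [ne ub] := rcn_has_sup p fS.
apply: (@le_trans _ _ `|tangent_real A f p 0|) => //.
by apply: ub_le_sup => //; exists 0 => //=; rewrite (form0 (g_lin p)).
Qed.

Lemma rcn_grad f p : smoothR A f -> grad_le f p (rcn f p).
Proof.
move=> fS v; have [ne ub] := rcn_has_sup p fS.
have Z a u : tangent_real A f p (a *: u) = a * tangent_real A f p u.
  have T0 : tangent_real A f p 0 = 0 by exact: derive0.
  have := tangent_real_lin p fS a u 0.
  by rewrite T0 !addr0.
have [->|v0] := eqVneq v 0.
  by rewrite gnrm0 mulr0 -(scale0r (0 : 'rV[R]_n)) Z mul0r normr0.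
have gp : 0 < gnrm p v by rewrite sqrtr_gt0 g_pos.
rewrite -ler_pdivrMr // -[X in _ / X]gtr0_norm // -normfV -normrM mulrC -Z.
apply: (ub_le_sup ub); exists ((gnrm p v)^-1 *: v) => [|//].
rewrite /= (formZZ (g_lin p) (g_sym p)) exprVn sqr_sqrtr ?g_ge0 // mulVf //.
by rewrite gt_eqF // g_pos.
Qed.

Lemma rcn_le f p C : smoothR A f -> 0 <= C -> grad_le f p C -> rcn f p <= C.
Proof.
move=> fS C0 H; have [ne ub] := rcn_has_sup p fS.
apply: ge_sup => // _ [v /= v1 <-]; apply: (le_trans (H v)).
by rewrite ler_piMr // /gnrm -sqrtr1 ler_wsqrtr.
Qed.

Lemma grad_le_chart f c y C : smoothR A f -> charts A c -> cimg c y ->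
  (forall v, `|'D_v (f \o cinv c : 'rV[R]_n -> R^o) y| <= C * Num.sqrt (Gm c y v v)) <->
  grad_le f (cinv c y) C.
Proof.
move=> fS Ac cy; have hc := chart_ok hA Ac; have dy := dom_cinv hc cy; split=> H v.
  have [w <-] := coord_field_surj hA v Ac dy.
  by have [_ <-] := coord_field_real hA w fS Ac cy; exact: H.
by have [_ ->] := coord_field_real hA v fS Ac cy; exact: H.
Qed.

Lemma norm_est1 (x y s0 s1 r0 e d : R) : `|x - y| <= e * s0 -> `|y| <= r0 * s0 ->
  s0 <= (1 + d) * s1 -> 0 <= r0 -> 0 <= e -> `|x| <= (r0 + e) * (1 + d) * s1.
Proof.
move=> h1 h2 h3 r00 e0; rewrite -(subrK y x).
apply: (le_trans (ler_normD _ _)); apply: (le_trans (lerD h1 h2)).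
by rewrite -mulrDl addrC -mulrA ler_wpM2l // addr_ge0.
Qed.

Lemma norm_est2 (x y s0 s1 r e d : R) : `|x - y| <= e * s0 -> `|x| <= r * s1 ->
  s1 <= (1 + d) * s0 -> 0 <= r -> `|y| <= (r * (1 + d) + e) * s0.
Proof.
move=> h1 h2 h3 r0; rewrite -(subrK x y).
apply: (le_trans (ler_normD _ _)); rewrite distrC addrC mulrDl lerD //.
by apply: (le_trans h2); rewrite -mulrA ler_wpM2l.
Qed.

(** In a chart, the coefficients of the metric and the partial derivatives both vary continuously.
    Comparing the norms in both directions bounds the supremum from above and from below. *)
Lemma rcn_continuous f : smoothR A f -> continuous (rcn f).
Proof.
move=> fS p; have [Ac cp] := chart_at_ok hA p.
pose c := chart_at A p; have hc : is_chart c := chart_ok hA Ac.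
apply: (@near_eq_cont _ _ ((rcn f \o cinv c) \o cmap c)).
  have := open_nbhs_nbhs (conj (open_dom hc) cp).
  by apply: filterS => q dq /=; rewrite cmapK.
apply: continuous_comp; first exact: cmap_continuous.
have cy0 : cimg c (cmap c p) by exact: cimg_cmap.
move: (cmap c p) cy0 => y0 cy0.
apply/(@cvgrPdist_le _ R^o _ (nbhs y0)) => e e0 /=.
set r0 := rcn f (cinv c y0).
have r00 : 0 <= r0 by exact: rcn_ge0.
have [m m0 hm] := form_lower (Gm_lin Ac cy0) (@Gm_sym c y0) (Gm_pos Ac cy0).
have sm : 0 < Num.sqrt m by rewrite sqrtr_gt0.
(* Chosen so that [d (r0 + e + 1) = e / 2]. Squared norms are compared with the factor [(1 + d)^2],
   hence norms with the factor [1 + d]. *)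
pose d := e / (2 * (r0 + e + 1)).
have d0 : 0 < d by rewrite divr_gt0 // mulr_gt0 //; lra.
have K1 : 1 < (1 + d) ^+ 2 by rewrite expr2; nra.
pose e' := e / 2 * Num.sqrt m / n.+1%:R.
have e'0 : 0 < e' by rewrite divr_gt0 // !mulr_gt0.
have fc := fS.2 c Ac.
have nD : \forall y \near y0, forall j, `|'D_(evec j) (f \o cinv c : 'rV[R]_n -> R^o) y - 'D_(evec j) (f \o cinv c : 'rV[R]_n -> R^o) y0| <= e'.
  apply: (@filter_forall _ _ (fun j y => `|'D_(evec j) (f \o cinv c : 'rV[R]_n -> R^o) y - 'D_(evec j) (f \o cinv c : 'rV[R]_n -> R^o) y0| <= e') (nbhs y0)) => j.
  have := Ck_continuous (Ck_derive (evec j) (fc 1%N)) cy0.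
  move=> /cvgrPdist_le /(_ _ e'0); by apply: filterS => y; rewrite distrC.
near=> y.
have [cy hK] : cimg c y /\ forall v, Gm c y v v <= (1 + d) ^+ 2 * Gm c y0 v v /\ Gm c y0 v v <= (1 + d) ^+ 2 * Gm c y v v.
  by near: y; exact: Gm_near.
have hD : forall j, `|'D_(evec j) (f \o cinv c : 'rV[R]_n -> R^o) y - 'D_(evec j) (f \o cinv c : 'rV[R]_n -> R^o) y0| <= e' by near: y.
have d10 : 0 <= 1 + d by lra.
have N1 v : Num.sqrt (Gm c y v v) <= (1 + d) * Num.sqrt (Gm c y0 v v).
  rewrite -[1 + d]ger0_norm // -sqrtr_sqr -sqrtrM ?sqr_ge0 //.
  by apply: ler_wsqrtr; case: (hK v).
have N2 v : Num.sqrt (Gm c y0 v v) <= (1 + d) * Num.sqrt (Gm c y v v).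
  rewrite -[1 + d]ger0_norm // -sqrtr_sqr -sqrtrM ?sqr_ge0 //.
  by apply: ler_wsqrtr; have [] := hK v.
have DD v : `|'D_v (f \o cinv c : 'rV[R]_n -> R^o) y - 'D_v (f \o cinv c : 'rV[R]_n -> R^o) y0| <= e / 2 * Num.sqrt (Gm c y0 v v).
  have [_ ->] := Ck1_is_derive v (open_cimg hc) (fc 1%N) cy.
  have [_ ->] := Ck1_is_derive v (open_cimg hc) (fc 1%N) cy0.
  rewrite -sumrB; apply: (le_trans (ler_norm_sum _ _ _)).
  apply: (@le_trans _ _ (\sum_(j < n) `|v| * e')).
    apply: ler_sum => j _; rewrite -mulrBr normrM; apply: ler_pM => //; exact: coord_le_norm.
  rewrite sumr_const card_ord -(mulr_natr (`|v| * e') n).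
  have vm : `|v| * Num.sqrt m <= Num.sqrt (Gm c y0 v v).
    rewrite mulrC -[`|v|]normr_id -sqrtr_sqr -sqrtrM ?(ltW m0) //; exact: ler_wsqrtr.
  have -> : `|v| * e' * n%:R = e / 2 * (`|v| * Num.sqrt m) * (n%:R / n.+1%:R) by rewrite /e'; ring.
  have h1 : 0 <= e / 2 * (`|v| * Num.sqrt m) by rewrite !mulr_ge0 // ?divr_ge0 // ltW.
  apply: (@le_trans _ _ (e / 2 * (`|v| * Num.sqrt m))).
    by rewrite ler_piMr // ler_pdivrMr // mul1r ler_nat.
  by rewrite ler_wpM2l // divr_ge0 // ltW.
set r := rcn f (cinv c y).
have r_ge0 : 0 <= r by exact: rcn_ge0.
have g0 := (grad_le_chart r0 fS Ac cy0).2 (rcn_grad _ fS).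
have gy := (grad_le_chart r fS Ac cy).2 (rcn_grad _ fS).
have B1 : r <= (r0 + e / 2) * (1 + d).
  have C0 : 0 <= (r0 + e / 2) * (1 + d) by rewrite mulr_ge0 //; lra.
  apply: (rcn_le fS C0); apply: (grad_le_chart _ fS Ac cy).1 => v.
  by apply: (norm_est1 (DD v) (g0 v) (N2 v)) => //; lra.
have B2 : r0 <= r * (1 + d) + e / 2.
  have C0 : 0 <= r * (1 + d) + e / 2 by apply: addr_ge0; [exact: mulr_ge0|lra].
  apply: (rcn_le fS C0); apply: (grad_le_chart _ fS Ac cy0).1 => v.
  exact: (norm_est2 (DD v) (gy v) (N1 v)).
have de : d * (r0 + e + 1) = e / 2 by rewrite /d; field; lra.
rewrite ler_norml; apply/andP; split; first by nra.
have : r * d <= (r0 + e) * d -> r0 - r <= e by nra.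
apply; rewrite ler_wpM2r ?ltW //; nra.
Unshelve. all: by end_near. Qed.

End Metric.

(** An induction principle that replaces finite subcovers: a property stable under subsets and
    finite unions passes from neighbourhoods to compact sets. The filter [F] is directed by the sets
    that have the property. *)
Lemma compact_ind (T : topologicalType) (P : set T -> Prop) (K : set T) :
  P set0 -> (forall A B, P A -> P B -> P (A `|` B)) -> (forall A B, A `<=` B -> P B -> P A) ->
  compact K -> (forall x, K x -> exists2 U, nbhs x U & P U) -> P K.
Proof.
move=> P0 PU PS /compact_near_coveringP cK loc.
pose F : set_system (set T) := filter_from P (fun A => [set B | P B /\ A `<=` B]).
have FF : Filter F.
  apply: filter_from_filter; first by exists set0.
  move=> A B PA PB; exists (A `|` B); first exact: PU.
  by move=> C [PC ABC]; split; split=> // x ?; apply: ABC; [left|right].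
have [|A PA AF] := cK _ F (fun A x => A x) FF.
  move=> x /loc[U nU PUU]; exists (U, [set B | P B /\ U `<=` B]) => /=.
    by split=> //; exists U.
  by move=> [y B] [/= Uy [_ UB]]; exact: UB.
by apply: (PS _ A) => //; apply: AF; split.
Qed.

Lemma ultra_fmap (T S : Type) (f : T -> S) (U : set_system T) : UltraFilter U -> UltraFilter (f @ U).
Proof.
move=> UU; have PU : ProperFilter U by exact: ultra_proper.
apply: Build_UltraFilter => G PG sub; apply/seteqP; split => A; last exact: sub.
move=> GA; have [//|nA] := in_ultra_setVsetC (f @^-1` A) UU.
have GnA : G (~` A) by exact: sub.
have : G set0 by rewrite -(setICr A); exact: filterI.
by move/filter_ex => [].
Qed.

Lemma cvg_to_le {R : realType} (T : Type) (F : set_system T) {FF : ProperFilter F} (f h : T -> R) (l l' : R) :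
  f x @[x --> F] --> l -> h x @[x --> F] --> l' -> (\forall x \near F, f x <= h x) -> l <= l'.
Proof.
move=> fl hl fh; rewrite -subr_ge0.
have c : (h x - f x) @[x --> F] --> l' - l by apply: (@cvgB _ R^o).
rewrite -(cvg_lim (@Rhausdorff R) c); apply: limr_ge; first by apply/cvg_ex; exists (l' - l).
by apply: filterS fh => x; rewrite subr_ge0.
Qed.

(** * Invariant functionals *)

Section CompactSupport.
Context {R : realType} {G : topologicalType}.

Definition Cc (f : G -> R) := continuous f /\ exists2 K, compact K & forall x, ~ K x -> f x = 0.
Definition Ccp (f : G -> R) := Cc f /\ forall x, 0 <= f x.
Definition nonzero (f : G -> R) := exists x, 0 < f x.

Lemma Cc_add f1 f2 : Cc f1 -> Cc f2 -> Cc (fun x => f1 x + f2 x).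
Proof.
move=> [c1 [K1 cK1 h1]] [c2 [K2 cK2 h2]]; split.
  by move=> x; apply: (@cvgD _ R^o); [exact: c1|exact: c2].
exists (K1 `|` K2); first exact: compactU.
by move=> x nx; rewrite h1 ?h2 ?addr0 // => ?; apply: nx; [right|left].
Qed.

Lemma Cc_mull (f1 f2 : G -> R) : continuous f1 -> Cc f2 -> Cc (fun x => f1 x * f2 x).
Proof.
move=> c1 [c2 [K2 cK2 h2]]; split.
  by move=> x; apply: (@cvgM R); [exact: c1|exact: c2].
by exists K2 => // x nx; rewrite h2 ?mulr0.
Qed.

Lemma Cc_scale a f : Cc f -> Cc (fun x => a * f x).
Proof. by move=> fC; apply: (Cc_mull (f1 := fun=> a)) => // x; exact: cvg_cst. Qed.

Lemma Cc_bounded f : Cc f -> exists2 B : R, 0 < B & forall x, f x <= B.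
Proof.
move=> [fc [K cK fK]].
have [|nK] := pselect (exists x0, K x0); last first.
  by exists 1 => // x; rewrite fK // => Kx; apply: nK; exists x.
move=> [x0 Kx0].
have [|||c _ hc] := @compact_EVT_max _ R f K.
- by exists x0.
- exact: cK.
- exact: continuous_subspaceT.
exists (`|f c| + 1); first by rewrite ltr_wpDl.
move=> x; have [Kx|nK] := pselect (K x); last by rewrite fK // addr_ge0.
apply: (le_trans (hc x _)); first by rewrite inE.
by apply: (le_trans (ler_norm _)); rewrite lerDl.
Qed.

Lemma Cc_sub (f1 f2 : G -> R) : Cc f1 -> Cc f2 -> Cc (fun x => f1 x - f2 x).
Proof.
move=> h1 h2; have := Cc_add h1 (Cc_scale (-1) h2).
by under eq_fun do rewrite mulN1r.
Qed.

Lemma Cc0 : Cc (fun=> 0 : R).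
Proof. by split; [move=> x; exact: cvg_cst|exists set0; [exact: compact0|]]. Qed.

Lemma Cc_bigsum (I : Type) (r : seq I) (F : I -> G -> R) :
  (forall i, Cc (F i)) -> Cc (fun x => \sum_(i <- r) F i x).
Proof.
move=> H; elim: r => [|i r IH].
  by under eq_fun do rewrite big_nil; exact: Cc0.
by under eq_fun do rewrite big_cons; exact: Cc_add.
Qed.

Lemma Cc_norm f : Cc f -> Cc (fun x => `|f x|).
Proof.
move=> [c [K cK h]]; split.
  by move=> x; apply: (@cvg_norm _ R^o _ (nbhs x)); exact: c.
by exists K => // x /h ->; rewrite normr0.
Qed.

Lemma Ccp_add f1 f2 : Ccp f1 -> Ccp f2 -> Ccp (fun x => f1 x + f2 x).
Proof. by move=> [c1 p1] [c2 p2]; split; [exact: Cc_add|move=> x; rewrite addr_ge0]. Qed.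

Lemma Ccp_scale a f : 0 <= a -> Ccp f -> Ccp (fun x => a * f x).
Proof. by move=> a0 [c1 p1]; split; [exact: Cc_scale|move=> x; rewrite mulr_ge0]. Qed.

End CompactSupport.

Section Haar.
Context {R : realType} {G : groupTopType}.
Implicit Types f psi phi : G -> R.
Hypothesis mulc : continuous (fun x : G * G => (x.1 * x.2)%g).
Hypothesis invc : continuous (fun x : G => (x^-1)%g).
Hypothesis hausG : hausdorff_space G.

Hypothesis bumpG : forall V : set G, nbhs (1%g : G) V -> exists f : G -> R, [/\ Ccp f, 0 < f 1%g & forall x, ~ V x -> f x = 0].

Definition covers (phi f : G -> R) (s : seq (R * G)) :=
  (forall p, p \in s -> 0 <= p.1) /\
  forall x, f x <= \sum_(p <- s) p.1 * phi (x * p.2)%g.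
Definition weight (s : seq (R * G)) := \sum_(p <- s) p.1.
(** Haar's covering ratio (f : phi), for right translates of [phi]. It is sublinear in [f] and
    invariant under right translation; additivity is reached only in the limit of [phi]
    concentrating at 1. *)
Definition ratio (phi f : G -> R) := inf [set t | exists2 s, covers phi f s & t = weight s].

Lemma right_continuous (h : G) : continuous (fun x : G => (x * h)%g).
Proof.
move=> x; apply: (@continuous_comp _ _ _ (fun x => (x, h)) (fun x : G * G => (x.1 * x.2)%g)).
  by apply: cvg_pair; [exact: cvg_id|exact: cvg_cst].
exact: mulc.
Qed.

Lemma Cc_right f h : Cc f -> Cc (fun x => f (x * h)%g).
Proof.
move=> [fc [K cK fK]]; split.
  by move=> x; apply: continuous_comp; [exact: right_continuous|exact: fc].
exists ((fun x : G => x * h^-1)%g @` K).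
  by apply: continuous_compact => //; apply: continuous_subspaceT; exact: right_continuous.
move=> x xK; apply: fK => Kx; apply: xK; exists (x * h)%g => //.
by rewrite -mulgA mulgV mulg1.
Qed.

Lemma covers_compact phi (K : set G) : Ccp phi -> nonzero phi -> compact K ->
  exists s : seq (R * G), (forall p, p \in s -> 0 <= p.1) /\
    forall x, K x -> 1 <= \sum_(p <- s) p.1 * phi (x * p.2)%g.
Proof.
move=> [[phic _] phi0] [x1 px1] cK.
apply: (compact_ind (P := fun K => exists s : seq (R * G), (forall p, p \in s -> 0 <= p.1) /\
    forall x, K x -> 1 <= \sum_(p <- s) p.1 * phi (x * p.2)%g)) cK _.
- by exists [::]; split.
- move=> A B [s [s0 sA]] [t [t0 tB]]; exists (s ++ t); split.
    by move=> p; rewrite mem_cat => /orP[/s0|/t0].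
  have S0 (u : seq (R * G)) (u0 : forall p, p \in u -> 0 <= p.1) y : 0 <= \sum_(p <- u) p.1 * phi (y * p.2)%g.
    by rewrite big_seq; apply: sumr_ge0 => p pu; rewrite mulr_ge0 // u0.
  move=> x [/sA h|/tB h]; rewrite big_cat /=; apply: (le_trans h).
    by rewrite lerDl S0.
  by rewrite lerDr S0.
- by move=> A B AB [s [s0 sB]]; exists s; split=> // x /AB; exact: sB.
move=> x Kx; exists [set y | phi x1 / 2 < phi (y * (x^-1 * x1))%g].
  have c : continuous (fun y => phi (y * (x^-1 * x1))%g).
    by move=> y; apply: continuous_comp; [exact: right_continuous|exact: phic].
  have := c x [set z | phi x1 / 2 < z]; apply; apply: lt_nbhsr; rewrite mulgA mulgV mul1g.
  by rewrite ltr_pdivrMr // ltr_pMr // ltr1n.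
exists [:: (2 / phi x1, (x^-1 * x1)%g)]; split.
  by move=> p; rewrite inE => /eqP -> /=; rewrite divr_ge0 // ltW.
move=> y /= hy; rewrite big_seq1 /=.
by rewrite mulrAC ler_pdivlMr // mul1r -ler_pdivrMl // mulrC ltW.
Qed.

Section Ratio.
Variable phi : G -> R.
Hypothesis phiC : Ccp phi.
Hypothesis phin : nonzero phi.

Lemma weight_ge0 s : (forall p : R * G, p \in s -> 0 <= p.1) -> 0 <= weight s.
Proof. by move=> s0; rewrite /weight big_seq; exact: sumr_ge0. Qed.

Lemma covers_exist f : Cc f -> exists s, covers phi f s.
Proof.
move=> fC; have [B B0 hB] := Cc_bounded fC.
have [_ [K cK fK]] := fC.
have [s [s0 hs]] := covers_compact phiC phin cK.
have sc x : \sum_(p <- [seq (B * p.1, p.2) | p <- s]) p.1 * phi (x * p.2)%g = B * \sum_(p <- s) p.1 * phi (x * p.2)%g.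
  by rewrite big_map big_distrr; apply: eq_bigr => p _; rewrite /= mulrA.
exists [seq (B * p.1, p.2) | p <- s]; split.
  by move=> p /mapP[q /s0 q0 ->] /=; rewrite mulr_ge0 // ltW.
move=> x; rewrite sc.
have S0 : 0 <= \sum_(p <- s) p.1 * phi (x * p.2)%g.
  by rewrite big_seq; apply: sumr_ge0 => p ps; rewrite mulr_ge0 ?s0 //; have [_ ->] := phiC.
have [Kx|nK] := pselect (K x); last by rewrite fK // mulr_ge0 // ltW.
by apply: (le_trans (hB x)); rewrite ler_peMr ?hs // ltW.
Qed.

Lemma ratio_has_inf f : Cc f -> has_inf [set t | exists2 s, covers phi f s & t = weight s].
Proof.
move=> fC; split; first by have [s hs] := covers_exist fC; exists (weight s), s.
by exists 0 => _ [s [s0 _] ->]; exact: weight_ge0.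
Qed.

Lemma ratio_le f s : Cc f -> covers phi f s -> ratio phi f <= weight s.
Proof. by move=> fC hs; apply: ge_inf; [have [] := ratio_has_inf fC|exists s]. Qed.

Lemma le_ratio f t : Cc f -> (forall s, covers phi f s -> t <= weight s) -> t <= ratio phi f.
Proof.
move=> fC H; apply: lb_le_inf; first by have [] := ratio_has_inf fC.
by move=> _ [s hs ->]; exact: H.
Qed.

Lemma ratio_ge0 f : Cc f -> 0 <= ratio phi f.
Proof. by move=> fC; apply: le_ratio => // s [s0 _]; exact: weight_ge0. Qed.

Lemma ratio_add f1 f2 : Cc f1 -> Cc f2 -> ratio phi (fun x => f1 x + f2 x) <= ratio phi f1 + ratio phi f2.
Proof.
move=> c1 c2; rewrite -lerBlDr; apply: le_ratio => // s1 [s10 hs1].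
rewrite lerBlDr addrC -lerBlDr; apply: le_ratio => // s2 [s20 hs2]; rewrite lerBlDr addrC.
rewrite /weight -big_cat; apply: ratio_le; first exact: Cc_add.
split; first by move=> p; rewrite mem_cat => /orP[/s10|/s20].
by move=> x; rewrite big_cat /= lerD.
Qed.

Lemma ratio_scale_le a f : 0 <= a -> Cc f -> ratio phi (fun x => a * f x) <= a * ratio phi f.
Proof.
move=> a0 fC; have [->|an] := eqVneq a 0.
  have H : covers phi (fun x => 0 * f x) [::] by split=> // x; rewrite big_nil mul0r.
  by apply: (le_trans (ratio_le (Cc_scale 0 fC) H)); rewrite mul0r /weight big_nil.
have ap : 0 < a by rewrite lt0r an.
rewrite -ler_pdivrMl //; apply: le_ratio => // s [s0 hs]; rewrite ler_pdivrMl //.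
have -> : a * weight s = weight [seq (a * p.1, p.2) | p <- s] by rewrite /weight big_map big_distrr.
apply: ratio_le; first exact: Cc_scale.
split; first by move=> p /mapP[q /s0 q0 ->] /=; rewrite mulr_ge0.
move=> x; rewrite big_map; apply: (le_trans (ler_wpM2l a0 (hs x))).
by rewrite big_distrr /= le_eqVlt; apply/orP; left; apply/eqP/eq_bigr => p _; rewrite mulrA.
Qed.

Lemma ratio_scale a f : 0 <= a -> Cc f -> ratio phi (fun x => a * f x) = a * ratio phi f.
Proof.
move=> a0 fC; apply/eqP; rewrite eq_le ratio_scale_le //=.
have [->|an] := eqVneq a 0.
  by rewrite mul0r; apply: ratio_ge0; exact: Cc_scale.
have ap : 0 < a by rewrite lt0r an.
rewrite -ler_pdivlMl //; have ai : 0 <= a^-1 by rewrite invr_ge0.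
have := ratio_scale_le ai (Cc_scale a fC).
by under eq_fun do rewrite mulrA mulVf // mul1r.
Qed.

Lemma ratio_right_le f h : Cc f -> ratio phi (fun x => f (x * h)%g) <= ratio phi f.
Proof.
move=> fC; apply: le_ratio => // s [s0 hs].
have -> : weight s = weight [seq (p.1, (h * p.2)%g) | p <- s] by rewrite /weight big_map.
apply: ratio_le; first exact: Cc_right.
split; first by move=> p /mapP[q /s0 q0 ->].
move=> x; rewrite big_map; apply: (le_trans (hs _)).
by rewrite le_eqVlt; apply/orP; left; apply/eqP/eq_bigr => p _; rewrite mulgA.
Qed.

Lemma ratio_right f h : Cc f -> ratio phi (fun x => f (x * h)%g) = ratio phi f.
Proof.
move=> fC; apply/eqP; rewrite eq_le ratio_right_le //=.
have := ratio_right_le h^-1%g (Cc_right h fC).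
by under eq_fun do rewrite -mulgA mulVg mulg1.
Qed.

Lemma ratio_gt0 f : Ccp f -> nonzero f -> 0 < ratio phi f.
Proof.
move=> [fC f0] [x1 fx1].
have [B B0 hB] : exists2 B, 0 < B & forall x, phi x <= B by apply: Cc_bounded; have [] := phiC.
apply: (@lt_le_trans _ _ (f x1 / B)); first by rewrite divr_gt0.
apply: le_ratio => // s [s0 hs]; rewrite ler_pdivrMr //; apply: (le_trans (hs x1)).
rewrite /weight big_distrl big_seq [leRHS]big_seq; apply: ler_sum => p ps.
by rewrite ler_wpM2l // s0.
Qed.

End Ratio.

(** A covering of [f] by translates of [psi] is composed with one of [psi] by translates of [phi].
    This bounds the normalised ratios independently of [phi]. *)
Lemma ratio_trans phi psi f : Ccp phi -> nonzero phi -> Ccp psi -> nonzero psi -> Cc f ->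
  ratio phi f <= ratio psi f * ratio phi psi.
Proof.
move=> hp np hs ns fC.
have rp := ratio_gt0 hp np hs ns.
have [hsC _] := hs.
rewrite -ler_pdivrMr //; apply: le_ratio => // s [s0 hcs]; rewrite ler_pdivrMr //.
(* A covering of weight 0 is treated apart, because the estimate divides by the weight. *)
have [w0|wn] := eqVneq (weight s) 0.
  rewrite w0 mul0r -w0; apply: (ratio_le hp np fC); split=> // x.
  have z p : p \in s -> p.1 = 0.
    move: w0 => /eqP; rewrite /weight big_seq psumr_eq0; last by move=> q /s0.
    by move=> /allP H ps; apply/eqP; have := H p ps; rewrite ps.
  apply: (le_trans (hcs x)); rewrite big_seq [leRHS]big_seq; apply: ler_sum => p ps.
  by rewrite z // !mul0r.
have wp : 0 < weight s by rewrite lt0r wn weight_ge0.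
rewrite -ler_pdivrMl //; apply: le_ratio => // t [t0 hct]; rewrite ler_pdivrMl //.
pose st := [seq (p.1 * q.1, (p.2 * q.2)%g) | p <- s, q <- t].
have -> : weight s * weight t = weight st.
  rewrite /weight big_allpairs_dep big_distrl; apply: eq_bigr => p _.
  by rewrite big_distrr.
apply: ratio_le => //; split.
  by move=> r /allpairsP[[p q] [/= ps qt ->]] /=; apply: mulr_ge0; [exact: (s0 _ ps)|exact: (t0 _ qt)].
move=> x; apply: (le_trans (hcs x)); rewrite big_allpairs_dep /=.
rewrite big_seq [leRHS]big_seq; apply: ler_sum => p ps.
apply: (le_trans (ler_wpM2l (s0 p ps) (hct _))).
rewrite big_distrr /= le_eqVlt; apply/orP; left; apply/eqP/eq_bigr => q _.
by rewrite mulrA mulgA.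
Qed.

Lemma Cc_uniform f e : Cc f -> 0 < e -> \forall v \near (1%g : G), forall y, `|f (v * y)%g - f y| <= e.
Proof.
move=> [fc [K /compact_near_coveringP cK fK]] e0.
have H1 : \forall v \near (1%g : G), forall y, K y -> `|f (v * y)%g - f y| <= e.
  apply: (cK _ (nbhs (1%g : G)) (fun v y => `|f (v * y)%g - f y| <= e)) => y Ky.
  have cs : {for (y, 1%g : G), continuous (fun z : G * G => (z.2 * z.1)%g)}.
    apply: (@continuous_comp _ _ _ (fun z : G * G => (z.2, z.1)) (fun z : G * G => (z.1 * z.2)%g)); last exact: mulc.
    by apply: cvg_pair; [exact: cvg_snd|exact: cvg_fst].
  have ca : {for (y, 1%g : G), continuous (fun z : G * G => f (z.2 * z.1)%g : R^o)}.
    by apply: (@continuous_comp _ _ _ (fun z : G * G => (z.2 * z.1)%g) (f : G -> R^o)) => //; exact: fc.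
  have cb : {for (y, 1%g : G), continuous (fun z : G * G => f z.1 : R^o)}.
    by apply: (@continuous_comp _ _ _ (fun z : G * G => z.1) (f : G -> R^o)); [exact: cvg_fst|exact: fc].
  have := @cvgB R R^o _ (nbhs (y, 1%g : G)) _ _ _ _ _ ca cb.
  rewrite /= mul1g subrr => /(_ (nbhs_filter (y, 1%g : G))) /cvgrPdist_le /(_ _ e0).
  by apply: filterS => -[z v] /=; rewrite sub0r normrN.
(* For [y] outside the support with [v y] inside, the estimate is applied to [v^-1] at the point
   [v y]. *)
have H2 : \forall v \near (1%g : G), forall y, K y -> `|f (v^-1 * y)%g - f y| <= e.
  have : (fun v : G => v^-1)%g @ (1%g : G) --> (1%g : G) by rewrite -[X in _ --> X]invg1; exact: invc.
  by move=> cv; exact: (cv _ H1).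
near=> v => y.
have h1 : forall y, K y -> `|f (v * y)%g - f y| <= e by near: v.
have h2 : forall y, K y -> `|f (v^-1 * y)%g - f y| <= e by near: v.
have [Ky|nK] := pselect (K y); first exact: h1.
have [Kvy|nKv] := pselect (K (v * y)%g); last by rewrite !fK // subr0 normr0 ltW.
by have := h2 _ Kvy; rewrite mulgA mulVg mul1g distrC.
Unshelve. all: by end_near. Qed.

Lemma Cc_quot (f1 F : G -> R) K (d : R) : Cc f1 -> continuous F -> compact K -> (forall x, ~ K x -> f1 x = 0) ->
  0 < d -> (forall x, K x -> d <= F x) -> Cc (fun x => f1 x / F x).
Proof.
move=> [c1 _] cF cK f1K d0 FK; split; last by exists K => // x /f1K ->; rewrite mul0r.
move=> x; have [Kx|nK] := pselect (K x).
  apply: (@cvgM R); first exact: c1.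
  by apply: cvgV; [rewrite gt_eqF // (lt_le_trans d0) // FK|exact: cF].
apply: (@near_eq_cont _ R^o (fun=> 0)); last exact: cvg_cst.
have oK : open (~` K) by apply: closed_openC; exact: compact_closed.
by apply: filterS (open_nbhs_nbhs (conj oK nK)) => y nKy; rewrite f1K // mul0r.
Qed.

(* The key estimate of the Weil-Cartan construction, the converse of the subadditivity of
   [ratio phi]: a covering of [f1 + f2 + d * f'] splits in the proportions [f1 : f2], which
   are nearly constant on translates of the support of phi by uniform continuity. *)
Lemma ratio_almost_additive (f1 f2 f' : G -> R) (K : set G) (d : R) : Ccp f1 -> Ccp f2 -> Ccp f' ->
  compact K -> (forall x, ~ K x -> f1 x = 0) -> (forall x, ~ K x -> f2 x = 0) ->
  (forall x, K x -> 1 <= f' x) -> 0 < d ->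
  exists2 V, nbhs (1%g : G) V & forall phi, Ccp phi -> nonzero phi -> (forall x, ~ V x -> phi x = 0) ->
    ratio phi f1 + ratio phi f2 <= (1 + 2 * d) * (ratio phi (fun x => f1 x + f2 x) + d * ratio phi f').
Proof.
move=> [C1 p1] [C2 p2] [C' p'] cK K1 K2 K' d0.
(* The term [d f'] keeps the denominator at least [d] on [K], so that the proportions [h1] and [h2]
   are continuous. *)
pose F x := f1 x + f2 x + d * f' x.
have CF : Cc F by apply: Cc_add; [exact: Cc_add|exact: Cc_scale].
have FK x : K x -> d <= F x.
  move=> Kx; rewrite /F; apply: (@le_trans _ _ (d * f' x)); first by rewrite ler_peMr ?K' // ltW.
  by rewrite lerDr addr_ge0.
have F0 x : 0 <= F x by rewrite /F !addr_ge0 // mulr_ge0 // ltW.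
pose h1 x := f1 x / F x; pose h2 x := f2 x / F x.
have H1 : Cc h1 by apply: Cc_quot FK => //; have [] := CF.
have H2 : Cc h2 by apply: Cc_quot FK => //; have [] := CF.
have e1 x : f1 x = F x * h1 x.
  rewrite /h1; have [Kx|/K1 ->] := pselect (K x); last by rewrite mul0r mulr0.
  by rewrite mulrC divfK // gt_eqF // (lt_le_trans d0) // FK.
have e2 x : f2 x = F x * h2 x.
  rewrite /h2; have [Kx|/K2 ->] := pselect (K x); last by rewrite mul0r mulr0.
  by rewrite mulrC divfK // gt_eqF // (lt_le_trans d0) // FK.
have q1 x : 0 <= h1 x by rewrite divr_ge0.
have q2 x : 0 <= h2 x by rewrite divr_ge0.
have sum1 x : h1 x + h2 x <= 1.
  rewrite /h1 /h2; have [Kx|nK] := pselect (K x); last by rewrite K1 // K2 // mul0r addr0.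
  rewrite -mulrDl ler_pdivrMr ?mul1r; last by rewrite (lt_le_trans d0) // FK.
  by rewrite /F lerDl mulr_ge0 // ltW.
have N1 := Cc_uniform H1 d0; have N2 := Cc_uniform H2 d0.
exists ([set v | forall y, `|h1 (v * y)%g - h1 y| <= d] `&` [set v | forall y, `|h2 (v * y)%g - h2 y| <= d]).
  exact: filterI.
move=> phi phiC phin phiV.
(* If [phi (x p.2)] is nonzero, then [h x] exceeds [h p.2^-1] by at most [d]. Multiplying the
   coefficients by [h p.2^-1 + d] thus turns a covering of [F] into one of [F h]. *)
have step (h f : G -> R) s : (forall x, f x = F x * h x) -> (forall x, 0 <= h x) ->
   (forall v, phi v != 0 -> forall y, `|h (v * y)%g - h y| <= d) -> Cc f ->
   covers phi F s -> ratio phi f <= \sum_(p <- s) p.1 * (h p.2^-1%g + d).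
  move=> ef h0 hV fC [s0 hs].
  have -> : \sum_(p <- s) p.1 * (h p.2^-1%g + d) = weight [seq (p.1 * (h p.2^-1%g + d), p.2) | p <- s].
    by rewrite /weight big_map.
  apply: ratio_le => //; split.
    by move=> p /mapP[q qs ->] /=; rewrite mulr_ge0 ?s0 // addr_ge0 // ltW.
  move=> x; rewrite ef big_map; apply: (le_trans (ler_wpM2r (h0 x) (hs x))).
  rewrite big_distrl big_seq [leRHS]big_seq /=; apply: ler_sum => p ps.
  rewrite -!mulrA ler_wpM2l ?s0 //.
  have [->|pn] := eqVneq (phi (x * p.2)%g) 0; first by rewrite mul0r mulr0.
  rewrite mulrC ler_wpM2r //; first by have [_ ->] := phiC.
  have := hV _ pn p.2^-1%g; rewrite -mulgA mulgV mulg1 => /(le_trans (ler_norm _)).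
  by rewrite lerBlDl.
have V1 v : phi v != 0 -> forall y, `|h1 (v * y)%g - h1 y| <= d.
  move=> pv; have [[h _]|nV] := pselect (([set v | forall y, `|h1 (v * y)%g - h1 y| <= d] `&` [set v | forall y, `|h2 (v * y)%g - h2 y| <= d]) v); first exact: h.
  by move: pv; rewrite phiV ?eqxx.
have V2 v : phi v != 0 -> forall y, `|h2 (v * y)%g - h2 y| <= d.
  move=> pv; have [[_ h]|nV] := pselect (([set v | forall y, `|h1 (v * y)%g - h1 y| <= d] `&` [set v | forall y, `|h2 (v * y)%g - h2 y| <= d]) v); first exact: h.
  by move: pv; rewrite phiV ?eqxx.
have d1 : 0 < 1 + 2 * d by rewrite addr_gt0 // mulr_gt0.
apply: (@le_trans _ _ ((1 + 2 * d) * ratio phi F)).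
  rewrite -ler_pdivrMl //; apply: le_ratio => // s cs; rewrite ler_pdivrMl //.
  apply: (le_trans (lerD (step h1 f1 s e1 q1 V1 C1 cs) (step h2 f2 s e2 q2 V2 C2 cs))).
  rewrite -big_split /weight big_distrr big_seq [leRHS]big_seq /=; apply: ler_sum => p ps.
  rewrite -mulrDr mulrC ler_wpM2r //; first by have [s0 _] := cs; exact: s0.
  by have := sum1 (p.2^-1)%g; lra.
rewrite ler_pM2l //; apply: (le_trans (ratio_add phiC phin (Cc_add C1 C2) (Cc_scale d C'))).
by rewrite lerD2l ratio_scale // ltW.
Qed.

Lemma Cc_ge1 (K : set G) : compact K -> exists2 f' : G -> R, Ccp f' & forall x, K x -> 1 <= f' x.
Proof.
move=> cK; have [phi [phiC p1 _]] := bumpG filterT.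
have [s [s0 hs]] := covers_compact phiC (ex_intro (fun x => 0 < phi x) _ p1) cK.
exists (fun x => \sum_(p <- s) p.1 * phi (x * p.2)%g) => //; split.
  by apply: Cc_bigsum => p; apply: Cc_scale; apply: Cc_right; have [] := phiC.
by move=> x; rewrite big_seq; apply: sumr_ge0 => p ps; rewrite mulr_ge0 ?s0 //; have [_ ->] := phiC.
Qed.

(** An ultrafilter finer than this filter of shrinking bumps takes the place of Tychonoff's theorem
    in the classical construction. *)
Definition small_bumps : set_system (G -> R) :=
  filter_from (nbhs (1%g : G)) (fun V => [set phi | [/\ Ccp phi, nonzero phi & forall x, ~ V x -> phi x = 0]]).

Lemma small_bumps_proper : ProperFilter small_bumps.
Proof.
apply: filter_from_proper; last first.
  move=> V nV; have [f [fC f1 fV]] := bumpG nV; exists f; split=> //; by exists 1%g.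
apply: filter_from_filter; first by exists setT; exact: filterT.
move=> V W nV nW; exists (V `&` W); first exact: filterI.
move=> f [fC fn fVW]; split; split=> // x nx; apply: fVW => -[Vx Wx]; exact: nx.
Qed.

Section Functional.
Variable U : set_system (G -> R).
Hypothesis UU : UltraFilter U.
Hypothesis sU : small_bumps `<=` U.
Variable f0 : G -> R.
Hypothesis f0C : Ccp f0.
Hypothesis f0n : nonzero f0.

Let PU : ProperFilter U := @ultra_proper _ _ UU.

(** Dividing by the ratio of a fixed [f0] keeps the values bounded as [phi] shrinks: by [ratio f0 f]
    from above and, for nonzero [f], by [(ratio f f0)^-1] from below. Hence limits along [U] exist,
    and positive ones stay positive. *)
Definition ratio0 f phi := ratio phi f / ratio phi f0.
Definition haar_lim f := lim (ratio0 f phi @[phi --> U]).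

Lemma near_good : \forall phi \near U, Ccp phi /\ nonzero phi.
Proof. by apply: sU; exists setT; [exact: filterT|move=> phi []]. Qed.

Lemma ratio0_bound f : Ccp f -> exists M, \forall phi \near U, 0 <= ratio0 f phi <= M.
Proof.
move=> [fC fp]; exists (ratio f0 f); near=> phi.
have [phiC phin] : Ccp phi /\ nonzero phi by near: phi; exact: near_good.
have r0 := ratio_gt0 phiC phin f0C f0n.
apply/andP; split; first by rewrite /ratio0; apply: divr_ge0; [exact: ratio_ge0|exact: ltW].
by rewrite ler_pdivrMr //; exact: ratio_trans.
Unshelve. all: by end_near. Qed.

Lemma haar_lim_cvg f : Ccp f -> ratio0 f phi @[phi --> U] --> haar_lim f.
Proof.
move=> fC; have [M hM] := ratio0_bound fC.
have UF : UltraFilter (ratio0 f @ U) by exact: ultra_fmap.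
have := @segment_compact R 0 M; rewrite compact_ultra => /(_ _ UF) [].
  by apply: filterS hM => phi /=; rewrite in_itv.
by move=> p [_ /= cp]; have := cvg_lim (@Rhausdorff R) cp; rewrite /haar_lim => ->.
Qed.

Lemma haar_lim_ge0 f : Ccp f -> 0 <= haar_lim f.
Proof.
move=> fC; have [M hM] := ratio0_bound fC.
apply: (cvg_to_le (cvg_cst _) (haar_lim_cvg fC)).
by apply: filterS hM => phi /andP[].
Qed.

Lemma haar_lim_gt0 f : Ccp f -> nonzero f -> 0 < haar_lim f.
Proof.
move=> fC fn; have rf := ratio_gt0 fC fn f0C f0n.
apply: (@lt_le_trans _ _ (ratio f f0)^-1); first by rewrite invr_gt0.
apply: (cvg_to_le (cvg_cst _) (haar_lim_cvg fC)).
near=> phi.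
have [phiC phin] : Ccp phi /\ nonzero phi by near: phi; exact: near_good.
have r0 := ratio_gt0 phiC phin f0C f0n.
rewrite ler_pdivlMr // ler_pdivrMl //; apply: ratio_trans => //; by have [] := f0C.
Unshelve. all: by end_near. Qed.

Lemma Ccp_right f h : Ccp f -> Ccp (fun x => f (x * h)%g).
Proof. by move=> [c1 p1]; split; [exact: Cc_right|]. Qed.

Lemma haar_lim_scale a f : 0 <= a -> Ccp f -> haar_lim (fun x => a * f x) = a * haar_lim f.
Proof.
move=> a0 fC; apply: (cvg_lim (@Rhausdorff R)).
apply: (@cvg_trans _ ((fun phi => a * ratio0 f phi) @ U)); last first.
  by apply: (@cvgM R); [exact: cvg_cst|exact: haar_lim_cvg].
apply: near_eq_cvg; near=> phi.
have [phiC phin] : Ccp phi /\ nonzero phi by near: phi; exact: near_good.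
by rewrite /ratio0 ratio_scale ?mulrA //; have [] := fC.
Unshelve. all: by end_near. Qed.

Lemma haar_lim_right f h : Ccp f -> haar_lim (fun x => f (x * h)%g) = haar_lim f.
Proof.
move=> fC; apply: (cvg_lim (@Rhausdorff R)).
apply: (@cvg_trans _ (ratio0 f @ U)); last exact: haar_lim_cvg.
apply: near_eq_cvg; near=> phi.
have [phiC phin] : Ccp phi /\ nonzero phi by near: phi; exact: near_good.
by rewrite /ratio0 ratio_right //; have [] := fC.
Unshelve. all: by end_near. Qed.

Lemma haar_lim_add f1 f2 : Ccp f1 -> Ccp f2 -> haar_lim (fun x => f1 x + f2 x) = haar_lim f1 + haar_lim f2.
Proof.
move=> c1 c2; have c12 := Ccp_add c1 c2.
have cs : (fun phi => ratio0 f1 phi + ratio0 f2 phi) @ U --> haar_lim f1 + haar_lim f2.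
  by apply: (@cvgD _ R^o); exact: haar_lim_cvg.
apply/eqP; rewrite eq_le; apply/andP; split.
  apply: (cvg_to_le (haar_lim_cvg c12) cs); near=> phi.
  have [phiC phin] : Ccp phi /\ nonzero phi by near: phi; exact: near_good.
  have r0 := ratio_gt0 phiC phin f0C f0n.
  rewrite /ratio0 -mulrDl ler_wpM2r ?invr_ge0 ?(ltW r0) //.
  by apply: ratio_add => //; [have [] := c1|have [] := c2].
have [_ [K1 cK1 h1]] := c1.1; have [_ [K2 cK2 h2]] := c2.1.
have cK : compact (K1 `|` K2) by exact: compactU.
have [f' f'C f'1] := Cc_ge1 cK.
have [M hM] := ratio0_bound c12; have [M' hM'] := ratio0_bound f'C.
have M0 : 0 <= M.
  have [phi /andP[a b]] := filter_ex hM; exact: le_trans b.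
have M'0 : 0 <= M'.
  have [phi /andP[a b]] := filter_ex hM'; exact: le_trans b.
apply/ler_addgt0Pr => e e0.
(* With [d <= 1] the excess [2 d r + d r' + 2 d^2 r'] is at most [d (2 M + 3 M')]; the summand 1
   keeps the denominator positive. *)
pose d := Num.min 1 (e / (2 * M + 3 * M' + 1)).
have den : 0 < 2 * M + 3 * M' + 1 by lra.
have d0 : 0 < d by rewrite lt_min ltr01 divr_gt0.
have [V nV hV] := ratio_almost_additive c1 c2 f'C cK (fun x nx => h1 x (fun k => nx (or_introl k)))
   (fun x nx => h2 x (fun k => nx (or_intror k))) f'1 d0.
have cs' : (fun phi => ratio0 (fun x => f1 x + f2 x) phi + e) @ U --> haar_lim (fun x => f1 x + f2 x) + e.
  by apply: (@cvgD _ R^o); [exact: haar_lim_cvg|exact: cvg_cst].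
apply: (cvg_to_le cs cs'); near=> phi.
have [phiC phin phiV] : [/\ Ccp phi, nonzero phi & forall x, ~ V x -> phi x = 0].
  by near: phi; apply: sU; exists V.
have r0 := ratio_gt0 phiC phin f0C f0n.
have /andP[a1 b1] : 0 <= ratio0 (fun x => f1 x + f2 x) phi <= M by near: phi.
have /andP[a2 b2] : 0 <= ratio0 f' phi <= M' by near: phi.
have H : ratio0 f1 phi + ratio0 f2 phi <= (1 + 2 * d) * (ratio0 (fun x => f1 x + f2 x) phi + d * ratio0 f' phi).
  rewrite /ratio0 -mulrDl ler_pdivrMr //; apply: (le_trans (hV phi phiC phin phiV)).
  rewrite le_eqVlt; apply/orP; left; apply/eqP; field; by rewrite gt_eqF.
apply: (le_trans H).
have dl : d <= 1 by rewrite ge_min lexx.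
have de : d * (2 * M + 3 * M' + 1) <= e by rewrite -ler_pdivlMr // ge_min lexx orbT.
move: (ratio0 (fun x => f1 x + f2 x) phi) (ratio0 f' phi) a1 b1 a2 b2 => r r' a1 b1 a2 b2.
have t1 : d * r <= d * M by rewrite ler_wpM2l // ltW.
have t2 : d * r' <= d * M' by rewrite ler_wpM2l // ltW.
have t3 : d * (d * r') <= d * M'.
  rewrite ler_wpM2l ?(ltW d0) //; apply: (le_trans _ b2); rewrite ler_piMl //.
by nra.
Unshelve. all: by end_near. Qed.

Definition pos_part (f : G -> R) x := 2^-1 * (`|f x| + f x).
Definition neg_part (f : G -> R) x := 2^-1 * (`|f x| - f x).

Lemma Ccp_pos f : Cc f -> Ccp (pos_part f).
Proof.
move=> c; split; first by apply: Cc_scale; apply: Cc_add => //; exact: Cc_norm.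
by move=> x; rewrite mulr_ge0 // -lerBlDr sub0r -normrN ler_norm.
Qed.

Lemma Ccp_neg f : Cc f -> Ccp (neg_part f).
Proof.
move=> c; split; first by apply: Cc_scale; apply: Cc_sub => //; exact: Cc_norm.
by move=> x; rewrite mulr_ge0 // subr_ge0 ler_norm.
Qed.

Definition haar_fun f := haar_lim (pos_part f) - haar_lim (neg_part f).

(** The value does not depend on how a function is written as a difference of nonnegative ones;
    linearity follows by choosing a convenient decomposition each time. *)
Lemma haar_fun_sub u v : Ccp u -> Ccp v -> haar_fun (fun x => u x - v x) = haar_lim u - haar_lim v.
Proof.
move=> cu cv; have C : Cc (fun x => u x - v x) by apply: Cc_sub; [have [] := cu|have [] := cv].
have cp := Ccp_pos C; have cn := Ccp_neg C.
have E : haar_lim (pos_part (fun x => u x - v x)) + haar_lim v = haar_lim u + haar_lim (neg_part (fun x => u x - v x)).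
  rewrite -(haar_lim_add cp cv) -(haar_lim_add cu cn); congr haar_lim.
  by apply/funext => x; rewrite /pos_part /neg_part; lra.
by rewrite /haar_fun; move: E; lra.
Qed.

Lemma haar_fun_pos f : Ccp f -> haar_fun f = haar_lim f.
Proof.
move=> fC; have c0 : Ccp (fun _ : G => 0 : R) by split; [exact: Cc0|].
have := haar_fun_sub fC c0; under eq_fun do rewrite subr0.
move=> ->; have := haar_lim_scale (lexx 0) c0; under [X in haar_lim X]eq_fun do rewrite mulr0.
by move=> ->; rewrite mul0r subr0.
Qed.

Lemma splitE f x : f x = pos_part f x - neg_part f x.
Proof. by rewrite /pos_part /neg_part; lra. Qed.

Lemma haar_fun_add f1 f2 : Cc f1 -> Cc f2 -> haar_fun (fun x => f1 x + f2 x) = haar_fun f1 + haar_fun f2.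
Proof.
move=> c1 c2.
have -> : (fun x => f1 x + f2 x) = (fun x => (pos_part f1 x + pos_part f2 x) - (neg_part f1 x + neg_part f2 x)).
  by apply/funext => x; rewrite (splitE f1) (splitE f2); lra.
have p1 := Ccp_pos c1; have p2 := Ccp_pos c2; have n1 := Ccp_neg c1; have n2 := Ccp_neg c2.
by rewrite haar_fun_sub; [rewrite !haar_lim_add // /haar_fun; lra|exact: Ccp_add|exact: Ccp_add].
Qed.

Lemma haar_fun_scale a f : Cc f -> haar_fun (fun x => a * f x) = a * haar_fun f.
Proof.
move=> c; have p := Ccp_pos c; have m := Ccp_neg c.
have [a0|a0] := leP 0 a.
  have -> : (fun x => a * f x) = (fun x => a * pos_part f x - a * neg_part f x).
    by apply/funext => x; rewrite {1}(splitE f) mulrBr.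
  by rewrite (haar_fun_sub (Ccp_scale a0 p) (Ccp_scale a0 m)) (haar_lim_scale a0 p) (haar_lim_scale a0 m) /haar_fun; ring.
have a0' : 0 <= - a by rewrite oppr_ge0 ltW.
have -> : (fun x => a * f x) = (fun x => - a * neg_part f x - - a * pos_part f x).
  by apply/funext => x; rewrite {1}(splitE f); ring.
by rewrite (haar_fun_sub (Ccp_scale a0' m) (Ccp_scale a0' p)) (haar_lim_scale a0' p) (haar_lim_scale a0' m) /haar_fun; ring.
Qed.

Lemma haar_fun_right f h : Cc f -> haar_fun (fun x => f (x * h)%g) = haar_fun f.
Proof.
move=> c; have p := Ccp_pos c; have m := Ccp_neg c.
have -> : (fun x => f (x * h)%g) = (fun x => pos_part f (x * h)%g - neg_part f (x * h)%g).
  by apply/funext => x; rewrite {1}(splitE f).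
by rewrite haar_fun_sub; [rewrite !haar_lim_right|exact: Ccp_right|exact: Ccp_right].
Qed.

End Functional.

(** A Haar integral given as a functional on compactly supported continuous functions. Right
    invariance makes averages over orbits invariant, since [a h' (a h x) = a (h' h) x]. *)
Definition right_haar (J : (G -> R) -> R) : Prop :=
  [/\ forall f1 f2, Cc f1 -> Cc f2 -> J (fun x => f1 x + f2 x) = J f1 + J f2,
      forall a f, Cc f -> J (fun x => a * f x) = a * J f,
      forall f, Ccp f -> 0 <= J f,
      forall f, Ccp f -> nonzero f -> 0 < J f &
      forall f h, Cc f -> J (fun x => f (x * h)%g) = J f].

Lemma right_haar_exists : exists J, right_haar J.
Proof.
have [U [UU sU]] := ultraFilterLemma small_bumps_proper.
have [f0 [f0C f01 _]] := bumpG filterT.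
have f0n : nonzero f0 by exists 1%g.
exists (haar_fun U f0); split.
- by move=> f1 f2; exact: haar_fun_add.
- by move=> a f; exact: haar_fun_scale.
- by move=> f fC; rewrite haar_fun_pos //; exact: haar_lim_ge0.
- by move=> f fC fn; rewrite haar_fun_pos //; exact: haar_lim_gt0.
- by move=> f h; exact: haar_fun_right.
Qed.

End Haar.

(** * Differentiation under an invariant functional *)

Lemma pairl_continuous (T S : topologicalType) (y : S) : continuous (fun x : T => (x, y)).
Proof. by move=> x; apply: cvg_pair; [exact: cvg_id|exact: cvg_cst]. Qed.

Lemma pairr_continuous (T S : topologicalType) (x : T) : continuous (fun y : S => (x, y)).
Proof. by move=> y; apply: cvg_pair; [exact: cvg_cst|exact: cvg_id]. Qed.

Lemma map_fst_continuous (T S Y : topologicalType) (c : T -> S) h y : {for h, continuous c} ->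
  {for (h, y), continuous (fun z : T * Y => (c z.1, z.2))}.
Proof.
move=> cc B [[B1 B2] [/= /cc n1 n2] sB]; exists (c @^-1` B1, B2) => //.
by move=> [u v] [/= Bu Bv]; apply: sB.
Qed.

Section Slice.
Context {R : realType}.
Variables V W X : normedModType R.

Lemma is_derive_slice (F : V * W -> X) (x : V) (y v : W) d :
  is_derive y v (fun y => F (x, y)) d <-> is_derive (x, y) (0, v) F d.
Proof.
have E : (fun h : R => h^-1 *: ((F \o shift (x, y)) (h *: ((0, v) : V * W)) - F (x, y)))
   = (fun h => h^-1 *: (((fun y => F (x, y)) \o shift y) (h *: v) - F (x, y))).
  apply/funext => h /=; congr (_ *: (F _ - _)).
  by rewrite -[LHS]/(h *: 0 + x, h *: v + y) scaler0 add0r.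
split=> -[dv <-].
  by apply: DeriveDef; move: dv; rewrite /derivable /derive E.
by apply: DeriveDef; move: dv; rewrite /derivable /derive E.
Qed.

Lemma Ck_slice k D (F : V * W -> X) (x : V) : open D -> Ck k D F ->
  Ck k [set y | D (x, y)] (fun y => F (x, y)).
Proof.
move=> oD.
have cp (y : W) : {for y, continuous (fun y : W => (x, y))}.
  by apply: cvg_pair; [exact: cvg_cst|exact: cvg_id].
have oS : open [set y | D (x, y)].
  have -> : [set y | D (x, y)] = (fun y : W => (x, y)) @^-1` D by [].
  by apply: open_comp => // y _; exact: cp.
elim: k F => [|k IH] F cF.
  split=> // y Dy; apply: (@continuous_comp _ _ _ (fun y : W => (x, y)) F); first exact: cp.
  exact: (Ck_continuous cF).
split=> [y Dy|v].
  apply: (@continuous_comp _ _ _ (fun y : W => (x, y)) F); first exact: cp.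
  exact: (Ck_continuous cF).
have H y : D (x, y) -> is_derive y v (fun y => F (x, y)) ('D_(0, v) F (x, y)).
  move=> Dy; apply/is_derive_slice; apply: derivableP; exact: (Ck_derivable cF Dy).
split=> [y Dy|]; first by have [] := H y Dy.
apply: Ck_ext oS _ (IH _ (Ck_derive (0, v) cF)) => y Dy.
by have [_ ->] := H y Dy.
Qed.

End Slice.

Section DiffUnderHaar.
Context {R : realType} {G : groupTopType}.
Hypothesis hausG : hausdorff_space G.
Variable J : (G -> R) -> R.
Hypothesis hJ : right_haar J.
Hypothesis ge1 : forall K : set G, compact K -> exists2 f' : G -> R, Ccp f' & forall x, K x -> 1 <= f' x.

Lemma JD f1 f2 : Cc f1 -> Cc f2 -> J (fun x => f1 x + f2 x) = J f1 + J f2.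
Proof. by have [h _ _ _ _] := hJ; exact: h. Qed.
Lemma JZ a f : Cc f -> J (fun x => a * f x) = a * J f.
Proof. by have [_ h _ _ _] := hJ; exact: h. Qed.
Lemma J_ge0 f : Ccp f -> 0 <= J f.
Proof. by have [_ _ h _ _] := hJ; exact: h. Qed.
Lemma JB f1 f2 : Cc f1 -> Cc f2 -> J (fun x => f1 x - f2 x) = J f1 - J f2.
Proof.
move=> c1 c2; have := JD c1 (Cc_scale (-1) c2); rewrite JZ // mulN1r => <-.
by congr J; apply/funext => x; rewrite mulN1r.
Qed.
Lemma J_le f1 f2 : Cc f1 -> Cc f2 -> (forall x, f1 x <= f2 x) -> J f1 <= J f2.
Proof.
move=> c1 c2 h; rewrite -subr_ge0 -JB //; apply: J_ge0; split; first exact: Cc_sub.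
by move=> x; rewrite subr_ge0.
Qed.

Lemma J_norm f w : Cc f -> Cc w -> (forall x, `|f x| <= w x) -> `|J f| <= J w.
Proof.
move=> cf cw h; rewrite ler_norml; apply/andP; split.
  rewrite -mulN1r -JZ //; apply: J_le => //; first exact: Cc_scale.
  by move=> x; rewrite mulN1r; have := h x; rewrite ler_norml => /andP[].
by apply: J_le => // x; have := h x; rewrite ler_norml => /andP[].
Qed.

Section Param.
Variable n : nat.
Implicit Types (U : set 'rV[R]_n) (Phi : G -> 'rV[R]_n -> R^o).

(** The analogue of [Ck] in [y], with derivatives jointly continuous in [(h, y)]: joint continuity
    gives uniformity for [h] in a compact set. *)
Fixpoint JCk (k : nat) U Phi : Prop :=
  (forall h y, U y -> {for (h, y), continuous (fun z : G * 'rV[R]_n => Phi z.1 z.2 : R^o)}) /\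
  if k is k'.+1 then
    forall v, (forall h y, U y -> derivable (Phi h) y v) /\ JCk k' U (fun h y => 'D_v (Phi h) y)
  else True.

Definition locsupp U Phi := forall y, U y -> exists W K,
  [/\ open W, W y, compact K & forall h y', W y' -> ~ K h -> Phi h y' = 0].

Lemma JCk_cont k U Phi : JCk k U Phi -> forall h y, U y -> {for (h, y), continuous (fun z : G * 'rV[R]_n => Phi z.1 z.2 : R^o)}.
Proof. by case: k => [|k] []. Qed.

Lemma JCk_Cc k U Phi y : JCk k U Phi -> locsupp U Phi -> U y -> Cc (Phi^~ y).
Proof.
move=> cP sP Uy; split.
  move=> h; apply: (@continuous_comp _ _ _ (fun h : G => (h, y)) (fun z : G * 'rV[R]_n => Phi z.1 z.2 : R^o)).
    exact: pairl_continuous.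
  exact: (JCk_cont cP).
have [W [K [oW Wy cK h]]] := sP y Uy; exists K => // x nK; exact: h.
Qed.

Lemma JCk_uniform k U Phi y0 (K : set G) (e : R) : JCk k U Phi -> U y0 -> compact K -> 0 < e ->
  \forall y \near y0, forall h, K h -> `|Phi h y - Phi h y0| <= e.
Proof.
move=> cP Uy /compact_near_coveringP cK e0.
apply: (cK _ (nbhs y0) (fun y h => `|Phi h y - Phi h y0| <= e)) => h Kh.
have ca : {for (h, y0), continuous (fun z : G * 'rV[R]_n => Phi z.1 z.2 : R^o)} := JCk_cont cP Uy.
have cb : {for (h, y0), continuous (fun z : G * 'rV[R]_n => Phi z.1 y0 : R^o)}.
  apply: (@continuous_comp _ _ _ (fun z : G * 'rV[R]_n => (z.1, y0)) (fun z : G * 'rV[R]_n => Phi z.1 z.2 : R^o)) => //.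
  by apply: (@continuous_comp _ _ _ (fun z : G * 'rV[R]_n => z.1) (fun x : G => (x, y0))); [exact: cvg_fst|exact: pairl_continuous].
have := @cvgB R R^o _ (nbhs (h, y0)) _ _ _ _ _ ca cb.
rewrite /= subrr => /(_ (nbhs_filter (h, y0))) /cvgrPdist_le /(_ _ e0).
by apply: filterS => -[h' y] /=; rewrite sub0r normrN.
Qed.

(** The dominating function is a small multiple of one that is at least 1 on the common support. It
    serves as dominated convergence both for continuity and for differentiation. *)
Lemma J_param_bound k U Phi y0 (e : R) : open U -> JCk k U Phi -> locsupp U Phi -> U y0 -> 0 < e ->
  exists w : G -> R, [/\ Ccp w, J w <= e & \forall y \near y0, forall h, `|Phi h y - Phi h y0| <= w h].
Proof.
move=> oU cP sP Uy0 e0; have [W [K [oW Wy cK hW]]] := sP _ Uy0.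
have [w wC w1] := ge1 cK.
have Jw := J_ge0 wC.
pose d := e / (J w + 1).
have d0 : 0 < d by rewrite divr_gt0 // ltr_wpDl.
exists (fun h => d * w h); split.
- by split; [apply: Cc_scale; have [] := wC|move=> x; rewrite mulr_ge0 ?(ltW d0) //; have [_ ->] := wC].
- rewrite JZ; last by have [] := wC.
  rewrite /d -mulrA ler_piMr ?(ltW e0) // mulrC ler_pdivrMr; [by rewrite mul1r lerDl|by rewrite ltr_wpDl].
near=> y => h.
have [Kh|nK] := pselect (K h).
  apply: (@le_trans _ _ d); last by rewrite ler_peMr ?w1 // ltW.
  by move: h Kh; near: y; exact: JCk_uniform cP Uy0 cK d0.
have Wy' : W y by near: y; exact: open_nbhs_nbhs.
have w0 : 0 <= w h by have [_ ->] := wC.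
by rewrite (hW h y) // (hW h y0) // subrr normr0 mulr_ge0 // ltW.
Unshelve. all: by end_near. Qed.

Lemma J_param_continuous k U Phi y0 : open U -> JCk k U Phi -> locsupp U Phi -> U y0 ->
  {for y0, continuous (fun y => J (Phi^~ y) : R^o)}.
Proof.
move=> oU cP sP Uy0; apply/(@cvgrPdist_le _ R^o _ (nbhs y0)) => e e0.
have [w [wC Jw hw]] := J_param_bound oU cP sP Uy0 e0.
near=> y; rewrite distrC.
have Uy : U y by near: y; exact: open_nbhs_nbhs.
rewrite -JB; [|exact: JCk_Cc cP sP Uy|exact: JCk_Cc cP sP Uy0].
apply: le_trans Jw; apply: J_norm.
- by apply: Cc_sub; [exact: JCk_Cc cP sP Uy|exact: JCk_Cc cP sP Uy0].
- by have [] := wC.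
- by near: y.
Unshelve. all: by end_near. Qed.

Lemma locsupp_derive U Phi v : open U -> locsupp U Phi -> locsupp U (fun h y => 'D_v (Phi h) y).
Proof.
move=> oU sP y Uy; have [W [K [oW Wy cK hW]]] := sP _ Uy; exists W, K; split=> // h y' Wy' nK.
transitivity ('D_v (fun=> 0 : R^o) y'); last exact: derive_cst.
apply: near_eq_derive; apply: filterS (open_nbhs_nbhs (conj oW Wy')) => z Wz; exact: hW.
Qed.

(** For each [h], the mean value theorem bounds the difference between quotient and derivative by
    the function [w] that [J_param_bound] gives for the derivative. *)
Lemma J_param_derive k U Phi y0 v : open U -> JCk k.+1 U Phi -> locsupp U Phi -> U y0 ->
  is_derive y0 v (fun y => J (Phi^~ y) : R^o) (J (fun h => 'D_v (Phi h) y0)).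
Proof.
move=> oU cP sP Uy0.
have [_ /(_ v)[dP cD]] := cP.
have sD := locsupp_derive v oU sP.
suff H : h^-1 *: (((fun y => J (Phi^~ y) : R^o) \o shift y0) (h *: v) - J (Phi^~ y0)) @[h --> (0 : R)^'] --> (J (fun h => 'D_v (Phi h) y0) : R^o).
  by apply: DeriveDef; [apply/cvg_ex; exists (J (fun h => 'D_v (Phi h) y0))|exact/cvg_lim].
apply/cvgrPdist_le => e e0.
have [w [wC Jw hw]] := J_param_bound oU cD sD Uy0 e0.
have /nbhs_ballP[r r0 hr] : \forall y \near y0, U y /\ forall h, `|'D_v (Phi h) y - 'D_v (Phi h) y0| <= w h.
  by apply: filterI => //; exact: open_nbhs_nbhs.
have rv : 0 < r / (`|v| + 1) by rewrite divr_gt0 // ltr_wpDl.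
near=> t.
have t0 : t != 0 by near: t; exact: nbhs_dnbhs_neq.
have tr : `|t| < r / (`|v| + 1) by near: t; exact: dnbhs0_lt.
have inball s : `|s| <= `|t| -> ball y0 r (y0 + s *: v).
  move=> st; rewrite -ball_normE /= opprD addrA subrr sub0r normrN normrZ.
  apply: (@le_lt_trans _ _ (`|t| * (`|v| + 1))); last by rewrite -ltr_pdivlMr // ltr_wpDl.
  by apply: ler_pM => //; rewrite lerDl.
have Ut : U (t *: v + y0) by rewrite addrC; have [] := hr _ (inball t (lexx _)).
have Cd := JCk_Cc cD sD Uy0; have Ct := JCk_Cc cP sP Ut; have C0 := JCk_Cc cP sP Uy0.
have Cdiff : Cc (fun h => t^-1 * (Phi h (t *: v + y0) - Phi h y0)) by apply: Cc_scale; exact: Cc_sub.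
rewrite /= distrC.
have -> : t^-1 *: (J (Phi^~ (t *: v + y0)) - J (Phi^~ y0)) = J (fun h => t^-1 * (Phi h (t *: v + y0) - Phi h y0)).
  by rewrite JZ ?JB //; exact: Cc_sub.
rewrite -JB //; apply: le_trans Jw; apply: J_norm; [exact: Cc_sub|by have [] := wC|].
move=> h.
have st s : Num.min 0 t <= s <= Num.max 0 t -> `|s| <= `|t|.
  case: (leP 0 t) => h0 /andP[s0 s1]; first by rewrite !ger0_norm.
  by rewrite !ler0_norm ?lerN2 // ltW.
have D1 s : Num.min 0 t <= s <= Num.max 0 t -> is_derive s (1 : R) (fun s => Phi h (y0 + s *: v)) ('D_v (Phi h) (y0 + s *: v)).
  by move=> /st hs; apply: is_derive_line; apply: dP; have [] := hr _ (inball _ hs).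
have D2 s : Num.min 0 t <= s <= Num.max 0 t -> `|'D_v (Phi h) (y0 + s *: v) - 'D_v (Phi h) y0| <= w h.
  by move=> /st hs; have [_] := hr _ (inball _ hs); exact.
have := mvt_estimate D1 D2.
rewrite scale0r addr0 subr0 [y0 + _]addrC => M.
have -> : t^-1 * (Phi h (t *: v + y0) - Phi h y0) - 'D_v (Phi h) y0 = t^-1 * (Phi h (t *: v + y0) - Phi h y0 - 'D_v (Phi h) y0 * t).
  by field.
by rewrite normrM normfV ler_pdivrMl ?normr_gt0 // [_ * w h]mulrC.
Unshelve. all: by end_near. Qed.

Lemma J_param_Ck k U Phi : open U -> JCk k U Phi -> locsupp U Phi ->
  Ck k U (fun y => J (Phi^~ y) : R^o).
Proof.
move=> oU; elim: k Phi => [|k IH] Phi cP sP.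
  by split=> // y Uy; exact: J_param_continuous cP sP Uy.
split=> [y Uy|v]; first exact: J_param_continuous cP sP Uy.
split=> [y Uy|]; first by have [] := J_param_derive v oU cP sP Uy.
have [_ /(_ v)[dP cD]] := cP.
apply: (Ck_ext oU _ (IH _ cD (locsupp_derive v oU sP))) => y Uy.
by have [_ ->] := J_param_derive v oU cP sP Uy.
Qed.

End Param.
End DiffUnderHaar.

(** * Smooth bump functions *)

Section RadialBump.
Context {R : realType} {n : nat}.
Implicit Types (y z : 'rV[R]_n).

(** The squared Euclidean distance is used because, unlike the supremum norm, it is smooth; its ball
    of radius [r] lies in the ball of the same radius for the supremum norm. *)
Definition rbump y (r : R) z : R^o := flat 0 (r ^+ 2 - \sum_j (z 0 j - y 0 j) ^+ 2).

Lemma Ck_coord_id k (U : set 'rV[R]_n) j : open U -> Ck k U (fun z : 'rV[R]_n => z 0 j : R^o).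
Proof.
move=> oU; apply: (Ck_coord (f := id)) => //.
by apply: (@Ck_linear R _ _ k U (@idfun 'rV[R]_n : {linear 'rV[R]_n -> 'rV[R]_n})) => x; exact: cvg_id.
Qed.

Lemma rbump_Ck k y r : Ck k setT (rbump y r).
Proof.
have oT : open [set: 'rV[R]_n] by exact: openT.
apply: (@Ck_comp_R R _ k (flat 0) setT setT (fun z => r ^+ 2 - \sum_j (z 0 j - y 0 j) ^+ 2 : R^o)) => //.
- exact: openT.
- exact: Ck_flat.
apply: Ck_sub_fun => //; first exact: Ck_cst.
apply: Ck_sum => // j _.
have H : Ck k setT (fun z : 'rV[R]_n => z 0 j - y 0 j : R^o).
  by apply: Ck_sub_fun => //; [exact: Ck_coord_id|exact: Ck_cst].
by apply: (Ck_ext oT _ (Ck_mul oT H H)) => z _; rewrite expr2.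
Qed.

Lemma rbump_ge0 y r z : 0 <= rbump y r z. Proof. exact: flat_ge0. Qed.

Lemma rbump_gt0 y r : 0 < r -> 0 < rbump y r y.
Proof.
move=> r0; apply: flat_gt0; rewrite big1 ?subr0 ?exprn_gt0 // => j _.
by rewrite subrr expr0n.
Qed.

Lemma rbump_out y r z : 0 < r -> r < `|z - y| -> rbump y r z = 0.
Proof.
move=> r0; rewrite ltNge => /negP h; apply: flat_le0; rewrite leNgt; apply/negP => p; apply: h.
apply: norm_le_coord; first exact: ltW.
move=> j; rewrite !mxE -[r]ger0_norm ?(ltW r0) // -ler_sqr ?nnegrE // !real_normK ?num_real //.
move: p; rewrite subr_gt0 => /ltW; apply: le_trans.
by rewrite (bigD1 j) //= lerDl sumr_ge0 // => i _; exact: sqr_ge0.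
Qed.

End RadialBump.

Section ManifoldBump.
Context {R : realType} {n : nat} {M : topologicalType}.
Variable A : atlas 'rV[R]_n M.
Hypothesis hA : is_manifold A.
Let sA : smooth_atlas A. Proof. by have [] := hA. Qed.
Let hM : hausdorff_space M. Proof. by have [] := hA. Qed.

Lemma chart_ball p (V : set M) : nbhs p V -> exists2 r, 0 < r &
  forall z, `|z - cmap (chart_at A p) p| <= r -> cimg (chart_at A p) z /\ V (cinv (chart_at A p) z).
Proof.
move=> nV; have hc := is_chart_at sA p; have cy := cimg_cmap (dom_chart_at sA p).
have : \forall z \near cmap (chart_at A p) p, cimg (chart_at A p) z /\ V (cinv (chart_at A p) z).
  near=> z; split; first by near: z; exact: (open_nbhs_nbhs (conj (open_cimg hc) cy)).
  near: z; apply: (cinv_continuous hc cy); rewrite cmapK //; exact: dom_chart_at.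
move=> /nbhs_ballP[r r0 hr]; exists (r / 2); first by rewrite divr_gt0.
move=> z hz; apply: hr; rewrite -ball_normE /= distrC (le_lt_trans hz) //.
by rewrite ltr_pdivrMr // ltr_pMr // ltr1n.
Unshelve. all: by end_near. Qed.

Lemma bump_exists p (V : set M) : nbhs p V -> exists f : M -> R,
  [/\ smoothR A f, Cc f, forall q, 0 <= f q, 0 < f p & forall q, ~ V q -> f q = 0].
Proof.
move=> /chart_ball[r r0 hr].
have [Ac cp] := chart_at_ok sA p; have hc := is_chart_at sA p.
pose y := cmap (chart_at A p) p.
have sub : [set z | `|z - y| <= r] `<=` cimg (chart_at A p) by move=> z /hr[].
have out z : r < `|z - y| -> rbump y r z = 0 by exact: rbump_out.
exists (extend (chart_at A p) (rbump y r)); split.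
- by apply: (smoothR_extend sA hM (y := y) (r := r)) => // k; exact: rbump_Ck.
- split; first by have [] := smoothR_extend sA hM Ac sub (fun k => rbump_Ck k y r) out.
  exists (bump_supp (chart_at A p) y r); first exact: (compact_bump_supp sA).
  by move=> q; apply: (extend_out sA).
- by move=> q; rewrite /extend; case: ifP => // _; exact: rbump_ge0.
- by rewrite /extend asboolT //; exact: rbump_gt0.
move=> q nV; apply: (extend_out sA (y := y) (r := r)) => //.
by move=> [z /hr[_ Vz] zq]; apply: nV; rewrite -zq.
Qed.

End ManifoldBump.

(** * Averaging over the group *)

Section Average.
Context {R : realType} {k n : nat} {G : groupTopType} {M : topologicalType}.
Variables (AG : atlas 'rV[R]_k G) (AM : atlas 'rV[R]_n M) (a : group_action G M).
Hypothesis hG : lie_group AG.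
Hypothesis hM : is_manifold AM.
Hypothesis hact : smooth_map (prod_atlas AG AM) AM (fun z => a z.1 z.2).
Hypothesis hprop : proper_action a.

Let mG : is_manifold AG. Proof. by have [] := hG. Qed.
Let sG : smooth_atlas AG. Proof. by have [] := mG. Qed.
Let sM : smooth_atlas AM. Proof. by have [] := hM. Qed.
Let hausG : hausdorff_space G. Proof. by have [] := mG. Qed.
Let hausM : hausdorff_space M. Proof. by have [] := hM. Qed.

Lemma mulG_continuous : continuous (fun x : G * G => (x.1 * x.2)%g).
Proof. by have [_ [h _] _] := hG. Qed.

Lemma invG_continuous : continuous (fun x : G => (x^-1)%g).
Proof. by have [_ _ [h _]] := hG. Qed.

Lemma bumpG (V : set G) : nbhs (1%g : G) V -> exists f : G -> R, [/\ Ccp f, 0 < f 1%g & forall x, ~ V x -> f x = 0].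
Proof. by move=> /(bump_exists mG)[f [_ fC f0 f1 fV]]; exists f. Qed.

Lemma haar_exists : exists J : (G -> R) -> R, right_haar J.
Proof. exact: (right_haar_exists mulG_continuous invG_continuous hausG bumpG). Qed.

Lemma ge1G (K : set G) : compact K -> exists2 f' : G -> R, Ccp f' & forall x, K x -> 1 <= f' x.
Proof. exact: (Cc_ge1 mulG_continuous bumpG). Qed.

Lemma act_continuous : continuous (fun z : G * M => a z.1 z.2).
Proof. by have [h _] := hact. Qed.

Lemma act1_continuous h : continuous (a h).
Proof.
move=> x; apply: (@continuous_comp _ _ _ (fun x : M => (h, x)) (fun z : G * M => a z.1 z.2)).
  exact: pairr_continuous.
exact: act_continuous.
Qed.

Lemma act2_continuous x : continuous (fun h => a h x).
Proof.
move=> h; apply: (@continuous_comp _ _ _ (fun h : G => (h, x)) (fun z : G * M => a z.1 z.2)).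
  exact: pairl_continuous.
exact: act_continuous.
Qed.

(** The form in which properness is used: the transporter is the projection to [G] of the preimage
    of [L x K]. *)
Lemma act_transporter (L K : set M) : compact L -> compact K ->
  compact [set h | exists2 x, L x & K (a h x)].
Proof.
move=> cL cK; have := hprop (compact_setX cL cK).
move=> c; have -> : [set h | exists2 x, L x & K (a h x)] = fst @` [set z : G * M | (L `*` K) (z.2, a z.1 z.2)].
  apply/seteqP; split=> [h [x Lx Kx]|h [[h' x] [/= Lx Kx] <-]]; last by exists x.
  by exists (h, x).
by apply: continuous_compact => //; apply: continuous_subspaceT => z; exact: cvg_fst.
Qed.

Lemma chart_prod c d : charts AG c -> charts AM d -> charts (prod_atlas AG AM) (prod_chart c d).
Proof. by move=> Gc Md; exists c, d. Qed.

Lemma smoothR_intro (f : M -> R) : (forall c k, charts AM c -> Ck k (cimg c) (f \o cinv c : 'rV[R]_n -> R^o)) -> smoothR AM f.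
Proof.
move=> H; split; last by move=> c Ac l; exact: H.
move=> p; have [Ac cp] := chart_at_ok sM p; have hc := chart_ok sM Ac.
apply: (@near_eq_cont _ R^o ((f \o cinv (chart_at AM p)) \o cmap (chart_at AM p))).
  by apply: filterS (open_nbhs_nbhs (conj (open_dom hc) cp)) => q dq /=; rewrite cmapK.
apply: continuous_comp; first exact: cmap_continuous.
by apply: (Ck_continuous (H _ 0%N Ac)); exact: cimg_cmap.
Qed.

Lemma act1_smooth h : smooth_map AM AM (a h).
Proof.
split; first exact: act1_continuous.
move=> c d Mc Md l; have hc := chart_ok sM Mc; have hd := chart_ok sM Md.
have [Ge eh] := chart_at_ok sG h; have he := chart_ok sG Ge.
pose e := chart_at AG h.
have hp : is_chart (prod_chart e c) by exact: is_chart_prod.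
have [_ /(_ _ d (chart_prod Ge Mc) Md l)] := hact.
rewrite !image_domI //.
set D := [set y | _].
have oD : open D.
  apply: open_preim_cinv => //; apply: open_comp => [x _|]; [exact: act_continuous|exact: open_dom].
move=> cD; have := Ck_slice (cmap e h) oD cD.
have -> : [set y | D (cmap e h, y)] = [set y | cimg c y /\ (a h @^-1` dom d) (cinv c y)].
  apply/seteqP; split=> y; rewrite /D /= cimg_prod /= cmapK //; first by move=> [[]].
  by move=> [cy dy]; split=> //; split=> //; exact: cimg_cmap.
congr Ck; by apply/funext => y /=; rewrite cmapK.
Qed.

Lemma continuous_of_charts (U : set 'rV[R]_n) (Phi : G -> 'rV[R]_n -> R^o) : open U ->
  (forall d, charts AG d -> Ck 0 (cimg d `*` U) (fun z : 'rV[R]_k * 'rV[R]_n => Phi (cinv d z.1) z.2 : R^o)) ->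
  forall h y, U y -> {for (h, y), continuous (fun z : G * 'rV[R]_n => Phi z.1 z.2 : R^o)}.
Proof.
move=> oU H h y Uy; have [Gd dh] := chart_at_ok sG h; have hd := chart_ok sG Gd.
pose d := chart_at AG h.
apply: (@near_eq_cont _ R^o ((fun z : 'rV[R]_k * 'rV[R]_n => Phi (cinv d z.1) z.2 : R^o) \o (fun z : G * 'rV[R]_n => (cmap d z.1, z.2)))).
  have := open_nbhs_nbhs (conj (open_setX (open_dom hd) oU) (conj dh Uy : (dom d `*` U) (h, y))).
  by apply: filterS => -[h' y'] [/= dh' _]; rewrite cmapK.
apply: continuous_comp; first by apply: map_fst_continuous; exact: cmap_continuous.
by apply: (Ck_continuous (H d Gd)); split=> //=; exact: cimg_cmap.
Qed.

(** Charts of the group serve to express joint regularity; the derivatives in [y] are those in the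
    directions [(0, v)] of the product chart. *)
Lemma JCk_of_charts l (U : set 'rV[R]_n) (Phi : G -> 'rV[R]_n -> R^o) : open U ->
  (forall d, charts AG d -> Ck l (cimg d `*` U) (fun z : 'rV[R]_k * 'rV[R]_n => Phi (cinv d z.1) z.2 : R^o)) ->
  JCk l U Phi.
Proof.
move=> oU; elim: l Phi => [|l IH] Phi H.
  by split=> //; exact: continuous_of_charts.
split.
  by apply: continuous_of_charts => // d Gd; exact: Ck_leq (H d Gd).
move=> v; split=> [h y Uy|].
  have [Gd dh] := chart_at_ok sG h; have hd := chart_ok sG Gd.
  have Dz : (cimg (chart_at AG h) `*` U) (cmap (chart_at AG h) h, y) by split=> //=; exact: cimg_cmap.
  have dz := derivableP (Ck_derivable (H _ Gd) Dz : derivable _ _ ((0, v) : 'rV[R]_k * 'rV[R]_n)).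
  have [] := (is_derive_slice (fun z : 'rV[R]_k * 'rV[R]_n => Phi (cinv (chart_at AG h) z.1) z.2 : R^o) _ y v _).2 dz.
  by rewrite /= cmapK.
apply: IH => d Gd; have hd := chart_ok sG Gd.
have oD : open (cimg d `*` U) by apply: open_setX => //; exact: open_cimg.
apply: (Ck_ext oD _ (Ck_derive ((0, v) : 'rV[R]_k * 'rV[R]_n) (H d Gd))) => -[g y] Dz.
have dz := derivableP (Ck_derivable (H _ Gd) Dz : derivable _ _ ((0, v) : 'rV[R]_k * 'rV[R]_n)).
by have [_ <-] := (is_derive_slice (fun z : 'rV[R]_k * 'rV[R]_n => Phi (cinv d z.1) z.2 : R^o) g y v _).2 dz.
Qed.

Lemma JCk_act l (psi : M -> R) c : smoothR AM psi -> charts AM c ->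
  JCk l (cimg c) (fun h y => psi (a h (cinv c y))).
Proof.
move=> pS Mc; have hc := chart_ok sM Mc.
apply: JCk_of_charts; first exact: open_cimg.
move=> d Gd; rewrite -cimg_prod.
have hp : is_chart (prod_chart d c) by apply: is_chart_prod => //; exact: (chart_ok sG).
exact: (smoothR_comp sM l hp hact pS (chart_prod Gd Mc)).
Qed.

(** By properness, a compact neighbourhood of a point is brought into contact with the support of
    [psi] only by a compact set of group elements. *)
Lemma locsupp_act (psi : M -> R) c : Cc psi -> charts AM c ->
  locsupp (cimg c) (fun h y => psi (a h (cinv c y)) : R^o).
Proof.
move=> [_ [K cK pK]] Mc y cy; have hc := chart_ok sM Mc.
have /nbhs_ballP[r r0 hr] := open_nbhs_nbhs (conj (open_cimg hc) cy).
have sub : [set z | `|z - y| <= r / 2] `<=` cimg c.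
  move=> z /= hz; apply: hr; rewrite -ball_normE /= distrC (le_lt_trans hz) //.
  by rewrite ltr_pdivrMr // ltr_pMr // ltr1n.
exists (ball y (r / 2)), [set h | exists2 x, (cinv c @` [set z | `|z - y| <= r / 2]) x & K (a h x)]; split.
- exact: ball_open.
- by apply: ballxx; rewrite divr_gt0.
- by apply: act_transporter => //; apply: (compact_cinv sM) => //; exact: compact_cball.
move=> h y'; rewrite -ball_normE /= distrC => hy' nK; apply: pK => Ka; apply: nK.
by exists (cinv c y') => //; exists y' => //=; exact: ltW.
Qed.

Variable J : (G -> R) -> R.
Hypothesis hJ : right_haar J.

Definition Avg (psi : M -> R) (x : M) : R := J (fun h => psi (a h x)).

Lemma Cc_act (psi : M -> R) x : Cc psi -> Cc (fun h => psi (a h x)).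
Proof.
move=> [pc [K cK pK]]; split.
  by move=> h; apply: (@continuous_comp _ _ _ (fun h => a h x) psi); [exact: act2_continuous|exact: pc].
exists [set h | exists2 y, [set x] y & K (a h y)].
  by apply: act_transporter => //; exact: compact_set1.
by move=> h nK; apply: pK => Ka; apply: nK; exists x.
Qed.

Lemma Avg_invariant (psi : M -> R) h x : Cc psi -> Avg psi (a h x) = Avg psi x.
Proof.
move=> pC; have [_ _ _ _ inv] := hJ.
rewrite /Avg -(inv _ h (Cc_act x pC)); congr J; apply/funext => h'.
by rewrite act_mul.
Qed.

Lemma Avg_add (f1 f2 : M -> R) x : Cc f1 -> Cc f2 -> Avg (fun x => f1 x + f2 x) x = Avg f1 x + Avg f2 x.
Proof. by move=> c1 c2; apply: (JD hJ); exact: Cc_act. Qed.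

Lemma Avg_scale c (f : M -> R) x : Cc f -> Avg (fun x => c * f x) x = c * Avg f x.
Proof. by move=> c1; apply: (JZ hJ); exact: Cc_act. Qed.

Lemma Avg_gt0 (f : M -> R) x h : Cc f -> (forall q, 0 <= f q) -> 0 < f (a h x) -> 0 < Avg f x.
Proof.
move=> c1 H p; have [_ _ _ pos _] := hJ; apply: pos; last by exists h.
by split; [exact: Cc_act|].
Qed.

Lemma Avg_smoothR (psi : M -> R) : smoothR AM psi -> Cc psi -> smoothR AM (Avg psi).
Proof.
move=> pS pC; apply: smoothR_intro => c l Mc.
apply: (J_param_Ck hJ ge1G (Phi := fun h y => psi (a h (cinv c y)) : R^o)).
- by apply: open_cimg; exact: (chart_ok sM).
- exact: JCk_act.
- exact: locsupp_act.
Qed.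

Variable g : M -> 'rV[R]_n -> 'rV[R]_n -> R.
Hypothesis hg : riemannian_metric AM g.
Hypothesis hiso : isometric_action AM g a.

Lemma tangent_act (psi : M -> R) h x v : smoothR AM psi ->
  tangent_real AM (psi \o a h) x v = tangent_real AM psi (a h x) (tangent_map AM AM (a h) x v).
Proof.
move=> pS; apply: (tangent_comp sM sM (@smooth_atlas_line R) (@chain_R R)); first exact: act1_smooth.
exact/smRP.
Qed.

Lemma gnrm_act h x v : gnrm g (a h x) (tangent_map AM AM (a h) x v) = gnrm g x v.
Proof. by rewrite /gnrm hiso. Qed.

Lemma tangent_Avg (psi : M -> R) x v : smoothR AM psi -> Cc psi ->
  tangent_real AM (Avg psi) x v = J (fun h => tangent_real AM (psi \o a h) x v) /\
  Cc (fun h => tangent_real AM (psi \o a h) x v).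
Proof.
move=> pS pC; have [Mc cx] := chart_at_ok sM x; have hc := chart_ok sM Mc.
have oc := open_cimg hc.
have cJ := JCk_act 1 pS Mc; have lS := locsupp_act pC Mc.
split.
  by have [_] := J_param_derive hJ ge1G v oc cJ lS (cimg_cmap cx).
have [_ /(_ v)[_ cD]] := cJ.
exact: (@JCk_Cc _ _ _ 0 _ _ _ cD (locsupp_derive v oc lS) (cimg_cmap cx)).
Qed.

(* The gradient of an average at x only involves the gradient along the orbit of x, since
   the group acts by isometries. *)
Lemma Avg_grad (psi w : M -> R) x : smoothR AM psi -> Cc psi -> Cc w ->
  (forall h, grad_le AM g psi (a h x) (w (a h x))) -> grad_le AM g (Avg psi) x (Avg w x).
Proof.
move=> pS pC wC H v; have [-> cD] := tangent_Avg x v pS pC.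
rewrite mulrC -(JZ hJ); last exact: Cc_act.
apply: (J_norm hJ) => //; first by apply: Cc_scale; exact: Cc_act.
move=> h; rewrite tangent_act // mulrC -(gnrm_act h); exact: H.
Qed.

End Average.

(** * Curves and coordinate segments *)

Section Curves.
Context {R : realType} {n : nat} {M : topologicalType}.
Variable A : atlas 'rV[R]_n M.
Hypothesis hA : smooth_atlas A.
Variable g : M -> 'rV[R]_n -> 'rV[R]_n -> R.
Hypothesis hg : riemannian_metric A g.
Local Notation smooth_curve := (smooth_map (@line_atlas R) A).

Lemma open_dom_curve (gamma : R -> M) c : smooth_curve gamma -> charts A c ->
  open [set t : R^o | dom c (gamma t)].
Proof.
move=> [cg _] Ac; apply: (@open_comp R^o M gamma (dom c)) => [t _|]; first exact: cg.
exact: (open_dom (chart_ok hA Ac)).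
Qed.

Lemma curve_Ck (gamma : R -> M) c k : smooth_curve gamma -> charts A c ->
  Ck k [set t : R^o | dom c (gamma t)] (cmap c \o gamma : R^o -> 'rV[R]_n).
Proof.
move=> sg Ac.
have := @local_rep_Ck R n M A R^o R (@line_atlas R) (@smooth_atlas_line R) k gamma (@Chart R R^o R setT id id) c sg erefl Ac.
by apply: Ck_sub => t ct; split=> //; rewrite cimg_line.
Qed.

Definition velocity (gamma : R -> M) (t : R) : 'rV[R]_n := tangent_map (@line_atlas R) A gamma t (1 : R^o).
Definition speed (gamma : R -> M) (t : R^o) : R^o := gnrm g (gamma t) (velocity gamma t).

(** The velocity is read in the preferred chart at [gamma t], which may jump with [t]. Rewritten in
    one chart around [gamma t0], the squared speed is a sum of continuous terms. *)
Lemma speed_continuous (gamma : R -> M) : smooth_curve gamma -> continuous (speed gamma).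
Proof.
move=> sg t0.
have [Ac dc] := chart_at_ok hA (gamma t0); set c := chart_at A (gamma t0) in Ac dc.
have hc := chart_ok hA Ac.
pose U := [set t : R^o | dom c (gamma t)]; have oU : open U := open_dom_curve sg Ac.
have cC k : Ck k U (cmap c \o gamma : R^o -> 'rV[R]_n) := curve_Ck k sg Ac.
pose V (t : R^o) : 'rV[R]_n := 'D_1 (cmap c \o gamma : R^o -> 'rV[R]_n) t.
pose f2 (t : R^o) : R^o := Num.sqrt (\sum_i \sum_j V t 0 i * V t 0 j * Gm A g c (cmap c (gamma t)) (evec i) (evec j)).
apply: (@near_eq_cont _ _ f2).
  near=> t; have Ut : U t by near: t; exact: (open_nbhs_nbhs (conj oU dc)).
  rewrite /speed /velocity (velocity_chart hA sg Ac Ut) /f2 -/(V t).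
  rewrite -(@form_coords _ _ (Gm A g c (cmap c (gamma t)))); last 2 first.
  - exact: (Gm_lin hA hg Ac (cimg_cmap Ut)).
  - exact: (Gm_sym hg).
  by rewrite -(gnrm_Gm A g) (cmapK hc Ut).
have Vc : {for t0, continuous V} by apply: (@Ck_continuous _ _ _ 0 U) => //; exact: (Ck_derive _ (cC 1%N)).
have cc : {for t0, continuous (fun t : R^o => cmap c (gamma t))} := Ck_continuous (cC 0%N) dc.
apply: (@continuous_comp R^o R^o R^o _ (Num.sqrt : R^o -> R^o)); last exact: sqrt_continuous.
apply: (@cvg_bigsum R _ _ R^o (nbhs t0)) => i _.
apply: (@cvg_bigsum R _ _ R^o (nbhs t0)) => j _.
apply: (@cvgM R _ (nbhs t0)); first by apply: (@cvgM R _ (nbhs t0)); exact: (@continuous_coord R R^o n V t0 _ Vc).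
apply: (@continuous_comp _ _ _ (fun t : R^o => cmap c (gamma t)) (fun y => Gm A g c y (evec i) (evec j) : R^o)) => //.
exact: (Gm_cont hg Ac (cimg_cmap dc)).
Unshelve. all: by end_near. Qed.

Lemma speed_ge0 gamma t : 0 <= speed gamma t. Proof. exact: gnrm_ge0. Qed.

Lemma curve_lengthE gamma : curve_length A g gamma = (\int[@lebesgue_measure R]_(t in `[0%R, 1%R]) (speed gamma t)%:E)%E.
Proof. by []. Qed.

Lemma measurable_speed gamma : smooth_curve gamma ->
  measurable_fun (`[0%R, 1%R] : set (measurableTypeR R)) (EFin \o (speed gamma : R -> R)).
Proof.
move=> sg; apply/measurable_EFinP; apply: (measurable_funS measurableT) => //.
by apply: continuous_measurable_fun; exact: speed_continuous.
Qed.

Lemma curve_length_ge0 gamma : (0 <= curve_length A g gamma)%E.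
Proof. by apply: integral_ge0 => t _; rewrite lee_fin; exact: speed_ge0. Qed.

Lemma curve_length_le gamma (C : R) : smooth_curve gamma -> (forall t, speed gamma t <= C) ->
  (curve_length A g gamma <= C%:E)%E.
Proof.
move=> sg sC; rewrite curve_lengthE.
have -> : (C%:E = \int[@lebesgue_measure R]_(t in `[0%R, 1%R]) C%:E)%E.
  by rewrite integral_cst //= lebesgue_measure_itv /= lte_fin ltr01 oppr0 adde0 mule1.
apply: ge0_le_integral => //.
- by move=> t _; rewrite lee_fin; exact: speed_ge0.
- exact: measurable_speed.
- by move=> t _; rewrite lee_fin; exact: sC.
Qed.

Lemma curve_deriv f gamma (t : R) : smoothR A f -> smooth_curve gamma ->
  is_derive t (1 : R) (f \o gamma) (tangent_real A f (gamma t) (velocity gamma t)).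
Proof.
move=> sf sg.
have [Ac dc] := chart_at_ok hA (gamma t); set c := chart_at A (gamma t) in Ac dc.
have := @chain_charts R n M A hA R^o R^o R R (@line_atlas R) (@line_atlas R) (@smooth_atlas_line R)
   (@smooth_atlas_line R) (@chain_R R) gamma f
  (@Chart R R^o R setT id id) c (@Chart R R^o R setT id id) t 1 sg ((smRP A f).2 sf) erefl Ac erefl.
rewrite cimg_line => /(_ I dc I) => h.
apply: is_derive_eq h _.
rewrite /tangent_real /tangent_map /=. by [].
Qed.

(** The derivative of [f] along the curve is at most [C] times the speed; the fundamental theorem of
    calculus integrates this over [0, 1]. *)
Lemma curve_lip f gamma (C : R) : smoothR A f -> smooth_curve gamma -> 0 <= C -> (forall p, grad_le A g f p C) ->
  (`|f (gamma 1) - f (gamma 0)|%:E <= C%:E * curve_length A g gamma)%E.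
Proof.
move=> sf sg C0 fC.
pose dF (t : R) : R := tangent_real A f (gamma t) (velocity gamma t).
have dFE t : is_derive (t : R) (1 : R) (f \o gamma) (dF t) := curve_deriv t sf sg.
have fgC : Ck 1 setT (f \o gamma : R^o -> R^o).
  have := @smoothR_comp R n M A hA R^o R (@line_atlas R) gamma f (@Chart R R^o R setT id id) 1 (@is_chart_line R) sg sf erefl.
  by rewrite cimg_line.
have dFc : continuous (dF : R^o -> R^o).
  have -> : dF = 'D_1 (f \o gamma : R^o -> R^o).
    by apply/funext => t; have h := dFE t; rewrite (@derive_val _ _ _ _ _ _ _ h).
  by move=> t; apply: (@Ck_continuous _ _ _ 0 setT) => //; exact: (Ck_derive _ fgC).
have cF : continuous (f \o gamma : R^o -> R^o) by move=> t; exact: (Ck_continuous fgC).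
have e : (\int[@lebesgue_measure R]_(x in `[0%R, 1%R]) (dF x)%:E = (f (gamma 1))%:E - (f (gamma 0))%:E)%E.
  apply: (@continuous_FTC2 R dF (f \o gamma) 0 1 ltr01).
- exact: continuous_subspaceT.
- split.
  + by move=> t _; have h := dFE t; exact: (@ex_derive _ _ _ _ _ _ _ h).
  + by apply: cvg_at_right_filter; exact: cF.
  + by apply: cvg_at_left_filter; exact: cF.
- by move=> t _; rewrite derive1E; have h := dFE t; exact: (@derive_val _ _ _ _ _ _ _ h).
have -> : `|f (gamma 1) - f (gamma 0)|%:E = `| \int[@lebesgue_measure R]_(x in `[0%R, 1%R]) (dF x)%:E |%E by rewrite e.
have mdF : measurable_fun (`[0%R, 1%R] : set (measurableTypeR R)) (EFin \o dF).
  apply/measurable_EFinP; apply: (measurable_funS measurableT) => //.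
  exact: continuous_measurable_fun.
apply: (le_trans (le_abse_integral _ _ mdF)) => //.
rewrite curve_lengthE -ge0_integralZl //; last 2 first.
- exact: measurable_speed.
- by move=> t _; rewrite lee_fin; exact: speed_ge0.
apply: ge0_le_integral => //.
- by apply/measurableT_comp.
- by apply: measurable_funeM; exact: measurable_speed.
- by move=> t _; rewrite /= -EFinM lee_fin; exact: fC.
Qed.

Lemma path_lip f p s q (C : R) : smoothR A f -> 0 <= C -> (forall p, grad_le A g f p C) -> path_between A p s q ->
  (`|f q - f p|%:E <= C%:E * \sum_(gamma <- s) curve_length A g gamma)%E.
Proof.
move=> sf C0 fC; elim: s p => [p /= ->|gamma s IH p /= [sg <- ps]].
  by rewrite big_nil subrr normr0 mule0.
rewrite big_cons ge0_muleDr ?curve_length_ge0 //; last by apply: sume_ge0 => i _; exact: curve_length_ge0.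
apply: (le_trans _ (leeD (curve_lip sf sg C0 fC) (IH _ ps))).
rewrite -EFinD lee_fin (le_trans _ (ler_normD _ _)) //.
by have -> : f q - f (gamma 0) = f (gamma 1) - f (gamma 0) + (f q - f (gamma 1)) by ring.
Qed.

Definition dist_lt x y (e : R) := (riemannian_dist A g x y < e%:E)%E.

Lemma dist_ltP x y e : dist_lt x y e <-> exists2 s, path_between A x s y & (\sum_(gamma <- s) curve_length A g gamma < e%:E)%E.
Proof.
split; first by move=> /ereal_inf_lt [_ [s ps ->] l]; exists s.
move=> [s ps l]; apply: le_lt_trans l; apply: ereal_inf_lbound; by exists s.
Qed.

Lemma dist_lt_lip f x y (e C : R) : smoothR A f -> 0 <= C -> (forall p, grad_le A g f p C) -> dist_lt x y e ->
  `|f y - f x| <= C * e.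
Proof.
move=> sf C0 fC /dist_ltP[s ps l]; rewrite -lee_fin.
apply: (le_trans (path_lip sf C0 fC ps)); rewrite EFinM.
apply: lee_wpmul2l; [by rewrite lee_fin|exact: ltW].
Qed.

Lemma dist_lt_refl x (e : R) : 0 < e -> dist_lt x x e.
Proof. by move=> e0; apply/dist_ltP; exists [::] => //; rewrite big_nil lte_fin. Qed.

Lemma path_between_cat p s q s' r : path_between A p s q -> path_between A q s' r -> path_between A p (s ++ s') r.
Proof.
elim: s p => [p /= -> //|gamma s IH p /= [sg g0 ps] h]; split=> //; exact: IH.
Qed.

Lemma dist_lt_trans x y z (e1 e2 : R) : dist_lt x y e1 -> dist_lt y z e2 -> dist_lt x z (e1 + e2).
Proof.
move=> /dist_ltP[s1 p1 l1] /dist_ltP[s2 p2 l2]; apply/dist_ltP; exists (s1 ++ s2).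
  exact: path_between_cat p1 p2.
by rewrite big_cat /= EFinD lteD.
Qed.

Lemma dist_lt_le x y (e1 e2 : R) : e1 <= e2 -> dist_lt x y e1 -> dist_lt x y e2.
Proof. by move=> e12 h; apply: lt_le_trans h _; rewrite lee_fin. Qed.

End Curves.

(** * Coordinate segments and their lengths *)

Section Links.
Context {R : realType} {n : nat} {M : topologicalType}.
Variable A : atlas 'rV[R]_n M.
Hypothesis hA : smooth_atlas A.
Variable g : M -> 'rV[R]_n -> 'rV[R]_n -> R.
Hypothesis hg : riemannian_metric A g.

(** A straight segment of one chart with speed at most [f]. Its reverse and its pieces are again of
    this kind, which makes the pseudo-distance symmetric and divisible. *)
Definition link x y (f : R) := 0 <= f /\ exists c, [/\ charts A c, dom c x, dom c y &
  forall t, 0 <= t <= 1 -> let d := cmap c y - cmap c x in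
    cimg c (cmap c x + t *: d) /\ Gm A g c (cmap c x + t *: d) d d <= f ^+ 2].

Lemma link_sym x y f : link x y f -> link y x f.
Proof.
move=> [f0 [c [Ac cx cy h]]]; split; first exact: f0.
exists c; split; [exact: Ac|exact: cy|exact: cx|move=> t /andP[t0 t1] /=].
have /h/= [] : 0 <= 1 - t <= 1 by rewrite subr_ge0 t1 lerBlDr lerDl t0.
set d := cmap c y - cmap c x; have -> : cmap c x - cmap c y = - d by rewrite opprB.
have -> : cmap c y + t *: - d = cmap c x + (1 - t) *: d.
  by rewrite scalerBl scale1r scalerN addrA /d subrKC.
move=> cd Gd; split; first exact: cd.
by rewrite -[- d]scaleN1r (formZZ (Gm_lin hA hg Ac cd) (Gm_sym hg c _)) expr2 mulrNN !mul1r.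
Qed.

Lemma link_split x y f (s : R) : link x y f -> 0 <= s <= 1 ->
  exists w, link x w (s * f) /\ link w y ((1 - s) * f).
Proof.
move=> [f0 [c [Ac cx cy h]]] /andP[s0 s1]; have hc := chart_ok hA Ac.
set d := cmap c y - cmap c x in h.
have [ws _] := h s (introT andP (conj s0 s1)).
pose w := cinv c (cmap c x + s *: d); exists w.
have cw : cmap c w = cmap c x + s *: d by rewrite /w cinvK.
have dw : dom c w := dom_cinv hc ws.
have sub01 (t : R) : 0 <= t <= 1 -> 0 <= 1 - t <= 1 by move=> /andP[t0 t1]; rewrite subr_ge0 t1 lerBlDr lerDl t0.
split; (split; first by rewrite mulr_ge0 // subr_ge0).
- exists c; split=> // t /andP[t0 t1] /=; rewrite cw addrAC subrr add0r scalerA.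
  have /h/= [cd Gd] : 0 <= t * s <= 1 by rewrite mulr_ge0 //= mulr_ile1.
  split=> //; rewrite (formZZ (Gm_lin hA hg Ac cd) (Gm_sym hg c _)) exprMn.
  by rewrite ler_wpM2l // sqr_ge0.
- exists c; split=> // t /andP[t0 t1] /=; rewrite cw.
  have -> : cmap c y - (cmap c x + s *: d) = (1 - s) *: d by rewrite opprD addrA scalerBl scale1r.
  rewrite -addrA scalerA -scalerDl.
  have /h/= [cd Gd] : 0 <= s + t * (1 - s) <= 1.
    rewrite addr_ge0 ?mulr_ge0 ?subr_ge0 //= -lerBrDl -[leRHS]mul1r.
    by rewrite ler_wpM2r // subr_ge0.
  split=> //; rewrite (formZZ (Gm_lin hA hg Ac cd) (Gm_sym hg c _)) exprMn.
  by rewrite ler_wpM2l // sqr_ge0.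
Qed.

Lemma link_local p : let c := chart_at A p in exists2 r : R, 0 < r & forall u v,
  `|u - cmap c p| < r -> `|v - cmap c p| < r ->
  cimg c u /\ link (cinv c u) (cinv c v) (2 * Num.sqrt (Gm A g c (cmap c p) (v - u) (v - u))).
Proof.
move=> c; have [Ac dc] := chart_at_ok hA p; rewrite -/c in Ac dc; have hc := chart_ok hA Ac.
(* The factor 4 compares squared norms, whence the 2 in front of the square root. *)
have /nbhs_ballP[r /= r0 hr] := Gm_near hA hg Ac (cimg_cmap dc) (ltr1n R 4).
exists r => // u v; rewrite !(distrC _ (cmap c p)) => hu hv.
have bu : ball (cmap c p) r u by rewrite -ball_normE.
have bv : ball (cmap c p) r v by rewrite -ball_normE.
have [cu _] := hr _ bu; have [cv _] := hr _ bv; split=> //; split; first by rewrite mulr_ge0 // sqrtr_ge0.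
exists c; split=> //; [exact: dom_cinv|exact: dom_cinv|] => t /andP[t0 t1] /=; rewrite !cinvK //.
have /hr[cz /(_ (v - u))[G1 _]] : ball (cmap c p) r (u + t *: (v - u)).
  rewrite -ball_normE /ball_ /=.
  have -> : cmap c p - (u + t *: (v - u)) = (1 - t) *: (cmap c p - u) + t *: (cmap c p - v).
    by apply/rowP => j; rewrite !mxE; ring.
  have t1' : 0 <= 1 - t by rewrite subr_ge0.
  apply: (le_lt_trans (ler_normD _ _)); rewrite !normrZ (ger0_norm t0) (ger0_norm t1').
  have [t00|tp] := eqVneq t 0; first by rewrite t00 subr0 mul1r mul0r addr0.
  have -> : r = (1 - t) * r + t * r by rewrite -mulrDl subrK mul1r.
  by rewrite ler_ltD // ?ler_wpM2l // ?(ltW hu) // ltr_pM2l // lt_neqAle eq_sym tp.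
by split=> //; rewrite exprMn sqr_sqrtr ?(Gm_ge0 hg) // -natrX.
Qed.

(** The curves of [path_between] are smooth on the whole line, whereas the segment is known to stay
    in the chart only for parameters in [0, 1]. This parameter joins 0 to 1 without ever leaving
    [0, 1]. *)
Definition ramp (t : R) : R := 2^-1 * (1 - cos (pi * t)).

Lemma ramp01 t : 0 <= ramp t <= 1.
Proof.
have := cos_geN1 (pi * t); have := cos_le1 (pi * t); rewrite /ramp => c1 c2; apply/andP; split; lra.
Qed.

Lemma is_derive_ramp (t : R) : is_derive t (1 : R) ramp (2^-1 * (pi * sin (pi * t))).
Proof.
have h : is_derive t (1 : R) (fun t => pi * t) (pi : R).
  have := @is_deriveM R R^o (cst (pi : R)) id t 1 0 1 (is_derive_cst _ _ _) (is_derive_id _ _).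
  by move=> h0; apply: is_derive_eq h0 _; rewrite scaler0 addr0 /GRing.scale /= mulr1.
have h2 : is_derive t (1 : R) (fun t => cos (pi * t)) (- sin (pi * t) * pi).
  have h3 := is_derive_cos (pi * t : R).
  by have := @is_derive1_comp R (cos : R -> R) (fun t => pi * t) t _ _ h3 h; apply.
rewrite /ramp; apply: is_derive_eq; rewrite /GRing.scale /=; ring.
Qed.

Lemma ramp_Ck k : Ck k setT (ramp : R^o -> R^o).
Proof.
apply: Ck_mul; [exact: openT|exact: Ck_cst|].
apply: Ck_sub_fun; [exact: openT|exact: Ck_cst|].
apply: (@Ck_comp_R R R^o k (cos : R^o -> R^o) setT) => //; [exact: openT|exact: openT|exact: (Ck_sin_cos k).2|].
apply: Ck_mul; [exact: openT|exact: Ck_cst|].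
by apply: (@Ck_linear R R^o R^o k setT (idfun : {linear R^o -> R^o})) => x; exact: cvg_id.
Qed.

(** The segment is run through with the parameter [ramp], whose derivative is at most pi/2, hence at
    most 2, in absolute value. *)
Lemma link_dist x y f (e : R) : link x y f -> 2 * f < e -> dist_lt A g x y e.
Proof.
move=> [f0 [c [Ac cx cy h]]] fe; have hc := chart_ok hA Ac.
set d := cmap c y - cmap c x in h.
pose T (t : R^o) : 'rV[R]_n := cmap c x + ramp t *: d.
have cT t : cimg c (T t) by have [] := h _ (ramp01 t).
have TC k : Ck k setT T.
  apply: Ck_rV => [|j]; first exact: openT.
  have -> : (fun t => T t 0 j : R^o) = (fun t => cmap c x 0 j + ramp t * d 0 j) by apply/funext => t; rewrite !mxE.
  apply: Ck_add; [exact: openT|exact: Ck_cst|apply: Ck_mul; [exact: openT|exact: ramp_Ck|exact: Ck_cst]].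
pose gamma (t : R) : M := cinv c (T t).
have sg : smooth_map (@line_atlas R) A gamma.
  split.
    move=> t; apply: (@continuous_comp R^o _ _ T (cinv c)); first exact: (Ck_continuous (TC 0%N)).
    exact: (cinv_continuous hc).
  move=> _ e' /= -> Ae l; have he := chart_ok hA Ae.
  set U := (X in Ck l X _).
  have UE : U = [set t | dom e' (gamma t)].
    apply/seteqP; split=> t /=; first by move=> [s [_ ds] <-].
    by move=> dt; exists t.
  have oU : open U.
    rewrite UE; apply: (@open_comp R^o _ gamma (dom e')); last exact: open_dom.
    move=> t _; apply: (@continuous_comp R^o _ _ T (cinv c)); first exact: (Ck_continuous (TC 0%N)).
    exact: (cinv_continuous hc).
  apply: (@Ck_comp_rV2 R l R^o n n (cmap e' \o cinv c) [set y | cimg c y /\ dom e' (cinv c y)] U T) => //.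
  - exact: (open_preim_cinv hc (open_dom he)).
  - by move=> t; rewrite UE.
  - by apply: (transition_Ck hA).
  - by apply: Ck_sub (TC l).
have g0 : gamma 0 = x by rewrite /gamma /T /ramp mulr0 cos0 subrr mulr0 scale0r addr0 cmapK.
have g1 : gamma 1 = y.
  rewrite /gamma /T /ramp mulr1 cospi opprK (_ : 2^-1 * _ = 1) ?scale1r; last by lra.
  by rewrite /d subrKC cmapK.
apply/dist_ltP; exists [:: gamma]; first by split.
rewrite big_seq1; apply: (@le_lt_trans _ _ (2 * f)%:E); last by rewrite lte_fin.
apply: (curve_length_le hA hg sg) => t; rewrite /speed /velocity.
have dt : dom c (gamma t) := dom_cinv hc (cT t).
rewrite (velocity_chart hA sg Ac dt).
have -> : (cmap c \o gamma : R^o -> 'rV[R]_n) = T by apply/funext => s /=; rewrite /gamma cinvK.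
have dT : is_derive (t : R^o) (1 : R^o) T ((2^-1 * (pi * sin (pi * t))) *: d).
  apply: is_derive_rV => j.
  have hr := is_derive_ramp t.
  have -> : (fun t => T t 0 j) = (fun t => cmap c x 0 j + ramp t * d 0 j) by apply/funext => s; rewrite !mxE.
  have h2 := is_deriveD (is_derive_cst (cmap c x 0 j) t 1) (is_deriveM hr (is_derive_cst (d 0 j) t 1)).
  apply: is_derive_eq h2 _; rewrite scaler0 !add0r.
  by rewrite [RHS]mxE /GRing.scale /= /cst mulrC.
rewrite (@derive_val _ _ _ _ _ _ _ dT) gnrm_Gm.
have [_ /= Gd] := h _ (ramp01 t).
rewrite (formZZ (Gm_lin hA hg Ac (cT t)) (Gm_sym hg c _)).
rewrite -(@ger0_norm _ (2 * f)) ?mulr_ge0 // -sqrtr_sqr; apply: ler_wsqrtr.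
rewrite [leRHS]exprMn; apply: ler_pM; [exact: sqr_ge0|exact: (Gm_ge0 hg)| |exact: Gd].
have p0 : 0 <= pi :> R := pi_ge0 R.
have p4 : pi <= 4 :> R by have /andP[_] := @pihalf_02 R; move=> /ltW; rewrite ler_pdivrMr // => /le_trans; apply; lra.
have s1 : sin (pi * t) ^+ 2 <= 1 by rewrite -(cos2Dsin2 (pi * t)) lerDr sqr_ge0.
have p16 : pi ^+ 2 <= 16 :> R by nra.
have s0 := sqr_ge0 (sin (pi * t)).
rewrite !exprMn; nra.
Qed.

End Links.

Lemma form_upper {R : realType} {n : nat} (B : 'rV[R]_n -> 'rV[R]_n -> R) :
  (forall a u v w, B (a *: u + v) w = a * B u w + B v w) -> (forall v w, B v w = B w v) ->
  exists2 C : R, 0 < C & forall v, Num.sqrt (B v v) <= C * `|v|.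
Proof.
move=> rball Bs; pose S := \sum_i \sum_j `|B (evec i) (evec j)|.
have S0 : 0 <= S by apply: sumr_ge0 => i _; apply: sumr_ge0.
exists (1 + S) => [|v]; first by rewrite ltr_pwDl.
rewrite -(@ger0_norm _ ((1 + S) * _)) ?mulr_ge0 ?addr_ge0 // -sqrtr_sqr; apply: ler_wsqrtr.
apply: (@le_trans _ _ (S * `|v| ^+ 2)); last first.
  by rewrite exprMn ler_wpM2r ?sqr_ge0 //; nra.
rewrite (form_coords rball Bs) mulr_suml; apply: ler_sum => i _; rewrite mulr_suml; apply: ler_sum => j _.
rewrite mulrC; apply: (le_trans (ler_norm _)); rewrite !normrM ler_wpM2l // expr2.
by apply: ler_pM => //; exact: coord_le_norm.
Qed.

(** * The pseudo-distance on the quotient *)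

Section Reach.
Context {R : realType} {k n : nat} {G : groupTopType} {M : topologicalType}.
Variables (AG : atlas 'rV[R]_k G) (A : atlas 'rV[R]_n M) (a : group_action G M).
Hypothesis hG : lie_group AG.
Hypothesis hM : is_manifold A.
Hypothesis hact : smooth_map (prod_atlas AG A) A (fun z => a z.1 z.2).
Hypothesis hprop : proper_action a.
Variable g : M -> 'rV[R]_n -> 'rV[R]_n -> R.
Hypothesis hg : riemannian_metric A g.
Hypothesis hiso : isometric_action A g a.

Let sM : smooth_atlas A. Proof. by have [] := hM. Qed.
Let hausM : hausdorff_space M. Proof. by have [] := hM. Qed.

Lemma smooth_curve_act (gamma : R -> M) h : smooth_map (@line_atlas R) A gamma ->
  smooth_map (@line_atlas R) A (a h \o gamma).
Proof.
move=> sg; have ca := act1_smooth hG hM hact h.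
have cag : continuous (a h \o gamma).
  by move=> t; apply: continuous_comp; [exact: sg.1|exact: ca.1].
split=> // _ d /= -> Ad l.
set U := (X in Ck l X _).
have UE : U = [set t | dom d (a h (gamma t))].
  by apply/seteqP; split=> t /=; [move=> [s [_ ds] <-]|move=> dt; exists t].
apply: Ck_local => t; rewrite UE /= => dt.
have [Ac dc] := chart_at_ok sM (gamma t); set c := chart_at A (gamma t) in Ac dc.
pose B := [set t : R^o | dom c (gamma t) /\ dom d (a h (gamma t))]; exists B => //.
have oB : open B.
  apply: openI; first exact: (open_dom_curve sM sg Ac).
  apply: (@open_comp R^o M (a h \o gamma) (dom d)) => [s _|]; first exact: cag.
  exact: (open_dom (chart_ok sM Ad)).
apply: (@Ck_ext R _ _ l _ ((cmap d \o a h \o cinv c) \o (cmap c \o gamma))) => //.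
  by move=> s [cs _] /=; rewrite (cmapK (chart_ok sM Ac)).
apply: (@Ck_comp_rV2 R l R^o n n _ [set y | cimg c y /\ dom d (a h (cinv c y))]) => //.
- apply: (open_preim_cinv (chart_ok sM Ac) (B := a h @^-1` dom d)).
  by apply: open_comp => [x _|]; [exact: ca.1|exact: (open_dom (chart_ok sM Ad))].
- by move=> s [cs ds] /=; rewrite (cmapK (chart_ok sM Ac) cs); split; [exact: cimg_cmap|exact: ds].
- have [_ /(_ c d Ac Ad l)] := ca; by rewrite image_domI //; exact: (chart_ok sM Ac).
- by have := curve_Ck l sg Ac; apply: Ck_sub => s [].
Qed.

Lemma curve_length_act gamma h : smooth_map (@line_atlas R) A gamma ->
  curve_length A g (a h \o gamma) = curve_length A g gamma.
Proof.
move=> sg; rewrite !curve_lengthE.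
suff -> : speed A g (a h \o gamma) = speed A g gamma by [].
apply/funext => t; rewrite /speed /velocity.
rewrite (tangent_comp sM (@smooth_atlas_line R) sM (@chain_row R n) t _ sg (act1_smooth hG hM hact h)).
exact: (gnrm_act hiso).
Qed.

Lemma path_act s x y h : path_between A x s y -> path_between A (a h x) [seq a h \o gamma | gamma <- s] (a h y) /\
  (\sum_(j <- [seq a h \o gamma | gamma <- s]) curve_length A g j = \sum_(j <- s) curve_length A g j)%E.
Proof.
elim: s x => [x e|gamma s IH x [sg <- ps]].
  by split; [exact: (congr1 (a h) (e : x = y))|reflexivity].
have [p1 p2] := IH _ ps; split.
  by split=> //; exact: smooth_curve_act.
rewrite map_cons (big_cons _ _ _ [seq a h \o gamma | gamma <- s]) curve_length_act // p2.
by symmetry; rewrite big_cons.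
Qed.

Lemma dist_lt_act x y e h : dist_lt A g x y e -> dist_lt A g (a h x) (a h y) e.
Proof.
move=> /dist_ltP[s ps l]; have [p1 p2] := path_act h ps.
apply/dist_ltP; exists [seq a h \o gamma | gamma <- s]; first exact: p1.
by rewrite p2.
Qed.

Lemma rcn_local_cst f p (b : R) : smoothR A f -> (\forall q \near p, f q = b) -> rcn A g f p = 0.
Proof.
move=> sf fb; apply/eqP; rewrite eq_le rcn_ge0 // andbT.
have [Ac dc] := chart_at_ok sM p; set c := chart_at A p in Ac dc; have hc := chart_ok sM Ac.
apply: rcn_le => //.
rewrite -[p](cmapK hc dc); apply/grad_le_chart => //; first exact: cimg_cmap.
move=> v; rewrite mul0r.
have -> : 'D_v (f \o cinv c : 'rV[R]_n -> R^o) (cmap c p) = 'D_v (cst (b : R^o)) (cmap c p).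
  apply: near_eq_derive.
  have := cinv_continuous hc (cimg_cmap dc); rewrite /prop_for /continuous_at (cmapK hc dc) => ci.
  exact: (ci _ fb).
by rewrite derive_cst normr0.
Qed.

Lemma rcn_Cc f : smoothR A f -> Cc f -> Cc (rcn A g f).
Proof.
move=> sf [cf [K cK fK]]; split; first exact: rcn_continuous.
exists K => // q Kq; apply: (@rcn_local_cst _ _ 0) => //.
have oK : open (~` K) by rewrite openC; exact: compact_closed.
by near=> q'; apply: fK; near: q'; exact: open_nbhs_nbhs.
Unshelve. all: by end_near. Qed.

(** A bump at [p] has bounded gradient, so it cannot fall from [f p] to 0 over a distance
    [f p / (2 B)]. Both orders of the points are covered, which avoids reversing curves. *)
Lemma D_small p (U : set M) : nbhs p U ->
  exists2 e : R, 0 < e & forall q, dist_lt A g p q e \/ dist_lt A g q p e -> U q.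
Proof.
move=> pU; have [f [sf cf f0 fp fU]] := bump_exists hM pU.
have [B B0 fB] := Cc_bounded (rcn_Cc sf cf).
exists (f p / (2 * B)); first by rewrite divr_gt0 // mulr_gt0.
have e1 : B * (f p / (2 * B)) = f p / 2 by field; rewrite gt_eqF.
have gB q : grad_le A g f q B.
  have h1 : grad_le A g f q (rcn A g f q) by apply: rcn_grad.
  by move=> v; apply: (le_trans (h1 v)); rewrite ler_wpM2r ?gnrm_ge0.
move=> q hD; apply: contrapT => /fU fq.
have : `|f q - f p| <= f p / 2.
  by case: hD => /(dist_lt_lip sM hg sf (ltW B0) gB); rewrite e1 // distrC.
rewrite fq sub0r normrN gtr0_norm //; lra.
Qed.

(** Jumps along orbits cost nothing, so lengths are those of the quotient. The index is the length
    of a chain and not an infimum, so that a chain can be cut at a prescribed length. *)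
Inductive reach (x : M) : M -> R -> Prop :=
| reach_refl : reach x x 0
| reach_step y z e f : reach x y e -> link A g y z f -> reach x z (e + f)
| reach_jump y h e : reach x y e -> reach x (a h y) e.

Lemma reach_ge0 x y e : reach x y e -> 0 <= e.
Proof. by elim=> // y' z e' f _ e0 [f0 _]; rewrite addr_ge0. Qed.

Lemma reach_trans x y z e f : reach x y e -> reach y z f -> reach x z (e + f).
Proof.
move=> xy; elim=> [|z1 z2 e' f' _ h l|z1 h e' _ h']; first by rewrite addr0.
  by rewrite addrA; exact: reach_step h l.
exact: reach_jump.
Qed.

Lemma reach_link x y f : link A g x y f -> reach x y f.
Proof. by rewrite -[f]add0r => l; apply: reach_step (reach_refl _) _; rewrite add0r in l. Qed.

Lemma reach_orbit x h : reach x (a h x) 0.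
Proof. exact: reach_jump (reach_refl _). Qed.

Lemma reach_orbit_sym x h : reach (a h x) x 0.
Proof. by have := reach_orbit (a h x) h^-1%g; rewrite -act_mul mulVg act_one. Qed.

Lemma reach_sym x y e : reach x y e -> reach y x e.
Proof.
elim=> [|y' z e' f _ IH l|y' h e' _ IH]; first exact: reach_refl.
  by rewrite addrC; apply: reach_trans IH; exact: reach_link (link_sym sM hg l).
by rewrite -[e']add0r; apply: reach_trans IH; exact: reach_orbit_sym.
Qed.

(** The chain is cut inside the segment in which the length [s] is attained; here the divisibility
    of segments is used. *)
Lemma reach_split x z e (s : R) : reach x z e -> 0 <= s <= e ->
  exists w, reach x w s /\ reach w z (e - s).
Proof.
move=> r; elim: r s => [s /andP[s0 s1]|y z' e' f xy IH l s /andP[s0 s1]|y h e' xy IH s /IH[w [r1 r2]]].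
- have -> : s = 0 by apply/eqP; rewrite eq_le s1.
  by rewrite subr0; exists x; split; exact: reach_refl.
- have [se|es] := leP s e'.
    have [w [r1 r2]] := IH s (introT andP (conj s0 se)).
    by exists w; split=> //; rewrite addrAC; exact: reach_step r2 l.
  have f0 : 0 < f by lra.
  have fE : (s - e') / f * f = s - e' by rewrite divfK // gt_eqF.
  have [|w [l1 l2]] := link_split sM hg (s := (s - e') / f) l.
    by rewrite divr_ge0 ?subr_ge0 ?(ltW es) ?(ltW f0) //= ler_pdivrMr // mul1r; lra.
  exists w; split.
    by rewrite -[s](subrK e') addrC -fE; exact: reach_step xy l1.
  by have := reach_link l2; congr reach; rewrite mulrBl fE mul1r; lra.
- by exists w; split=> //; exact: reach_jump.
Qed.

Definition rball x (s : R) := [set y | exists2 e, e < s & reach x y e].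

Lemma rball_near x (s : R) : 0 < s -> \forall y \near x, rball x s y.
Proof.
move=> s0; have [r r0 hr] := link_local sM hg x; set c := chart_at A x in hr.
have [Ac dc] := chart_at_ok sM x; rewrite -/c in Ac dc; have hc := chart_ok sM Ac.
have [C C0 hC] := form_upper (Gm_lin sM hg Ac (cimg_cmap dc)) (Gm_sym hg c (cmap c x)).
pose B (y : M) := `|cmap c x - cmap c y| < r /\ 2 * (C * `|cmap c x - cmap c y|) < s.
have : \forall y \near x, dom c y /\ B y.
  near=> y; split; first by near: y; exact: (open_nbhs_nbhs (conj (open_dom hc) dc)).
  have : `|cmap c x - cmap c y| < Num.min r (s / (2 * C)).
    near: y; apply: (@cvgr_dist_lt _ _ _ (nbhs x) _ (cmap c)); first exact: cmap_continuous.
    by rewrite lt_min r0 divr_gt0 // mulr_gt0.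
  rewrite lt_min => /andP[yr ys]; split=> //.
  by move: ys; rewrite ltr_pdivlMr ?mulr_gt0 // => ys; rewrite mulrA mulrC.
apply: filterS => y [dy [yr ys]].
have [||_ l] := hr (cmap c x) (cmap c y); [by rewrite subrr normr0|by rewrite distrC|].
rewrite !(cmapK hc) // in l.
exists (2 * Num.sqrt (Gm A g c (cmap c x) (cmap c y - cmap c x) (cmap c y - cmap c x))); last exact: reach_link.
by apply: le_lt_trans ys; rewrite ler_wpM2l // distrC.
Unshelve. all: by end_near. Qed.

(** As the action is isometric, all jumps can be pushed to the end of the chain, at the price of
    reaching only a translate of the end point. The factor 2 is that of [link_dist]. *)
Lemma reach_dist_lt x y e (e' : R) : reach x y e -> 2 * e < e' ->
  exists h, dist_lt A g x (a h y) e' /\ dist_lt A g (a h y) x e'.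
Proof.
move=> r; elim: r e' => [e' e0|y' z e1 f _ IH l e' he|y' h' e1 _ IH e' /IH[h [h1 h2]]].
- by exists 1%g; rewrite act_one; split; apply: dist_lt_refl; rewrite mulr0 in e0.
- pose d := (e' - 2 * e1 - 2 * f) / 2.
  have d0 : 0 < d by rewrite /d; lra.
  have [h [h1 h2]] := IH (2 * e1 + d) ltac:(by rewrite ltrDl).
  have eE : e' = (2 * e1 + d) + (2 * f + d) by rewrite /d; lra.
  have fd : 2 * f < 2 * f + d by rewrite ltrDl.
  exists h; split.
    rewrite eE; apply: dist_lt_trans h1 _; apply: dist_lt_act; exact: link_dist l _.
  rewrite eE addrC; apply: dist_lt_trans h2; apply: dist_lt_act; exact: (link_dist sM hg (link_sym sM hg l)).
- exists (h * h'^-1)%g; have -> : a (h * h'^-1)%g (a h' y') = a h y' by rewrite -act_mul -mulgA mulVg mulg1.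
  by [].
Qed.

(** Cocompactness without the quotient topology and its closures; [Gcompact_cocompact] and
    [cocompact_Gcompact] relate the two notions. *)
Definition Gcompact (S : set M) := exists2 K : set M, compact K & forall y, S y -> exists h, K (a h y).

Lemma Gcompact_sub S T : S `<=` T -> Gcompact T -> Gcompact S.
Proof. by move=> ST [K cK hK]; exists K => // y /ST; exact: hK. Qed.

Lemma Gcompact_setU S T : Gcompact S -> Gcompact T -> Gcompact (S `|` T).
Proof.
move=> [K cK hK] [L cL hL]; exists (K `|` L); first exact: compactU.
by move=> y [/hK[h Kh]|/hL[h Lh]]; exists h; [left|right].
Qed.

Lemma Gcompact0 : Gcompact set0.
Proof. by exists set0 => //; exact: compact0. Qed.

Lemma nbhs_compact p : exists2 K : set M, compact K & nbhs (p : M) K.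
Proof.
have [r r0 hr] := chart_ball hM (@filterT _ (nbhs p) _); set c := chart_at A p in hr.
have [Ac dc] := chart_at_ok sM p; rewrite -/c in Ac dc; have hc := chart_ok sM Ac.
exists (cinv c @` [set z | `|z - cmap c p| <= r]).
  apply: (compact_cinv sM Ac (@compact_cball R n (cmap c p) r)) => z /hr[cz _]; exact: cz.
near=> q; have dq : dom c q by near: q; exact: (open_nbhs_nbhs (conj (open_dom hc) dc)).
exists (cmap c q); last exact: cmapK.
rewrite /= distrC; near: q; apply: (@cvgr_dist_le _ _ _ (nbhs p) _ (cmap c)) => //; exact: cmap_continuous.
Unshelve. all: by end_near. Qed.

Lemma reach_le_rball x y z (s t u : R) : rball x s y -> rball y t z -> s + t <= u -> rball x u z.
Proof.
move=> [e1 l1 r1] [e2 l2 r2] le; exists (e1 + e2); last exact: reach_trans r1 r2.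
by apply: lt_le_trans le; rewrite ltrD.
Qed.

Lemma rball_sym x y s : rball x s y -> rball y s x.
Proof. by move=> [e l r]; exists e => //; exact: reach_sym. Qed.

Lemma rball_orbit x y s h : rball x s y -> rball x s (a h y).
Proof. by move=> [e l r]; exists e => //; exact: reach_jump. Qed.

(** The chain is cut in the proportion [s : t], which keeps both inequalities strict. *)
Lemma rball_split x z (s t u : R) : rball x u z -> 0 < s -> 0 < t -> u <= s + t -> exists2 w, rball x s w & rball w t z.
Proof.
move=> [e eu r] s0 t0 us; have e0 := reach_ge0 r.
have st : 0 < s + t by rewrite addr_gt0.
have es : e < s + t by apply: lt_le_trans eu us.
have q0 : 0 <= e / (s + t) by rewrite divr_ge0 // ltW.
have q1 : e / (s + t) < 1 by rewrite ltr_pdivrMr // mul1r.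
have eE : e = e / (s + t) * s + e / (s + t) * t by rewrite -mulrDr divfK // gt_eqF.
have h1 : e / (s + t) * s < s by rewrite gtr_pMl.
have h2 : e / (s + t) * t < t by rewrite gtr_pMl.
have h0 : 0 <= e / (s + t) * t by rewrite mulr_ge0 // ltW.
have [|w [r1 r2]] := reach_split (s := e / (s + t) * s) r.
  by rewrite mulr_ge0 ?(ltW s0) //= {2}eE lerDl.
exists w; first by exists (e / (s + t) * s).
by exists (e - e / (s + t) * s) => //; rewrite {1}eE addrAC subrr add0r.
Qed.

Lemma rball_Gcompact_small x : exists2 e : R, 0 < e & Gcompact (rball x e).
Proof.
have [K cK xK] := nbhs_compact x; have [e e0 he] := D_small xK.
exists (e / 2); first by rewrite divr_gt0.
exists K => // y [f fe r]; have [|h [h1 _]] := reach_dist_lt (e' := e) r; first lra.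
by exists h; apply: he; left.
Qed.

(** Points of the ball with a translate close to a given point [p] of [K] lie within [s / 4] of one
    of them, [w0]. Their balls of radius [s / 4] then lie in the ball of radius [s / 2] around [w0],
    and finitely many such [p] suffice. *)
Lemma rball_Gcompact_grow x (s r : R) : 0 < s -> r <= s -> Gcompact (rball x r) ->
  (forall y, rball x s y -> Gcompact (rball y (s / 2))) ->
  Gcompact [set z | exists2 w, rball x r w & rball w (s / 4) z].
Proof.
move=> s0 rs [K cK hK] hs.
pose P (B : set M) := Gcompact [set z | exists2 w, rball x r w /\ (exists h, B (a h w)) & rball w (s / 4) z].
suff : P K by apply: Gcompact_sub => z [w xw wz]; exists w => //; split=> //; exact: hK.
apply: compact_ind cK _.
- by apply: Gcompact_sub Gcompact0 => z [w [_ [h []]]].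
- move=> B C PB PC; apply: Gcompact_sub (Gcompact_setU PB PC) => z [w [xw [h [Bh|Ch]]] wz].
    by left; exists w => //; split=> //; exists h.
  by right; exists w => //; split=> //; exists h.
- move=> B C BC; apply: Gcompact_sub => z [w [xw [h Bh]] wz].
  by exists w => //; split=> //; exists h; exact: BC.
move=> p Kp; exists (rball p (s / 8)); first by apply: rball_near; rewrite divr_gt0.
have [[w0 [xw0 [h0 ph0]]]|none] := pselect (exists w, rball x r w /\ exists h, rball p (s / 8) (a h w)); last first.
  by apply: Gcompact_sub Gcompact0 => z [w [xw hw] _]; apply: none; exists w.
have Bw0 : rball x s w0 by have [e er re] := xw0; exists e => //; exact: lt_le_trans er rs.
apply: Gcompact_sub (hs w0 Bw0) => z [w [_ [h ph]] wz].
have l1 : rball w0 (s / 8) p.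
  by have := rball_orbit h0^-1%g ph0; rewrite -act_mul mulVg act_one; exact: rball_sym.
have l2 : rball p (s / 8) w by have := rball_orbit h^-1%g ph; rewrite -act_mul mulVg act_one.
have l3 : rball w0 (s / 4) w by apply: reach_le_rball l1 l2 _; lra.
apply: reach_le_rball l3 wz _; lra.
Qed.

(** Otherwise the ball of radius [s / 2] around [x] is cocompact too, and two enlargements by
    [s / 4] reach the radius [s]. *)
Lemma HR_step x (s : R) : 0 < s -> ~ Gcompact (rball x s) ->
  exists2 y, rball x s y & ~ Gcompact (rball y (s / 2)).
Proof.
move=> s0 nx; apply: contrapT => nex; apply: nx.
have hs y : rball x s y -> Gcompact (rball y (s / 2)).
  by move=> xy; apply: contrapT => ny; apply: nex; exists y.
have s4 : 0 < s / 4 by rewrite divr_gt0.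
have h1 : Gcompact (rball x (s / 2)) by apply: hs; exists 0 => //; exact: reach_refl.
have h2 : Gcompact (rball x (3 * s / 4)).
  have le1 : s / 2 <= s by lra.
  apply: (Gcompact_sub _ (rball_Gcompact_grow s0 le1 h1 hs)) => z xz.
  by have [||w xw wz] := @rball_split x z (s / 2) (s / 4) _ xz _ s4; [lra|lra|exists w].
have le2 : 3 * s / 4 <= s by lra.
apply: (Gcompact_sub _ (rball_Gcompact_grow s0 le2 h2 hs)) => z xz.
by have [||w xw wz] := @rball_split x z (3 * s / 4) (s / 4) _ xz _ s4; [lra|lra|exists w].
Qed.

Lemma rball_orbit_left x h s : rball (a h x) s = rball x s.
Proof.
apply/seteqP; split=> y [e l r]; exists e => //.
  by rewrite -[e]add0r; exact: reach_trans (reach_orbit x h) r.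
by rewrite -[e]add0r; exact: reach_trans (reach_orbit_sym x h) r.
Qed.

Hypothesis hcomplete : riemannian_complete A g.

(* The part of Hopf-Rinow that is needed, for the pseudo-distance of M/G: halving the radius
   while staying at non-cocompact balls would give a Cauchy sequence without limit. *)
Theorem rball_Gcompact x s : Gcompact (rball x s).
Proof.
have [s0|s0] := leP s 0.
  by apply: Gcompact_sub Gcompact0 => y [e es /reach_ge0 e0]; lra.
apply: contrapT => nx.
pose t (i : nat) : R := s / 2 ^+ i.
have t0 i : 0 < t i by rewrite divr_gt0 // exprn_gt0.
have tS i : t i.+1 = t i / 2 by rewrite /t exprSr invfM mulrA.
(* The next centre is replaced by a translate, so that consecutive centres are close for the
   Riemannian distance itself, in both orders. *)
have step (z : nat * M) : exists y, ~ Gcompact (rball z.2 (t z.1)) ->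
    [/\ dist_lt A g z.2 y (2 * t z.1), dist_lt A g y z.2 (2 * t z.1) & ~ Gcompact (rball y (t z.1.+1))].
  have [pz|nz] := pselect (Gcompact (rball z.2 (t z.1))); first by exists z.2.
  have [y [e et r] ny] := HR_step (t0 z.1) nz.
  have [|h [h1 h2]] := reach_dist_lt (e' := 2 * t z.1) r; first by rewrite ltr_pM2l.
  by exists (a h y) => _; rewrite rball_orbit_left tS.
have [F hF] := choice step.
pose u := fix u i := if i is i'.+1 then F (i', u i') else x.
have uN i : ~ Gcompact (rball (u i) (t i)).
  elim: i => [|i IH]; first by rewrite /t expr0 divr1.
  by have [] := hF (i, u i) IH.
have uS i : dist_lt A g (u i) (u i.+1) (2 * t i) /\ dist_lt A g (u i.+1) (u i) (2 * t i).
  by have [] := hF (i, u i) (uN i).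
(* Geometric series, in the form [4 t i = 2 t i + 4 t i.+1]. *)
have far m : forall i, dist_lt A g (u i) (u (i + m)%N) (4 * t i) /\ dist_lt A g (u (i + m)%N) (u i) (4 * t i).
  elim: m => [|m IH] i.
    by rewrite addn0; split; apply: dist_lt_refl; rewrite mulr_gt0.
  have [u1 u2] := uS i; have [u3 u4] := IH i.+1; rewrite addSnnS in u3 u4.
  have -> : 4 * t i = 2 * t i + 4 * t i.+1 by rewrite tS; lra.
  by split; [exact: dist_lt_trans u1 u3|rewrite addrC; exact: dist_lt_trans u4 u2].
have tle i j : (i <= j)%N -> t j <= t i.
  move=> ij; rewrite /t ler_pM2l // lef_pV2 ?posrE ?exprn_gt0 //.
  by apply: ler_weXn2l => //; rewrite ler1n.
have tlim (e : R) : 0 < e -> exists N, forall i, (N <= i)%N -> 4 * t i < e.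
  move=> e0; pose N := (Num.truncn (4 * s / e)).+1.
  have hN : 4 * s / e < N%:R by rewrite truncnS_gt.
  exists N => i Ni; apply: (@le_lt_trans _ _ (4 * t N)); first by rewrite ler_pM2l ?tle.
  rewrite /t mulrA ltr_pdivrMr ?exprn_gt0 // [ltRHS]mulrC -ltr_pdivrMr //.
  apply: (lt_trans hN); rewrite -natrX ltr_nat; exact: ltn_expl.
have [|p hp] := hcomplete (u := u).
  move=> e e0; have [N hN] := tlim e e0; exists N => i j Ni Nj.
  have [ij|ji] := leqP i j.
    by have [+ _] := far (j - i)%N i; rewrite subnKC //; apply: dist_lt_le; exact: ltW (hN _ Ni).
  by have [_] := far (i - j)%N j; rewrite subnKC ?(ltnW ji) //; apply: dist_lt_le; exact: ltW (hN _ Nj).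
(* For large [i] the ball of radius [t i] around [u i] lies in this cocompact ball around the limit,
   a contradiction. *)
have [e e0 pe] := rball_Gcompact_small p.
have [d d0 hd] := D_small (@rball_near p (e / 2) ltac:(by rewrite divr_gt0)).
have [N1 h1] := hp d d0; have [N2 h2] := tlim (e / 2) ltac:(by rewrite divr_gt0).
pose i := maxn N1 N2; apply: (uN i); apply: Gcompact_sub pe => z uz.
have pu : rball p (e / 2) (u i) by apply: hd; right; apply: h1; exact: leq_maxl.
have := h2 i (leq_maxr _ _) => ti.
by apply: (reach_le_rball pu uz); have := t0 i; lra.
Qed.

End Reach.

(** * Cocompact sets *)

Section Quotient.
Context {R : realType} {k n : nat} {G : groupTopType} {M : topologicalType}.
Variables (AG : atlas 'rV[R]_k G) (A : atlas 'rV[R]_n M) (a : group_action G M).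
Hypothesis hM : is_manifold A.
Hypothesis hact : smooth_map (prod_atlas AG A) A (fun z => a z.1 z.2).
Hypothesis hprop : proper_action a.

Let hausM : hausdorff_space M. Proof. by have [] := hM. Qed.
Local Notation saturation K := [set x | exists h, (K : set M) (a h x)].

(** Near [x], only group elements moving points of [K] into a compact neighbourhood [L] matter. They
    form a compact set by properness, so their translates of [K] make up a compact, hence closed,
    set. *)
Lemma closed_saturation (K : set M) : compact K -> closed (saturation K).
Proof.
move=> cK x clx.
have [L cL xL] := nbhs_compact hM x.
have cT := act_transporter hprop cK cL.
pose B := (fun z : G * M => a z.1 z.2) @` ([set h | exists2 x, K x & L (a h x)] `*` K).
have cB : compact B.
  apply: continuous_compact; last exact: compact_setX.
  by apply: continuous_subspaceT; exact: (act_continuous hact).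
have clB : closed B by exact: compact_closed.
have : B x.
  apply: clB => U Ux.
  have [y [[h Khy] [Uy Ly]]] := clx _ (filterI Ux xL).
  exists y; split=> //; exists (h^-1%g, a h y) => /=; last by rewrite -act_mul mulVg act_one.
  by split=> //=; exists (a h y) => //; rewrite -act_mul mulVg act_one.
by move=> [[h y] [_ /= Ky] <-]; exists h^-1%g; rewrite -act_mul mulVg act_one.
Qed.

Lemma orbit_projE x y : orbit_proj a x = orbit_proj a y <-> exists h, a h x = y.
Proof.
by rewrite /orbit_proj; split=> [/eqmodP/asboolP|h]; last exact/eqmodP/asboolP.
Qed.

Lemma preim_orbit_proj (K : set M) : orbit_proj a @^-1` (orbit_proj a @` K) = saturation K.
Proof.
apply/seteqP; split=> x /=.
  by move=> [y Ky /esym/orbit_projE[h e]]; exists h; rewrite e.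
by move=> [h Kh]; exists (a h x) => //; apply/esym/orbit_projE; exists h.
Qed.

Lemma orbit_proj_continuous : continuous (orbit_proj a).
Proof. exact: pi_continuous. Qed.

Lemma open_orbit_proj (U : set M) : open U -> open (orbit_proj a @` U).
Proof.
move=> oU; change (open (orbit_proj a @^-1` (orbit_proj a @` U))); rewrite preim_orbit_proj.
have -> : saturation U = \bigcup_h (a h @^-1` U) by apply/seteqP; split=> x /= [h]; exists h.
apply: bigcup_open => h _; apply: open_comp => // x _; exact: (act1_continuous hact).
Qed.

Lemma Gcompact_cocompact (S : set M) : Gcompact a S -> cocompact a S.
Proof.
move=> [K cK hK].
have cpK : compact (orbit_proj a @` K).
  by apply: continuous_compact cK; apply: continuous_subspaceT; exact: orbit_proj_continuous.
have clK : closed (orbit_proj a @` K).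
  rewrite -openC; change (open (orbit_proj a @^-1` (~` (orbit_proj a @` K)))).
  have -> : orbit_proj a @^-1` (~` (orbit_proj a @` K)) = ~` saturation K by rewrite -preim_orbit_proj.
  by rewrite openC; exact: closed_saturation.
apply: (subclosed_compact _ cpK); first exact: closed_closure.
rewrite closureE => q; apply; split=> // _ [x Sx <-].
by have [h Kh] := hK x Sx; exists (a h x) => //; apply/esym/orbit_projE; exists h.
Qed.

(** The orbit projection is open, so images of compact neighbourhoods are neighbourhoods in the
    quotient, and finitely many of them cover the closure. *)
Lemma cocompact_Gcompact (S : set M) : cocompact a S -> Gcompact a S.
Proof.
move=> cS.
suff : Gcompact a (orbit_proj a @^-1` closure (orbit_proj a @` S)).
  by apply: Gcompact_sub => x Sx; apply: subset_closure; exists x.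
pose P (B : set (orbit_space a)) := Gcompact a (orbit_proj a @^-1` B).
apply: (@compact_ind _ P _ _ _ _ cS).
- by rewrite /P preimage_set0; exact: Gcompact0.
- by move=> B C; rewrite /P preimage_setU; exact: Gcompact_setU.
- by move=> B C BC; apply: Gcompact_sub => x; exact: BC.
move=> q _; have [p pq] : exists p, orbit_proj a p = q by exists (repr q); exact: reprK.
have [K cK pK] := nbhs_compact hM p.
exists (orbit_proj a @` K); last by rewrite /P preim_orbit_proj; exists K.
have [U [oU Up] UK] : exists2 U, open_nbhs p U & U `<=` K by move: pK; rewrite nbhsE => -[U]; exists U.
apply: (@filterS _ _ _ (orbit_proj a @` U)); first exact: image_subset.
by apply: open_nbhs_nbhs; split; [exact: open_orbit_proj|exists p].
Qed.

Lemma noncompact_Gcompact : ~ compact [set: orbit_space a] -> ~ Gcompact a [set: M].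
Proof.
move=> nc /Gcompact_cocompact; rewrite /cocompact => c; apply: nc.
have -> // : [set: orbit_space a] = closure (orbit_proj a @` setT).
apply/seteqP; split=> // q _; apply: subset_closure; exists (repr q) => //; exact: reprK.
Qed.

Lemma compact_norm_bounded (T : topologicalType) (K : set T) (f : T -> R) : compact K -> continuous f ->
  exists B : R, forall x, K x -> `|f x| <= B.
Proof.
move=> cK cf; apply: (compact_ind (P := fun B => exists C : R, forall x, B x -> `|f x| <= C) _ _ _ cK).
- by exists 0.
- by move=> B C [b hb] [c hc]; exists (Num.max b c) => x [/hb|/hc] h; rewrite le_max h ?orbT.
- by move=> B C BC [c hc]; exists c => x /BC/hc.
move=> x _; exists [set y | `|f y| <= `|f x| + 1]; last by exists (`|f x| + 1).
have : \forall y \near x, `|f x - f y| < 1 by apply: (@cvgr_dist_lt _ R^o _ (nbhs x) _ f); [exact: cf|].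
apply: filterS => y /ltW h /=; rewrite -[f y](subrK (f x)) addrC.
by apply: (le_trans (ler_normD _ _)); rewrite lerD2l distrC.
Qed.

Lemma Gcompact_bounded (S : set M) (f : M -> R) : Gcompact a S -> continuous f ->
  (forall h x, f (a h x) = f x) -> exists B : R, forall x, S x -> `|f x| <= B.
Proof.
move=> [K cK hK] cf fa; have [B hB] := compact_norm_bounded cK cf.
by exists B => x /hK[h Kh]; rewrite -(fa h); exact: hB.
Qed.

Lemma compact_lower_bound (K : set M) (f : M -> R) : compact K -> continuous f ->
  (forall x, K x -> 0 < f x) -> exists2 m : R, 0 < m & forall x, K x -> m <= f x.
Proof.
move=> cK cf f0.
apply: (compact_ind (P := fun B => exists2 m : R, 0 < m & forall x, B x -> m <= f x) _ _ _ cK).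
- by exists 1.
- move=> B C [b b0 hb] [c c0 hc]; exists (Num.min b c); first by rewrite lt_min b0.
  by move=> x [/hb|/hc] h; rewrite ge_min h ?orbT.
- by move=> B C BC [c c0 hc]; exists c => // x /BC/hc.
move=> x /f0 fx; exists [set y | f x / 2 < f y]; last by exists (f x / 2); [rewrite divr_gt0|move=> y /ltW].
by apply: (@cvgr_gt _ _ (nbhs x) _ f (f x)); [exact: cf|rewrite ltr_pdivrMr // ltr_pMr // ltr1n].
Qed.

End Quotient.

(** * Classes, the pseudo-distance to a point, and Lipschitz cutoffs *)

Section Ends.
Context {R : realType} {k n : nat} {G : groupTopType} {M : topologicalType}.
Variables (AG : atlas 'rV[R]_k G) (A : atlas 'rV[R]_n M) (a : group_action G M).
Hypothesis hG : lie_group AG.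
Hypothesis hM : is_manifold A.
Hypothesis hact : smooth_map (prod_atlas AG A) A (fun z => a z.1 z.2).
Hypothesis hprop : proper_action a.
Variable g : M -> 'rV[R]_n -> 'rV[R]_n -> R.
Hypothesis hg : riemannian_metric A g.
Hypothesis hiso : isometric_action A g a.
Local Notation reach := (reach A a g).
Local Notation rball := (rball A a g).

Definition class (x : M) := [set y | exists e, reach x y e].

Lemma rball_open x s : open (rball x s).
Proof.
rewrite openE => y [e es r]; have se : 0 < s - e by rewrite subr_gt0.
apply: filterS (rball_near a hM hg y se) => z [f fs r']; exists (e + f); last exact: reach_trans r r'.
by rewrite -ltrBrDl.
Qed.

Lemma class_refl x : class x x. Proof. by exists 0; exact: reach_refl. Qed.

Lemma class_sym x y : class x y -> class y x.
Proof. by move=> [e r]; exists e; exact: (reach_sym hM hg r). Qed.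

Lemma class_trans x y z : class x y -> class y z -> class x z.
Proof. by move=> [e r] [f r']; exists (e + f); exact: reach_trans r r'. Qed.

Lemma class_act x h y : class x y -> class x (a h y).
Proof. by move=> [e r]; exists e; exact: reach_jump. Qed.

Lemma class_near y : \forall z \near y, class y z.
Proof. by apply: filterS (rball_near a hM hg y ltr01) => z [e _ r]; exists e. Qed.

Lemma rball_class x s y : rball x s y -> class x y. Proof. by move=> [e _ r]; exists e. Qed.

Lemma class_rball x y : class x y -> exists s, rball x s y.
Proof. by move=> [e r]; exists (e + 1); exists e => //; rewrite ltrDl. Qed.

Variable x0 : M.
Definition rho (y : M) : R := inf [set e | reach x0 y e].

Lemma rho_has_inf y : class x0 y -> has_inf [set e | reach x0 y e].
Proof. by move=> [e r]; split; [exists e|exists 0 => f /reach_ge0]. Qed.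

Lemma rho_le y e : reach x0 y e -> rho y <= e.
Proof. by move=> r; apply: ge_inf => //; exists 0 => f /reach_ge0. Qed.

Lemma rho_rball y s : class x0 y -> rho y < s <-> rball x0 s y.
Proof.
move=> xy; split; last by move=> [e es /rho_le]; move=> h; exact: le_lt_trans h es.
by move=> ys; have [e /= r es] := inf_lt (rho_has_inf xy).1 ys; exists e.
Qed.

Lemma rho_lip y z f : class x0 y -> reach y z f -> rho z <= rho y + f.
Proof.
move=> xy r; rewrite -lerBlDr; apply: lb_le_inf; first exact: (rho_has_inf xy).1.
by move=> e /= r'; rewrite lerBlDr; apply: rho_le; exact: reach_trans r' r.
Qed.

Lemma rho_lip2 y z f : class x0 y -> reach y z f -> `|rho z - rho y| <= f.
Proof.
move=> xy r; have xz : class x0 z by apply: class_trans xy _; exists f.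
have h1 := rho_lip xy r; have h2 := rho_lip xz (reach_sym hM hg r).
by rewrite ler_norml; apply/andP; split; lra.
Qed.

(** Outside the class of [x0], [rho] is the infimum of an empty set and carries no meaning; the
    value 0 is imposed there. *)
Definition cutoff (r l : R) (y : M) : R :=
  if `[< class x0 y >] then Num.min 1 (Num.max 0 ((rho y - r) / l)) else 0.

Lemma clamp_lip (s t : R) : `|Num.min 1 (Num.max 0 s) - Num.min 1 (Num.max 0 t)| <= `|s - t|.
Proof.
have [s0|s0] := leP s 0; have [t0|t0] := leP t 0.
- by rewrite (min_r ler01) subrr normr0.
- by rewrite (min_r ler01) sub0r normrN [leRHS]distrC !ger0_norm; case: (leP 1 t); lra.
- by rewrite (min_r ler01) subr0 !ger0_norm; case: (leP 1 s); lra.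
- case: (leP 1 s) => s1; case: (leP 1 t) => t1; rewrite ?subrr ?normr0 //.
    by rewrite !ger0_norm; lra.
  by rewrite [leLHS]distrC [leRHS]distrC !ger0_norm; lra.
Qed.

Section Cutoff.
Variables r l : R.
Hypothesis l0 : 0 < l.

Lemma cutoff01 y : 0 <= cutoff r l y <= 1.
Proof.
rewrite /cutoff; case: ifP => _; last by rewrite lexx ler01.
by rewrite le_min ler01 le_max lexx /= ge_min lexx.
Qed.

Lemma cutoff_lip y z f : reach y z f -> `|cutoff r l z - cutoff r l y| <= l^-1 * f.
Proof.
move=> ryz; rewrite /cutoff; have f0 := reach_ge0 ryz.
have lf : 0 <= l^-1 * f by rewrite mulr_ge0 // invr_ge0 ltW.
case: (asboolP (class x0 y)) => xy; case: (asboolP (class x0 z)) => xz; rewrite ?subrr ?normr0 //.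
- apply: (le_trans (clamp_lip _ _)); rewrite -mulrBl opprB addrA subrK normrM mulrC ger0_norm ?invr_ge0 ?(ltW l0) //.
  by rewrite ler_wpM2l ?invr_ge0 ?(ltW l0) //; exact: rho_lip2.
- by case: xz; apply: class_trans xy _; exists f.
- by case: xy; apply: class_trans xz (class_sym _); exists f.
Qed.

Lemma cutoff_inv h y : cutoff r l (a h y) = cutoff r l y.
Proof.
(* A jump has length 0, so the Lipschitz bound gives equality. *)
apply/eqP; rewrite -subr_eq0 -normr_le0; have := cutoff_lip (reach_orbit A a g y h).
by rewrite mulr0.
Qed.

Lemma cutoff_continuous : continuous (cutoff r l : M -> R^o).
Proof.
move=> y; apply/(@cvgrPdist_le _ R^o _ (nbhs y)) => e e0.
apply: filterS (rball_near a hM hg y (_ : 0 < l * e)); last by rewrite mulr_gt0.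
move=> z [f fe ryz]; rewrite distrC; apply: (le_trans (cutoff_lip ryz)).
by rewrite ler_pdivrMl // ltW.
Qed.

Lemma cutoff0 y : class x0 y -> rball x0 r y -> cutoff r l y = 0.
Proof.
move=> xy /(rho_rball _ xy) h; rewrite /cutoff asboolT // max_l ?(min_r ler01) //.
by rewrite pmulr_lle0 ?invr_gt0 // subr_le0 ltW.
Qed.

Lemma cutoff1 y : class x0 y -> ~ rball x0 (r + l) y -> cutoff r l y = 1.
Proof.
move=> xy h; rewrite /cutoff asboolT // min_l // le_max; apply/orP; right.
rewrite ler_pdivlMr // mul1r lerBrDl leNgt; apply/negP => /(rho_rball _ xy); exact: h.
Qed.

End Cutoff.
End Ends.

(** * Regularisation of Lipschitz functions *)

(* Row vectors as a multiplicative group, to which the Haar functional applies. *)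
Definition vecgrp (R : realType) (n : nat) : Type := 'rV[R]_n.

Section VecGroup.
Variables (R : realType) (n : nat).

HB.instance Definition _ := Topological.copy (vecgrp R n) 'rV[R]_n.

Fact vec_addA : associative (fun u v : vecgrp R n => (u : 'rV[R]_n) + v : vecgrp R n).
Proof. exact: addrA. Qed.
Fact vec_add0 : left_id (0 : 'rV[R]_n) (fun u v : vecgrp R n => (u : 'rV[R]_n) + v : vecgrp R n).
Proof. exact: add0r. Qed.
Fact vec_addN : left_inverse (0 : 'rV[R]_n) (fun u : vecgrp R n => - (u : 'rV[R]_n)) (fun u v : vecgrp R n => (u : 'rV[R]_n) + v : vecgrp R n).
Proof. exact: addNr. Qed.
Fact vec_addr0 : right_id (0 : 'rV[R]_n) (fun u v : vecgrp R n => (u : 'rV[R]_n) + v : vecgrp R n).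
Proof. exact: addr0. Qed.
Fact vec_addrN : right_inverse (0 : 'rV[R]_n) (fun u : vecgrp R n => - (u : 'rV[R]_n)) (fun u v : vecgrp R n => (u : 'rV[R]_n) + v : vecgrp R n).
Proof. exact: addrN. Qed.

HB.instance Definition _ := isGroup.Build (vecgrp R n) vec_addA vec_add0 vec_addr0 vec_addN vec_addrN.

Local Notation Gv := (vecgrp R n).

Lemma vec_mulc : continuous (fun x : Gv * Gv => (x.1 * x.2)%g).
Proof. case=> x y; exact: (@cvgD R 'rV[R]_n (Gv * Gv)%type (nbhs (x, y)) _ (fun z => z.1) (fun z => z.2) x y cvg_fst cvg_snd). Qed.

Lemma vec_invc : continuous (fun x : Gv => (x^-1)%g).
Proof. move=> x; exact: (@cvgN R 'rV[R]_n Gv (nbhs x) _ id x cvg_id). Qed.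

Lemma rbump_Ccp (y : 'rV[R]_n) (r : R) : 0 < r -> Ccp (rbump y r : Gv -> R).
Proof.
move=> r0; split; last by move=> x; exact: rbump_ge0.
split; first by move=> x; exact: (Ck_continuous (rbump_Ck 0 y r)).
exists [set z | `|z - y| <= r]; first exact: compact_cball.
by move=> z /negP; rewrite -ltNge; exact: rbump_out.
Qed.

Lemma vec_bump (V : set Gv) : nbhs (1%g : Gv) V ->
  exists f : Gv -> R, [/\ Ccp f, 0 < f 1%g & forall x, ~ V x -> f x = 0].
Proof.
move=> V1; have V0 : nbhs (0 : 'rV[R]_n) V by exact: V1.
move/nbhs_ballP: V0 => [r /= r0 hr]; have r20 : 0 < r / 2 by rewrite divr_gt0.
exists (rbump 0 (r / 2)); split; [exact: rbump_Ccp|exact: rbump_gt0|].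
move=> x nVx; apply: rbump_out => //; rewrite subr0 ltNge; apply/negP => h; apply: nVx.
apply: hr; rewrite -ball_normE /ball_ /= sub0r normrN; apply: le_lt_trans h _.
by rewrite ltr_pdivrMr // ltr_pMr // ltr1n.
Qed.

Lemma vec_haus : hausdorff_space Gv.
Proof. exact: (@norm_hausdorff R 'rV[R]_n). Qed.

Lemma vec_haar : exists J : (Gv -> R) -> R, right_haar J.
Proof. exact: (right_haar_exists vec_mulc vec_invc vec_haus vec_bump). Qed.

Lemma vec_ge1 (K : set Gv) : compact K -> exists2 f' : Gv -> R, Ccp f' & forall x, K x -> 1 <= f' x.
Proof. exact: (Cc_ge1 vec_mulc vec_bump). Qed.

Section Mollify.
Variable J : (Gv -> R) -> R.
Hypothesis hJ : right_haar J.

(** All derivatives fall on the kernel [B], so continuity of [w] suffices. *)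
Lemma conv_JCk k (B : 'rV[R]_n -> R^o) (d : R) (w : 'rV[R]_n -> R^o) :
  (forall l, Ck l setT B) -> (forall z, d < `|z| -> B z = 0) -> continuous w ->
  JCk k setT (fun (h : Gv) (y : 'rV[R]_n) => B ((h : 'rV[R]_n) - y) * w h : R^o).
Proof.
elim: k B => [|k IH] B BC B0 wc.
  split=> // h y _; apply: (@cvgM R _ (nbhs (h, y))).
    apply: (@continuous_comp _ _ _ (fun z : Gv * 'rV[R]_n => (z.1 : 'rV[R]_n) - z.2) B).
      by apply: (@cvgB R 'rV[R]_n _ (nbhs (h, y))); [exact: cvg_fst|exact: cvg_snd].
    exact: (Ck_continuous (BC 0%N)).
  apply: (@continuous_comp _ _ _ (fun z : Gv * 'rV[R]_n => (z.1 : 'rV[R]_n)) w); [exact: cvg_fst|exact: wc].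
split; first exact: (JCk_cont (IH B BC B0 wc)).
move=> v.
have dB h y : is_derive y v (fun y => B ((h : 'rV[R]_n) - y) * w h : R^o) ('D_(- v) B (h - y) * w h).
  have dT : is_derive y v (fun y : 'rV[R]_n => (h : 'rV[R]_n) - y) (- v).
    by apply: is_derive_eq; rewrite sub0r.
  have h1 : is_derive y v (B \o (fun y : 'rV[R]_n => (h : 'rV[R]_n) - y)) ('D_(- v) B (h - y)).
    by apply: (@chain_R R _ _ _ _ _ _ _ _ openT (BC 1%N)).
  have h2 := is_deriveM h1 (is_derive_cst (w h : R^o) y v).
  by apply: is_derive_eq h2 _; rewrite scaler0 add0r /GRing.scale /= /cst mulrC.
split.
  by move=> h y _; have h1 := dB h y; exact: (@ex_derive _ _ _ _ _ _ _ h1).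
have -> : (fun (h : Gv) y => 'D_v (fun y => B ((h : 'rV[R]_n) - y) * w h : R^o) y) =
  (fun (h : Gv) y => 'D_(- v) B ((h : 'rV[R]_n) - y) * w h).
  by apply/funext => h; apply/funext => y; have h1 := dB h y; rewrite (@derive_val _ _ _ _ _ _ _ h1).
apply: (IH ('D_(- v) B)); [by move=> l; exact: (Ck_derive _ (BC l.+1))| |exact: wc].
move=> z dz; rewrite -(@derive_cst R 'rV[R]_n R^o 0 z (- v)); apply: near_eq_derive.
have : \forall z' \near z, d < `|z'|.
  by apply: (@cvgr_gt _ _ (nbhs z) _ (fun z' : 'rV[R]_n => `|z'|) `|z|) => //; exact: norm_continuous.
by apply: filterS => z' /B0.
Qed.

Lemma conv_locsupp (B : 'rV[R]_n -> R^o) (d : R) (w : 'rV[R]_n -> R^o) : (forall z, d < `|z| -> B z = 0) ->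
  locsupp setT (fun (h : Gv) (y : 'rV[R]_n) => B ((h : 'rV[R]_n) - y) * w h : R^o).
Proof.
move=> B0 y _; exists (ball y 1), [set z | `|z - y| <= d + 1]; split.
- exact: ball_open.
- exact: ballxx.
- exact: compact_cball.
move=> h y'; rewrite -ball_normE /ball_ /= => yy' /negP; rewrite -ltNge => hy.
rewrite B0 ?mul0r //; have := ler_normD (h - y') (y' - y); rewrite addrA subrK (distrC y' y) => h1.
have := lt_le_trans hy h1; lra.
Qed.

Lemma conv_Ck k (B : 'rV[R]_n -> R^o) (d : R) (w : 'rV[R]_n -> R^o) :
  (forall l, Ck l setT B) -> (forall z, d < `|z| -> B z = 0) -> continuous w ->
  Ck k setT (fun y : 'rV[R]_n => J (fun h : Gv => B ((h : 'rV[R]_n) - y) * w h) : R^o).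
Proof.
move=> BC B0 wc; apply: (J_param_Ck hJ vec_ge1 openT (conv_JCk k BC B0 wc)).
exact: conv_locsupp B0.
Qed.

Lemma derive_bound (V : normedModType R) (f : V -> R^o) x v (c : R) : derivable f x v ->
  (\forall t \near (0 : R), `|f (t *: v + x) - f x| <= c * `|t|) -> `|'D_v f x| <= c.
Proof.
move=> df hf.
have F : ProperFilter (0 : R)^' by exact: Proper_dnbhs_numFieldType.
apply: (@cvg_to_le R _ (0 : R)^' _ (fun t => `|t^-1 *: ((f (t *: v + x) - f x) : R^o)|) (fun=> c)).
- exact: (cvg_norm df).
- exact: cvg_cst.
near=> t; have t0 : t != 0 by near: t; exact: nbhs_dnbhs_neq.
rewrite normrZ normfV ler_pdivrMl ?normr_gt0 // mulrC.
by near: t; exact: nbhs_dnbhs.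
Unshelve. all: by end_near. Qed.

Lemma J_weighted (B : 'rV[R]_n -> R) (d c : R) (F1 F2 : 'rV[R]_n -> R^o) : 0 < d -> Ccp (B : Gv -> R) ->
  (forall z, d < `|z| -> B z = 0) -> continuous F1 -> continuous F2 ->
  (forall z, `|z| <= d -> `|F1 z - F2 z| <= c) ->
  `|J (fun h => B h * F1 h) - J (fun h => B h * F2 h)| <= c * J B.
Proof.
move=> d0 [Bc B0] Bd c1 c2 hc.
have C1 : Cc (fun h : Gv => B h * F1 h) by under [X in Cc X]eq_fun do rewrite mulrC; exact: Cc_mull.
have C2 : Cc (fun h : Gv => B h * F2 h) by under [X in Cc X]eq_fun do rewrite mulrC; exact: Cc_mull.
rewrite -(JB hJ C1 C2) -(JZ hJ c Bc); apply: (J_norm hJ) => //; first exact: Cc_sub.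
  exact: Cc_scale.
move=> x; rewrite -mulrBr normrM (ger0_norm (B0 x)) mulrC.
have [xd|dx] := leP `|x| d; first by rewrite ler_wpM2r // hc.
by rewrite Bd // !mulr0.
Qed.

End Mollify.

(** [S] is the convolution of [w] with a normalised bump. Translation invariance also presents it as
    an average of translates of [w], so it inherits the Lipschitz constant of [w] for the norm [N],
    without loss. *)
Lemma mollify (w : 'rV[R]_n -> R^o) (y0 : 'rV[R]_n) (N : 'rV[R]_n -> R) (r L C e : R) :
  continuous w -> 0 < r -> 0 <= L -> 0 <= C -> (forall t v, N (t *: v) = `|t| * N v) ->
  (forall v, N v <= C * `|v|) -> 0 < e ->
  (forall u v, `|u - y0| < 2 * r -> `|v - y0| < 2 * r -> `|w v - w u| <= L * N (v - u)) ->
  exists S : 'rV[R]_n -> R^o, (forall k, Ck k setT S) /\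
    forall z, `|z - y0| <= r -> `|S z - w z| <= e /\ forall v, `|'D_v S z| <= L * N v.
Proof.
move=> wc r0 L0 C0 NZ NC e0 wL.
have [J hJ] := vec_haar.
(* The bound [r / 2] leaves room in the ball of radius [2 r] for a further increment of norm less
   than [r / 2]; the other bound makes the error [L C d] at most [e]. *)
pose d := Num.min (r / 2) (e / (L * C + 1)).
have LC : 0 < L * C + 1 by rewrite ltr_wpDl // mulr_ge0.
have d0 : 0 < d by rewrite lt_min !divr_gt0.
have dr : d <= r / 2 by rewrite ge_min lexx.
have de : L * (C * d) <= e.
  have : d <= e / (L * C + 1) by rewrite ge_min lexx orbT.
  rewrite ler_pdivlMr // => h; apply: le_trans h; nra.
pose B : 'rV[R]_n -> R^o := rbump 0 d.
have BC k : Ck k setT B := rbump_Ck k 0 d.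
have B0 z : d < `|z| -> B z = 0 by move=> dz; apply: rbump_out; rewrite ?subr0.
have Bp : Ccp (B : Gv -> R) := rbump_Ccp 0 d0.
have JB0 : 0 < J B by have [_ _ _ h _] := hJ; apply: h => //; exists 0; exact: rbump_gt0.
pose S (y : 'rV[R]_n) : R^o := (J B)^-1 * J (fun h : Gv => B ((h : 'rV[R]_n) - y) * w h).
have wt (y : 'rV[R]_n) : continuous (fun h : 'rV[R]_n => w (h + y) : R^o).
  move=> h; apply: (@continuous_comp _ _ _ (fun h : 'rV[R]_n => h + y) w); last exact: wc.
  by apply: (@cvgD R 'rV[R]_n _ (nbhs h)); [exact: cvg_id|exact: cvg_cst].
(* The substitution of [h + y] for [h] moves the dependence on [y] from the kernel to [w]. *)
have ES y : S y = (J B)^-1 * J (fun h : Gv => B h * w ((h : 'rV[R]_n) + y)).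
  rewrite /S; congr (_ * _).
  have CB : Cc (fun h : Gv => B ((h : 'rV[R]_n) - y) * w h).
    have := @JCk_Cc R Gv n 0 setT (fun (h : Gv) (y : 'rV[R]_n) => B ((h : 'rV[R]_n) - y) * w h) y.
    by apply; [exact: (conv_JCk 0 BC B0 wc)|exact: (conv_locsupp w B0)|].
  have [_ _ _ _ /(_ _ (y : Gv) CB) <-] := hJ.
  by congr J; apply/funext => h; congr (B _ * w _); exact: (addrK y (h : 'rV[R]_n)).
exists S; split.
  by move=> k; apply: Ck_mul; [exact: openT|exact: Ck_cst|exact: (conv_Ck hJ k BC B0 wc)].
move=> z zr; split.
  rewrite ES.
  have -> : w z = (J B)^-1 * J (fun h => B h * w z).
    have -> : (fun h => B h * w z) = (fun h => w z * B h) by apply/funext => h; rewrite mulrC.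
    by rewrite (JZ hJ _ Bp.1) mulrCA mulVf ?mulr1 // gt_eqF.
  rewrite -mulrBr normrM gtr0_norm ?invr_gt0 // ler_pdivrMl // mulrC.
  apply: (J_weighted hJ d0 Bp B0 (wt z) (@cst_continuous 'rV[R]_n R^o (w z))).
  move=> h hd; have := wL z (h + z); rewrite addrK => wz.
  apply: (le_trans (wz _ _)).
  - by apply: (le_lt_trans zr); lra.
  - by rewrite -addrA; apply: (le_lt_trans (ler_normD _ _)); lra.
  apply: le_trans de; rewrite ler_wpM2l //; apply: (le_trans (NC h)); exact: ler_wpM2l.
move=> v; apply: derive_bound.
  apply: (@Ck_derivable _ _ _ 0 setT) => //.
  by apply: Ck_mul; [exact: openT|exact: Ck_cst|exact: (conv_Ck hJ 1 BC B0 wc)].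
have : \forall t \near (0 : R), `|t| * `|v| < r / 2.
  have cv : (fun t : R => `|t| * `|v|) t @[t --> (0 : R)] --> `|0 : R| * `|v|.
    by apply: cvgMl; apply: cvg_norm; exact: cvg_id.
  by apply: (cvgr_lt _ cv); rewrite normr0 mul0r divr_gt0.
apply: filterS => t tv; rewrite !ES -mulrBr normrM gtr0_norm ?invr_gt0 // ler_pdivrMl // mulrC.
apply: (J_weighted hJ d0 Bp B0 (wt _) (wt _)) => h hd.
have := wL (h + z) (h + (t *: v + z)).
have -> : h + (t *: v + z) - (h + z) = t *: v by rewrite opprD addrACA subrr add0r addrK.
rewrite NZ mulrCA [`|t| * _]mulrC; apply.
  by rewrite -addrA; apply: (le_lt_trans (ler_normD _ _)); lra.
rewrite -!addrA; apply: (le_lt_trans (ler_normD _ _)).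
have := ler_normD (t *: v) (z - y0); rewrite normrZ; lra.
Qed.

End VecGroup.

(** * Smoothing Lipschitz functions with control of the gradient, then averaging *)

Section RealSmooth.
Context {R : realType} {n : nat} {M : topologicalType}.
Variable A : atlas 'rV[R]_n M.
Hypothesis hA : smooth_atlas A.

Lemma smoothR_continuous f : smoothR A f -> continuous (f : M -> R^o). Proof. by case. Qed.

Lemma smoothR_cst (b : R) : smoothR A (fun=> b).
Proof. by split=> [x|c _ l]; [exact: cvg_cst|exact: (Ck_cst l (cimg c) (b : R^o))]. Qed.

Lemma smoothR_add f1 f2 : smoothR A f1 -> smoothR A f2 -> smoothR A (fun x => f1 x + f2 x).
Proof.
move=> [c1 s1] [c2 s2]; split=> [x|c Ac l]; first by apply: (@cvgD R R^o _ (nbhs x)); [exact: c1|exact: c2].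
by apply: Ck_add; [exact: (open_cimg (chart_ok hA Ac))|exact: s1|exact: s2].
Qed.

Lemma smoothR_mul f1 f2 : smoothR A f1 -> smoothR A f2 -> smoothR A (fun x => f1 x * f2 x).
Proof.
move=> [c1 s1] [c2 s2]; split=> [x|c Ac l]; first by apply: (@cvgM R _ (nbhs x)); [exact: c1|exact: c2].
by apply: Ck_mul; [exact: (open_cimg (chart_ok hA Ac))|exact: s1|exact: s2].
Qed.

Lemma smoothR_sub f1 f2 : smoothR A f1 -> smoothR A f2 -> smoothR A (fun x => f1 x - f2 x).
Proof.
move=> s1 s2; have -> : (fun x => f1 x - f2 x) = (fun x => f1 x + (-1) * f2 x) by apply/funext => x; rewrite mulN1r.
by apply: smoothR_add => //; apply: smoothR_mul => //; exact: smoothR_cst.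
Qed.

Lemma smoothR_compR (F : R^o -> R^o) f : (forall l, Ck l setT F) -> smoothR A f -> smoothR A (fun x => F (f x)).
Proof.
move=> FC [cf sf]; split=> [x|c Ac l].
  by apply: (@continuous_comp _ R^o R^o f F); [exact: cf|exact: (Ck_continuous (FC 0%N))].
by apply: (@Ck_comp_R R _ l F setT) => //; [exact: (open_cimg (chart_ok hA Ac))|exact: openT|exact: sf].
Qed.

Variable g : M -> 'rV[R]_n -> 'rV[R]_n -> R.
Hypothesis hg : riemannian_metric A g.

Lemma tangent_real_add f1 f2 p v : smoothR A f1 -> smoothR A f2 ->
  tangent_real A (fun x => f1 x + f2 x) p v = tangent_real A f1 p v + tangent_real A f2 p v.
Proof.
move=> s1 s2; have [Ac dc] := chart_at_ok hA p; set c := chart_at A p in Ac dc; have hc := chart_ok hA Ac.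
have [w <-] := coord_field_surj hA v Ac dc.
have cy := cimg_cmap dc; rewrite -[p in LHS](cmapK hc dc) -[p in RHS](cmapK hc dc).
have h1 := coord_field_real hA w s1 Ac cy; have h2 := coord_field_real hA w s2 Ac cy.
have h3 := coord_field_real hA w (smoothR_add s1 s2) Ac cy; have h4 := is_deriveD h1 h2.
by rewrite -(@derive_val _ _ _ _ _ _ _ h3) -(@derive_val _ _ _ _ _ _ _ h4).
Qed.

Lemma grad_le_add f1 f2 p (C1 C2 : R) : smoothR A f1 -> smoothR A f2 -> grad_le A g f1 p C1 -> grad_le A g f2 p C2 ->
  grad_le A g (fun x => f1 x + f2 x) p (C1 + C2).
Proof.
move=> s1 s2 h1 h2 v; rewrite tangent_real_add // mulrDl.
by apply: (le_trans (ler_normD _ _)); apply: lerD; [exact: h1|exact: h2].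
Qed.

Lemma grad_le_mono f p (C1 C2 : R) : C1 <= C2 -> grad_le A g f p C1 -> grad_le A g f p C2.
Proof. by move=> C12 h v; apply: (le_trans (h v)); rewrite ler_wpM2r // gnrm_ge0. Qed.

End RealSmooth.

Section LocalSmoothing.
Context {R : realType} {k n : nat} {G : groupTopType} {M : topologicalType}.
Variables (AG : atlas 'rV[R]_k G) (A : atlas 'rV[R]_n M) (a : group_action G M).
Hypothesis hG : lie_group AG.
Hypothesis hM : is_manifold A.
Hypothesis hact : smooth_map (prod_atlas AG A) A (fun z => a z.1 z.2).
Hypothesis hprop : proper_action a.
Variable g : M -> 'rV[R]_n -> 'rV[R]_n -> R.
Hypothesis hg : riemannian_metric A g.
Hypothesis hiso : isometric_action A g a.

Let sM : smooth_atlas A. Proof. by have [] := hM. Qed.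
Let hausM : hausdorff_space M. Proof. by have [] := hM. Qed.

Variables (w : M -> R) (l : R).
Hypothesis l0 : 0 <= l.
Hypothesis wc : continuous (w : M -> R^o).
Hypothesis wlip : forall x y f, link A g x y f -> `|w y - w x| <= l * f.

(** [X] is a bump and [Y] is [X] times a convolution of [w]. In the differential of [Y - s X] the
    derivative of the bump is multiplied by a difference of size at most [b + e]. In [4 l], one
    factor 2 comes from [link_local], the other from comparing the norms at the centre and at
    [q]. *)
Lemma local_smoothing p : exists X : M -> R, [/\ smoothR A X, Cc X, forall q, 0 <= X q & 0 < X p] /\
  forall e : R, 0 < e -> exists Y : M -> R, [/\ smoothR A Y, Cc Y,
    forall q, `|Y q - w q * X q| <= e * X q &
    forall q (s b : R), `|w q - s| <= b ->
      grad_le A g (fun x => Y x - s * X x) q ((b + e) * rcn A g X q + 4 * l * X q)].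
Proof.
have [Ac dc] := chart_at_ok sM p; pose c := chart_at A p; rewrite -/c in Ac dc; have hc := chart_ok sM Ac.
pose y0 := cmap c p.
have [r1 r10 h1] := link_local sM hg p; rewrite -/c -/y0 in h1.
have /nbhs_ballP[r2 /= r20 h2] := Gm_near sM hg Ac (cimg_cmap dc) (ltr1n R 4).
(* The bump lives on the ball of radius [r], the Lipschitz bound holds up to [2 r], the cut below
   ends at [3 r], and the chart contains the ball of radius [4 r]. *)
pose r := Num.min r1 r2 / 4.
have r0 : 0 < r by rewrite divr_gt0 // lt_min r10.
have rr1 : 4 * r <= r1 by rewrite /r mulrC divfK // ge_min lexx.
have rr2 : 4 * r <= r2 by rewrite /r mulrC divfK // ge_min lexx orbT.
have cz z : `|z - y0| < 4 * r -> cimg c z.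
  by move=> zr; have [] := h1 z z (lt_le_trans zr rr1) (lt_le_trans zr rr1).
have r4 : r < 4 * r by lra.
have sub : [set z | `|z - y0| <= r] `<=` cimg c by move=> z zr; apply: cz; exact: le_lt_trans zr r4.
pose X := extend c (rbump y0 r).
have out z : r < `|z - y0| -> rbump y0 r z = 0 by exact: rbump_out.
have XS : smoothR A X by apply: (smoothR_extend sM hausM (y := y0) (r := r)) => // j; exact: rbump_Ck.
have XC : Cc X.
  split; first exact: smoothR_continuous XS.
  by exists (bump_supp c y0 r); [exact: (compact_bump_supp sM)|move=> q; apply: (extend_out sM)].
have X0 q : 0 <= X q by rewrite /X /extend; case: ifP => // _; exact: rbump_ge0.
exists X; split; first by split=> //; rewrite /X /extend asboolT //; exact: rbump_gt0.
move=> e e0.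
pose N v := Num.sqrt (Gm A g c y0 v v).
have cy0 : cimg c y0 := cimg_cmap dc.
have [C C0 NC] := form_upper (Gm_lin sM hg Ac cy0) (Gm_sym hg c y0).
have NZ t v : N (t *: v) = `|t| * N v.
  by rewrite /N (formZZ (Gm_lin sM hg Ac cy0) (Gm_sym hg c y0)) sqrtrM ?sqr_ge0 // sqrtr_sqr.
(* Equal to 1 up to distance [2 r] and to 0 beyond [3 r]: it extends [w] from the chart to a
   continuous function on the whole space, as [mollify] demands. *)
pose ct (z : 'rV[R]_n) : R := Num.min 1 (Num.max 0 (3 - `|z - y0| / r)).
pose w1 (z : 'rV[R]_n) : R^o := if `|z - y0| < 4 * r then ct z * w (cinv c z) else 0.
have w1E z : `|z - y0| < 2 * r -> w1 z = w (cinv c z).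
  move=> zr; rewrite /w1 ifT; last by lra.
  have : `|z - y0| / r < 2 by rewrite ltr_pdivrMr.
  move=> h; rewrite /ct max_r ?min_l ?mul1r //; lra.
have w1c : continuous w1.
  move=> z.
  have nrm : {for z, continuous (fun z : 'rV[R]_n => `|z - y0| : R^o)}.
    apply: (@continuous_comp _ _ R^o (fun z : 'rV[R]_n => z - y0) (fun u : 'rV[R]_n => `|u| : R^o)).
      by apply: (@cvgB R 'rV[R]_n _ (nbhs z) _ id (cst y0) z y0); [exact: cvg_id|exact: cvg_cst].
    exact: norm_continuous.
  have [zr|zr] := ltP `|z - y0| (4 * r).
    apply: (@near_eq_cont _ _ (fun z => ct z * w (cinv c z) : R^o)).
      have : \forall z' \near z, `|z' - y0| < 4 * r by apply: (cvgr_lt _ nrm).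
      by apply: filterS => z' hz; rewrite /w1 hz.
    apply: (@cvgM R _ (nbhs z)).
      have h3 : {for z, continuous (fun z : 'rV[R]_n => 3 - `|z - y0| / r : R^o)}.
        by apply: (@cvgB R R^o _ (nbhs z)); [exact: cvg_cst|apply: (@cvgMl R _ (nbhs z)); exact: nrm].
      apply/(@cvgrPdist_le _ R^o _ (nbhs z)) => e1 e10.
      have := @cvgr_dist_le _ R^o _ (nbhs z) _ _ _ h3 e1 e10.
      move=> /(_ (nbhs_filter z)); apply: filterS => z' hz'.
      exact: (le_trans (clamp_lip _ _) hz').
    by apply: (@continuous_comp _ _ R^o (cinv c) w); [exact: (cinv_continuous hc (cz z zr))|exact: wc].
  apply: (@near_eq_cont 'rV[R]_n R^o (fun=> 0)); last exact: (@cst_continuous 'rV[R]_n R^o 0).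
  have : \forall z' \near z, 3 * r < `|z' - y0| by apply: (cvgr_gt _ nrm); lra.
  apply: filterS => z' hz; rewrite /w1; case: ifP => // _.
  have : 3 < `|z' - y0| / r by rewrite ltr_pdivlMr.
  by move=> h; rewrite /ct max_l ?min_r ?mul0r //; lra.
have wl u v : `|u - y0| < 2 * r -> `|v - y0| < 2 * r -> `|w1 v - w1 u| <= 2 * l * N (v - u).
  move=> ur vr; rewrite !w1E //.
  have [||_ lk] := h1 u v; [lra|lra|].
  by apply: (le_trans (wlip lk)); rewrite mulrCA mulrA.
have l20 : 0 <= 2 * l by rewrite mulr_ge0.
have [S [SC hS]] := mollify w1c r0 l20 (ltW C0) NZ NC e0 wl.
pose b z : R^o := rbump y0 r z * S z.
have bC j : Ck j setT b by apply: Ck_mul; [exact: openT|exact: rbump_Ck|exact: SC].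
have b0 z : r < `|z - y0| -> b z = 0 by move=> h; rewrite /b out ?mul0r.
pose Y := extend c b.
have YS : smoothR A Y by exact: (smoothR_extend sM hausM Ac sub bC b0).
have YC : Cc Y.
  split; first exact: smoothR_continuous YS.
  by exists (bump_supp c y0 r); [exact: (compact_bump_supp sM)|move=> q; apply: (extend_out sM)].
have hw z : `|z - y0| <= r -> `|S z - w (cinv c z)| <= e.
  by move=> zr; have [+ _] := hS z zr; rewrite w1E //; lra.
exists Y; split=> //.
- move=> q; have [[z zr <-]|nq] := pselect (bump_supp c y0 r q).
    have cz' := sub z zr; rewrite /Y /X !(extendE sM) // /b.
    rewrite mulrC -mulrBl normrM (ger0_norm (rbump_ge0 y0 r z)).
    by rewrite ler_wpM2r ?rbump_ge0 // hw.
  by rewrite /Y /X !(extend_out sM (y := y0) (r := r)) // !mulr0 subrr normr0.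
move=> q s bb wq.
have sX : smoothR A (fun x => s * X x) by apply: smoothR_mul => //; exact: smoothR_cst.
have [[z zr zq]|nq] := pselect (bump_supp c y0 r q); last first.
  have oS : open (~` bump_supp c y0 r) by rewrite openC; exact: (closed_bump_supp sM hausM).
  have : rcn A g (fun x => Y x - s * X x) q = 0.
    apply: (rcn_local_cst hM hg (b := 0)); first exact: smoothR_sub.
    have : \forall q' \near q, ~ bump_supp c y0 r q' by exact: (open_nbhs_nbhs (conj oS nq)).
    apply: filterS => q' nq'.
    by rewrite /Y /X !(extend_out sM (y := y0) (r := r)) // mulr0 subrr.
  move=> h0; have := rcn_grad sM hg q (smoothR_sub sM YS sX); rewrite h0.
  apply: grad_le_mono => //; rewrite addr_ge0 ?mulr_ge0 // ?rcn_ge0 //.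
  by rewrite addr_ge0 ?(ltW e0) // (le_trans _ wq).
rewrite -zq; have czz := sub z zr.
apply/(grad_le_chart sM) => //; first exact: smoothR_sub.
move=> v.
have -> : 'D_v ((fun x => Y x - s * X x) \o cinv c : 'rV[R]_n -> R^o) z =
  'D_v (fun z => rbump y0 r z * (S z - s) : R^o) z.
  apply: near_eq_derive.
  have : \forall z' \near z, cimg c z' by exact: (open_nbhs_nbhs (conj (open_cimg hc) czz)).
  by apply: filterS => z' cz' /=; rewrite /Y /X !(extendE sM) // /b mulrBr [s * _]mulrC.
have dB : is_derive z v (rbump y0 r : 'rV[R]_n -> R^o) ('D_v (rbump y0 r) z).
  by apply: DeriveDef => //; exact: (Ck_derivable (rbump_Ck 1 y0 r)).
have dS : is_derive z v (fun z => S z - s : R^o) ('D_v S z).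
  have dS0 : is_derive z v S ('D_v S z) by apply: DeriveDef => //; exact: (Ck_derivable (SC 1%N)).
  have := is_deriveB dS0 (is_derive_cst (s : R^o) z v); rewrite subr0; exact.
have := is_deriveM dB dS => dM; rewrite (@derive_val _ _ _ _ _ _ _ dM).
have XB : 'D_v (rbump y0 r) z = 'D_v (X \o cinv c : 'rV[R]_n -> R^o) z.
  apply: near_eq_derive.
  have : \forall z' \near z, cimg c z' by exact: (open_nbhs_nbhs (conj (open_cimg hc) czz)).
  by apply: filterS => z' cz' /=; rewrite /X (extendE sM).
have B1 : `|'D_v (rbump y0 r) z| <= rcn A g X (cinv c z) * Num.sqrt (Gm A g c z v v).
  rewrite XB; move: v {dB dS dM XB}; apply/(grad_le_chart sM) => //; exact: (rcn_grad sM hg).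
have B2 : `|'D_v S z| <= 4 * l * Num.sqrt (Gm A g c z v v).
  have [_ hz] := hS z zr; apply: (le_trans (hz v)).
  have -> : 4 * l * Num.sqrt (Gm A g c z v v) = 2 * l * (2 * Num.sqrt (Gm A g c z v v)) by lra.
  rewrite ler_wpM2l // /N.
  have -> : 2 * Num.sqrt (Gm A g c z v v) = Num.sqrt (4 * Gm A g c z v v).
    by rewrite sqrtrM // (_ : 4 = 2 ^+ 2) ?sqrtr_sqr ?ger0_norm // -natrX.
  apply: ler_wsqrtr; have [] // := h2 z _; last by move=> _ /(_ v)[].
  by rewrite -ball_normE /ball_ /= distrC; apply: (le_lt_trans zr); lra.
have B3 : `|S z - s| <= bb + e.
  have -> : S z - s = (w q - s) + (S z - w (cinv c z)) by rewrite zq; lra.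
  by apply: (le_trans (ler_normD _ _)); rewrite lerD // hw.
have B4 := rbump_ge0 y0 r z.
have -> : X (cinv c z) = rbump y0 r z by rewrite /X (extendE sM).
rewrite /GRing.scale /=.
apply: (le_trans (ler_normD _ _)); rewrite !normrM (ger0_norm B4).
have G0 : 0 <= Num.sqrt (Gm A g c z v v) by exact: sqrtr_ge0.
have n0 := normr_ge0 (S z - s); have n1 := normr_ge0 ('D_v (rbump y0 r) z).
rewrite mulrDl addrC; apply: lerD.
  by rewrite -mulrA; apply: ler_pM.
by rewrite [leRHS]mulrAC [leLHS]mulrC; apply: ler_wpM2r.
Qed.

(** [X] and [B] are chosen before [e], so that [e] can later be taken small compared with the
    averages of both. [B] is a sum of the gradient norms of the local bumps and, being in [Cc], can
    be averaged. *)
Lemma compact_smoothing (K : set M) : compact K ->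
  exists X B : M -> R, [/\ smoothR A X, Cc X, Cc B, forall q, 0 <= X q & forall q, K q -> 0 < X q] /\
  forall e : R, 0 < e -> exists Y : M -> R, [/\ smoothR A Y, Cc Y,
    forall q, `|Y q - w q * X q| <= e * X q &
    forall q (s b : R), `|w q - s| <= b ->
      grad_le A g (fun x => Y x - s * X x) q ((b + e) * B q + 4 * l * X q)].
Proof.
pose P (K : set M) := exists X B : M -> R, [/\ smoothR A X, Cc X, Cc B, forall q, 0 <= X q & forall q, K q -> 0 < X q] /\
  forall e : R, 0 < e -> exists Y : M -> R, [/\ smoothR A Y, Cc Y,
    forall q, `|Y q - w q * X q| <= e * X q &
    forall q (s b : R), `|w q - s| <= b ->
      grad_le A g (fun x => Y x - s * X x) q ((b + e) * B q + 4 * l * X q)].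
move=> cK; apply: (@compact_ind _ P _ _ _ _ cK).
- exists (fun=> 0), (fun=> 0); split; first by split=> //; [exact: smoothR_cst|exact: Cc0|exact: Cc0].
  move=> e e0; exists (fun=> 0); split; [exact: smoothR_cst|exact: Cc0| |].
    by move=> q; rewrite !mulr0 subrr normr0.
  move=> q s b _; have -> : (fun _ : M => 0 - s * 0) = (fun=> 0 : R) by apply/funext => x; rewrite mulr0 subr0.
  have := rcn_grad sM hg q (smoothR_cst A (0 : R)).
  rewrite (rcn_local_cst hM hg (b := 0)) ?mulr0 ?addr0 //; first exact: smoothR_cst.
  exact: filterE.
- move=> K1 K2 [X1 [B1 [[X1S X1C B1C X10 X1K] H1]]] [X2 [B2 [[X2S X2C B2C X20 X2K] H2]]].
  exists (fun x => X1 x + X2 x), (fun x => B1 x + B2 x); split.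
    split; [exact: smoothR_add|exact: Cc_add|exact: Cc_add|by move=> q; rewrite addr_ge0|].
    by move=> q [/X1K h|/X2K h]; [rewrite ltr_pwDl|rewrite ltr_wpDl].
  move=> e e0; have [Y1 [Y1S Y1C E1 D1]] := H1 e e0; have [Y2 [Y2S Y2C E2 D2]] := H2 e e0.
  exists (fun x => Y1 x + Y2 x); split; [exact: smoothR_add|exact: Cc_add| |].
    move=> q; have -> : Y1 q + Y2 q - w q * (X1 q + X2 q) = (Y1 q - w q * X1 q) + (Y2 q - w q * X2 q) by ring.
    by apply: (le_trans (ler_normD _ _)); rewrite mulrDr lerD.
  move=> q s b wq.
  have -> : (fun x => Y1 x + Y2 x - s * (X1 x + X2 x)) = (fun x => (Y1 x - s * X1 x) + (Y2 x - s * X2 x)).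
    by apply/funext => x; ring.
  have -> : (b + e) * (B1 q + B2 q) + 4 * l * (X1 q + X2 q) =
    ((b + e) * B1 q + 4 * l * X1 q) + ((b + e) * B2 q + 4 * l * X2 q) by ring.
  have sX1 : smoothR A (fun x => s * X1 x) by apply: smoothR_mul => //; exact: smoothR_cst.
  have sX2 : smoothR A (fun x => s * X2 x) by apply: smoothR_mul => //; exact: smoothR_cst.
  by apply: grad_le_add => //; [exact: smoothR_sub|exact: smoothR_sub|exact: D1|exact: D2].
- move=> K1 K2 K12 [X [B [[XS XC BC X0 XK] H]]]; exists X, B; split=> //; split=> // q /K12; exact: XK.
move=> p _; have [X [[XS XC X0 Xp] H]] := local_smoothing p.
exists [set q | 0 < X q].
  by apply: (@cvgr_gt _ _ (nbhs p) _ X (X p)) => //; exact: (smoothR_continuous XS).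
exists X, (rcn A g X); split; first by split=> //; exact: (rcn_Cc hM hg).
exact: H.
Qed.

End LocalSmoothing.

Section InvariantSmoothing.
Context {R : realType} {k n : nat} {G : groupTopType} {M : topologicalType}.
Variables (AG : atlas 'rV[R]_k G) (A : atlas 'rV[R]_n M) (a : group_action G M).
Hypothesis hG : lie_group AG.
Hypothesis hM : is_manifold A.
Hypothesis hact : smooth_map (prod_atlas AG A) A (fun z => a z.1 z.2).
Hypothesis hprop : proper_action a.
Variable g : M -> 'rV[R]_n -> 'rV[R]_n -> R.
Hypothesis hg : riemannian_metric A g.
Hypothesis hiso : isometric_action A g a.

Let sM : smooth_atlas A. Proof. by have [] := hM. Qed.

Lemma Avg_continuous (J : (G -> R) -> R) (psi : M -> R) : right_haar J -> Cc psi -> continuous (Avg a J psi : M -> R^o).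
Proof.
move=> hJ pC p; have [Ac dc] := chart_at_ok sM p; set c := chart_at A p in Ac dc; have hc := chart_ok sM Ac.
apply: (@near_eq_cont _ R^o ((Avg a J psi \o cinv c) \o cmap c)).
  by apply: filterS (open_nbhs_nbhs (conj (open_dom hc) dc)) => q dq /=; rewrite cmapK.
apply: (@continuous_comp _ _ R^o (cmap c) (Avg a J psi \o cinv c)); first exact: cmap_continuous.
apply: (@J_param_continuous R G J hJ (ge1G hG) n 0 (cimg c) (fun h y => psi (a h (cinv c y)) : R^o)).
- exact: (open_cimg hc).
- split=> // h y cy.
  apply: (@continuous_comp _ _ R^o (fun z : G * 'rV[R]_n => a z.1 (cinv c z.2)) psi); last exact: pC.1.
  apply: (@continuous_comp _ _ _ (fun z : G * 'rV[R]_n => (z.1, cinv c z.2)) (fun z : G * M => a z.1 z.2)); last exact: (act_continuous hact).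
  apply: (@cvg_pair _ _ _ (nbhs (h, y)) _ _ _ _ _ (fun z : G * 'rV[R]_n => z.1) (fun z => cinv c z.2)); first exact: cvg_fst.
  by apply: (@continuous_comp _ _ _ (fun z : G * 'rV[R]_n => z.2) (cinv c)); [exact: cvg_snd|exact: (cinv_continuous hc cy)].
- exact: (locsupp_act hM hprop).
exact: cimg_cmap.
Qed.

(** [v] is the quotient of the averages [Q] of [Y] and [P] of [X]. At [x], with [s = v x], its
    differential is that of [Q - s P] divided by [P x], and [Q - s P] is the average of [Y - s X].
    The gradient of the latter is at most [2 e Avg B + 4 l P], which is at most [5 l P]. *)
Lemma invariant_smoothing (S : set M) (w : M -> R) (l d : R) : Gcompact a S -> 0 < l -> 0 < d ->
  continuous (w : M -> R^o) -> (forall h x, w (a h x) = w x) ->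
  (forall x y f, link A g x y f -> `|w y - w x| <= l * f) ->
  exists v O, [/\ open O, S `<=` O, forall h x, v (a h x) = v x,
    forall c j, charts A c -> Ck j [set y | cimg c y /\ O (cinv c y)] (v \o cinv c : 'rV[R]_n -> R^o) &
    forall x, S x -> `|v x - w x| <= d] /\
    (forall c y u, charts A c -> cimg c y -> S (cinv c y) ->
       `|'D_u (v \o cinv c : 'rV[R]_n -> R^o) y| <= 5 * l * Num.sqrt (Gm A g c y u u)).
Proof.
move=> pS l0 d0 wc wa wl.
have [K cK hK] := pS.
have [X [B [[XS XC BC X0 XK] H]]] := compact_smoothing hM hg (ltW l0) wc wl cK.
have [J hJ] := haar_exists hG.
pose P := Avg a J X.
have PS : smoothR A P := Avg_smoothR hG hM hact hprop hJ XS XC.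
have Pinv h x : P (a h x) = P x := Avg_invariant hact hprop hJ h x XC.
have Pgt0 x : K x -> 0 < P x.
  by move=> Kx; apply: (Avg_gt0 hact hprop hJ (h := 1%g) (f := X)) => //; rewrite act_one; exact: XK.
have [m m0 hm] := compact_lower_bound cK (smoothR_continuous PS) Pgt0.
have PSm x : S x -> m <= P x by move=> /hK[h Kh]; rewrite -(Pinv h); exact: hm.
have [||b hb] := @Gcompact_bounded R G M a S (Avg a J B) pS.
- by apply: Avg_continuous.
- by move=> h x; exact: (Avg_invariant hact hprop hJ h x BC).
(* Since [b] bounds the average of [B] and [m] is a lower bound of [P] on [S], the term [2 e Avg B]
   is at most [l m], hence at most [l P]. *)
pose e := Num.min d (l * m / (2 * (`|b| + 1))).
have b1 : 0 < `|b| + 1 by rewrite ltr_wpDl.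
have e0 : 0 < e by rewrite lt_min d0 divr_gt0 // ?mulr_gt0.
have ed : e <= d by rewrite ge_min lexx.
have eb : 2 * e * (`|b| + 1) <= l * m.
  have : e <= l * m / (2 * (`|b| + 1)) by rewrite ge_min lexx orbT.
  by rewrite ler_pdivlMr ?mulr_gt0 // => h; lra.
have [Y [YS YC YX YD]] := H e e0.
pose Q := Avg a J Y.
have QS : smoothR A Q := Avg_smoothR hG hM hact hprop hJ YS YC.
have Qinv h x : Q (a h x) = Q x := Avg_invariant hact hprop hJ h x YC.
have QP x : `|Q x - w x * P x| <= e * P x.
  have h1 : Q x - w x * P x = J (fun h => Y (a h x) - w x * X (a h x)).
    have cY := Cc_act hact hprop x YC; have cX := Cc_act hact hprop x XC.
    by rewrite (JB hJ cY (Cc_scale _ cX)) (JZ hJ _ cX).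
  have -> : e * P x = J (fun h => e * X (a h x)) by rewrite (JZ hJ _ (Cc_act hact hprop x XC)).
  rewrite h1; apply: (J_norm hJ).
  - by apply: Cc_sub; [exact: (Cc_act hact hprop x YC)|apply: Cc_scale; exact: (Cc_act hact hprop x XC)].
  - by apply: Cc_scale; exact: (Cc_act hact hprop x XC).
  by move=> h; rewrite -(wa h x); exact: YX.
pose v x := Q x / P x; pose O := [set x | 0 < P x].
have SO : S `<=` O by move=> x /PSm; exact: lt_le_trans.
have oO : open O.
  by apply: (@open_comp M R^o P [set t : R^o | 0 < t]); [move=> x _; exact: (smoothR_continuous PS)|exact: open_gt].
have vw x : S x -> `|v x - w x| <= e.
  move=> Sx; have Px : 0 < P x := SO x Sx.
  have -> : v x - w x = (Q x - w x * P x) / P x by rewrite mulrBl mulfK // gt_eqF.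
  by rewrite normrM normfV (gtr0_norm Px) ler_pdivrMr.
have oD c : charts A c -> open [set y | cimg c y /\ O (cinv c y)].
  by move=> Ac; exact: (open_preim_cinv (chart_ok sM Ac)).
exists v, O; split.
  split=> //.
  - by move=> h x; rewrite /v Qinv Pinv.
  - move=> c j Ac; apply: Ck_mul; first exact: oD.
      by apply: Ck_sub (QS.2 c Ac j) => y [].
    apply: (@Ck_comp_R R _ j (fun x => x^-1 : R^o) [set x : R^o | x != 0]).
    + exact: oD.
    + exact: open_neq.
    + by move=> y [_ Oy] /=; rewrite gt_eqF.
    + exact: Ck_inv.
    + by apply: Ck_sub (PS.2 c Ac j) => y [].
  - by move=> x Sx; apply: (le_trans (vw x Sx)).
move=> c y u Ac cy Sy; set x := cinv c y in Sy; have Px : 0 < P x := SO x Sy.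
pose s := v x.
pose F z := Y z - s * X z.
have sX : smoothR A (fun z => s * X z) by apply: smoothR_mul => //; exact: smoothR_cst.
have FS : smoothR A F by exact: smoothR_sub.
have FC : Cc F by apply: Cc_sub => //; exact: Cc_scale.
pose W z := (e + e) * B z + 4 * l * X z.
have WC : Cc W by apply: Cc_add; exact: Cc_scale.
have h1 : grad_le A g (Avg a J F) x (Avg a J W x).
  apply: (Avg_grad hG hM hact hprop hJ hiso) => // h.
  by apply: YD; rewrite wa distrC; exact: vw.
have WE : Avg a J W x = 2 * e * Avg a J B x + 4 * l * P x.
  rewrite /W (Avg_add hact hprop hJ x (Cc_scale (e + e) BC) (Cc_scale (4 * l) XC)).
  by rewrite (Avg_scale hact hprop hJ (e + e) x BC) (Avg_scale hact hprop hJ (4 * l) x XC) /P; ring.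
have FE z : Avg a J F z = Q z - s * P z.
  have cY := Cc_act hact hprop z YC; have cX := Cc_act hact hprop z XC.
  by rewrite /Avg /F (JB hJ cY (Cc_scale _ cX)) (JZ hJ _ cX).
have AFS : smoothR A (Avg a J F) := Avg_smoothR hG hM hact hprop hJ FS FC.
have dAF : `|'D_u (Avg a J F \o cinv c : 'rV[R]_n -> R^o) y| <= 5 * l * P x * Num.sqrt (Gm A g c y u u).
  have h2 := ((grad_le_chart sM g (Avg a J W x) AFS Ac cy).2 h1) u.
  apply: (le_trans h2); apply: ler_wpM2r; first exact: sqrtr_ge0.
  rewrite WE; have Bb : Avg a J B x <= `|b| + 1.
    by apply: (le_trans (ler_norm _)); apply: (le_trans (hb x Sy)); apply: (le_trans (ler_norm _)); rewrite lerDl.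
  have : 2 * e * Avg a J B x <= l * P x.
    apply: (@le_trans _ _ (2 * e * (`|b| + 1))); first by rewrite ler_wpM2l // mulr_ge0 // ltW.
    by apply: (le_trans eb); rewrite ler_wpM2l ?(ltW l0) // PSm.
  lra.
have dQ : is_derive y u (Q \o cinv c : 'rV[R]_n -> R^o) ('D_u (Q \o cinv c : 'rV[R]_n -> R^o) y).
  by apply: DeriveDef => //; exact: (Ck_derivable (QS.2 c Ac 1%N)).
have dP : is_derive y u (P \o cinv c : 'rV[R]_n -> R^o) ('D_u (P \o cinv c : 'rV[R]_n -> R^o) y).
  by apply: DeriveDef => //; exact: (Ck_derivable (PS.2 c Ac 1%N)).
have eF : 'D_u (Avg a J F \o cinv c : 'rV[R]_n -> R^o) y =
  'D_u (Q \o cinv c : 'rV[R]_n -> R^o) y - s * 'D_u (P \o cinv c : 'rV[R]_n -> R^o) y.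
  have -> : (Avg a J F \o cinv c : 'rV[R]_n -> R^o) = (fun z => (Q \o cinv c) z - s *: ((P \o cinv c) z : R^o)).
    by apply/funext => z /=; rewrite FE.
  have h3 := is_deriveB dQ (is_deriveZ s dP).
  by rewrite (@derive_val _ _ _ _ _ _ _ h3).
have dV : is_derive y u (v \o cinv c : 'rV[R]_n -> R^o)
   (('D_u (Q \o cinv c : 'rV[R]_n -> R^o) y - s * 'D_u (P \o cinv c : 'rV[R]_n -> R^o) y) / P x).
  have Pn : (P \o cinv c) y != 0 by rewrite /= gt_eqF.
  have h5 := is_deriveV Pn (is_derive_id (P x) (1 : R)).
  have h3 := is_derive_comp1 h5 (@ex_derive _ _ _ _ _ _ _ dP).
  have h4 := is_deriveM dQ h3.
  apply: is_derive_eq h4 _; rewrite /GRing.scale /= -/x /s /v; field; by rewrite gt_eqF.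
rewrite (@derive_val _ _ _ _ _ _ _ dV) -eF normrM normfV (gtr0_norm Px) ler_pdivrMr //.
by rewrite mulrAC.
Qed.

End InvariantSmoothing.

(** * Smooth invariant cutoffs *)

Section Step.
Context {R : realType}.

Definition step (t : R^o) : R^o := flat 0 t / (flat 0 t + flat 0 (1 - t)).

Lemma step_den t : 0 < flat 0 t + flat 0 (1 - t) :> R.
Proof.
have [t0|t0] := ltP 0 t; first by rewrite ltr_pwDl ?flat_gt0 ?flat_ge0.
by rewrite ltr_wpDl ?flat_gt0 ?flat_ge0 // subr_gt0; exact: le_lt_trans t0 ltr01.
Qed.

Lemma step_le0 t : t <= 0 -> step t = 0. Proof. by move=> t0; rewrite /step flat_le0 // mul0r. Qed.

Lemma step_ge1 t : 1 <= t -> step t = 1.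
Proof.
move=> t1; rewrite /step [flat 0 (1 - t)]flat_le0 ?subr_le0 // addr0 divff // gt_eqF // flat_gt0 //.
exact: lt_le_trans ltr01 t1.
Qed.

Lemma step01 t : 0 <= step t <= 1.
Proof.
have d0 := step_den t; rewrite /step divr_ge0 ?flat_ge0 ?(ltW d0) //=.
by rewrite ler_pdivrMr // mul1r lerDl flat_ge0.
Qed.

Lemma Ck_step k : Ck k setT step.
Proof.
have F : Ck k setT (flat 0 : R^o -> R^o) := Ck_flat k 0.
have D : Ck k setT (fun t : R^o => flat 0 t + flat 0 (1 - t) : R^o).
  apply: Ck_add; [exact: openT|exact: F|].
  apply: (@Ck_comp_R R R^o k (flat 0 : R^o -> R^o) setT) => //; [exact: openT|exact: openT|].
  apply: Ck_sub_fun; [exact: openT|exact: Ck_cst|].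
  by apply: (@Ck_linear R R^o R^o k setT (idfun : {linear R^o -> R^o})) => x; exact: cvg_id.
apply: Ck_mul; [exact: openT|exact: F|].
apply: (@Ck_comp_R R R^o k (fun x => x^-1 : R^o) [set x : R^o | x != 0]) => //.
- exact: openT.
- by move=> t _ /=; rewrite gt_eqF // step_den.
- exact: Ck_inv.
Qed.

(** The interval [-1, 2] is the range of [2 v - 1/2] for [v] within 1/4 of [0, 1], which is how
    [step] will be used. *)
Lemma step_deriv : exists2 C : R, 0 < C &
  forall t : R, -1 <= t <= 2 -> exists2 d : R, is_derive t (1 : R) (step : R -> R) d & `|d| <= C.
Proof.
have cD : continuous ('D_1 step : R^o -> R^o).
  by move=> t; apply: (@Ck_continuous _ _ _ 0 setT) => //; exact: (Ck_derive _ (Ck_step 1)).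
have [B hB] := @compact_norm_bounded R R^o `[-1, 2]%classic ('D_1 step : R^o -> R^o) (@segment_compact R (-1) 2) cD.
exists (`|B| + 1) => [|t t12]; first by rewrite ltr_wpDl.
exists ('D_1 step t).
  by apply: DeriveDef => //; exact: (Ck_derivable (Ck_step 1)).
apply: (le_trans (hB t _)); first by rewrite /= in_itv.
by apply: (le_trans (ler_norm _)); rewrite lerDl.
Qed.

End Step.

Section SmoothCutoff.
Context {R : realType} {k n : nat} {G : groupTopType} {M : topologicalType}.
Variables (AG : atlas 'rV[R]_k G) (A : atlas 'rV[R]_n M) (a : group_action G M).
Hypothesis hG : lie_group AG.
Hypothesis hM : is_manifold A.
Hypothesis hact : smooth_map (prod_atlas AG A) A (fun z => a z.1 z.2).
Hypothesis hprop : proper_action a.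
Variable g : M -> 'rV[R]_n -> 'rV[R]_n -> R.
Hypothesis hg : riemannian_metric A g.
Hypothesis hiso : isometric_action A g a.
Hypothesis hcomplete : riemannian_complete A g.
Local Notation reach := (reach A a g).
Local Notation rball := (rball A a g).
Local Notation class := (class A a g).

Let sM : smooth_atlas A. Proof. by have [] := hM. Qed.

(** [C] is chosen before [x0], [r] and [l], so that wide transitions have small gradients. Composing
    the smoothed cutoff with [step] restores the exact values 0 and 1, which allows gluing with
    constants outside [S]. The 10 is 5 from [invariant_smoothing] times the slope 2 of [s]. *)
Lemma smooth_cutoff : exists2 C : R, 0 < C & forall x0 (r l : R), 0 < l -> exists f : M -> R,
  [/\ smoothR A f, forall h x, f (a h x) = f x, forall x, 0 <= f x <= 1 &
      forall x, rcn A g f x <= C / l] /\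
  [/\ forall x, ~ class x0 x -> f x = 0, forall x, rball x0 r x -> f x = 0 &
      forall x, class x0 x -> ~ rball x0 (r + l) x -> f x = 1].
Proof.
have [C C0 hC] := @step_deriv R; exists (10 * C) => [|x0 r l l0]; first by rewrite mulr_gt0.
have li0 : 0 < l^-1 by rewrite invr_gt0.
(* The margin 1 makes [f] constant near every point outside [S], boundary points included. *)
pose S := rball x0 (r + l + 1).
have pS : Gcompact a S := rball_Gcompact hG hM hact hg hiso hcomplete x0 (r + l + 1).
pose w := cutoff A a g x0 r l.
have wc : continuous (w : M -> R^o) by apply: cutoff_continuous.
have wa h x : w (a h x) = w x by apply: cutoff_inv.
have wl x y f : link A g x y f -> `|w y - w x| <= l^-1 * f.
  by move=> lk; apply: cutoff_lip => //; exact: reach_link.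
have q0 : 0 < 4^-1 :> R by rewrite invr_gt0.
have [v [W [[oW SO va vC vw] vD]]] := invariant_smoothing hG hM hact hprop hg hiso pS li0 q0 wc wa wl.
(* As [v] is within 1/4 of [w], [s] is at most 0 where [w] is 0 and at least 1 where [w] is 1. *)
pose s x : R := 2 * v x - 2^-1.
have w01 x : 0 <= w x <= 1 by exact: cutoff01.
have s12 x : S x -> -1 <= s x <= 2.
  move=> /vw; have /andP[w0 w1] := w01 x; rewrite ler_norml => /andP[h1 h2].
  by rewrite /s; apply/andP; split; lra.
pose f x : R := if `[< S x >] then step (s x) else if `[< class x0 x >] then 1 else 0.
have fS x : S x -> f x = step (s x) by move=> Sx; rewrite /f asboolT.
have f_out x : ~ class x0 x -> f x = 0.
  by move=> nx; rewrite /f !asboolF // => Sx; apply: nx; exact: rball_class Sx.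
have f1 x : class x0 x -> ~ rball x0 (r + l) x -> f x = 1.
  move=> cx nx; have w1 : w x = 1 by apply: cutoff1.
  have [Sx|nS] := pselect (S x); last by rewrite /f asboolF // asboolT.
  rewrite fS // step_ge1 // /s; have := vw x Sx; rewrite w1 ler_norml => /andP[h1 h2]; lra.
have f0 x : rball x0 r x -> f x = 0.
  move=> rx; have cx := rball_class rx; have w0 : w x = 0 by apply: cutoff0.
  have Sx : S x by have [e er re] := rx; exists e => //; lra.
  rewrite fS // step_le0 // /s; have := vw x Sx; rewrite w0 ler_norml => /andP[h1 h2]; lra.
have fa h x : f (a h x) = f x.
  have SE : S (a h x) <-> S x.
    split=> [/(rball_orbit h^-1%g)|]; last exact: rball_orbit.
    by rewrite -act_mul mulVg act_one.
  have cE : class x0 (a h x) <-> class x0 x.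
    split=> [/(class_act h^-1%g)|]; last exact: class_act.
    by rewrite -act_mul mulVg act_one.
  by rewrite /f (asbool_equiv_eq SE) (asbool_equiv_eq cE) /s va.
have f01 x : 0 <= f x <= 1.
  rewrite /f; case: ifP => _; first exact: step01.
  by case: ifP => _; rewrite ?lexx ler01.
have oS : open S := rball_open a hM hg x0 (r + l + 1).
have far p : ~ S p -> exists b : R, \forall q \near p, f q = b.
  move=> nS; have [cp|ncp] := pselect (class x0 p).
    exists 1; apply: filterS (rball_near a hM hg p (ltr01 : 0 < 1 :> R)) => q pq.
    apply: f1; first by apply: class_trans cp _; exact: rball_class pq.
    by move=> rq; apply: nS; apply: (reach_le_rball rq (rball_sym hM hg pq)).
  exists 0; apply: filterS (class_near a hM hg p) => q pq; apply: f_out => cq; apply: ncp.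
  by apply: class_trans cq _; exact: (class_sym hM hg pq).
have oD c : charts A c -> open [set y | cimg c y /\ S (cinv c y)].
  by move=> Ac; exact: (open_preim_cinv (chart_ok sM Ac)).
have fsm : smoothR A f.
  apply: (smoothR_intro hM) => c j Ac; have hc := chart_ok sM Ac.
  apply: Ck_local => y cy.
  have [Sy|nSy] := pselect (S (cinv c y)).
    exists [set y | cimg c y /\ S (cinv c y)] => //.
    apply: (@Ck_ext R _ _ j _ (fun y => step (s (cinv c y)) : R^o)); first exact: oD.
      by move=> z [_ Sz] /=; rewrite fS.
    apply: (@Ck_comp_R R _ j step setT) => //; [exact: oD|exact: openT|exact: Ck_step|].
    apply: Ck_sub_fun; [exact: oD| |exact: Ck_cst].
    apply: Ck_mul; [exact: oD|exact: Ck_cst|].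
    by apply: Ck_sub (vC c j Ac) => z [cz /SO].
  have [b fb] := far _ nSy.
  have fb' : nbhs (cinv c y) [set q | f q = b] by exact: fb.
  move: fb'; rewrite nbhsE => -[B [oB By] hB].
  exists [set y | cimg c y /\ B (cinv c y)] => //.
  apply: (@Ck_ext R _ _ j _ (fun _ => b : R^o)); [exact: (open_preim_cinv hc oB)| |exact: Ck_cst].
  by move=> z [_ Bz]; have := hB _ Bz; rewrite /= => ->.
exists f; split=> //; split=> // x.
have [Sx|nS] := pselect (S x); last first.
  have [b fb] := far x nS; rewrite (rcn_local_cst hM hg fsm fb).
  by rewrite divr_ge0 ?mulr_ge0 ?(ltW C0) ?(ltW l0).
have Cl : 0 <= 10 * C / l by rewrite divr_ge0 ?mulr_ge0 ?(ltW C0) ?(ltW l0).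
apply: rcn_le => //.
have [Ac dc] := chart_at_ok sM x; set c := chart_at A x in Ac dc; have hc := chart_ok sM Ac.
have cx := cimg_cmap dc; rewrite -[x](cmapK hc dc).
apply/(grad_le_chart sM) => // u.
have Sx' : S (cinv c (cmap c x)) by rewrite (cmapK hc dc).
have -> : 'D_u (f \o cinv c : 'rV[R]_n -> R^o) (cmap c x) =
  'D_u (fun y => step (s (cinv c y)) : R^o) (cmap c x).
  apply: near_eq_derive; apply: filterS (open_nbhs_nbhs (conj (oD c Ac) (conj cx Sx'))) => z [_ Sz] /=.
  by rewrite fS.
have dv : is_derive (cmap c x) u (v \o cinv c : 'rV[R]_n -> R^o) ('D_u (v \o cinv c : 'rV[R]_n -> R^o) (cmap c x)).
  apply: DeriveDef => //; apply: (Ck_derivable (vC c 1%N Ac)); split=> //; exact: SO.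
have ds : is_derive (cmap c x) u (s \o cinv c : 'rV[R]_n -> R^o) (2 * 'D_u (v \o cinv c : 'rV[R]_n -> R^o) (cmap c x)).
  have h1 := is_deriveB (is_deriveZ (2 : R) dv) (is_derive_cst (2^-1 : R^o) (cmap c x) u).
  by apply: is_derive_eq h1 _; rewrite subr0.
have [d dd dC] := hC _ (s12 _ Sx').
have exs : derivable (s \o cinv c : 'rV[R]_n -> R^o) (cmap c x) u := @ex_derive _ _ _ _ _ _ _ ds.
have h2 := @is_derive_comp1 R 'rV[R]_n step d (s \o cinv c) (cmap c x) u dd exs.
rewrite (@derive_val _ _ _ _ _ _ _ h2) (@derive_val _ _ _ _ _ _ _ ds).
rewrite !normrM (ger0_norm (_ : 0 <= 2 :> R)) //.
have h3 := vD c (cmap c x) u Ac cx Sx'.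
have -> : 10 * C / l * Num.sqrt (Gm A g c (cmap c x) u u) =
  C * (2 * (5 * l^-1 * Num.sqrt (Gm A g c (cmap c x) u u))) by ring.
by apply: ler_pM => //; rewrite ?mulr_ge0 // ler_wpM2l.
Qed.

End SmoothCutoff.

(** * An unbounded Higson function *)

Section HigsonFunction.
Context {R : realType} {k n : nat} {G : groupTopType} {M : topologicalType}.
Variables (AG : atlas 'rV[R]_k G) (A : atlas 'rV[R]_n M) (a : group_action G M).
Hypothesis hG : lie_group AG.
Hypothesis hM : is_manifold A.
Hypothesis hact : smooth_map (prod_atlas AG A) A (fun z => a z.1 z.2).
Hypothesis hprop : proper_action a.
Variable g : M -> 'rV[R]_n -> 'rV[R]_n -> R.
Hypothesis hg : riemannian_metric A g.
Hypothesis hiso : isometric_action A g a.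
Hypothesis hcomplete : riemannian_complete A g.
Local Notation reach := (reach A a g).
Local Notation rball := (rball A a g).
Local Notation class := (class A a g).

Let sM : smooth_atlas A. Proof. by have [] := hM. Qed.

Lemma clopen_curve (gamma : R -> M) (B : set M) : continuous (gamma : R^o -> M) -> open B -> open (~` B) ->
  B (gamma 0) -> B (gamma 1).
Proof.
move=> cg oB oC B0; apply: contrapT => nB1.
pose f (t : R) : R := if `[< B (gamma t) >] then 1 else 0.
have cf : continuous (f : R^o -> R^o).
  move=> t; have [Bt|nBt] := pselect (B (gamma t)).
    apply: (@near_eq_cont R^o R^o (fun=> 1)); last exact: (@cst_continuous R^o R^o 1).
    have E : nbhs t [set s | B (gamma s)] by exact: (cg t B (open_nbhs_nbhs (conj oB Bt))).
    by apply: filterS E => s Bs; rewrite /f asboolT.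
  apply: (@near_eq_cont R^o R^o (fun=> 0)); last exact: (@cst_continuous R^o R^o 0).
  have E : nbhs t [set s | ~ B (gamma s)] by exact: (cg t _ (open_nbhs_nbhs (conj oC nBt))).
  by apply: filterS E => s Bs; rewrite /f asboolF.
have [||t _] := @IVT R f 0 1 2^-1 ler01.
- exact: continuous_subspaceT.
- rewrite /f asboolT // asboolF //; apply/andP; split.
    by rewrite ge_min (_ : (0 : R) <= 2^-1) ?orbT // invr_ge0.
  by rewrite le_max (_ : 2^-1 <= (1 : R)) //; lra.
by rewrite /f; case: ifP => _; lra.
Qed.

(** Curves lead from [x] to a translate of [y]. A curve cannot leave a clopen set, and invariance
    removes the translation. *)
Lemma clopen_class (B : set M) x y : open B -> open (~` B) -> (forall h z, B z -> B (a h z)) ->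
  class x y -> B x -> B y.
Proof.
move=> oB oC Ba [e r] Bx.
have [|h [/dist_ltP[s ps _] _]] := reach_dist_lt hG hM hact hg hiso (e' := 2 * e + 1) r; first by rewrite ltrDl.
have : B (a h y).
  elim: s x ps {r} Bx => [x /= -> //|gamma s IH x /= [sg g0 ps] Bx].
  by apply: (IH _ ps); apply: (clopen_curve (gamma := gamma) sg.1 oB oC); rewrite g0.
by move=> /(Ba h^-1%g); rewrite -act_mul mulVg act_one.
Qed.

Lemma smoothR_bigsum m (F : nat -> M -> R) : (forall j, smoothR A (F j)) -> smoothR A (fun x => \sum_(j < m) F j x).
Proof.
move=> FS; elim: m => [|m IH].
  have -> : (fun x => \sum_(j < 0) F j x) = (fun=> 0) by apply/funext => x; rewrite big_ord0.
  exact: smoothR_cst.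
have -> : (fun x => \sum_(j < m.+1) F j x) = (fun x => \sum_(j < m) F j x + F m x) by apply/funext => x; rewrite big_ord_recr.
exact: smoothR_add.
Qed.

Lemma grad_le_bigsum m (F : nat -> M -> R) (C : nat -> R) p : (forall j, smoothR A (F j)) ->
  (forall j, grad_le A g (F j) p (C j)) -> grad_le A g (fun x => \sum_(j < m) F j x) p (\sum_(j < m) C j).
Proof.
move=> FS FC; elim: m => [|m IH].
  have -> : (fun x => \sum_(j < 0) F j x) = (fun=> 0 : R) by apply/funext => x; rewrite big_ord0.
  have := rcn_grad sM hg p (smoothR_cst A (0 : R)).
  by rewrite (rcn_local_cst hM hg (b := 0)) ?big_ord0 //; [exact: smoothR_cst|exact: filterE].
have -> : (fun x => \sum_(j < m.+1) F j x) = (fun x => \sum_(j < m) F j x + F m x) by apply/funext => x; rewrite big_ord_recr.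
by rewrite big_ord_recr /=; apply: grad_le_add => //; exact: smoothR_bigsum.
Qed.

Lemma smoothR_of_local (f : M -> R) : (forall p : M, exists2 f', smoothR A f' & \forall q \near p, f' q = f q) -> smoothR A f.
Proof.
move=> H; apply: (smoothR_intro hM) => c j Ac; have hc := chart_ok sM Ac.
apply: Ck_local => y cy; have [f' fS'] := H (cinv c y).
move=> E; have : nbhs (cinv c y) [set q | f' q = f q] by exact: E.
rewrite nbhsE => -[B [oB By] hB].
exists [set z | cimg c z /\ B (cinv c z)] => //.
apply: (@Ck_ext R _ _ j _ (f' \o cinv c : 'rV[R]_n -> R^o)); first exact: (open_preim_cinv hc oB).
  by move=> z [_ Bz]; exact: (hB _ Bz).
by apply: Ck_sub (fS'.2 c Ac j) => z [].
Qed.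

Lemma rcn_near f f' p : smoothR A f -> smoothR A f' -> (\forall q \near p, f' q = f q) -> rcn A g f p = rcn A g f' p.
Proof.
move=> fS fS' E; rewrite /rcn /real_codiff_norm; congr (sup (_ @` _)).
have [Ac dc] := chart_at_ok sM p; have hc := chart_ok sM Ac.
apply/funext => v; congr (`|_|); rewrite /tangent_map /=; apply: near_eq_derive.
have := cinv_continuous hc (cimg_cmap dc); rewrite /prop_for /continuous_at (cmapK hc dc) => ci.
have : nbhs p [set q | f q = f' q] by apply: filterS E => q /= ->.
exact: ci.
Qed.

(** [h] is the sum of cutoffs [phi j] rising from 0 to 1 across disjoint annuli of width [l j], with
    gradient at most [C / l j]. At most one of them varies near a given point, so the gradient tends
    to 0 while the sum grows without bound. *)
Lemma higson_function x0 : ~ Gcompact a (class x0) -> exists h : M -> R,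
  [/\ smoothR A h, forall b x, h (a b x) = h x, forall x, 0 <= h x &
      forall e : R, 0 < e -> exists2 S, Gcompact a S & forall x, ~ S x -> rcn A g h x < e] /\
  (forall t : R, exists x, t < h x) /\
  (forall B : set M, open B -> open (~` B) -> (forall b z, B z -> B (a b z)) -> forall x, B x -> exists2 z, B z & h z = 0).
Proof.
move=> ncx.
have [C C0 hC] := smooth_cutoff hG hM hact hprop hg hiso hcomplete.
(* Quadratic radii leave room for annuli of growing width with a gap of 1:
   [r i + l i + 1 <= r i.+1]. *)
pose r (j : nat) : R := (j.+1 ^ 2)%:R; pose l (j : nat) : R := j.+1%:R.
have l0 j : 0 < l j by rewrite ltr0n.
have rl i j : (i < j)%N -> r i + l i + 1 <= r j.
  move=> ij; have -> : r i + l i + 1 = (i.+1 ^ 2 + i.+1).+1%:R by rewrite -natr1 natrD.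
  rewrite ler_nat.
  have : (i.+2 ^ 2 <= j.+1 ^ 2)%N by rewrite leq_exp2r.
  move/(leq_trans _); apply; rewrite -[i.+2]addn1 sqrnD -addnA -addnS leq_add2l exp1n muln1 mul2n -addnn add1n ltnS.
  exact: leq_addr.
have rm i j : (i <= j)%N -> r i <= r j by move=> ij; rewrite ler_nat leq_exp2r.
have rge j : j.+1%:R <= r j by rewrite ler_nat expnS expn1 leq_pmulr.
have [phi hphi] := choice (fun j => hC x0 (r j) (l j) (l0 j)).
have pS j : smoothR A (phi j) by have [[]] := hphi j.
have pa j b x : phi j (a b x) = phi j x by have [[_ + _ _] _] := hphi j; apply.
have p01 j x : 0 <= phi j x <= 1 by have [[_ _ + _] _] := hphi j; apply.
have pC j x : rcn A g (phi j) x <= C / l j by have [[_ _ _ +] _] := hphi j; apply.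
have pout j x : ~ class x0 x -> phi j x = 0 by have [_ [+ _ _]] := hphi j; apply.
have pin j x : rball x0 (r j) x -> phi j x = 0 by have [_ [_ + _]] := hphi j; apply.
have pfar j x : class x0 x -> ~ rball x0 (r j + l j) x -> phi j x = 1 by have [_ [_ _ +]] := hphi j; apply.
(* At such points all terms of index at least [m] vanish, so the infinite sum is locally finite. *)
pose good m x := ~ class x0 x \/ rball x0 (r m) x.
have good0 m x j : good m x -> (m <= j)%N -> phi j x = 0.
  case=> [nx|mx] mj; first exact: pout.
  by apply: pin; have [e er re] := mx; exists e => //; apply: lt_le_trans er (rm _ _ mj).
have goodS m m' x : good m x -> (m <= m')%N -> \sum_(j < m') phi j x = \sum_(j < m) phi j x.
  move=> gm mm; rewrite -(subnKC mm) big_split_ord /= [X in _ + X]big1 ?addr0 // => i _.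
  by apply: good0 gm _; rewrite leq_addr.
have ex x : exists m, good m x.
  have [/class_rball[s sx]|nx] := pselect (class x0 x); last by exists 0%N; left.
  exists (Num.truncn s); right; have [e es re] := sx; exists e => //.
  apply: (lt_trans es); apply: lt_le_trans (rge _); exact: truncnS_gt.
have [N hN] := choice ex.
pose h x := \sum_(j < N x) phi j x.
have hE m x : good m x -> h x = \sum_(j < m) phi j x.
  move=> gm; rewrite /h -(goodS _ (maxn (N x) m) _ (hN x)) ?leq_maxl //.
  by rewrite (goodS _ _ _ gm) // leq_maxr.
have good_near m x : good m x -> \forall y \near x, good m y.
  case=> [nx|mx].
    apply: filterS (class_near a hM hg x) => y xy; left => cy; apply: nx.
    exact: class_trans cy (class_sym hM hg xy).
  by apply: filterS (open_nbhs_nbhs (conj (rball_open a hM hg x0 (r m)) mx)) => y my; right.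
have hnear x : \forall y \near x, \sum_(j < N x) phi j y = h y.
  by apply: filterS (good_near _ _ (hN x)) => y /hE ->.
have hS : smoothR A h.
  by apply: smoothR_of_local => p; exists (fun y => \sum_(j < N p) phi j y); [exact: smoothR_bigsum|exact: hnear].
have ha b x : h (a b x) = h x.
  rewrite (hE (N x)); first by apply: eq_bigr => j _; exact: pa.
  have [nx|mx] := hN x; last by right; exact: rball_orbit.
  by left => /(class_act b^-1%g); rewrite -act_mul mulVg act_one.
have hge0 x : 0 <= h x by apply: sumr_ge0 => j _; have /andP[] := p01 j x.
have rcn0 j x : class x0 x -> ~ rball x0 (r j + l j + 1) x -> rcn A g (phi j) x = 0.
  move=> cx nx; apply: (rcn_local_cst hM hg (b := 1)) => //.
  apply: filterS (rball_near a hM hg x (ltr01 : 0 < 1 :> R)) => y xy.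
  apply: pfar; first by apply: class_trans cx _; exact: rball_class xy.
  by move=> ry; apply: nx; apply: (reach_le_rball ry (rball_sym hM hg xy)).
have rcn1 j x : good j x -> rcn A g (phi j) x = 0.
  move=> gj; apply: (rcn_local_cst hM hg (b := 0)) => //.
  by apply: filterS (good_near _ _ gj) => y gy; apply: good0 gy _.
have rcnh J x : ~ rball x0 (r J) x -> rcn A g h x <= C / l J.
  move=> nJ; have CJ : 0 <= C / l J by rewrite divr_ge0 // ltW.
  rewrite (rcn_near hS (smoothR_bigsum (N x) pS) (hnear x)).
  apply: rcn_le => //; first exact: smoothR_bigsum.
  apply: (@grad_le_mono _ _ _ _ _ _ _ (\sum_(j < N x) rcn A g (phi j) x)); last first.
    by apply: (@grad_le_bigsum (N x) phi (fun j => rcn A g (phi j) x) x pS) => j; apply: rcn_grad.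
  have [cx|nx] := pselect (class x0 x); last first.
    by rewrite big1 // => j _; apply: rcn1; left.
  (* For the least good index, written [m.+1] when positive, [x] lies outside the ball of radius
     [r m] and inside that of radius [r m.+1]: only [phi m] can have a nonzero gradient. *)
  have exg : exists m, `[< good m x >] by exists (N x); apply/asboolP.
  case: (ex_minnP exg) => m /asboolP gm mmin.
  case: m gm mmin => [|m] gm mmin.
    rewrite big1 // => j _; apply: rcn1; case: gm => [//|rx]; right.
    by have [e er re] := rx; exists e => //; apply: lt_le_trans er (rm _ _ (leq0n _)).
  have ngm : ~ rball x0 (r m) x.
    by move=> rx; have := mmin m; rewrite ltnn => /implyP; rewrite implybF => /asboolP; apply; right.
  have Jm : (J <= m)%N.
    rewrite leqNgt; apply/negP => mJ; apply: nJ; case: gm => [//|[e er re]]; exists e => //.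
    by apply: lt_le_trans er (rm _ _ _).
  apply: (@le_trans _ _ (\sum_(j < N x) (if (j : nat) == m then C / l m else 0))).
    apply: ler_sum => j _; case: eqP => [->|jm]; first exact: pC.
    have [jlt|mlt|//] := ltngtP j m.
      rewrite rcn0 // => rx; apply: ngm; have [e er re] := rx; exists e => //.
      by apply: lt_le_trans er (rl _ _ jlt).
    rewrite rcn1 //; case: gm => [//|[e er re]]; right; exists e => //.
    by apply: lt_le_trans er (rm _ _ mlt).
  have Cm : 0 <= C / l m by rewrite divr_ge0 // ltW.
  apply: (@le_trans _ _ (C / l m)); last first.
    by rewrite ler_wpM2l ?(ltW C0) // lef_pV2 ?posrE // ler_nat ltnS.
  have [mN|Nm] := ltnP m (N x).
    by rewrite (bigD1 (Ordinal mN)) //= eqxx big1 ?addr0 // => i; rewrite -val_eqE /= => /negPf ->.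
  by rewrite big1 // => i _; rewrite ltn_eqF // (leq_trans (ltn_ord i)).
exists h; split; last split.
- split=> // e e0; pose J := Num.truncn (C / e).
  exists (rball x0 (r J)); first exact: (rball_Gcompact hG hM hact hg hiso hcomplete).
  move=> x /rcnh hx; apply: (le_lt_trans hx); rewrite /l ltr_pdivrMr ?ltr0n // mulrC -ltr_pdivrMr //.
  exact: truncnS_gt.
- move=> t; pose J := Num.truncn t.
  (* Beyond the radius [r J.+1] the first [J.+1] terms of the sum are equal to 1. *)
  have [y [cy ny]] : exists y, class x0 y /\ ~ rball x0 (r J.+1) y.
    apply: contrapT => H; apply: ncx.
    apply: Gcompact_sub (rball_Gcompact hG hM hact hg hiso hcomplete x0 (r J.+1)) => y cy.
    by apply: contrapT => ny; apply: H; exists y.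
  exists y; apply: (@lt_le_trans _ _ J.+1%:R); first exact: truncnS_gt.
  have JN : (J.+1 <= N y)%N.
    rewrite leqNgt; apply/negP => NJ; apply: ny; case: (hN y) => [//|[e er re]]; exists e => //.
    by apply: lt_le_trans er (rm _ _ _); exact: ltnW.
  rewrite /h -(subnKC JN) big_split_ord /= -[leLHS]addr0; apply: lerD.
    rewrite -[X in X%:R]card_ord -sumr_const; apply: ler_sum => j _ /=; rewrite pfar // => ry.
    apply: ny; have [e er re] := ry; exists e => //; apply: (lt_le_trans er).
    by apply: le_trans (rl _ _ (ltn_ord j)); rewrite lerDl.
  by apply: sumr_ge0 => j _; have /andP[] := p01 (rshift J.+1 j) y.
- move=> B oB oC Ba x Bx; have [cx|nx] := pselect (class x0 x); last first.
    by exists x => //; rewrite /h big1 // => j _; exact: pout.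
  exists x0; first by apply: clopen_class Bx => //; exact: (class_sym hM hg cx).
  by rewrite /h big1 // => j _; apply: pin; exists 0; [rewrite ltr0n|exact: reach_refl].
Qed.

(** Finitely many cocompact classes cannot cover [M], so a new class can be chosen at every step. *)
Lemma classes_sequence : (forall x, Gcompact a (class x)) -> ~ Gcompact a [set: M] ->
  exists u : nat -> M, forall i j, i <> j -> ~ class (u i) (u j).
Proof.
move=> hc nc.
have ex (s : seq M) : exists y, forall x, List.In x s -> ~ class x y.
  apply: contrapT => H; apply: nc.
  have : Gcompact a [set y | exists2 x, List.In x s & class x y].
    elim: s {H} => [|x s IH]; first by apply: Gcompact_sub (Gcompact0 a) => y [].
    apply: Gcompact_sub (Gcompact_setU (hc x) IH) => y [z [<-|zs] zy]; first by left.
    by right; exists z.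
  apply: Gcompact_sub => y _; apply: contrapT => H2; apply: H; exists y => x xs xy.
  by apply: H2; exists x.
have [F hF] := choice ex.
pose us := fix us m : seq M := if m is m'.+1 then F (us m') :: us m' else [::].
have usI i j : (i < j)%N -> List.In (F (us i)) (us j).
  elim: j => // j IH; rewrite ltnS leq_eqVlt => /orP[/eqP ->|/IH h]; first by left.
  by right.
exists (fun m => F (us m)) => i j ij.
have [lt|lt|//] := ltngtP i j; first by apply: hF; exact: usI.
by move=> /(class_sym hM hg); apply: hF; exact: usI.
Qed.

End HigsonFunction.

(** The reals are uncountable because countable sets have Lebesgue measure 0, whereas [0, 1] has
    measure 1. *)
Lemma uncountable_of_chain {R : realType} (X : Type) (B : set X) (F : R -> X) :
  (forall c, B (F c)) -> (forall c c', c < c' -> F c <> F c') -> ~ countable B.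
Proof.
move=> FB Fne cB.
have Finj : {in [set: R] &, injective F}.
  move=> c c' _ _ E; apply/eqP; apply: contraT => cc'.
  have [lt|lt|eq] := ltgtP c c'; [by case: (Fne _ _ lt)|by case: (Fne _ _ lt)|].
  by rewrite eq eqxx in cc'.
have cR : countable [set: R].
  have /countable_injP[f fi] := cB; apply/countable_injP; exists (f \o F) => c c' _ _ /= e.
  by apply: Finj; rewrite ?inE //; apply: fi; rewrite ?inE.
have := @countable_lebesgue_measure0 R `[0, 1]%classic.
rewrite lebesgue_measure_itv /= lte_fin ltr01 oppr0 adde0 => H.
have : (1%:E : \bar R) = 0%E by apply: H; apply: sub_countable cR; exact: subset_card_le.
by move=> [] /eqP; rewrite oner_eq0.
Qed.

(** * Membership in the algebras *)

Section ComplexNorm.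
Context {R : realType}.
Local Open Scope complex_scope.
Implicit Types z : R[i].

(** The norm of [R[i]] takes its values in [R[i]]; estimates are made with this real form. *)
Definition cnorm z : R := Num.sqrt (complex.Re z ^+ 2 + complex.Im z ^+ 2).

Lemma cnormE z : `|z| = (cnorm z)%:C. Proof. by case: z. Qed.

Lemma cnorm_ge0 z : 0 <= cnorm z. Proof. exact: sqrtr_ge0. Qed.

Lemma cnorm_lt z (e : R) : (`|z| < e%:C) = (cnorm z < e). Proof. by rewrite cnormE ltcR. Qed.

Lemma cnorm_le z (e : R) : (`|z| <= e%:C) = (cnorm z <= e). Proof. by rewrite cnormE lecR. Qed.

Lemma cnormD z1 z2 : cnorm (z1 + z2) <= cnorm z1 + cnorm z2.
Proof. by have := ler_normD z1 z2; rewrite !cnormE -rmorphD lecR. Qed.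

Lemma cnormM z1 z2 : cnorm (z1 * z2) = cnorm z1 * cnorm z2.
Proof. by have := normrM z1 z2; rewrite !cnormE -rmorphM => /complexI. Qed.

Lemma cnormN z : cnorm (- z) = cnorm z.
Proof. by have := normrN z; rewrite !cnormE => /complexI. Qed.

Lemma cnorm_dist z1 z2 : cnorm (z1 - z2) = cnorm (z2 - z1).
Proof. by rewrite -cnormN opprB. Qed.

Lemma cnorm0 : cnorm 0 = 0. Proof. by rewrite /cnorm /= expr0n addr0 sqrtr0. Qed.

Lemma cnorm1 : cnorm 1 = 1. Proof. by rewrite /cnorm /= expr0n addr0 expr1n sqrtr1. Qed.

Lemma Re_le_cnorm z : `|complex.Re z| <= cnorm z.
Proof. by rewrite -sqrtr_sqr; apply: ler_wsqrtr; rewrite lerDl sqr_ge0. Qed.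

Lemma Im_le_cnorm z : `|complex.Im z| <= cnorm z.
Proof. by rewrite -sqrtr_sqr; apply: ler_wsqrtr; rewrite lerDr sqr_ge0. Qed.

Lemma sqrt_sqrD_le (x y : R) : 0 <= x -> 0 <= y -> Num.sqrt (x ^+ 2 + y ^+ 2) <= x + y.
Proof.
move=> x0 y0; rewrite -[leRHS]ger0_norm ?addr_ge0 // -sqrtr_sqr; apply: ler_wsqrtr.
by rewrite sqrrD addrAC lerDl mulrn_wge0 // mulr_ge0.
Qed.

Lemma cnorm_le_ReIm z : cnorm z <= `|complex.Re z| + `|complex.Im z|.
Proof.
rewrite /cnorm -(real_normK (num_real (complex.Re z))) -(real_normK (num_real (complex.Im z))).
exact: sqrt_sqrD_le.
Qed.

Lemma ReB z1 z2 : complex.Re (z1 - z2) = complex.Re z1 - complex.Re z2.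
Proof. by case: z1 => a b; case: z2 => c d. Qed.

Lemma ImB z1 z2 : complex.Im (z1 - z2) = complex.Im z1 - complex.Im z2.
Proof. by case: z1 => a b; case: z2 => c d. Qed.

Lemma complex_continuousP (T : topologicalType) (f : T -> R[i]) x :
  {for x, continuous (f : T -> R[i]^o)} <->
  forall e : R, 0 < e -> \forall y \near x, cnorm (f x - f y) < e.
Proof.
split=> [cf e e0|H].
  have e0' : 0 < e%:C by rewrite ltcR.
  have := @cvgr_dist_lt _ R[i]^o _ (nbhs x) _ f (f x) cf _ e0'.
  by move=> /(_ (nbhs_filter x)); apply: filterS => y; rewrite cnorm_lt.
apply/(@cvgrPdist_lt _ R[i]^o _ (nbhs x)) => e e0.
have eE : e = (complex.Re e)%:C.
  by move: e0; rewrite ltcE /=; case: e => a b /= /andP[/eqP -> _].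
have e0' : 0 < complex.Re e by move: e0; rewrite ltcE => /andP[].
by apply: filterS (H _ e0') => y h; rewrite eE cnorm_lt.
Qed.

Lemma continuous_Re (T : topologicalType) (f : T -> R[i]) x : {for x, continuous (f : T -> R[i]^o)} ->
  {for x, continuous (fun y => complex.Re (f y) : R^o)}.
Proof.
move/complex_continuousP => H; apply/(@cvgrPdist_lt _ R^o _ (nbhs x)) => e /H.
by apply: filterS => y; apply: le_lt_trans; rewrite -ReB Re_le_cnorm.
Qed.

Lemma continuous_Im (T : topologicalType) (f : T -> R[i]) x : {for x, continuous (f : T -> R[i]^o)} ->
  {for x, continuous (fun y => complex.Im (f y) : R^o)}.
Proof.
move/complex_continuousP => H; apply/(@cvgrPdist_lt _ R^o _ (nbhs x)) => e /H.
by apply: filterS => y; apply: le_lt_trans; rewrite -ImB Im_le_cnorm.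
Qed.

Lemma continuous_ReIm (T : topologicalType) (f : T -> R[i]) x :
  {for x, continuous (fun y => complex.Re (f y) : R^o)} -> {for x, continuous (fun y => complex.Im (f y) : R^o)} ->
  {for x, continuous (f : T -> R[i]^o)}.
Proof.
move=> cR cI; apply/complex_continuousP => e e0; have e2 : 0 < e / 2 by rewrite divr_gt0.
have h1 := @cvgr_dist_lt _ R^o _ (nbhs x) _ _ _ cR _ e2.
have h2 := @cvgr_dist_lt _ R^o _ (nbhs x) _ _ _ cI _ e2.
near=> y; apply: (le_lt_trans (cnorm_le_ReIm _)); rewrite ReB ImB [ltRHS]splitr.
by apply: ltrD; near: y; [exact: h1|exact: h2].
Unshelve. all: by end_near. Qed.

End ComplexNorm.

Section Membership.
Context {R : realType} {k n : nat} {G : groupTopType} {M : topologicalType}.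
Variables (AG : atlas 'rV[R]_k G) (A : atlas 'rV[R]_n M) (a : group_action G M).
Hypothesis hG : lie_group AG.
Hypothesis hM : is_manifold A.
Hypothesis hact : smooth_map (prod_atlas AG A) A (fun z => a z.1 z.2).
Hypothesis hprop : proper_action a.
Variable g : M -> 'rV[R]_n -> 'rV[R]_n -> R.
Hypothesis hg : riemannian_metric A g.
Hypothesis hiso : isometric_action A g a.
Local Open Scope complex_scope.

Let sM : smooth_atlas A. Proof. by have [] := hM. Qed.

(** Isometry gives one inequality, and the same for the inverse element gives the other. *)
Lemma rcn_invariant (f : M -> R) h x : smoothR A f -> (forall b y, f (a b y) = f y) -> rcn A g f (a h x) = rcn A g f x.
Proof.
move=> fS fa.
have le b y : rcn A g f y <= rcn A g f (a b y).
  apply: rcn_le => //; first exact: rcn_ge0.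
  move=> v; have h1 := rcn_grad sM hg (a b y) fS (tangent_map A A (a b) y v).
  rewrite (gnrm_act hiso) in h1; apply: le_trans h1.
  rewrite -(tangent_act hG hM hact) //.
  by have -> : f \o a b = f by apply/funext => z /=.
apply/eqP; rewrite eq_le le andbT.
by have := le h^-1%g (a h x); rewrite -act_mul mulVg act_one.
Qed.

Lemma grad_le_comp (F : R^o -> R^o) (h : M -> R) x (C B d : R) : (forall l, Ck l setT F) -> smoothR A h ->
  is_derive (h x) (1 : R) (F : R -> R) d -> `|d| <= C -> grad_le A g h x B -> grad_le A g (fun y => F (h y)) x (C * B).
Proof.
move=> FC hS dF dC hB.
have [Ac dc] := chart_at_ok sM x; set c := chart_at A x in Ac dc; have hc := chart_ok sM Ac.
have cx := cimg_cmap dc; move: hB dF; rewrite -[x](cmapK hc dc) => hB dF.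
apply/(grad_le_chart sM) => //; first exact: smoothR_compR.
move=> v.
have dh : derivable (h \o cinv c : 'rV[R]_n -> R^o) (cmap c x) v := Ck_derivable (hS.2 c Ac 1%N) cx.
have h2 := @is_derive_comp1 R 'rV[R]_n F d (h \o cinv c) (cmap c x) v dF dh.
rewrite (@derive_val _ _ _ _ _ _ _ h2) normrM -mulrA; apply: ler_pM => //.
by move: v {dh h2}; apply/(grad_le_chart sM).
Qed.

(** The decay condition of [C0G] by itself, so that continuity and invariance need not be carried
    through computations with traces and matrix entries. *)
Definition vanish (f : M -> R[i]) := forall e : R, 0 < e -> exists2 S, Gcompact a S & forall x, ~ S x -> cnorm (f x) < e.

Lemma C0G_vanish f : C0G a f -> vanish f.
Proof.
move=> [_ _ H] e /H[M1 [cM h]]; exists M1; first exact: (cocompact_Gcompact hM hact).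
by move=> x /h; rewrite cnorm_lt.
Qed.

Lemma vanish_add f1 f2 : vanish f1 -> vanish f2 -> vanish (fun x => f1 x + f2 x).
Proof.
move=> h1 h2 e e0; have e2 : 0 < e / 2 by rewrite divr_gt0.
have [S1 c1 s1] := h1 _ e2; have [S2 c2 s2] := h2 _ e2.
exists (S1 `|` S2); first exact: Gcompact_setU.
move=> x nx; apply: (le_lt_trans (cnormD _ _)); rewrite [ltRHS]splitr; apply: ltrD.
  by apply: s1 => h; apply: nx; left.
by apply: s2 => h; apply: nx; right.
Qed.

Lemma vanish0 : vanish (fun=> 0).
Proof. by move=> e e0; exists set0; [exact: Gcompact0|move=> x _; rewrite cnorm0]. Qed.

Lemma vanish_sum (I : Type) (r : seq I) (F : I -> M -> R[i]) : (forall i, vanish (F i)) -> vanish (fun x => \sum_(i <- r) F i x).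
Proof.
move=> H; elim: r => [|i r IH].
  have -> : (fun x => \sum_(i <- [::]) F i x) = (fun=> 0) by apply/funext => x; rewrite big_nil.
  exact: vanish0.
have -> : (fun x => \sum_(i <- i :: r) F i x) = (fun x => F i x + \sum_(i <- r) F i x) by apply/funext => x; rewrite big_cons.
exact: vanish_add.
Qed.

Lemma C0G0 : C0G a (fun=> 0 : R[i]).
Proof.
split=> //; first by move=> x; exact: cvg_cst.
move=> e e0; exists set0; split; last by move=> x _; rewrite normr0 ltcR.
apply: (Gcompact_cocompact hM hact hprop); exact: Gcompact0.
Qed.

(** The function is smooth and serves as its own approximation; the norm of its differential is at
    most the sum of those of the real and imaginary parts. *)
Lemma CgG_of_real (u v : M -> R) : smoothR A u -> smoothR A v -> (forall h x, u (a h x) = u x) -> (forall h x, v (a h x) = v x) ->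
  (exists B : R, forall x, `|u x| <= B /\ `|v x| <= B) ->
  (forall e : R, 0 < e -> exists2 S, Gcompact a S & forall x, ~ S x -> rcn A g u x + rcn A g v x < e) ->
  CgG A g a (fun x => (u x) +i* (v x)).
Proof.
move=> uS vS ua va [B hB] H.
have CB : CbG a (fun x => (u x) +i* (v x)).
  split.
  - by move=> x; apply: continuous_ReIm; [exact: uS.1|exact: vS.1].
  - by move=> h x; rewrite ua va.
  - exists (B + B) => x; rewrite cnorm_le; apply: (le_trans (cnorm_le_ReIm _)) => /=.
    by have [h1 h2] := hB x; apply: lerD.
split=> // e e0; exists (fun x => (u x) +i* (v x)); last by move=> x; rewrite subrr normr0 lecR ltW.
split; [exact: CB|by split; apply/(smRP A)|].
pose q x := Num.sqrt (rcn A g u x ^+ 2 + rcn A g v x ^+ 2).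
have qc : continuous (q : M -> R^o).
  move=> x; apply: (@continuous_comp _ R^o R^o (fun x => rcn A g u x ^+ 2 + rcn A g v x ^+ 2) (Num.sqrt : R^o -> R^o)); last exact: sqrt_continuous.
  apply: (@cvgD R R^o _ (nbhs x)).
    by apply: (@cvgM R _ (nbhs x)); exact: (rcn_continuous sM hg uS).
  by apply: (@cvgM R _ (nbhs x)); exact: (rcn_continuous sM hg vS).
split.
- by move=> x; apply: continuous_ReIm => /=; [exact: qc|exact: cvg_cst].
- by move=> h x; rewrite /codiff_norm /= -!/(rcn A g _ _) !rcn_invariant.
move=> d /H[S cS hS]; exists S; split; first exact: (Gcompact_cocompact hM hact hprop).
move=> x /hS h1; rewrite cnorm_lt; apply: le_lt_trans h1.
have r1 := rcn_ge0 sM hg x uS; have r2 := rcn_ge0 sM hg x vS.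
apply: (le_trans (cnorm_le_ReIm _)); rewrite /= normr0 addr0 ger0_norm ?sqrtr_ge0 //.
change (Num.sqrt (rcn A g u x ^+ 2 + rcn A g v x ^+ 2) <= rcn A g u x + rcn A g v x).
exact: (sqrt_sqrD_le r1 r2).
Qed.

Lemma CgG_cst (c : R) : CgG A g a (fun=> c%:C).
Proof.
apply: (@CgG_of_real (fun=> c) (fun=> 0)) => //; try exact: smoothR_cst.
  by exists `|c| => x; rewrite normr0.
move=> e e0; exists set0; first exact: Gcompact0.
by move=> x _; rewrite !(rcn_local_cst hM hg (smoothR_cst A _) (filterE _ (fun=> erefl))) addr0.
Qed.

Lemma CgG_indic (B : set M) : open B -> open (~` B) -> (forall h x, B (a h x) <-> B x) ->
  CgG A g a (fun x => (if `[< B x >] then 1 else 0)%:C).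
Proof.
move=> oB oC Ba; pose u x : R := if `[< B x >] then 1 else 0.
have loc (p : M) : exists b : R, \forall q \near p, b = u q.
  have [Bp|nBp] := pselect (B p).
    by exists 1; apply: filterS (open_nbhs_nbhs (conj oB Bp)) => q Bq; rewrite /u asboolT.
  by exists 0; apply: filterS (open_nbhs_nbhs (conj oC nBp)) => q Bq; rewrite /u asboolF.
have uS : smoothR A u.
  by apply: (smoothR_of_local hM) => p; have [b hb] := loc p; exists (fun=> b); [exact: smoothR_cst|exact: hb].
apply: (@CgG_of_real u (fun=> 0)) => //; try exact: smoothR_cst.
- by move=> h x; rewrite /u (asbool_equiv_eq (Ba h x)).
- by exists 1 => x; rewrite normr0 ler01 /u; split=> //; case: ifP => _; rewrite ?normr1 ?normr0.
move=> e e0; exists set0; first exact: Gcompact0.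
move=> x _; rewrite (rcn_local_cst hM hg (smoothR_cst A _) (filterE _ (fun=> erefl))) addr0.
have [b hb] := loc x; rewrite (rcn_local_cst hM hg (b := b) uS) //.
by apply: filterS hb => q ->.
Qed.

Lemma CgG_exp (h : M -> R) (c : R) : smoothR A h -> (forall b x, h (a b x) = h x) ->
  (forall e : R, 0 < e -> exists2 S, Gcompact a S & forall x, ~ S x -> rcn A g h x < e) ->
  CgG A g a (fun x => cos (c * h x) +i* sin (c * h x)).
Proof.
move=> hS ha H.
have mC l : Ck l setT (fun t : R^o => c * t : R^o).
  apply: Ck_mul; [exact: openT|exact: Ck_cst|].
  by apply: (@Ck_linear R R^o R^o l setT (idfun : {linear R^o -> R^o})) => x; exact: cvg_id.
have cC l : Ck l setT (fun t : R^o => cos (c * t) : R^o).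
  by apply: (@Ck_comp_R R R^o l (cos : R^o -> R^o) setT) => //; [exact: openT|exact: openT|exact: (Ck_sin_cos l).2].
have sC l : Ck l setT (fun t : R^o => sin (c * t) : R^o).
  by apply: (@Ck_comp_R R R^o l (sin : R^o -> R^o) setT) => //; [exact: openT|exact: openT|exact: (Ck_sin_cos l).1].
have uS : smoothR A (fun x => cos (c * h x)) := smoothR_compR sM cC hS.
have vS : smoothR A (fun x => sin (c * h x)) := smoothR_compR sM sC hS.
have dm (t : R) : is_derive t (1 : R) (fun t => c * t) c.
  have h0 := @is_deriveM R R^o (cst (c : R)) id t 1 0 1 (is_derive_cst _ _ _) (is_derive_id _ _).
  by apply: is_derive_eq h0 _; rewrite scaler0 addr0 /GRing.scale /= mulr1.
have sin1 (t : R) : `|sin t| <= 1 by rewrite ler_norml sin_geN1 sin_le1.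
have cos1 (t : R) : `|cos t| <= 1 by rewrite ler_norml cos_geN1 cos_le1.
have b1 x : rcn A g (fun x => cos (c * h x)) x <= `|c| * rcn A g h x.
  apply: rcn_le => //; first by rewrite mulr_ge0 // rcn_ge0.
  have d1 := @is_derive1_comp R (cos : R -> R) (fun t => c * t) (h x) _ _ (is_derive_cos (c * h x : R)) (dm (h x)).
  apply: (grad_le_comp cC hS d1); last exact: rcn_grad.
  by rewrite mulNr normrN normrM ler_piMl.
have b2 x : rcn A g (fun x => sin (c * h x)) x <= `|c| * rcn A g h x.
  apply: rcn_le => //; first by rewrite mulr_ge0 // rcn_ge0.
  have d1 := @is_derive1_comp R (sin : R -> R) (fun t => c * t) (h x) _ _ (is_derive_sin (c * h x : R)) (dm (h x)).
  apply: (grad_le_comp sC hS d1); last exact: rcn_grad.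
  by rewrite normrM ler_piMl.
apply: CgG_of_real => //; try by move=> b x; rewrite ha.
  by exists 1.
move=> e e0; have c1 : 0 < 2 * (`|c| + 1) by rewrite mulr_gt0 // ltr_wpDl.
have [S cS hS'] := H (e / (2 * (`|c| + 1))) (divr_gt0 e0 c1); exists S => // x /hS' hx.
apply: (le_lt_trans (lerD (b1 x) (b2 x))).
move: hx; rewrite ltr_pdivlMr // => hx; apply: le_lt_trans hx.
have r0 := rcn_ge0 sM hg x hS; nra.
Qed.

End Membership.

(** * K-theory of the corona *)

Section MatrixFunctions.
Context {R : realType} {T : Type}.
Variables S J : set (T -> R[i]).
Local Notation F := (T -> R[i]).

Definition evmx {m n} (x : T) (u : 'M[F]_(m, n)) : 'M[R[i]]_(m, n) := \matrix_(i, j) u i j x.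

Lemma evmx_mul m n p (u : 'M[F]_(m, n)) (v : 'M[F]_(n, p)) x : evmx x (u *m v) = evmx x u *m evmx x v.
Proof.
apply/matrixP => i j; rewrite !mxE fct_sumE; apply: eq_bigr => l _; by rewrite !mxE.
Qed.

Lemma evmx_dsum m n (u : 'M[F]_m) (v : 'M[F]_n) x : evmx x (dsum u v) = block_mx (evmx x u) 0 0 (evmx x v).
Proof.
apply/matrixP => i j; rewrite /dsum !mxE; case: splitP => i' _; rewrite !mxE; case: splitP => j' _; by rewrite !mxE.
Qed.

Lemma evmx1 n x : evmx x (1%:M : 'M[F]_n) = 1%:M.
Proof. by apply/matrixP => i j; rewrite !mxE; case: (i == j). Qed.

Hypothesis J0 : J 0.

Lemma dsum_mul m n (u u' : 'M[F]_m) (v v' : 'M[F]_n) : dsum u v *m dsum u' v' = dsum (u *m u') (v *m v').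
Proof. by rewrite /dsum mulmx_block !mulmx0 !mul0mx !addr0 !add0r. Qed.

Lemma mxin_dsum (X : set F) m n (u : 'M[F]_m) (v : 'M[F]_n) : X 0 -> mxin X u -> mxin X v -> mxin X (dsum u v).
Proof.
move=> X0 hu hv i j; rewrite /dsum !mxE; case: splitP => i' _; rewrite !mxE; case: splitP => j' _ //; rewrite ?mxE //.
Qed.

Lemma eqmodJ_dsum m n (u u' : 'M[F]_m) (v v' : 'M[F]_n) : eqmodJ J u u' -> eqmodJ J v v' ->
  eqmodJ J (dsum u v) (dsum u' v').
Proof.
move=> hu hv; rewrite /eqmodJ.
have -> : dsum u v - dsum u' v' = dsum (u - u') (v - v').
  by rewrite /dsum opp_block_mx add_block_mx !oppr0 !addr0.
exact: mxin_dsum.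
Qed.

Lemma eqmodJ_refl m n (u : 'M[F]_(m, n)) : eqmodJ J u u.
Proof. by move=> i j; rewrite !mxE subrr. Qed.

Lemma dsum_idem m n (u : 'M[F]_m) (v : 'M[F]_n) : eqmodJ J (u *m u) u -> eqmodJ J (v *m v) v ->
  eqmodJ J (dsum u v *m dsum u v) (dsum u v).
Proof. by move=> hu hv; rewrite dsum_mul; exact: eqmodJ_dsum. Qed.

Hypothesis S0 : S 0.
Hypothesis S1 : S 1.

(** The empty matrix represents 0, so that [(p, idem0)] stands for the class of [p]. *)
Definition idem0 : idempotent_mx S J.
Proof. by apply: (@IdempotentMx R T S J 0 0); move=> []. Defined.

Lemma K0_rel_refl (z : idempotent_mx S J * idempotent_mx S J) : K0_rel z z.
Proof.
exists idem0; set P := dsum _ _.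
have PI : eqmodJ J (P *m P) P by do 2 (apply: dsum_idem; last by apply: imx_idem); apply: imx_idem.
have PS : mxin S P by apply: mxin_dsum => //; [apply: mxin_dsum => //; exact: imx_in|exact: imx_in].
by exists P, P.
Qed.

Lemma mxin1 n : mxin S (1%:M : 'M[F]_n).
Proof. by move=> i j; rewrite mxE; case: (i == j). Qed.

Lemma K1_rel_refl (u : invertible_mx S J) : K1_rel u u.
Proof.
exists 0%N, 0%N, erefl; rewrite castmx_id; exists (fun=> dsum (gmx u) (1%:M : 'M[F]_0)); split.
- move=> t _; have [uS [v [vS h1 h2]]] := gmx_inv u.
  split; first by apply: mxin_dsum => //; exact: mxin1.
  exists (dsum v 1%:M); split; first by apply: mxin_dsum => //; exact: mxin1.
    by rewrite dsum_mul mul1mx (scalar_mx_block (gdim u) 0); apply: eqmodJ_dsum => //; exact: eqmodJ_refl.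
  by rewrite dsum_mul mul1mx (scalar_mx_block (gdim u) 0); apply: eqmodJ_dsum => //; exact: eqmodJ_refl.
- move=> t e _ e0; exists 1 => // s _ _ i j; exists 0, 0; split=> // x.
  by rewrite subrr subr0 normr0.
- exact: eqmodJ_refl.
- exact: eqmodJ_refl.
Qed.

Lemma K0_uncountable (p : R -> idempotent_mx S J) :
  (forall c c', c < c' -> ~ K0_rel (p c, idem0) (p c', idem0)) ->
  forall u : invertible_mx S J, ~ countable (K0 S J `*` K1 S J).
Proof.
move=> hp u; pose f c := ([set w | K0_rel (p c, idem0) w], [set v | K1_rel u v]).
apply: (@uncountable_of_chain R _ _ f) => [c|c c' cc' E].
  by split; [exists (p c, idem0)|exists u].
apply: (hp c c' cc').
have [E1 _] : [set w | K0_rel (p c, idem0) w] = [set w | K0_rel (p c', idem0) w] /\ True by case: E.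
have : [set w | K0_rel (p c', idem0) w] (p c', idem0) by exact: K0_rel_refl.
by rewrite -E1.
Qed.

Lemma K1_uncountable (u : R -> invertible_mx S J) :
  (forall c c', c < c' -> ~ K1_rel (u c) (u c')) -> ~ countable (K0 S J `*` K1 S J).
Proof.
move=> hu; pose f c := ([set w | K0_rel (idem0, idem0) w], [set v | K1_rel (u c) v]).
apply: (@uncountable_of_chain R _ _ f) => [c|c c' cc' E].
  by split; [exists (idem0, idem0)|exists (u c)].
apply: (hu c c' cc').
have [E1 _] : [set v | K1_rel (u c) v] = [set v | K1_rel (u c') v] /\ True by case: E.
have : [set v | K1_rel (u c') v] (u c') by exact: K1_rel_refl.
by rewrite -E1.
Qed.

End MatrixFunctions.

Section DetClose.
Context {R : realType}.

Lemma prod_bound (I : Type) (r : seq I) (a : I -> R[i]) (B : R) : 0 <= B -> (forall i, cnorm (a i) <= B) ->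
  cnorm (\prod_(i <- r) a i) <= B ^+ size r.
Proof.
move=> B0 hB; elim: r => [|i r IH]; first by rewrite big_nil cnorm1.
by rewrite big_cons cnormM exprS; apply: ler_pM => //; exact: cnorm_ge0.
Qed.

Lemma prod_close (I : Type) (r : seq I) (a b : I -> R[i]) (B d : R) : 0 <= B -> (forall i, cnorm (a i) <= B) ->
  (forall i, cnorm (b i) <= B) -> (forall i, cnorm (a i - b i) <= d) -> 0 <= d ->
  cnorm (\prod_(i <- r) a i - \prod_(i <- r) b i) <= (size r)%:R * B ^+ (size r).-1 * d.
Proof.
move=> B0 ha hb hd d0; elim: r => [|i r IH]; first by rewrite !big_nil subrr cnorm0 mul0r mul0r.
rewrite !big_cons.
have -> : a i * \prod_(j <- r) a j - b i * \prod_(j <- r) b j =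
  a i * (\prod_(j <- r) a j - \prod_(j <- r) b j) + (a i - b i) * \prod_(j <- r) b j by ring.
apply: (le_trans (cnormD _ _)); rewrite !cnormM /=.
have h1 : cnorm (a i) * cnorm (\prod_(j <- r) a j - \prod_(j <- r) b j) <= (size r)%:R * B ^+ size r * d.
  apply: (@le_trans _ _ (B * ((size r)%:R * B ^+ (size r).-1 * d))).
    by apply: ler_pM => //; exact: cnorm_ge0.
  case: (size r) => [|m]; first by rewrite !mul0r mulr0.
  by rewrite /= exprS le_eqVlt; apply/orP; left; apply/eqP; ring.
have h2 : cnorm (a i - b i) * cnorm (\prod_(j <- r) b j) <= d * B ^+ size r.
  by apply: ler_pM; rewrite ?cnorm_ge0 ?prod_bound.
by apply: (le_trans (lerD h1 h2)); rewrite -natr1 le_eqVlt; apply/orP; left; apply/eqP; ring.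
Qed.

Lemma cnorm_sum (I : Type) (r : seq I) (F : I -> R[i]) : cnorm (\sum_(i <- r) F i) <= \sum_(i <- r) cnorm (F i).
Proof.
elim: r => [|i r IH]; first by rewrite !big_nil cnorm0.
by rewrite !big_cons; apply: (le_trans (cnormD _ _)); rewrite lerD2l.
Qed.

(** The Leibniz formula, with products compared factor by factor. The constant depends only on the
    size and the bound of the entries, hence is uniform over the points of the manifold. *)
Lemma det_lipschitz n (B : R) : 0 <= B -> exists2 K : R, 0 <= K & forall (U V : 'M[R[i]]_n) d, 0 <= d ->
  (forall i j, cnorm (U i j) <= B) -> (forall i j, cnorm (V i j) <= B) ->
  (forall i j, cnorm (U i j - V i j) <= d) -> cnorm (\det U - \det V) <= K * d.
Proof.
move=> B0; pose s := index_enum ('I_n : finType).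
exists (\sum_(p : 'S_n) (size s)%:R * B ^+ (size s).-1).
  by apply: sumr_ge0 => p _; rewrite mulr_ge0 // exprn_ge0.
move=> U V d d0 hU hV hUV; rewrite /determinant -sumrB mulr_suml.
apply: (le_trans (cnorm_sum _ _)); apply: ler_sum => p _.
rewrite -mulrBr cnormM.
have -> : cnorm ((-1 : R[i]) ^+ p) = 1.
  by have h1 := normr_sign R[i] p; rewrite cnormE in h1; exact: (@complexI R _ 1 h1).
by rewrite mul1r; apply: prod_close.
Qed.

End DetClose.

(** * Continuous arguments of quotients of functions *)

Section LogRelation.
Context {R : realType} {G : groupTopType} {M : topologicalType}.
Variable a : group_action G M.
Variable h : M -> R.
Hypothesis ha : forall b x, h (a b x) = h x.
Local Open Scope complex_scope.
Implicit Types f : M -> R[i].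

(* Where [h] is large, the quotient [f2 / f1] has a bounded continuous invariant argument. *)
Definition homotopic_args f1 f2 := exists r B (theta : M -> R^o), forall x, r < h x ->
  [/\ {for x, continuous theta}, `|theta x| <= B, forall b, theta (a b x) = theta x &
      exists2 rho : R, 0 < rho & f2 x = f1 x * (rho%:C * (cos (theta x) +i* sin (theta x)))].

Lemma cis_mul (s t : R) : (cos s +i* sin s) * (cos t +i* sin t) = cos (s + t) +i* sin (s + t).
Proof. by rewrite cosD sinD; apply/eqP; rewrite eq_complex /= eqxx /= addrC. Qed.

Lemma cis0 : (cos 0 +i* sin 0) = 1 :> R[i]. Proof. by rewrite cos0 sin0. Qed.

Lemma homotopic_args_refl f : homotopic_args f f.
Proof.
exists 0, 0, (fun=> 0) => x _; split=> //; [exact: cvg_cst|by rewrite normr0|].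
by exists 1 => //; rewrite cis0 !mulr1.
Qed.

Lemma homotopic_args_sym f1 f2 : homotopic_args f1 f2 -> homotopic_args f2 f1.
Proof.
move=> [r [B [t H]]]; exists r, B, (fun x => - t x) => x /H[tc tB ta [rho r0 e]]; split.
- by apply: (@cvgN R R^o _ (nbhs x)).
- by rewrite normrN.
- by move=> b; rewrite ta.
exists rho^-1; first by rewrite invr_gt0.
rewrite e -mulrA mulrACA cis_mul subrr cis0 mulr1 -rmorphM mulfV ?mulr1 // gt_eqF //.
Qed.

Lemma homotopic_args_trans f1 f2 f3 : homotopic_args f1 f2 -> homotopic_args f2 f3 -> homotopic_args f1 f3.
Proof.
move=> [r1 [B1 [t1 H1]]] [r2 [B2 [t2 H2]]].
exists (Num.max r1 r2), (B1 + B2), (fun x => t1 x + t2 x) => x; rewrite gt_max => /andP[h1 h2].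
have [c1 b1 a1 [s1 s10 e1]] := H1 x h1; have [c2 b2 a2 [s2 s20 e2]] := H2 x h2; split.
- by apply: (@cvgD R R^o _ (nbhs x)).
- by apply: (le_trans (ler_normD _ _)); exact: lerD.
- by move=> b; rewrite a1 a2.
exists (s1 * s2); first by rewrite mulr_gt0.
by rewrite e2 e1 -mulrA mulrACA cis_mul -rmorphM.
Qed.

(** The quotient [z] stays within 1/2 of 1, hence in the right half-plane, where atan(Im z / Re z)
    is a continuous argument bounded by pi/2. *)
Lemma homotopic_args_close f1 f2 (m r : R) : 0 < m ->
  continuous (f1 : M -> R[i]^o) -> continuous (f2 : M -> R[i]^o) ->
  (forall b x, f1 (a b x) = f1 x) -> (forall b x, f2 (a b x) = f2 x) ->
  (forall x, r < h x -> m <= cnorm (f1 x) /\ cnorm (f2 x - f1 x) <= m / 2) -> homotopic_args f1 f2.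
Proof.
move=> m0 c1 c2 a1 a2 H.
pose z x := f2 x / f1 x.
exists r, (pi / 2), (fun x => atan (complex.Im (z x) / complex.Re (z x))) => x /H[h1 h2].
have f10 : f1 x != 0 by apply/eqP => e; move: h1; rewrite e cnorm0; lra.
have zc : {for x, continuous (z : M -> R[i]^o)}.
  by apply: (@cvgM R[i] _ (nbhs x)); [exact: c2|apply: (@cvgV R[i] _ (nbhs x)) => //; exact: c1].
have z1 : cnorm (z x - 1) <= 2^-1.
  have -> : z x - 1 = (f2 x - f1 x) / f1 x by rewrite mulrBl mulfV.
  have e : cnorm ((f2 x - f1 x) / f1 x) * cnorm (f1 x) = cnorm (f2 x - f1 x) by rewrite -cnormM divfK.
  have c0 := cnorm_ge0 ((f2 x - f1 x) / f1 x); nra.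
have Rz : 0 < complex.Re (z x).
  have := le_trans (Re_le_cnorm _) z1; rewrite ReB /= ler_norml => /andP[]; lra.
set w := complex.Im (z x) / complex.Re (z x).
have [t1 t2] : - (pi / 2) < atan w /\ atan w < pi / 2 by split; [exact: atan_gtNpi2|exact: atan_ltpi2].
have cp : 0 < cos (atan w) by apply: cos_gt0_pihalf; rewrite t1.
split.
- apply: (@continuous_comp _ R^o R^o (fun x => complex.Im (z x) / complex.Re (z x)) (atan : R^o -> R^o)); last exact: continuous_atan.
  by apply: (@cvgM R _ (nbhs x)); [exact: continuous_Im|apply: (@cvgV R _ (nbhs x)); [rewrite gt_eqF|exact: continuous_Re]].
- by rewrite ler_norml !ltW.
- by move=> b; rewrite /z a1 a2.
exists (complex.Re (z x) / cos (atan w)); first by rewrite divr_gt0.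
have -> : f2 x = f1 x * z x by rewrite /z mulrC divfK.
congr (_ * _); apply/eqP; rewrite eq_complex /= !mul0r subr0 addr0; apply/andP; split; apply/eqP.
  by rewrite divfK // gt_eqF.
have tw : tan (atan w) = w := atanK w.
have -> : complex.Re (z x) / cos (atan w) * sin (atan w) = complex.Re (z x) * tan (atan w).
  by rewrite /tan; ring.
by rewrite tw /w mulrC divfK // gt_eqF.
Qed.

(** The class of 0 is open and closed, and the intermediate value theorem for its indicator,
    extended by clamping, concludes. Since every instance of [homotopic_args] has its own bound, no
    uniform bound along a path has to be tracked. *)
Lemma unit_interval_connected (P : R -> R -> Prop) :
  (forall t, P t t) -> (forall s t, P s t -> P t s) -> (forall s t u, P s t -> P t u -> P s u) ->
  (forall t, 0 <= t <= 1 -> exists2 d : R, 0 < d & forall s, 0 <= s <= 1 -> `|s - t| < d -> P t s) -> P 0 1.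
Proof.
move=> Pr Ps Pt loc; apply: contrapT => n01.
pose cl (t : R) : R := Num.min 1 (Num.max 0 t).
have cl01 t : 0 <= cl t <= 1 by rewrite /cl le_min ler01 le_max lexx /= ge_min lexx.
pose f (t : R) : R := if `[< P 0 (cl t) >] then 1 else 0.
have cf : continuous (f : R^o -> R^o).
  move=> t; have [d d0 hd] := loc (cl t) (cl01 t).
  apply: (@near_eq_cont R^o R^o (fun=> f t)); last exact: (@cst_continuous R^o R^o (f t)).
  have : \forall s \near t, `|t - s| < d by apply: (@cvgr_dist_lt _ R^o _ (nbhs t) _ id t); [exact: cvg_id|].
  apply: filterS => s ts; have P1 : P (cl t) (cl s).
    apply: hd => //; apply: (le_lt_trans (clamp_lip _ _)); by rewrite distrC.
  rewrite /f; congr (if _ then _ else _); apply: asbool_equiv_eq.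
  by split=> h0; [exact: Pt h0 P1|exact: Pt h0 (Ps _ _ P1)].
have [||t _] := @IVT R f 0 1 2^-1 ler01.
- exact: continuous_subspaceT.
- have e0 : cl 0 = 0 by rewrite /cl maxxx min_r // ler01.
  have e1 : cl 1 = 1 by rewrite /cl max_r ?ler01 // minxx.
  rewrite /f e0 e1 asboolT // asboolF //; apply/andP; split.
    by rewrite ge_min (_ : (0 : R) <= 2^-1) ?orbT // invr_ge0.
  by rewrite le_max (_ : 2^-1 <= (1 : R)) //; lra.
by rewrite /f; case: ifP => _; lra.
Qed.

End LogRelation.

(** * Traces of idempotents and determinants of invertibles over the corona *)

Section KTheoryOfCorona.
Context {R : realType} {k n : nat} {G : groupTopType} {M : topologicalType}.
Variables (AG : atlas 'rV[R]_k G) (A : atlas 'rV[R]_n M) (a : group_action G M).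
Hypothesis hG : lie_group AG.
Hypothesis hM : is_manifold A.
Hypothesis hact : smooth_map (prod_atlas AG A) A (fun z => a z.1 z.2).
Hypothesis hprop : proper_action a.
Variable g : M -> 'rV[R]_n -> 'rV[R]_n -> R.
Hypothesis hg : riemannian_metric A g.
Hypothesis hiso : isometric_action A g a.
Local Open Scope complex_scope.
Local Notation S := (CgG A g a).
Local Notation J := (C0G a).
Local Notation F := (M -> R[i]).
Local Notation vanish := (vanish a).
Local Notation class := (class A a g).

Let sM : smooth_atlas A. Proof. by have [] := hM. Qed.
Let J0 : J (0 : F). Proof. exact: (C0G0 hM hact hprop). Qed.
Let S0 : S (0 : F). Proof. exact: (CgG_cst hG hM hact hprop hg hiso 0). Qed.
Let S1 : S (1 : F). Proof. exact: (CgG_cst hG hM hact hprop hg hiso 1). Qed.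

Lemma vanish_opp (f : F) : vanish f -> vanish (fun x => - f x).
Proof. by move=> H e /H[B cB hB]; exists B => // x /hB; rewrite cnormN. Qed.

Lemma eqmodJ_vanish m l (u v : 'M[F]_(m, l)) i j : eqmodJ J u v -> vanish (fun x => u i j x - v i j x).
Proof.
move=> /(_ i j)/(C0G_vanish hM hact); rewrite !mxE.
by have -> : (fun x => u i j x - v i j x) = u i j - v i j by apply/funext.
Qed.

Lemma vanish_trace m (u v : 'M[F]_m) : eqmodJ J u v -> vanish (fun x => \tr (evmx x u) - \tr (evmx x v)).
Proof.
move=> uv.
have -> : (fun x => \tr (evmx x u) - \tr (evmx x v)) = (fun x => \sum_i (u i i x - v i i x)).
  by apply/funext => x; rewrite /mxtrace -sumrB; apply: eq_bigr => i _; rewrite !mxE.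
by apply: vanish_sum => i; exact: eqmodJ_vanish.
Qed.

(** At each point [x y] and [y x] have the same trace, and matrices congruent modulo the ideal have
    traces whose difference vanishes at infinity. *)
Lemma mvn_vanish_trace m l (p : 'M[F]_m) (q : 'M[F]_l) : mvn_equiv S J p q ->
  vanish (fun x => \tr (evmx x p) - \tr (evmx x q)).
Proof.
move=> [x [y [_ _ h1 h2]]].
have -> : (fun z => \tr (evmx z p) - \tr (evmx z q)) =
  (fun z => - (\tr (evmx z (x *m y)) - \tr (evmx z p)) + (\tr (evmx z (y *m x)) - \tr (evmx z q))).
  by apply/funext => z; rewrite !evmx_mul mxtrace_mulC opprB addrA subrK.
by apply: vanish_add; [apply: vanish_opp|]; exact: vanish_trace.
Qed.

Section Indicators.
Variable u : nat -> M.
Hypothesis uclass : forall i j, i <> j -> ~ class (u i) (u j).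

Definition classes_below (c : R) : set M := [set y | exists2 q : rat, ratr q < c & class (u (pickle q)) y].

Lemma open_classes_below c : open (classes_below c).
Proof.
rewrite openE => y [q qc yq]; apply: filterS (class_near a hM hg y) => z yz.
by exists q => //; exact: class_trans yq yz.
Qed.

Lemma closed_classes_below c : open (~` classes_below c).
Proof.
rewrite openE => y ny; apply: filterS (class_near a hM hg y) => z yz [q qc zq]; apply: ny.
by exists q => //; apply: class_trans zq (class_sym hM hg yz).
Qed.

Lemma classes_below_inv c b x : classes_below c (a b x) <-> classes_below c x.
Proof.
split=> [[q qc h]|[q qc h]]; exists q => //; last exact: class_act.
by have := class_act b^-1%g h; rewrite -act_mul mulVg act_one.
Qed.

Definition indic (c : R) : F := fun x => (if `[< classes_below c x >] then 1 else 0)%:C.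

Definition indic_idem (c : R) : idempotent_mx S J.
Proof.
apply: (@IdempotentMx R M S J 1 (const_mx (indic c))).
- move=> i j; rewrite mxE; apply: (CgG_indic hG hM hact hprop hg hiso).
  + exact: open_classes_below.
  + exact: closed_classes_below.
  + exact: classes_below_inv.
- move=> i j; rewrite !mxE big_ord1 !mxE.
  have -> : indic c * indic c - indic c = 0 :> F; last exact: J0.
  by apply/funext => x; change (indic c x * indic c x - indic c x = 0); rewrite /indic; case: ifP => _; rewrite ?mulr1 ?mulr0 subrr.
Defined.

(** In the difference of traces the stabilising summand [r] cancels, and the empty matrices
    contribute nothing. *)
Lemma K0_rel_indic c c' : K0_rel (indic_idem c, idem0 S J) (indic_idem c', idem0 S J) ->
  vanish (fun x => indic c x - indic c' x).
Proof.
move=> [r /mvn_vanish_trace].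
have -> // : (fun x => \tr (evmx x (dsum (dsum (imx (indic_idem c)) (imx (idem0 S J))) (imx r))) -
  \tr (evmx x (dsum (dsum (imx (indic_idem c')) (imx (idem0 S J))) (imx r)))) = (fun x => indic c x - indic c' x).
apply/funext => x; rewrite !evmx_dsum !mxtrace_block.
have tr1 c0 : \tr (evmx x (imx (indic_idem c0))) = indic c0 x by rewrite /mxtrace /= big_ord1 !mxE.
by rewrite !tr1 opprD addrACA subrr addr0 opprD addrACA subrr addr0.
Qed.

(** Classes are open and invariant, and each contains at most one of the points [u i]. *)
Lemma Gcompact_classes (B : set M) : Gcompact a B -> exists N, forall i x, B x -> class (u i) x -> (i < N)%N.
Proof.
move=> [K cK hK].
suff [N hN] : exists N, forall i x, K x -> class (u i) x -> (i < N)%N.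
  by exists N => i x /hK[b Kb] ix; apply: hN Kb _; exact: class_act.
apply: (compact_ind (P := fun B => exists N, forall i x, B x -> class (u i) x -> (i < N)%N) _ _ _ cK).
- by exists 0%N.
- move=> B1 B2 [N1 h1] [N2 h2]; exists (maxn N1 N2) => i x [b|b] ix; rewrite leq_max.
    by rewrite (h1 i x b ix).
  by rewrite (h2 i x b ix) orbT.
- by move=> B1 B2 B12 [N hN]; exists N => i x /B12; exact: hN.
move=> p _; exists (class p); first exact: (class_near a hM hg p).
have [[i ip]|none] := pselect (exists i, class (u i) p); last first.
  by exists 0%N => i x px ix; case: none; exists i; exact: class_trans ix (class_sym hM hg px).
exists i.+1 => j x px jx; have [->|/eqP ij] := eqVneq i j; first exact: ltnSn.
by case: (uclass ij); apply: class_trans (class_trans ip px) (class_sym hM hg jx).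
Qed.

(** Two distinct rationals cannot both have the code [N], so one of the two halves of the interval
    supplies a larger code. *)
Lemma rat_large_code N : forall c c' : R, c < c' -> exists q : rat, [/\ c < ratr q, ratr q < c' & (N <= pickle q)%N].
Proof.
elim: N => [|N IH] c c' cc'.
  by have [q] := rat_in_itvoo cc'; rewrite in_itv /= => /andP[h1 h2]; exists q.
pose m := (c + c') / 2.
have [q1 [a1 b1 n1]] := IH c m ltac:(rewrite /m; lra).
have [q2 [a2 b2 n2]] := IH m c' ltac:(rewrite /m; lra).
move: n1; rewrite leq_eqVlt => /orP[/eqP e1|n1]; last by exists q1; split=> //; rewrite /m in b1; lra.
move: n2; rewrite leq_eqVlt => /orP[/eqP e2|n2]; last by exists q2; split=> //; rewrite /m in a2; lra.
have e : q1 = q2 by apply: (pcan_inj (@pickleK rat)); rewrite -e1 -e2.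
by move: b1 a2; rewrite e; lra.
Qed.

(** The difference has modulus 1 on the classes with index between [c] and [c']. Some of these have
    arbitrarily large codes, and so escape any given cocompact set. *)
Lemma indic_not_vanish c c' : c < c' -> ~ vanish (fun x => indic c x - indic c' x).
Proof.
move=> cc' /(_ 1 ltr01)[B cB hB].
have [N hN] := Gcompact_classes cB.
have [q [h1 h2 h3]] := rat_large_code N cc'.
have uq := class_refl A a g (u (pickle q)).
suff Bq : B (u (pickle q)) by have := hN _ _ Bq uq; rewrite ltnNge h3.
apply: contrapT => /hB.
have -> : indic c' (u (pickle q)) = 1 by rewrite /indic asboolT //; exists q.
have -> : indic c (u (pickle q)) = 0.
  rewrite /indic asboolF // => -[q' qc' h]; apply: (uclass _ h) => e.
  have eq : q' = q by apply: (pcan_inj (@pickleK rat)).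
  by move: qc' h1; rewrite eq; lra.
by rewrite sub0r cnormN cnorm1 ltxx.
Qed.

Lemma K0_of_classes : ~ countable (K0 S J `*` K1 S J).
Proof.
have v0 : invertible S J (0 : 'M[F]_0) by split; [case|exists 0; split; case].
apply: (K0_uncountable J0 S0 (p := indic_idem) _ (InvertibleMx v0)) => c c' cc' /K0_rel_indic.
exact: indic_not_vanish.
Qed.

End Indicators.

Section Exponentials.
Variable h : M -> R.
Hypothesis hS : smoothR A h.
Hypothesis ha : forall b x, h (a b x) = h x.
Hypothesis hrcn : forall e : R, 0 < e -> exists2 B, Gcompact a B & forall x, ~ B x -> rcn A g h x < e.
Hypothesis hunb : forall t : R, exists x, t < h x.
Hypothesis hconn : forall B : set M, open B -> open (~` B) -> (forall b z, B z -> B (a b z)) ->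
  forall x, B x -> exists2 z, B z & h z = 0.

Definition cis (c : R) : F := fun x => cos (c * h x) +i* sin (c * h x).

Lemma cisN c : cis c * cis (- c) = 1 :> F.
Proof.
apply/funext => x; change (cis c x * cis (- c) x = 1).
by rewrite /cis cis_mul mulNr subrr cis0.
Qed.

Lemma cis_in c : S (cis c). Proof. exact: (CgG_exp hG hM hact hprop hg hiso c hS ha hrcn). Qed.

Lemma cis_invertible c : invertible S J (const_mx (cis c) : 'M[F]_1).
Proof.
split; first by move=> i j; rewrite mxE; exact: cis_in.
exists (const_mx (cis (- c))); split; first by move=> i j; rewrite mxE; exact: cis_in.
- move=> i j; rewrite !mxE big_ord1 !mxE cisN !ord1 eqxx.
  have -> : 1 - 1%:R = 0 :> F by rewrite subrr.
  exact: J0.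
- move=> i j; rewrite !mxE big_ord1 !mxE -[X in cis (- c) * cis X]opprK cisN !ord1 eqxx.
  have -> : 1 - 1%:R = 0 :> F by rewrite subrr.
  exact: J0.
Qed.

(** [h] is bounded on cocompact sets, so the region where it is large avoids any given one. *)
Lemma vanish_large (f : F) : vanish f -> forall e : R, 0 < e -> exists r : R, forall x, r < h x -> cnorm (f x) < e.
Proof.
move=> H e /H[B cB hB].
have [r hr] := Gcompact_bounded cB hS.1 ha; exists r => x rx; apply: hB => /hr.
by move=> /(le_trans (ler_norm _)); rewrite leNgt rx.
Qed.

Lemma vanish_large_mx m (f : 'I_m -> 'I_m -> M -> R[i]) : (forall i j, vanish (f i j)) ->
  forall e : R, 0 < e -> exists r : R, forall x, r < h x -> forall i j, cnorm (f i j x) < e.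
Proof.
move=> H e e0.
have [r hr] := choice (fun z : 'I_m * 'I_m => vanish_large (H z.1 z.2) e0).
exists (\sum_z `|r z|) => x rx i j; apply: (hr (i, j)); apply: le_lt_trans rx.
rewrite (bigD1 (i, j)) //= -[leLHS]addr0; apply: lerD; first exact: ler_norm.
exact: sumr_ge0.
Qed.

Lemma mxin_bounded m (u : 'M[F]_m) : mxin S u -> exists2 B : R, 0 <= B & forall x i j, cnorm (u i j x) <= B.
Proof.
move=> uS.
have hb (z : 'I_m * 'I_m) : exists B : R, forall x, cnorm (u z.1 z.2 x) <= B.
  have [[_ _ [B hB]] _] := uS z.1 z.2; exists B => x; rewrite -cnorm_le; exact: hB.
have [r hr] := choice hb.
exists (\sum_z `|r z|) => [|x i j]; first exact: sumr_ge0.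
apply: (le_trans (hr (i, j) x)).
rewrite (bigD1 (i, j)) //= -[leLHS]addr0; apply: lerD; first exact: ler_norm.
exact: sumr_ge0.
Qed.

Definition detf m (u : 'M[F]_m) : F := fun x => \det (evmx x u).

Lemma detf_continuous m (u : 'M[F]_m) : mxin S u -> continuous (detf u : M -> R[i]^o).
Proof.
move=> uS x; have [B B0 hB] := mxin_bounded uS; have [K K0 hK] := det_lipschitz m B0.
apply/complex_continuousP => e e0.
have d0 : 0 < e / (K + 1) by rewrite divr_gt0 // ltr_wpDl.
have : \forall y \near x, forall z : 'I_m * 'I_m, cnorm (u z.1 z.2 x - u z.1 z.2 y) < e / (K + 1).
  apply: (@filter_forall _ _ (fun (z : 'I_m * 'I_m) y => cnorm (u z.1 z.2 x - u z.1 z.2 y) < e / (K + 1)) (nbhs x)) => z.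
  by have [[uc _ _] _] := uS z.1 z.2; have /complex_continuousP := uc x; apply.
apply: filterS => y hy; apply: (@le_lt_trans _ _ (K * (e / (K + 1)))).
  apply: hK; rewrite ?(ltW d0) //.
  - by move=> i j; rewrite mxE.
  - by move=> i j; rewrite mxE.
  - by move=> i j; rewrite !mxE ltW //; exact: (hy (i, j)).
by rewrite mulrA ltr_pdivrMr ?ltr_wpDl // mulrC ltr_pM2l // ltrDl.
Qed.

Lemma detf_inv m (u : 'M[F]_m) b x : mxin S u -> detf u (a b x) = detf u x.
Proof.
move=> uS; rewrite /detf; congr (\det _); apply/matrixP => i j; rewrite !mxE.
by have [[_ ui _] _] := uS i j.
Qed.

(** Where [h] is large, [u v] is close to the identity and so is its determinant to 1, while the
    determinant of [v] is bounded everywhere. *)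
Lemma detf_lower m (u : 'M[F]_m) : invertible S J u ->
  exists2 c : R, 0 < c & exists r : R, forall x, r < h x -> c <= cnorm (detf u x).
Proof.
move=> [uS [v [vS uv _]]].
have [B B0 hB] := mxin_bounded vS; have [K K0 hK] := det_lipschitz m B0.
(* A bound for the entries of [u v] where they differ by less than 1 from those of the identity. *)
have two : (0 : R) <= 2 by [].
have [K' K0' hK'] := det_lipschitz m two.
pose D := cnorm (\det (0 : 'M[R[i]]_m)) + K * B + 1.
have D0 : 0 < D by rewrite ltr_wpDl // addr_ge0 ?cnorm_ge0 ?mulr_ge0.
have hv x : cnorm (detf v x) <= D.
  have := hK (evmx x v) 0 B B0; rewrite /detf => H.
  have h1 : cnorm (\det (evmx x v) - \det (0 : 'M[R[i]]_m)) <= K * B.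
    apply: H; move=> i j; rewrite ?mxE ?cnorm0 ?subr0 //.
  have := cnormD (\det (evmx x v) - \det (0 : 'M[R[i]]_m)) (\det (0 : 'M[R[i]]_m)).
  rewrite subrK /D => h2; lra.
pose e := Num.min 1 (2^-1 / (K' + 1)).
have K1 : 0 < K' + 1 by rewrite ltr_wpDl.
have e0 : 0 < e by rewrite lt_min ltr01 divr_gt0 // invr_gt0.
have e1 : e <= 1 by rewrite ge_min lexx.
have eK : K' * e <= 2^-1.
  have : e <= 2^-1 / (K' + 1) by rewrite ge_min lexx orbT.
  by rewrite ler_pdivlMr // => h1; apply: le_trans h1; rewrite mulrC ler_wpM2l ?(ltW e0) // lerDl.
have [r hr] := vanish_large_mx (fun i j => eqmodJ_vanish i j uv) e0.
exists (2^-1 / D); first by rewrite divr_gt0 // invr_gt0.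
exists r => x /hr close.
have ent i j : cnorm ((u *m v) i j x - (i == j)%:R) < e.
  have := close i j; rewrite [X in _ - X](_ : _ = (i == j)%:R) //.
  by rewrite mxE; case: (i == j).
have n1 (b : bool) : cnorm (b%:R : R[i]) <= 1 by case: b; rewrite ?cnorm1 ?cnorm0 ?ler01.
have h1 : cnorm (\det (evmx x (u *m v)) - \det (1%:M : 'M[R[i]]_m)) <= K' * e.
  apply: hK'; rewrite ?(ltW e0) // => i j; rewrite !mxE.
  - rewrite -[X in cnorm X](subrK ((i == j)%:R)); apply: (le_trans (cnormD _ _)).
    have := ent i j; have := n1 (i == j); rewrite mxE => h2 h3; lra.
  - by apply: (le_trans (n1 _)); lra.
  - by have := ent i j; rewrite mxE => /ltW.
rewrite evmx_mul det_mulmx det1 in h1.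
have h2 : 2^-1 <= cnorm (detf u x) * cnorm (detf v x).
  rewrite -cnormM /detf; have := cnormD (1 - \det (evmx x u) * \det (evmx x v)) (\det (evmx x u) * \det (evmx x v)).
  rewrite subrK cnorm1 cnorm_dist => h3; lra.
rewrite ler_pdivrMr //; apply: (le_trans h2); rewrite ler_wpM2l ?cnorm_ge0 //; exact: hv.
Qed.

Lemma detf_homotopic m (u : 'M[F]_m) : invertible S J u -> exists2 e : R, 0 < e &
  forall v : 'M[F]_m, mxin S v -> (exists r : R, forall x, r < h x -> forall i j, cnorm (v i j x - u i j x) < e) ->
  homotopic_args a h (detf u) (detf v).
Proof.
move=> iu; have uS := iu.1; have [c c0 [r hr]] := detf_lower iu.
have [B B0 hB] := mxin_bounded uS; have B1 : 0 <= B + 1 by rewrite addr_ge0.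
have [K K0 hK] := det_lipschitz m B1.
have K1 : 0 < K + 1 by rewrite ltr_wpDl.
pose e := Num.min 1 (c / 2 / (K + 1)).
have e0 : 0 < e by rewrite lt_min ltr01 !divr_gt0.
have e1 : e <= 1 by rewrite ge_min lexx.
have eK : K * e <= c / 2.
  have : e <= c / 2 / (K + 1) by rewrite ge_min lexx orbT.
  by rewrite ler_pdivlMr // => h1; apply: le_trans h1; rewrite mulrC ler_wpM2l ?(ltW e0) // lerDl.
exists e => // v vS [r' hr'].
apply: (@homotopic_args_close _ _ _ _ _ _ _ c (Num.max r r')) => //.
- exact: detf_continuous.
- exact: detf_continuous.
- by move=> b x; exact: detf_inv.
- by move=> b x; exact: detf_inv.
move=> x; rewrite gt_max => /andP[/hr rx /hr' rx']; split=> //.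
apply: le_trans eK; apply: hK; rewrite ?(ltW e0) // => i j; rewrite !mxE.
- rewrite -[v i j x](subrK (u i j x)); apply: (le_trans (cnormD _ _)).
  by have := rx' i j; have := hB x i j => h1 h2; lra.
- by have := hB x i j => h1; lra.
- exact: ltW.
Qed.

(** The ends of the path agree with [u] and [v] only modulo the ideal, which costs an additional
    step [hends] at each end. *)
Lemma gl_homotopic_args m (u v : 'M[F]_m) : mxin S u -> mxin S v -> gl_homotopic S J u v ->
  homotopic_args a h (detf u) (detf v).
Proof.
move=> uS vS [gamma [ginv gcont g0 g1]].
have i01 : 0 <= (0 : R) <= 1 by rewrite lexx ler01.
have i11 : 0 <= (1 : R) <= 1 by rewrite lexx ler01.
have hends (w : 'M[F]_m) t : 0 <= t <= 1 -> mxin S w -> eqmodJ J (gamma t) w ->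
    homotopic_args a h (detf (gamma t)) (detf w).
  move=> t01 wS tw; have [e e0 he] := detf_homotopic (ginv t t01); apply: he => //.
  have [r hr] := vanish_large_mx (fun i j => eqmodJ_vanish i j tw) e0.
  by exists r => x /hr hx i j; rewrite cnorm_dist.
apply: (homotopic_args_trans (homotopic_args_sym (hends u 0 i01 uS g0))).
apply: (fun H => homotopic_args_trans H (hends v 1 i11 vS g1)).
pose cl (t : R) : R := Num.min 1 (Num.max 0 t).
apply: (unit_interval_connected (P := fun s t => homotopic_args a h (detf (gamma s)) (detf (gamma t)))).
- by move=> t; exact: homotopic_args_refl.
- by move=> s t; exact: homotopic_args_sym.
- by move=> s t w; exact: homotopic_args_trans.
move=> t t01; have [e e0 he] := detf_homotopic (ginv t t01).
have e2 : 0 < e / 2 by rewrite divr_gt0.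
have [d d0 hd] := gcont t (e / 2) t01 e2; exists d => // s s01 st.
apply: he; first by have [] := ginv s s01.
(* Closeness in the quotient norm is closeness up to an element of the ideal, which is small where
   [h] is large. *)
have ex (z : 'I_m * 'I_m) : exists f : M -> R[i], vanish f /\
    forall x, cnorm (gamma s z.1 z.2 x - gamma t z.1 z.2 x - f x) <= e / 2.
  have [f [e' [Jf e'e hf]]] := hd s s01 st z.1 z.2; exists f; split; first exact: (C0G_vanish hM hact Jf).
  by move=> x; apply: (le_trans _ (ltW e'e)); rewrite -cnorm_le; exact: hf.
have [f hf] := choice ex.
have [r hr] := vanish_large_mx (fun i j => (hf (i, j)).1) e2.
exists r => x /hr hx i j; have := (hf (i, j)).2 x => /= h1.
rewrite -[X in cnorm X](subrK (f (i, j) x)); apply: (le_lt_trans (cnormD _ _)).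
by have := hx i j => h2; lra.
Qed.

Definition cis_elt c : invertible_mx S J := InvertibleMx (cis_invertible c).

(** Both invertibles have size 1, so they are stabilised by identities of the same size and the cast
    is trivial; the determinant gives back [cis]. *)
Lemma K1_rel_cis c c' : K1_rel (cis_elt c) (cis_elt c') -> homotopic_args a h (cis c) (cis c').
Proof.
move=> [b [d [e H]]]; have bd : b = d := addnI (e : (1 + b = 1 + d)%N).
subst d; rewrite (eq_irrelevance e erefl) castmx_id in H.
have dE c0 : detf (dsum (gmx (cis_elt c0)) (1%:M : 'M[F]_b)) = cis c0.
  by apply/funext => x; rewrite /detf evmx_dsum det_ublock evmx1 det1 mulr1 det_mx11 !mxE.
have dS c0 : mxin S (dsum (gmx (cis_elt c0)) (1%:M : 'M[F]_b)).
  apply: mxin_dsum => //; first by have [] := cis_invertible c0.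
  exact: mxin1.
rewrite -(dE c) -(dE c'); exact: (gl_homotopic_args (dS c) (dS c') H).
Qed.

Lemma cis_not_homotopic c c' : c < c' -> ~ homotopic_args a h (cis c) (cis c').
Proof.
move=> cc' [r0 [B0 [theta H]]].
(* The maximum with 0 makes [r < h x] impossible at a zero of [h], which yields the final
   contradiction. *)
pose r := Num.max r0 0; pose B := Num.max B0 0.
pose psi x : R := (c' - c) * h x - theta x.
have dc : 0 < c' - c by rewrite subr_gt0.
(* After division by the exponentials, taking moduli shows that the positive factor is 1, and real
   parts then give [cos (psi x) = 1]. *)
have Hr x : r < h x -> [/\ {for x, continuous (theta : M -> R^o)}, `|theta x| <= B,
    forall b, theta (a b x) = theta x & cos (psi x) = 1].
  rewrite gt_max => /andP[rx _]; have [tc tB ta [rho rho0 e]] := H x rx; split=> //.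
    by rewrite le_max tB.
  have e1 : (1 : R[i]) = (rho%:C) * (cos (- psi x) +i* sin (- psi x)).
    have e2 : cis (- c') x * cis c' x = 1 by have /(congr1 (fun f => f x)) := cisN (- c'); rewrite opprK.
    rewrite -e2 e.
    transitivity (rho%:C * (cis (- c') x * cis c x * (cos (theta x) +i* sin (theta x)))); first by ring.
    congr (_ * _); rewrite /cis !cis_mul /psi.
    by have -> : - c' * h x + c * h x + theta x = - ((c' - c) * h x - theta x) by ring.
  have nrm : cnorm (cos (- psi x) +i* sin (- psi x)) = 1 by rewrite /cnorm /= cos2Dsin2 sqrtr1.
  have rho1 : rho = 1.
    have := congr1 cnorm e1; rewrite cnorm1 cnormM nrm mulr1 /cnorm /= expr0n addr0 sqrtr_sqr gtr0_norm //.
  by move: e1; rewrite rho1 mul1r => /(congr1 (@complex.Re R)) /=; rewrite cosN.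
(* Larger than [psi] wherever [r < h <= r + 1], so that [U] stays away from the level [h = r]. *)
pose T0 := (c' - c) * (r + 1) + B + 1.
pose N := Num.truncn T0.
(* An odd multiple of pi: [cos T = -1], so [psi] never takes the value [T] where [h] exceeds [r],
   and [U] is closed as well as open. *)
pose T : R := pi + (pi *+ 2) *+ N.+1.
have cosT : cos T = -1 by rewrite /T (periodicn (@cosD2pi R)) cospi.
have TT : T0 < T.
  apply: (@lt_le_trans _ _ N.+1%:R); first exact: truncnS_gt.
  have p2 := pi_ge2 R; rewrite /T -mulrnA -[_ *+ (2 * _)]mulr_natr natrM.
  have n0 : 0 <= N.+1%:R :> R by []; nra.
pose U := [set x | r < h x /\ T < psi x].
have hc : continuous (h : M -> R^o) := hS.1.
have pc x : r < h x -> {for x, continuous (psi : M -> R^o)}.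
  move=> /Hr[tc _ _ _]; apply: (@cvgB R R^o _ (nbhs x)) => //.
  by apply: (@cvgMr R _ (nbhs x)); exact: hc.
have near_h x : r < h x -> \forall y \near x, r < h y.
  by move=> rx; apply: (@cvgr_gt _ _ (nbhs x) _ h (h x)) => //; exact: hc.
have oU : open U.
  rewrite openE => x [rx Tx]; rewrite /interior /=.
  have n1 := near_h x rx.
  have n2 : \forall y \near x, T < psi y by apply: (@cvgr_gt _ _ (nbhs x) _ psi (psi x)) => //; exact: pc.
  by apply: filterS2 n1 n2 => y h1 h2; split.
have oUc : open (~` U).
  rewrite openE => x nx; rewrite /interior /=.
  have [rx|rx] := ltP r (h x).
    have Tx : psi x < T.
      rewrite lt_neqAle; apply/andP; split; last by rewrite leNgt; apply/negP => Tx; apply: nx.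
      apply/eqP => e; have [_ _ _] := Hr x rx; rewrite e cosT => /eqP; rewrite -subr_eq0 => /eqP; lra.
    have n2 : \forall y \near x, psi y < T by apply: (@cvgr_lt _ _ (nbhs x) _ psi (psi x)) => //; exact: pc.
    by apply: filterS n2 => y hy [_ hy2]; lra.
  have n1 : \forall y \near x, h y < r + 1.
    by apply: (@cvgr_lt _ _ (nbhs x) _ h (h x)); [exact: hc|apply: (le_lt_trans rx); rewrite ltrDl].
  apply: filterS n1 => y hy [ry Ty]; have [_ tB _ _] := Hr y ry.
  have := le_trans (ler_norm _) tB => _; move: tB; rewrite ler_norml => /andP[tB _].
  have h1 : (c' - c) * h y <= (c' - c) * (r + 1) by rewrite ler_pM2l // ltW.
  by move: Ty TT; rewrite /psi /T0; lra.
have Ua b x : U x -> U (a b x).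
  by move=> [rx Tx]; have [_ _ ta _] := Hr x rx; split; rewrite /psi ?ha // ta.
have [x hx] := hunb (Num.max r ((T + B) / (c' - c))).
move: hx; rewrite gt_max => /andP[rx hx].
have Ux : U x.
  split=> //; have [_ tB _ _] := Hr x rx; move: tB; rewrite ler_norml => /andP[_ tB].
  by move: hx; rewrite ltr_pdivrMr // /psi [h x * _]mulrC; lra.
have [z [rz _] hz] := hconn oU oUc Ua Ux.
by move: rz; rewrite hz /r gt_max ltxx andbF.
Qed.

Lemma K1_of_function : ~ countable (K0 S J `*` K1 S J).
Proof.
apply: (K1_uncountable J0 S0 S1 (u := cis_elt)) => c c' cc' /K1_rel_cis.
exact: cis_not_homotopic.
Qed.

End Exponentials.
End KTheoryOfCorona.

Theorem theorem6p19 (R : realType) (k n : nat)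
    (G : groupTopType) (AG : atlas 'rV[R]_k G)
    (M : topologicalType) (AM : atlas 'rV[R]_n M)
    (g : M -> 'rV[R]_n -> 'rV[R]_n -> R) (a : group_action G M)
    (hG : lie_group AG)
    (hM : G_riemannian AG AM g a)
    (hcomplete : riemannian_complete AM g)
    (hnoncompact : ~ compact [set: orbit_space a]) :
  ~ countable (K0 (CgG AM g a) (C0G a) `*` K1 (CgG AM g a) (C0G a)).
Proof.
have [[mM rg] sact pact iact] := hM.
have nc := noncompact_Gcompact mM sact pact hnoncompact.
have [hc|] := pselect (forall x, Gcompact a (class AM a g x)).
  have [u hu] := classes_sequence mM rg hc nc.
  exact: (K0_of_classes hG mM sact pact rg iact hu).
move=> /existsNP[x0 ncx].
have [h [[hS ha h0 hr] [hunb hconn]]] := higson_function hG mM sact pact rg iact hcomplete ncx.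
exact: (K1_of_function hG mM sact pact rg iact hS ha hr hunb hconn).
Qed.
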